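(* Let $N\ge1$, $\nu>0$, and let $z_1^{(\nu-1)}>\dots>z_N^{(\nu-1)}>0$ be the zeros of the classical Laguerre polynomial $L_N^{(\nu-1)}$ (orthogonal with respect to $e^{-x}x^{\nu-1}$ on $]0,\infty[$). Put $r=(r_1,\dots,r_N)$ with $r_i:=\sqrt{2z_i^{(\nu-1)}}$. Fix a starting point $x\in C_N^B$ and for $\beta>0$ let $(X_{t,(\nu\beta,\beta)})_{t\ge0}$ be the Bessel process of type $B_N$ with multiplicities $(k_1,k_2)=(\nu\beta,\beta)$ started in $x$. Define $S=(s_{i,j})_{i,j=1,\dots,N}$ by $$s_{i,i}:=1+\frac{2\nu}{r_i^2}+2\sum_{l\ne i}(r_i-r_l)^{-2}+2\sum_{l\ne i}(r_i+r_l)^{-2},\qquad s_{i,j}:=2(r_i+r_j)^{-2}-2(r_i-r_j)^{-2}\ (i\ne j).$$ Then $S$ is invertible and, with $\Sigma:=S^{-1}$, for every $t>0$, $$X_{t,(\nu\beta,\beta)}-\sqrt{\beta t}\,r\ \longrightarrow\ N(0,t\Sigma)\qquad\text{in distribution as }\beta\to\infty.$$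
   Context: $C_N^B:=\{x\in\mathbb R^N: x_1\ge x_2\ge\dots\ge x_N\ge0\}$. For $k_1,k_2\ge0$, the Bessel process of type $B_N$ with multiplicities $(k_1,k_2)$ is the diffusion on $C_N^B$ with reflecting boundary whose generator is $Lf=\frac12\Delta f+k_2\sum_{i=1}^N\sum_{j\ne i}\big(\frac{1}{x_i-x_j}+\frac{1}{x_i+x_j}\big)\frac{\partial f}{\partial x_i}+k_1\sum_{i=1}^N\frac{1}{x_i}\frac{\partial f}{\partial x_i}$, with domain the restrictions to $C_N^B$ of $C^2$ functions on $\mathbb R^N$ invariant under permutations and sign changes of the coordinates. $N(0,t\Sigma)$ denotes the centered $N$-dimensional normal distribution with covariance matrix $t\Sigma$. *)

(* Defs.v *)
From HB Require Import structures.
From mathcomp Require Import all_boot all_order all_algebra all_fingroup.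
From mathcomp Require Import all_classical all_reals all_analysis.
Set Implicit Arguments. Unset Strict Implicit. Unset Printing Implicit Defensive.
Import Order.TTheory GRing.Theory Num.Theory.
Import numFieldNormedType.Exports.
Local Open Scope classical_set_scope.
Local Open Scope ring_scope.

Section Defs.
Variable R : realType.
Variable N : nat.

Definition coord (x : 'rV[R]_N) (i : 'I_N) : R := x ord0 i.

Definition CNB : set 'rV[R]_N :=
  [set x | (forall i j : 'I_N, (i <= j)%N -> coord x j <= coord x i) /\
           (forall i, 0 <= coord x i)].

Definition evec (i : 'I_N) : 'rV[R]_N := delta_mx ord0 i.
Definition pd (i : 'I_N) (f : 'rV[R]_N -> R) : 'rV[R]_N -> R :=
  fun x => 'D_(evec i) f x.

Definition C2 (f : 'rV[R]_N -> R) : Prop :=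
  (forall x i, derivable f x (evec i)) /\
  (forall x i j, derivable (pd i f) x (evec j)) /\
  continuous f /\ (forall i, continuous (pd i f)) /\
  (forall i j, continuous (pd j (pd i f))).

Definition BN_invariant (f : 'rV[R]_N -> R) : Prop :=
  (forall (s : 'S_N) x, f (\row_i coord x (s i)) = f x) /\
  (forall (eps : 'I_N -> bool) x,
      f (\row_i (if eps i then - coord x i else coord x i)) = f x).

Definition compact_support (f : 'rV[R]_N -> R) : Prop :=
  exists M : R, forall x, M < `|x| -> f x = 0.

Definition test_fun (f : 'rV[R]_N -> R) : Prop :=
  C2 f /\ BN_invariant f /\ compact_support f.

Definition genB (k1 k2 : R) (f : 'rV[R]_N -> R) (x : 'rV[R]_N) : R :=
  2^-1 * (\sum_i pd i (pd i f) x)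
  + k2 * (\sum_i \sum_(j | j != i)
            ((coord x i - coord x j)^-1 + (coord x i + coord x j)^-1)
              * pd i f x)
  + k1 * (\sum_i (coord x i)^-1 * pd i f x).

Definition bdd_fun (h : 'rV[R]_N -> R) : Prop :=
  exists C : R, forall y, `|h y| <= C.

(* (X_t) is a Bessel process of type B_N with multiplicities (k1,k2) started
   at x: continuous C_N^B-valued paths, X_0 = x, and for each test function f
   the process f(X_t) - f(X_0) - \int_0^t Lf(X_u) du is a martingale w.r.t.
   the natural filtration of X (martingale problem). *)
Definition bessel_B (k1 k2 : R) (x : 'rV[R]_N)
    d (Omega : measurableType d) (P : probability Omega R)
    (X : R -> Omega -> 'rV[R]_N) : Prop :=
  (forall t i, 0 <= t -> measurable_fun setT (fun w => coord (X t w) i)) /\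
  (forall w, X 0 w = x) /\
  (forall w t, 0 <= t -> CNB (X t w)) /\
  (forall w, {within [set u : R | 0 <= u], continuous (fun u => X u w)}) /\
  (forall f, test_fun f ->
     let M := fun t w =>
        f (X t w) - f (X 0 w)
        - Rintegral lebesgue_measure `[0, t] (fun u => genB k1 k2 f (X u w)) in
     forall s t, 0 <= s -> s <= t ->
     forall (m : nat) (u : 'I_m -> R) (h : 'I_m -> 'rV[R]_N -> R),
       (forall k, 0 <= u k <= s) ->
       (forall k, continuous (h k)) ->
       (forall k, bdd_fun (h k)) ->
       Rintegral P setT
         (fun w => (M t w - M s w) * \prod_k h k (X (u k) w)) = 0).

Fixpoint iter_int (n : nat) (F : (nat -> R) -> R) : R :=
  match n with
  | 0 => F (fun _ => 0)
  | n'.+1 => Rintegral lebesgue_measure setT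
               (fun y : R => iter_int n' (fun v => F (fun k => if k == n' then y else v k)))
  end.

Definition gauss_density (C : 'M[R]_N) (y : 'rV[R]_N) : R :=
  (Num.sqrt ((2 * pi) ^+ N * \det C))^-1
  * expR (- ((y *m invmx C *m y^T) ord0 ord0) / 2).

Definition gauss_int (C : 'M[R]_N) (g : 'rV[R]_N -> R) : R :=
  iter_int N (fun v => g (\row_i v (nat_of_ord i)) * gauss_density C (\row_i v (nat_of_ord i))).

(* Laguerre polynomial L_n^(alpha)(x) = sum_k (-1)^k binom(n+alpha, n-k) x^k / k! *)
Definition laguerre (n : nat) (alpha : R) : {poly R} :=
  \poly_(k < n.+1)
    ((-1) ^+ k / (k`!)%:R
     * (\prod_(k.+1 <= j < n.+1) (alpha + j%:R)) / ((n - k)`!)%:R).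

Definition Smat (nu : R) (r : 'I_N -> R) : 'M[R]_N :=
  \matrix_(i, j)
    (if i == j then
       1 + 2 * nu / (r i ^+ 2)
       + 2 * (\sum_(l | l != i) (r i - r l) ^- 2)
       + 2 * (\sum_(l | l != i) (r i + r l) ^- 2)
     else 2 * (r i + r j) ^- 2 - 2 * (r i - r j) ^- 2).

End Defs.

(* Main.v *)
(* Evaluating Laguerre's differential equation at its zeros gives the weak
   stationarity [drift nu r = r / 2], so that [sqrt (beta t) r] solves the
   noiseless equation, with linearisation governed by [S], which is the identity
   plus a positive definite form.

   Tightness: the test functions built from |y|^2 bound E|X_t|^2 from above. From
   below, E<r, X_t>^2 is bounded through the smooth Weyl-invariant function
   eps ln (sum_w exp (<w r, y> / eps)), which approximates max_w <w r, y> and is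
   a subsolution because the boundary terms have a favourable sign. Together
   these bound E|X_t - sqrt (beta t) r|^2 uniformly in beta.

   Characteristic function: if xi' = (S - 1) xi / (2 s), then
   exp (c (s)) cos (<xi (s), X_s - sqrt (beta s) r> + th), cut off deep inside the
   chamber and symmetrised, has expectation almost constant in [s]. The flow
   tends to 0 as s -> 0, which removes the dependence on the starting point, and
   the value at s = t is that of the Gaussian law.

   Levy's continuity theorem: with second moments bounded, it suffices to
   approximate a bounded continuous function on a box by trigonometric
   polynomials, here the Bernstein polynomials in the variables
   (1 + cos (eta y_i + pi / 2)) / 2. *)
Require Import Defs.
From HB Require Import structures.
From mathcomp Require Import all_boot all_order all_algebra all_fingroup.
From mathcomp Require Import all_classical all_reals all_analysis.
From mathcomp Require complex.
From mathcomp Require Import measurable_realfun ring lra.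
Import Order.TTheory GRing.Theory Num.Theory.
Import numFieldNormedType.Exports.
Local Open Scope classical_set_scope.
Local Open Scope ring_scope.
Set Implicit Arguments. Unset Strict Implicit. Unset Printing Implicit Defensive.

(** * Expectations along continuous paths *)

(** The process is known only through a martingale problem for compactly supported invariant
    functions. There is no driving noise for Ito's formula, and nothing in the definition keeps
    paths off the walls, where the drift is singular. So every estimate is about expectations and
    rests on one comparison principle: a continuous function below (or above) the generator of a
    test function controls the growth of its mean. Continuity is the point: on invariant functions
    the singular drift is bounded, but with the convention 1/0 = 0 it may jump at the walls.

    The upper and lower moment bounds match to leading order through a single number,
    [m = kaptot N nu]. Off the walls [drift nu y y = m], and stationarity tested on [r] itself gives
    |r|^2 = 2 m. The bounds 2 beta m t for E|X_t|^2 (up to terms bounded in beta) and 4 beta m^2 t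
    for E<r, X_t>^2 are the values taken at sqrt (beta t) r.

    In the characteristic function the errors are of order k / sqrt beta and 1 / k for a cutoff of
    squared radius [k], with constants blowing up as the initial time s tends to 0; so s is fixed
    before [k], and [k] before beta. *)

Section Measurability.
Context {R : realType}.

Lemma measurable_fun_glue d d' (T : measurableType d) (U : measurableType d')
    (C : countType) (K : T -> C) (F : C -> T -> U) :
  (forall c, measurable (K @^-1` [set c])) ->
  (forall c, measurable_fun setT (F c)) ->
  measurable_fun setT (fun w => F (K w) w).
Proof.
move=> mK mF _ B mB; rewrite setTI.
have -> : (fun w => F (K w) w) @^-1` B =
    \bigcup_c (K @^-1` [set c] `&` F c @^-1` B).
  apply/seteqP; split => [w Bw|w [c _ [/= <-]]//].
  by exists (K w).
apply: countable_bigcupT_measurable => [|c]; first exact: countableP.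
by apply: measurableI => //; rewrite -[X in measurable X]setTI; exact: mF.
Qed.

Lemma measurable_floor_fiber d (T : measurableType d) (f : T -> R) (k : int) :
  measurable_fun setT f -> measurable ((fun w => Num.floor (f w)) @^-1` [set k]).
Proof.
move=> mf.
have -> : (fun w => Num.floor (f w)) @^-1` [set k] =
    setT `&` f @^-1` `[k%:~R, (k + 1)%:~R[%classic.
  rewrite setTI; apply/seteqP; split => w /=.
    by move/eqP; rewrite floor_eq in_itv.
  by rewrite in_itv /= -floor_eq => /eqP.
exact: mf.
Qed.

Lemma cvg_floor_grid (x : R) :
  (Num.floor (n.+1%:R * x))%:~R / n.+1%:R @[n --> \oo] --> x.
Proof.
apply/cvgrPdist_le => e e0; near=> n.
have n0 : (0 : R) < n.+1%:R by rewrite ltr0n.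
have /andP[h1 h2] := floor_itv (n.+1%:R * x).
rewrite intrD in h2.
have -> : x - (Num.floor (n.+1%:R * x))%:~R / n.+1%:R =
   (n.+1%:R * x - (Num.floor (n.+1%:R * x))%:~R) / n.+1%:R.
  by field; rewrite gt_eqF.
rewrite ger0_norm ?divr_ge0 ?subr_ge0 ?ler0n//.
rewrite ler_pdivrMr//.
have ne : 1 <= e * n.+1%:R.
  rewrite -ler_pdivrMl// mulr1; near: n.
  apply: filterS (nbhs_infty_ger e^-1) => n /= /le_trans; apply.
  by rewrite ler_nat.
by move: h1 h2; rewrite mulr1z => h1 h2; lra.
Unshelve. all: by end_near. Qed.

Lemma cvg_rV (N : nat) (T : Type) (F : set_system T) (FF : Filter F)
    (u : T -> 'rV[R]_N) (v : 'rV[R]_N) :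
  (forall i, u n ord0 i @[n --> F] --> v ord0 i) -> u n @[n --> F] --> v.
Proof.
move=> h; apply/cvgrPdist_lt => e e0.
have H i : \forall n \near F, `|v ord0 i - u n ord0 i| < e.
  by have /cvgrPdist_lt := h i; apply.
have {}H : \forall n \near F, forall i, `|v ord0 i - u n ord0 i| < e.
  exact: filter_forall.
near=> n; rewrite [ltLHS]/Num.norm/= mx_normrE; apply/bigmax_ltP; split => // -[a i] _ /=.
by rewrite !mxE ord1; move: i; near: n.
Unshelve. all: by end_near. Qed.

(** Rounded down to the grid of mesh 1/(n+1), [Y w] takes countably many values, each on a
    measurable set determined by the coordinates. Continuity of [h] then lets the mesh tend to 0. *)
Lemma measurable_continuous_coords d (T : measurableType d) (N : nat)
    (Y : T -> 'rV[R]_N) (h : 'rV[R]_N -> R) :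
  (forall i, measurable_fun setT (fun w => Y w ord0 i)) -> continuous h ->
  measurable_fun setT (fun w => h (Y w)).
Proof.
move=> mY ch.
pose K n w : 'rV[int]_N := \row_i Num.floor (n.+1%:R * Y w ord0 i).
pose G n (k : 'rV[int]_N) : 'rV[R]_N := \row_i ((k ord0 i)%:~R / n.+1%:R).
apply: (@measurable_fun_cvg _ _ _ _ (fun n w => h (G n (K n w)))).
- move=> n; apply: (measurable_fun_glue (F := fun c _ => h (G n c))) => [c|c].
    have -> : K n @^-1` [set c] =
      \bigcap_i ((fun w => Num.floor (n.+1%:R * Y w ord0 i)) @^-1` [set c ord0 i]).
      apply/seteqP; split => w /=.
        by move=> <- i _ /=; rewrite mxE.
      by move=> H; apply/rowP => i; rewrite mxE; exact: H.
    rewrite bigcap_mkcond; rewrite (_ : bigcap _ _ = \big[setI/setT]_(i < N)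
        ((fun w => Num.floor (n.+1%:R * Y w ord0 i)) @^-1` [set c ord0 i])).
      apply: bigsetI_measurable => i _; apply: measurable_floor_fiber.
      exact: measurable_funM.
    rewrite -bigcap_seq; apply/seteqP; split => w H i Hi /=.
      by have := H i I; rewrite in_setT; apply.
    by rewrite in_setT; apply: H; rewrite /= mem_index_enum.
  exact: measurable_cst.
- move=> w _; apply: continuous_cvg; first exact: ch.
  apply: cvg_rV => i.
  rewrite (_ : (fun _ => _) = (fun n => (Num.floor (n.+1%:R * Y w ord0 i))%:~R / n.+1%:R)).
    exact: cvg_floor_grid.
  by apply/funext => n; rewrite !mxE.
Qed.

(** Rounding the time to a grid leaves countably many random variables glued along measurable time
    slices, and path continuity removes the rounding. The maximum with 0 extends the process to the
    whole line, so that it becomes a function on a product space. *)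
Lemma measurable_joint_continuous d (T : measurableType d) (N : nat)
    (X : R -> T -> 'rV[R]_N) :
  (forall t i, 0 <= t -> measurable_fun setT (fun w => X t w ord0 i)) ->
  (forall w, {within [set u : R | 0 <= u], continuous (fun u => X u w)}) ->
  forall i, measurable_fun setT (fun z : R * T => X (Num.max 0 z.1) z.2 ord0 i).
Proof.
move=> mX cX i.
pose K n (z : R * T) : int := Num.floor (n.+1%:R * Num.max 0 z.1).
(* The maximum keeps the rounded time nonnegative for every integer [k], including those that are
   never attained. *)
pose H n (k : int) : R := Num.max 0 (k%:~R / n.+1%:R).
apply: (@measurable_fun_cvg _ _ _ _ (fun n z => X (H n (K n z)) z.2 ord0 i)).
- move=> n.
  apply: (measurable_fun_glue (F := fun c (z : R * T) => X (H n c) z.2 ord0 i)) => [c|c].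
    apply: measurable_floor_fiber; apply: measurable_funM => //.
    by apply: measurable_maxr => //; exact: measurable_fst.
  apply: (measurableT_comp (f := fun w => X (H n c) w ord0 i)).
    by apply: mX; rewrite /H le_max lexx.
  exact: measurable_snd.
- move=> [u w] _ /=.
  have Hu : H n (K n (u, w)) @[n --> \oo] --> Num.max 0 u.
    have -> : Num.max 0 u = Num.max 0 (Num.max 0 u) by rewrite maxA maxxx.
    have cm : {for Num.max 0 u, continuous (fun x : R => Num.max 0 x)}.
      by apply: (@continuous_max R R^o (cst 0) idfun); [exact: cvg_cst|exact: cvg_id].
    exact: (continuous_cvg _ cm (@cvg_floor_grid (Num.max 0 u))).
  have H0 : 0 <= Num.max 0 u by rewrite le_max lexx.
  have : X (H n (K n (u, w))) w @[n --> \oo] --> X (Num.max 0 u) w.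
    have /subspace_continuousP/(_ _ H0) := cX w.
    apply: cvg_comp => A wA.
    have hA : \forall n \near \oo, [set v : R | 0 <= v] (H n (K n (u, w))) ->
      A (H n (K n (u, w))) := Hu _ wA.
    by apply: filterS hA => n; apply; rewrite /= /H le_max lexx.
  exact: (continuous_cvg _ (@coord_continuous R 1 N ord0 i _)).
Qed.

End Measurability.

Section BoundedIntegrals.
Context {R : realType}.
Local Notation mu := (@lebesgue_measure R).

Lemma integrable_bounded d (T : measurableType d) (mu : {measure set T -> \bar R})
    (D : set T) (f : T -> R) (C : R) :
  measurable D -> (mu D < +oo)%E -> measurable_fun D f ->
  (forall w, D w -> `|f w| <= C) -> mu.-integrable D (EFin \o f).
Proof.
move=> mD muD mf fC; apply: measurable_bounded_integrable => //.
exists C; split; first exact: num_real.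
by move=> M CM w Dw /=; apply: le_trans (fC _ Dw) (ltW CM).
Qed.

Lemma integrable_probability d (T : measurableType d) (P : probability T R)
    (f : T -> R) (C : R) :
  measurable_fun setT f -> (forall w, `|f w| <= C) ->
  P.-integrable setT (EFin \o f).
Proof.
move=> mf fC; apply: (@integrable_bounded _ _ P setT f C) => //.
exact: (le_lt_trans (probability_le1 P measurableT) (ltry 1)).
Qed.

Lemma Rintegral_dominated_cvg d (T : measurableType d) (P : probability T R)
    (f : nat -> T -> R) (g : T -> R) (C : R) :
  (forall n, measurable_fun setT (f n)) ->
  (forall n w, `|f n w| <= C) -> (forall w, f n w @[n --> \oo] --> g w) ->
  \int[P]_w f n w @[n --> \oo] --> \int[P]_w g w.
Proof.
move=> mf fC fg.
have mg : measurable_fun setT g.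
  by apply: (@measurable_fun_cvg _ _ _ setT f) => // w _; exact: fg.
have gC w : `|g w| <= C.
  have h := fg w; have /(cvg_norm) h2 := h.
  rewrite -(cvg_lim (@Rhausdorff R) h2); apply: limr_le.
    by apply/cvg_ex; eexists; exact: h2.
  by apply: nearW => n; exact: fC.
have hc w : setT w -> (f n w)%:E @[n --> \oo] --> (g w)%:E.
  by move=> _; apply: cvg_EFin; [exact: nearW|exact: fg].
have iC : P.-integrable setT (cst C%:E).
  by apply: (@integrable_probability _ _ P (cst C) `|C|).
have [_ _ h] := @dominated_convergence _ T R P setT measurableT
  (fun n w => (f n w)%:E) (fun w => (g w)%:E) (cst C%:E)
  (fun n => (measurable_EFinP _ _).2 (mf n)) ((measurable_EFinP _ _).2 mg)
  (aeW _ hc) iC (aeW _ (fun w n _ => fC n w)).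
apply: fine_cvg; rewrite fineK; first exact: h.
by apply: integrable_fin_num => //; apply: (@integrable_probability _ _ P g C).
Qed.

(** The functions x / (x^2 + 1/(n+1)) are continuous and converge to the inverse everywhere,
    including at 0, where the inverse is 0 by convention. *)
Lemma measurable_inv_comp d (T : measurableType d) (f : T -> R) :
  measurable_fun setT f -> measurable_fun setT (fun w => (f w)^-1).
Proof.
move=> mf; apply: (measurableT_comp (f := fun x : R => x^-1)) => //.
pose g (n : nat) (x : R) := x / (x ^+ 2 + n.+1%:R^-1).
apply: (@measurable_fun_cvg _ _ _ setT g).
  move=> n; apply: measurable_realfun.continuous_measurable_fun => x.
  apply: cvgM; first exact: cvg_id.
  apply: cvgV.
    by rewrite gt_eqF// ltr_wpDl ?sqr_ge0// invr_gt0 ltr0n.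
  by apply: cvgD; [exact: exprn_continuous|exact: cvg_cst].
move=> x _; have [->|x0] := eqVneq x 0.
  rewrite invr0; rewrite (_ : (fun _ => _) = cst 0); first exact: cvg_cst.
  by apply/funext => n; rewrite /g mul0r.
have <- : x / (x ^+ 2 + 0) = x^-1 by rewrite addr0; field.
apply: cvgM; first exact: cvg_cst.
apply: cvgV; first by rewrite addr0 sqrf_eq0.
apply: cvgD; first exact: cvg_cst.
exact: cvg_harmonic.
Qed.

(** Multiplying by the indicator of [D] turns the time integral into one over the whole line, where
    Fubini applies on the product with [P]. *)
Lemma Rintegral_fubini_bounded d (T : measurableType d) (P : probability T R)
    (D : set (measurableTypeR R)) (F : measurableTypeR R * T -> R) (C : R) :
  measurable D -> (lebesgue_measure D < +oo)%E -> measurable_fun setT F ->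
  (forall z, `|F z| <= C) ->
  [/\ P.-integrable setT (EFin \o (fun w => \int[lebesgue_measure]_(u in D) F (u, w))),
    lebesgue_measure.-integrable D (EFin \o (fun u => \int[P]_w F (u, w))) &
    \int[P]_w \int[lebesgue_measure]_(u in D) F (u, w) =
    \int[lebesgue_measure]_(u in D) \int[P]_w F (u, w)].
Proof.
move=> mD muD mF FC.
have C0 : 0 <= C by exact: le_trans (normr_ge0 _) (FC (0, point)).
pose G (z : measurableTypeR R * T) := \1_D z.1 * F z.
have mI : measurable_fun setT (\1_D : measurableTypeR R -> R) by exact: measurable_indic.
have mGr : measurable_fun setT G.
  apply: measurable_funM => //.
  by apply: (measurableT_comp (f := \1_D : measurableTypeR R -> R)) => //; exact: measurable_fst.
have mG : measurable_fun setT (EFin \o G) by exact/measurable_EFinP.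
have mFu u : measurable_fun setT (fun w => F (u, w)).
  exact: (measurableT_comp mF (pair1_measurable u)).
have mFw w : measurable_fun setT (fun u => F (u, w)).
  exact: (measurableT_comp mF (pair2_measurable w)).
have iFu u : P.-integrable setT (EFin \o (fun w => F (u, w))).
  by apply: (@integrable_probability _ _ P _ C).
have iFw w : mu.-integrable D (EFin \o (fun u => F (u, w))).
  apply: (@integrable_bounded _ _ mu D _ C) => //. apply: measurable_funTS. exact: mFw.
have E1 u : (\int[P]_w (G (u, w))%:E = (\1_D u * \int[P]_w F (u, w))%:E)%E.
  rewrite /G /=; under eq_integral do rewrite EFinM.
  rewrite integralZl//; last exact: iFu.
  by rewrite EFinM; congr (_ * _)%E; rewrite /Rintegral fineK//;
     apply: integrable_fin_num => //; exact: iFu.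
have E2 w : (\int[mu]_u (G (u, w))%:E = (\int[mu]_(u in D) F (u, w))%:E)%E.
  rewrite /Rintegral fineK; last by apply: integrable_fin_num => //; exact: iFw.
  rewrite [RHS]integral_mkcond; apply: eq_integral => u _.
  by rewrite epatch_indic /G /= EFinM muleC.
have iG : (mu \x P)%E.-integrable setT (EFin \o G).
  apply/integrable12ltyP => //.
  apply: (@le_lt_trans _ _ (\int[mu]_u (C * \1_D u)%:E)%E).
    apply: ge0_le_integral => //.
    - by move=> u _; apply: integral_ge0.
    - apply: (measurable_fun_fubini_tonelli_F (abse \o (EFin \o G))) => //.
      exact: measurableT_comp.
      by move=> z; exact: abse_ge0.
    - by apply/measurable_EFinP; exact: measurable_funM.
    move=> u _; apply: (@le_trans _ _ (\int[P]_w (C * \1_D u)%:E)%E).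
      apply: ge0_le_integral => //.
      - apply: (measurableT_comp (f := abse)) => //; apply/measurable_EFinP.
        exact: (measurableT_comp mGr (pair1_measurable u)).
      move=> w _; rewrite /G /= lee_fin normrM mulrC ler_pM//.
      by rewrite indicE normr_nat.
    by rewrite integral_cst// [X in (_ * X)%E](probability_setT P) mule1.
  rewrite (_ : (\int[mu]_u (C * \1_D u)%:E = \int[mu]_(u in D) C%:E)%E).
    by rewrite integral_cst// lte_mul_pinfty.
  rewrite [RHS]integral_mkcond; apply: eq_integral => u _.
  by rewrite epatch_indic /= EFinM.
have Fub := Fubini iG.
split.
- apply: (@integrable_probability _ _ P _ (C * fine (mu D))).
    have := measurable_fubini_G iG.
    rewrite (_ : fubini_G _ _ = EFin \o (fun w => \int[mu]_(u in D) F (u, w))).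
      by move/measurable_EFinP.
    by apply/funext => w; rewrite /fubini_G /= E2.
  move=> w; have h := le_normr_Rintegral mD (iFw w).
  apply: (le_trans h); clear h.
  rewrite -Rintegral_cst//; apply: le_Rintegral => //.
    apply: (@integrable_bounded _ _ mu D _ C) => //.
      by apply: measurable_funTS; exact: measurableT_comp.
    by move=> u _; rewrite normr_id.
  by apply: (@integrable_bounded _ _ mu D _ `|C|).
- have iF := @integrable_fubini_F _ _ _ _ _ mu P _ iG.
  apply: (@integrable_bounded _ _ mu D _ C) => //.
    have h := measurable_int _ iF.
    apply: (@eq_measurable_fun _ _ _ _ D (fun u => \1_D u * \int[P]_w F (u, w))).
      by move=> u uD; rewrite indicE uD mul1r.
    apply: measurable_funTS; apply/measurable_EFinP.
    rewrite [X in measurable_fun _ X](_ : _ = fubini_F P (EFin \o G)) //.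
    by apply/funext => u; rewrite /fubini_F /= -E1.
  move=> u _; have h' := le_normr_Rintegral measurableT (iFu u).
  apply: (le_trans h'); clear h'.
  rewrite -[leRHS]mulr1 (_ : 1 = fine (P setT)); last by rewrite probability_setT.
  rewrite -Rintegral_cst//; apply: le_Rintegral => //.
    apply: (@integrable_probability _ _ P _ C) => //.
      exact: measurableT_comp.
    by move=> w; rewrite normr_id.
  exact: (@integrable_probability _ _ P _ `|C|).
- have : (\int[P]_w (\int[mu]_(u in D) F (u, w))%:E =
     \int[mu]_u (\1_D u * \int[P]_w F (u, w))%:E)%E.
    under eq_integral do rewrite -E2.
    by under [RHS]eq_integral do rewrite -E1.
  move=> /(congr1 fine); rewrite /Rintegral => ->.
  congr fine; rewrite [RHS]integral_mkcond; apply: eq_integral => u _.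
  by rewrite epatch_indic /= EFinM muleC.
Qed.
End BoundedIntegrals.

Section Auxiliary.
Context {R : realType}.

Lemma measurable_sum_cond d (T : measurableType d) (I : finType) (Q : pred I)
    (h : I -> T -> R) :
  (forall i, Q i -> measurable_fun setT (h i)) ->
  measurable_fun setT (fun w => \sum_(i | Q i) h i w).
Proof.
move=> mh; rewrite (_ : (fun w => _) =
    fun w => \sum_i (if Q i then h i w else 0)); last first.
  by apply/funext => w; rewrite big_mkcond.
by apply: measurable_sum => i; case Qi : (Q i); [exact: mh|exact: measurable_cst].
Qed.

Lemma continuous_bounded_ball (N : nat) (f : 'rV[R]_N -> R) (M : R) :
  continuous f -> exists C, forall y, `|y| <= M -> `|f y| <= C.
Proof.
move=> cf; pose A := [set y : 'rV[R]_N | `|y| <= M].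
have cA : compact A.
  apply: bounded_closed_compact.
    exists M; split; first exact: num_real.
    by move=> e Me y /= yM; exact: le_trans yM (ltW Me).
  have -> : A = (fun y : 'rV[R]_N => `|y|) @^-1` [set r : R | r <= M] by [].
  apply: closed_comp; last exact: closed_le.
  by move=> y _; exact: norm_continuous.
have /compact_bounded[C [_ hC]] := @continuous_compact _ _ f A
  (continuous_subspaceT cf) cA.
exists (C + 1) => y yM; apply: (hC (C + 1)); first by rewrite ltrDl.
by exists y.
Qed.

End Auxiliary.

(** * Growth of means from the martingale problem *)

Section BesselProcess.
Context {R : realType} {N : nat} (k1 k2 : R) (x : 'rV[R]_N).
Context d (Omega : measurableType d) (P : probability Omega R).
Context (X : R -> Omega -> 'rV[R]_N) (HX : bessel_B k1 k2 x P X).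
Local Notation mu := (@lebesgue_measure R).

Lemma bessel_measurable t (h : 'rV[R]_N -> R) : 0 <= t -> continuous h ->
  measurable_fun setT (fun w => h (X t w)).
Proof.
move=> t0 ch; apply: measurable_continuous_coords => // i.
by case: HX => + _; apply.
Qed.

Lemma bessel_joint_measurable (h : 'rV[R]_N -> R) : continuous h ->
  measurable_fun setT
    (fun z : measurableTypeR R * Omega => h (X (Num.max 0 z.1) z.2)).
Proof.
move=> ch.
apply: (@measurable_continuous_coords _ _ _ _
  (fun z : measurableTypeR R * Omega => X (Num.max 0 z.1) z.2)) => // i.
case: HX => mX [_ [_ [cX _]]].
exact: (measurable_joint_continuous mX cX).
Qed.

Lemma bessel_genB_measurable f : C2 f ->
  measurable_fun setT
    (fun z : measurableTypeR R * Omega => genB k1 k2 f (X (Num.max 0 z.1) z.2)).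
Proof.
move=> [_ [_ [cf [c1 c2]]]]; rewrite /genB.
have mc i := bessel_joint_measurable (@coord_continuous R 1 N ord0 i).
have m1 i := bessel_joint_measurable (c1 i).
have m2 i j := bessel_joint_measurable (c2 i j).
apply: measurable_funD; first apply: measurable_funD.
- by apply: measurable_funM => //; apply: measurable_sum.
- apply: measurable_funM => //; apply: measurable_sum => i.
  apply: measurable_sum_cond => j _.
  apply: measurable_funM; last exact: m1.
  apply: measurable_funD; apply: measurable_inv_comp.
    by apply: measurable_funB; exact: mc.
  by apply: measurable_funD; exact: mc.
- apply: measurable_funM => //; apply: measurable_sum => i.
  apply: measurable_funM; last exact: m1.
  by apply: measurable_inv_comp; exact: mc.
Qed.

Lemma bessel_path_cvg (u : nat -> R) (s : R) (w : Omega) : (forall n, 0 <= u n) -> 0 <= s ->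
  u n @[n --> \oo] --> s -> X (u n) w @[n --> \oo] --> X s w.
Proof.
move=> u0 s0 us; case: HX => _ [_ [_ [cX _]]].
have /subspace_continuousP/(_ _ s0) := cX w.
apply: cvg_comp => A wA.
have hA : \forall n \near \oo, [set v : R | 0 <= v] (u n) -> A (u n) := us _ wA.
by apply: filterS hA => n; apply => /=.
Qed.

Lemma bessel_integrable t (h : 'rV[R]_N -> R) (C : R) :
  0 <= t -> continuous h -> (forall y, CNB y -> `|h y| <= C) ->
  P.-integrable setT (EFin \o (fun w => h (X t w))).
Proof.
move=> t0 ch hC; apply: (@integrable_probability _ _ _ P _ C).
  exact: bessel_measurable.
by move=> w; apply: hC; case: HX => _ [_ [+ _]]; apply.
Qed.

(** The comparison principle. The mean increment of [f] is the time integral of the mean of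
    [genB f]. The latter need not depend continuously on time, since [genB f] may jump at the walls,
    so it is replaced by a continuous minorant [h] whose mean is controlled at each time. *)
Lemma bessel_compare (f h : 'rV[R]_N -> R) (C c s t : R) :
  test_fun f -> (forall y, CNB y -> `|genB k1 k2 f y| <= C) ->
  continuous h -> (forall y, CNB y -> `|h y| <= C) ->
  (forall y, CNB y -> h y <= genB k1 k2 f y) ->
  0 <= s -> s <= t -> (forall u, s <= u <= t -> c <= \int[P]_w h (X u w)) ->
  c * (t - s) <= \int[P]_w f (X t w) - \int[P]_w f (X s w).
Proof.
move=> tf gC ch hC hg s0 st hc.
have t0 : 0 <= t by exact: le_trans st.
have [mX [_ [XC [cX mart]]]] := HX.
have [c2f _] := tf; have [_ [_ [cf _]]] := c2f.
have [_ [_ [M fM]]] := tf.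
pose D : set (measurableTypeR R) := `]s, t]%classic.
have mD : measurable D by exact: measurable_itv.
have D0 : D `<=` [set u | s <= u <= t].
  by move=> u; rewrite /D /= in_itv /= => /andP[/ltW -> ->].
have muD : mu D = (t - s)%:E.
  rewrite /D lebesgue_measure_itv /= lte_fin; case: ltP => // ts.
  by rewrite (_ : t = s) ?subrr//; apply/eqP; rewrite eq_le ts st.
have muDoo : (mu D < +oo)%E by rewrite muD ltry.
have C0 : 0 <= C by apply: le_trans (normr_ge0 _) (gC _ (XC point 0 (lexx _))).
have mg := bessel_genB_measurable c2f.
have mh := bessel_joint_measurable ch.
have X0 (z : R * Omega) : CNB (X (Num.max 0 z.1) z.2).
  by apply: XC; rewrite le_max lexx.
have [ig1 _ eg] := Rintegral_fubini_bounded P mD muDoo mg (fun z => gC _ (X0 z)).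
have [ih1 ih2 eh] := Rintegral_fubini_bounded P mD muDoo mh (fun z => hC _ (X0 z)).
have igu (B : set (measurableTypeR R)) w : measurable B -> (mu B < +oo)%E ->
    mu.-integrable B (EFin \o (fun u => genB k1 k2 f (X (Num.max 0 u) w))).
  move=> mB muB; apply: (@integrable_bounded _ _ _ mu B _ C) => //.
    apply: measurable_funTS.
    exact: (measurableT_comp mg (pair2_measurable w)).
  by move=> u _; exact: (gC _ (X0 (u, w))).
have ihu w : mu.-integrable D (EFin \o (fun u => h (X (Num.max 0 u) w))).
  apply: (@integrable_bounded _ _ _ mu D _ C) => //.
    apply: measurable_funTS.
    exact: (measurableT_comp mh (pair2_measurable w)).
  by move=> u _; exact: (hC _ (X0 (u, w))).
have mt w : \int[mu]_(u in `[0, t]) genB k1 k2 f (X u w) -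
    \int[mu]_(u in `[0, s]) genB k1 k2 f (X u w) =
    \int[mu]_(u in D) genB k1 k2 f (X (Num.max 0 u) w).
  have e v : \int[mu]_(u in `[0, v]) genB k1 k2 f (X u w) =
      \int[mu]_(u in `[0, v]) genB k1 k2 f (X (Num.max 0 u) w).
    apply: eq_Rintegral => u; rewrite inE /= in_itv /= => /andP[u0 _].
    by rewrite max_r.
  rewrite !e Rintegral_itvB ?bnd_simp//.
  apply: igu; first exact: measurable_itv.
  by rewrite lebesgue_measure_itv /=; case: ifP => // _; rewrite ltry.
have [Cf fC] : exists Cf, forall y, CNB y -> `|f y| <= Cf.
  have [Cf hf] := continuous_bounded_ball M cf.
  exists `|Cf| => y _; case: (leP `|y| M) => [/hf h1|/fM ->].
    exact: le_trans h1 (ler_norm _).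
  by rewrite normr0.
have iF v : 0 <= v -> P.-integrable setT (EFin \o (fun w => f (X v w))).
  by move=> v0; apply: (bessel_integrable (C := Cf)).
(* With an empty family of weights the martingale property says that the increment has mean zero. *)
have no (Q : 'I_0 -> Prop) : forall k, Q k by move=> [].
have := mart f tf s t s0 st 0 (fun=> 0) (fun=> cst 0) (no _) (no _) (no _).
have -> : \int[P]_w ((f (X t w) - f (X 0 w) -
      \int[mu]_(u in `[0, t]) genB k1 k2 f (X u w) -
      (f (X s w) - f (X 0 w) - \int[mu]_(u in `[0, s]) genB k1 k2 f (X u w))) *
      \prod_(k < 0) cst 0 (X 0 w)) =
   \int[P]_w (f (X t w) - f (X s w) -
      \int[mu]_(u in D) genB k1 k2 f (X (Num.max 0 u) w)).
  apply: eq_Rintegral => w _; rewrite big_ord0 mulr1 -mt.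
  by rewrite !opprB; ring.
have iB : P.-integrable setT (EFin \o (fun w => f (X t w) - f (X s w))).
  have -> : EFin \o (fun w => f (X t w) - f (X s w)) =
    ((EFin \o (fun w => f (X t w))) \- (EFin \o (fun w => f (X s w))))%E.
    by apply/funext => w /=; rewrite EFinB.
  by apply: integrableB => //; exact: iF.
rewrite RintegralB// RintegralB//; [|exact: iF..].
move=> /eqP; rewrite subr_eq0 => /eqP ->.
apply: (@le_trans _ _ (\int[P]_w \int[mu]_(u in D) h (X (Num.max 0 u) w))).
  rewrite eh.
  have -> : c * (t - s) = \int[mu]_(u in D) c.
    by rewrite Rintegral_cst//; congr (_ * _); have /= <- := congr1 fine muD.
  apply: le_Rintegral => //.
    by apply: (@integrable_bounded _ _ _ mu D _ `|c|).
  by move=> u /D0 /= us; rewrite max_r; [exact: hc|case/andP: us => /(le_trans s0)].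
apply: le_Rintegral => //.
move=> w _; apply: le_Rintegral => //; first exact: igu.
by move=> u _; apply: hg; exact: (X0 (u, w)).
Qed.

End BesselProcess.

(** * Twice differentiable functions and Weyl symmetrisation *)

Section Calculus.
Context {R : realType} {N : nat}.
Local Notation V := 'rV[R]_N.

Lemma is_derive_line (f : V -> R) (x v : V) (l : R) :
  is_derive (0 : R) (1 : R) (fun h : R => f (h *: v + x)) l <-> is_derive x v f l.
Proof.
have E : (fun h : R => h^-1 *: (((fun h : R => f (h *: v + x)) \o shift 0) (h *: 1)
     - f ((0 : R) *: v + x))) = (fun h => h^-1 *: ((f \o shift x) (h *: v) - f x)).
  by apply/funext => h /=; rewrite addr0 scale0r add0r /GRing.scale /= mulr1.
by split => -[h1 h2]; split; move: h1 h2; rewrite /derivable /derive E.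
Qed.

Lemma is_derive_comp1 (phi : R -> R) (f : V -> R) (x v : V) (a b : R) :
  is_derive (f x) (1 : R) phi a -> is_derive x v f b ->
  is_derive x v (phi \o f) (a * b).
Proof.
move=> hphi /is_derive_line hf; apply/is_derive_line.
apply: (@is_derive1_comp _ phi (fun h : R => f (h *: v + x))).
by rewrite scale0r add0r.
Qed.

Lemma is_derive_dirZ (f : V -> R) (x v : V) (c l : R) :
  is_derive x v f l -> is_derive x (c *: v) f (c * l).
Proof.
move=> /is_derive_line hf; apply/is_derive_line.
have -> : (fun h : R => f (h *: (c *: v) + x)) =
    (fun h : R => f (h *: v + x)) \o (fun h : R => h * c).
  by apply/funext => h /=; rewrite scalerA.
rewrite mulrC; apply: is_derive1_comp; first by rewrite mul0r.
have h := @is_deriveM R R idfun (cst c) 0 1 1 0.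
apply: is_derive_eq (h _ _) _.
by rewrite /= /GRing.scale /= mulr0 add0r mulr1.
Qed.

Lemma is_derive_coord (x v : V) i : is_derive x v (fun y : V => y ord0 i) (v ord0 i).
Proof.
apply/is_derive_line.
have -> : (fun h : R => (h *: v + x) ord0 i) = (fun h : R => h * v ord0 i + x ord0 i).
  by apply/funext => h; rewrite !mxE.
have -> : (fun h : R => h * v ord0 i + x ord0 i) =
  ((idfun : R -> R) * cst (v ord0 i) + cst (x ord0 i)) by [].
apply: is_derive_eq.
by rewrite /= /GRing.scale /= mulr0 add0r mulr1 addr0.
Qed.

(** Gradient and Hessian are carried as explicit functions, so that generators of composite test
    functions are computed by algebra rather than by unfolding directional derivatives. *)
Definition hasC2 (f : V -> R) (g : 'I_N -> V -> R) (H : 'I_N -> 'I_N -> V -> R) :=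
  [/\ forall x i, is_derive x (evec R i) f (g i x),
      forall x i j, is_derive x (evec R j) (g i) (H i j x),
      continuous f, forall i, continuous (g i) & forall i j, continuous (H i j)].

Lemma hasC2_pd f g H : hasC2 f g H -> forall i, pd i f = g i.
Proof. by move=> [h _ _ _ _] i; apply/funext => x; have [_] := h x i. Qed.

Lemma hasC2_pd2 f g H : hasC2 f g H -> forall i j, pd j (pd i f) = H i j.
Proof.
move=> h i j; rewrite (hasC2_pd h); apply/funext => x.
by case: h => _ h _ _ _; have [_] := h x i j.
Qed.

Lemma hasC2_C2 f g H : hasC2 f g H -> C2 f.
Proof.
move=> h; have p1 := hasC2_pd h; have p2 := hasC2_pd2 h.
case: h => h1 h2 h3 h4 h5; split; first by move=> x i; have [] := h1 x i.
split; first by move=> x i j; rewrite p1; have [] := h2 x i j.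
split=> //; split => [i|i j]; first by rewrite p1.
by rewrite p2.
Qed.

Lemma genB_hasC2 (k1 k2 : R) f g H y : hasC2 f g H ->
  genB k1 k2 f y = 2^-1 * (\sum_i H i i y)
  + k2 * (\sum_i \sum_(j | j != i)
      ((y ord0 i - y ord0 j)^-1 + (y ord0 i + y ord0 j)^-1) * g i y)
  + k1 * (\sum_i (y ord0 i)^-1 * g i y).
Proof.
move=> h; rewrite /genB; congr (_ * _ + _ * _ + _ * _).
- by apply: eq_bigr => i _; rewrite (hasC2_pd2 h).
- by apply: eq_bigr => i _; apply: eq_bigr => j _; rewrite (hasC2_pd h).
- by apply: eq_bigr => i _; rewrite (hasC2_pd h).
Qed.

Lemma hasC2_cst (c : R) : hasC2 (cst c) (fun _ => cst 0) (fun _ _ => cst 0).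
Proof.
by split=> *; try exact: is_derive_cst; exact: cst_continuous.
Qed.

Lemma hasC2_coord k :
  hasC2 (fun y : V => y ord0 k) (fun i _ => (k == i)%:R) (fun _ _ => cst 0).
Proof.
split=> *; try exact: cst_continuous.
- by apply: is_derive_eq (is_derive_coord _ _ _) _; rewrite mxE eqxx.
- exact: is_derive_cst.
- exact: coord_continuous.
Qed.

Lemma hasC2_add f1 g1 H1 f2 g2 H2 : hasC2 f1 g1 H1 -> hasC2 f2 g2 H2 ->
  hasC2 (fun y => f1 y + f2 y) (fun i y => g1 i y + g2 i y)
    (fun i j y => H1 i j y + H2 i j y).
Proof.
move=> [a1 a2 a3 a4 a5] [b1 b2 b3 b4 b5]; split.
- by move=> x i; exact: is_deriveD.
- by move=> x i j; exact: is_deriveD.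
- by move=> y; exact: (continuousD (a3 y) (b3 y)).
- by move=> i y; exact: (continuousD (a4 i y) (b4 i y)).
- by move=> i j y; exact: (continuousD (a5 i j y) (b5 i j y)).
Qed.

Lemma hasC2_mul f1 g1 H1 f2 g2 H2 : hasC2 f1 g1 H1 -> hasC2 f2 g2 H2 ->
  hasC2 (fun y => f1 y * f2 y) (fun i y => f1 y * g2 i y + f2 y * g1 i y)
    (fun i j y => (f1 y * H2 i j y + g2 i y * g1 j y)
      + (f2 y * H1 i j y + g1 i y * g2 j y)).
Proof.
move=> [a1 a2 a3 a4 a5] [b1 b2 b3 b4 b5]; split.
- by move=> x i; exact: is_deriveM.
- by move=> x i j; apply: is_deriveD; exact: is_deriveM.
- by move=> y; exact: (continuousM (a3 y) (b3 y)).
- by move=> i y; exact: (continuousD (continuousM (a3 y) (b4 i y)) (continuousM (b3 y) (a4 i y))).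
- by move=> i j y; exact: (continuousD
    (continuousD (continuousM (a3 y) (b5 i j y)) (continuousM (b4 i y) (a4 j y)))
    (continuousD (continuousM (b3 y) (a5 i j y)) (continuousM (a4 i y) (b4 j y)))).
Qed.

(** The outer function has to be smooth only at values of [f]; this admits the logarithm of a
    positive function. *)
Lemma hasC2_comp (phi phi1 phi2 : R -> R) f g H : hasC2 f g H ->
  (forall x, is_derive (f x) (1 : R) phi (phi1 (f x))) ->
  (forall x, is_derive (f x) (1 : R) phi1 (phi2 (f x))) ->
  (forall x, {for f x, continuous phi2}) ->
  hasC2 (fun y => phi (f y)) (fun i y => phi1 (f y) * g i y)
    (fun i j y => phi1 (f y) * H i j y + phi2 (f y) * g j y * g i y).
Proof.
move=> [a1 a2 a3 a4 a5] p1 p2 p3.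
have c0 x : {for f x, continuous phi}.
  by apply: differentiable_continuous; apply/derivable1_diffP; have [] := p1 x.
have c1 x : {for f x, continuous phi1}.
  by apply: differentiable_continuous; apply/derivable1_diffP; have [] := p2 x.
have d0 : continuous (fun y => phi (f y)).
  by move=> y; apply: continuous_comp; [exact: a3|exact: c0].
have d1 : continuous (fun y => phi1 (f y)).
  by move=> y; apply: continuous_comp; [exact: a3|exact: c1].
have d2 : continuous (fun y => phi2 (f y)).
  by move=> y; apply: continuous_comp; [exact: a3|exact: p3].
split=> //.
- by move=> x i; exact: is_derive_comp1.
- move=> x i j.
  have h1 := @is_derive_comp1 phi1 f x (evec R j) _ _ (p2 x) (a1 x j).
  have h := @is_deriveM _ _ _ _ _ _ _ _ h1 (a2 x i j).
  apply: is_derive_eq h _; rewrite /GRing.scale /=; ring.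
- by move=> i y; exact: (continuousM (d1 y) (a4 i y)).
- move=> i j y; exact: (continuousD (continuousM (d1 y) (a5 i j y))
    (continuousM (continuousM (d2 y) (a4 j y)) (a4 i y))).
Qed.

Lemma hasC2_sum (I : Type) (s : seq I) (f : I -> V -> R) g H :
  (forall k, hasC2 (f k) (g k) (H k)) ->
  hasC2 (fun y => \sum_(k <- s) f k y) (fun i y => \sum_(k <- s) g k i y)
    (fun i j y => \sum_(k <- s) H k i j y).
Proof.
move=> h; elim: s => [|k s IH].
  have := hasC2_cst 0.
  congr hasC2; first by apply/funext => y; rewrite big_nil.
    by apply/funext => i; apply/funext => y; rewrite big_nil.
  by apply/funext => i; apply/funext => j; apply/funext => y; rewrite big_nil.
have := hasC2_add (h k) IH.
congr hasC2; first by apply/funext => y; rewrite big_cons.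
  by apply/funext => i; apply/funext => y; rewrite big_cons.
by apply/funext => i; apply/funext => j; apply/funext => y; rewrite big_cons.
Qed.

Lemma hasC2_eq f g H f' g' H' : hasC2 f g H -> f =1 f' -> (forall i, g i =1 g' i) ->
  (forall i j, H i j =1 H' i j) -> hasC2 f' g' H'.
Proof.
move=> h /funext <- hg hH.
have <- : g = g' by apply/funext => i; apply/funext; exact: hg.
have <- // : H = H' by apply/funext => i; apply/funext => j; apply/funext; exact: hH.
Qed.

Lemma hasC2_scale (c : R) f g H : hasC2 f g H ->
  hasC2 (fun y => c * f y) (fun i y => c * g i y) (fun i j y => c * H i j y).
Proof.
move=> h; apply: hasC2_eq (hasC2_mul (hasC2_cst c) h) _ _ _ => //= [i y|i j y] /=; ring.
Qed.

End Calculus.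

(** * The hyperoctahedral group and averaging over it *)

Section SignedPermutations.
Context {R : realType} {N : nat}.
Local Notation V := 'rV[R]_N.
Local Notation W := ('S_N * {ffun 'I_N -> bool})%type.

Definition act (w : W) (y : V) : V := \row_i ((-1) ^+ w.2 i * y ord0 (w.1 i)).

Definition weyl1 : W := (1%g, [ffun=> false]).

Lemma act1 y : act weyl1 y = y.
Proof. by apply/rowP => i; rewrite !mxE perm1 ffunE expr0 mul1r. Qed.

Lemma act_linear w c (y z : V) : act w (c *: y + z) = c *: act w y + act w z.
Proof. by apply/rowP => i; rewrite !mxE mulrDr mulrCA. Qed.

Lemma act_evec w j : act w (evec R j) =
  (-1) ^+ w.2 ((w.1)^-1%g j) *: evec R ((w.1)^-1%g j).
Proof.
apply/rowP => i; rewrite !mxE /= ?eqxx /=.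
have [->|ne] := eqVneq i (w.1^-1%g j); first by rewrite permKV eqxx.
rewrite (_ : (w.1 i == j) = false) ?mulr0//.
by apply/negbTE; apply: contra_neq ne => <-; rewrite permK.
Qed.

Lemma act_continuous w : continuous (act w).
Proof.
move=> y; apply: (@cvg_rV _ _ _ (nbhs y) (nbhs_filter y)) => i; rewrite mxE.
under eq_fun do rewrite mxE.
by apply: cvgM; [exact: cvg_cst|exact: coord_continuous].
Qed.

Lemma is_derive_act w (f : V -> R) (x v : V) (l : R) :
  is_derive (act w x) (act w v) f l -> is_derive x v (fun y => f (act w y)) l.
Proof.
move=> /is_derive_line h; apply/is_derive_line.
by under eq_fun do rewrite act_linear.
Qed.

Lemma hasC2_act (w : W) f g H : hasC2 f g H ->
  let q : 'S_N := (w.1^-1)%g in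
  let s i := (-1) ^+ w.2 (q i) : R in
  hasC2 (fun y => f (act w y)) (fun i y => s i * g (q i) (act w y))
   (fun i j y => s i * s j * H (q i) (q j) (act w y)).
Proof.
move=> [a1 a2 a3 a4 a5] q s.
have ca (h : V -> R) : continuous h -> continuous (fun y => h (act w y)).
  by move=> ch y; apply: continuous_comp; [exact: act_continuous|exact: ch].
split.
- by move=> x i; apply: is_derive_act; rewrite act_evec; apply: is_derive_dirZ.
- move=> x i j.
  have h : is_derive x (evec R j) (fun y => g (q i) (act w y))
      (s j * H (q i) (q j) (act w x)).
    by apply: is_derive_act; rewrite act_evec; exact: is_derive_dirZ.
  have := @is_deriveM _ _ _ _ _ _ _ _ (is_derive_cst (s i) x (evec R j)) h.
  rewrite scaler0 addr0 /GRing.scale /= mulrA; exact.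
- exact: ca.
- move=> i y; apply: (@continuousM _ _ (cst (s i))); first exact: cst_continuous.
  exact: (ca _ (a4 _)).
- move=> i j y; apply: (@continuousM _ _ (cst (s i * s j))); first exact: cst_continuous.
  exact: (ca _ (a5 _ _)).
Qed.

Lemma BN_invariant_sum (f : V -> R) : BN_invariant (fun y => \sum_(w : W) f (act w y)).
Proof.
split=> [s x|eps x].
- rewrite [RHS](reindex (fun w : W => ((w.1 * s)%g, w.2))) /=; last first.
    exists (fun w => ((w.1 * s^-1)%g, w.2)) => -[p e] _ /=;
      by rewrite -mulgA ?mulgV ?mulVg mulg1.
  apply: eq_bigr => w _; congr f; apply/rowP => i; rewrite !mxE /= permM.
  by rewrite /Defs.coord.
- rewrite [RHS](reindex (fun w : W => (w.1, [ffun i => w.2 i (+) eps (w.1 i)]))) /=;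
    last first.
    exists (fun w : W => (w.1, [ffun i => w.2 i (+) eps (w.1 i)])) => -[p e] _ /=;
      by congr pair; apply/ffunP => i; rewrite !ffunE -addbA addbb addbF.
  apply: eq_bigr => w _; congr f; apply/rowP => i; rewrite !mxE /= !ffunE.
  by rewrite signr_addb -mulrA /Defs.coord; case: (eps _); rewrite ?mul1r ?mulN1r.
Qed.

Lemma BN_invariant_comp (phi : R -> R) (f : V -> R) :
  BN_invariant f -> BN_invariant (fun y => phi (f y)).
Proof. by move=> [h1 h2]; split=> *; rewrite ?h1 ?h2. Qed.

Lemma BN_invariant_mul (f1 f2 : V -> R) :
  BN_invariant f1 -> BN_invariant f2 -> BN_invariant (fun y => f1 y * f2 y).
Proof. by move=> [a1 a2] [b1 b2]; split=> *; rewrite ?a1 ?b1 ?a2 ?b2. Qed.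

End SignedPermutations.

(** * Zeros of Laguerre polynomials *)

Section Roots.
Context {R : realType} {N : nat}.
Local Notation rootT := ('I_N * 'I_N * bool)%type.

(* The index [(i, j, b)] stands for the root [e_i - (-1)^b e_j]; [(i, i, true)]
   is [2 e_i], which carries the multiplicity [nu], and [(i, i, false)] is the
   zero vector, which gets weight [0]. Each root with [i != j] occurs twice up
   to sign, whence the weight [1/2]. *)
Definition kap (nu : R) (e : rootT) : R :=
  if e.1.1 == e.1.2 then (if e.2 then nu else 0) else 2^-1.

Definition rdf (e : rootT) (G : 'I_N -> R) : R := G e.1.1 - (-1) ^+ e.2 * G e.1.2.

(** For [G] the gradient of [f] at [y], [b] times this is the first-order part of the generator with
    multiplicities (nu b, b). As a sum over roots it depends on [y] and [G] only through their
    pairings with the roots, which suits reflections and Taylor expansion. *)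
Definition drift (nu : R) (y G : 'I_N -> R) : R :=
  \sum_e kap nu e * (rdf e G / rdf e y).

(** Equal to N (N - 1 + nu). By homogeneity it is the value of [drift nu y y] off the walls. *)
Definition kaptot (nu : R) : R := \sum_(e : rootT) kap nu e.

Lemma kap_ge0 nu e : 0 <= nu -> 0 <= kap nu e.
Proof. by rewrite /kap => h; case: ifP => // _; case: ifP. Qed.

Lemma rdfD e F G : rdf e (fun i => F i + G i) = rdf e F + rdf e G.
Proof. rewrite /rdf; ring. Qed.

Lemma rdfZ e (c : R) G : rdf e (fun i => c * G i) = c * rdf e G.
Proof. rewrite /rdf; ring. Qed.

Lemma rdf_sum (I : Type) (s : seq I) e (F : I -> 'I_N -> R) :
  rdf e (fun i => \sum_(k <- s) F k i) = \sum_(k <- s) rdf e (F k).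
Proof. by rewrite /rdf mulr_sumr -sumrB. Qed.

Lemma sum_rootT (F : rootT -> R) :
  \sum_e F e = \sum_i \sum_j (F (i, j, false) + F (i, j, true)).
Proof.
rewrite (pair_bigA _ (fun i j => F (i, j, false) + F (i, j, true))) /=.
transitivity (\sum_(p : 'I_N * 'I_N) \sum_(b : bool) F (p, b)).
  rewrite (pair_bigA _ (fun p b => F (p, b))) /=.
  by apply: eq_bigr => -[].
by apply: eq_bigr => -[i j] _; rewrite big_bool addrC.
Qed.

(** A root with [i != j] feeds both coordinates [i] and [j]. Exchanging the two indices shows the
    two halves to be equal, and the weight 1/2 is used up. *)
Lemma driftE nu y G : drift nu y G =
  \sum_i (\sum_(j | j != i) ((y i - y j)^-1 + (y i + y j)^-1) + nu * (y i)^-1) * G i.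
Proof.
rewrite /drift sum_rootT.
pose A i j := (y i - y j)^-1 + (y i + y j)^-1.
have E i : \sum_j (kap nu (i, j, false) * (rdf (i, j, false) G / rdf (i, j, false) y)
    + kap nu (i, j, true) * (rdf (i, j, true) G / rdf (i, j, true) y)) =
    nu * (y i)^-1 * G i + (\sum_(j | j != i) 2^-1 * (A i j * G i) +
      \sum_(j | j != i) 2^-1 * (A j i * G j)).
  rewrite -big_split (bigD1 i) //=; congr (_ + _).
    rewrite /kap /rdf /= eqxx mul0r add0r expr1 !mulN1r !opprK.
    have [->|y0] := eqVneq (y i) 0; first by rewrite addr0 invr0; ring.
    by field; rewrite y0 /= -mulr2n -mulr_natr mulf_neq0 // pnatr_eq0.
  apply: eq_bigr => j ji; rewrite /kap /= eq_sym (negbTE ji) /rdf /= expr0 expr1.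
  rewrite !mul1r !mulN1r !opprK /A.
  rewrite (addrC (y j) (y i)) -[y j - y i]opprB invrN; ring.
rewrite (eq_bigr _ (fun i _ => E i)) !big_split /=.
have -> : \sum_i \sum_(j | j != i) 2^-1 * (A j i * G j) =
    \sum_i \sum_(j | j != i) 2^-1 * (A i j * G i).
  rewrite (exchange_big_dep predT) //=; apply: eq_bigr => i _.
  by apply: eq_bigl => j; rewrite eq_sym.
rewrite -!big_split /=; apply: eq_bigr => i _.
rewrite mulrDl [RHS]addrC -mulrA; congr (_ + _).
rewrite mulr_suml -big_split /=; apply: eq_bigr => j _; rewrite -/(A i j).
by field.
Qed.

Lemma driftD nu y F G : drift nu y (fun i => F i + G i) = drift nu y F + drift nu y G.
Proof.
by rewrite /drift -big_split; apply: eq_bigr => e _; rewrite rdfD mulrDl mulrDr.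
Qed.

Lemma driftZ nu y (c : R) G : drift nu y (fun i => c * G i) = c * drift nu y G.
Proof.
rewrite /drift mulr_sumr; apply: eq_bigr => e _; rewrite rdfZ; ring.
Qed.

End Roots.
Arguments kaptot {R} N nu.

Section Laguerre.
Context {R : realType}.

Lemma deriv_prod_XsubC (s : seq R) (x : R) : x \notin s ->
  (\prod_(a <- s) ('X - a%:P))^`().[x] =
  (\prod_(a <- s) ('X - a%:P)).[x] * \sum_(a <- s) (x - a)^-1.
Proof.
elim: s => [|a s IH]; first by rewrite !big_nil derivC hornerC mulr0.
rewrite inE negb_or => /andP[xa /IH {}IH]; rewrite !big_cons derivM !hornerE IH.
rewrite derivXsubC !hornerE mulrDr mulrAC mulfV ?mul1r ?subr_eq0//.
Qed.

Lemma laguerre_coef_rec (n : nat) (nu : R) (k : nat) : 0 < nu ->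
  (k.+1%:R * (k%:R + nu)) * (laguerre n (nu - 1))`_k.+1 =
  - (n%:R - k%:R) * (laguerre n (nu - 1))`_k.
Proof.
move=> nu0; rewrite !coef_poly !ltnS.
have [kn|nk|->] := ltngtP k n; last 2 first.
- by rewrite !mulr0.
- by rewrite mulr0 subrr oppr0 mul0r.
rewrite (big_ltn (m := k.+1)) ?ltnS//.
have -> : (n - k)%N = (n - k.+1).+1 by rewrite subnSK.
set Pr := \prod_(_ <= j < _) _.
rewrite !factS !natrM exprS.
have -> : n%:R - k%:R = ((n - k.+1).+1)%:R :> R.
  by rewrite subnSK// natrB// ltnW.
have h1 : k.+1%:R != 0 :> R by rewrite pnatr_eq0.
have h2 : k`!%:R != 0 :> R by rewrite pnatr_eq0 -lt0n fact_gt0.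
have h3 : (n - k.+1)`!%:R != 0 :> R by rewrite pnatr_eq0 -lt0n fact_gt0.
have h4 : (n - k.+1).+1%:R != 0 :> R by rewrite pnatr_eq0.
have -> : nu - 1 + k.+1%:R = k%:R + nu by rewrite -natr1; ring.
move: h1 h2 h3 h4.
move: (k.+1%:R : R) (k`!%:R : R) ((n - k.+1)`!%:R : R) ((n - k.+1).+1%:R : R).
by move=> a b c d h1 h2 h3 h4; field; rewrite h1 h2 h3 h4.
Qed.

(** Comparing coefficients of x^k, the equation is the two-term recursion [laguerre_coef_rec]. *)
Lemma laguerre_ode (n : nat) (nu : R) (x : R) : 0 < nu ->
  x * (laguerre n (nu - 1))^`()^`().[x] + (nu - x) * (laguerre n (nu - 1))^`().[x]
  + n%:R * (laguerre n (nu - 1)).[x] = 0.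
Proof.
move=> nu0; set p := laguerre n (nu - 1).
suff E : 'X * p^`()^`() + (nu%:P - 'X) * p^`() + n%:R *: p = 0.
  by have := congr1 (horner^~ x) E; rewrite !hornerE => <-.
apply/polyP => k; rewrite coef0 !coefD coefXM coefZ mulrBl coefB coefCM coefXM.
have := laguerre_coef_rec n k nu0; rewrite -/p => rec.
case: k rec => [|k] rec /=; rewrite ?coef_deriv.
  move: rec; rewrite mul1r add0r subr0 => rec.
  by rewrite add0r subr0 mulr1n rec; ring.
rewrite -(mulr_natr (_ *+ _) k.+1) -(mulr_natr p`_k.+2 k.+2) -(mulr_natr p`_k.+1 k.+1).
have e : k.+1%:R = k%:R + 1 :> R by rewrite -natr1.
have e2 : k.+2%:R = k%:R + 2 :> R by rewrite -addn2 natrD.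
move: rec; rewrite e e2 => rec.
suff : (k%:R + 2) * (k%:R + 1 + nu) * p`_k.+2 + (n%:R - (k%:R + 1)) * p`_k.+1 = 0.
  by move=> h; rewrite -[RHS]h; ring.
by rewrite rec; ring.
Qed.

(** The Stieltjes relation. Write p = c (X - z_i) q; at the zero z_i one has p' = c q and p'' = 2 c
    q', and q'/q is the sum of the inverse differences. Dividing the differential equation by c
    q(z_i) gives the claim. *)
Lemma laguerre_stieltjes (N : nat) (nu : R) (z : 'I_N -> R) : 0 < nu ->
  (forall i j : 'I_N, (i < j)%N -> z j < z i) ->
  (forall i, root (laguerre N (nu - 1)) (z i)) ->
  forall i, 2 * z i * (\sum_(j | j != i) (z i - z j)^-1) = z i - nu.
Proof.
move=> nu0 zlt zroot i; set p := laguerre N (nu - 1).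
have zinj : injective z.
  move=> a b eab; apply/val_inj.
  by have [/zlt|/zlt|//] := ltngtP a b; rewrite eab ltxx.
pose s := [seq z j | j <- enum 'I_N].
have us : uniq s by rewrite map_inj_uniq ?enum_uniq.
have lc : p`_N != 0.
  rewrite coef_poly ltnSn big_geq // subnn fact0 mulr1 divr1 mulf_eq0 negb_or.
  by rewrite signr_eq0 invr_eq0 pnatr_eq0 -lt0n fact_gt0.
have sp : size p = N.+1.
  apply/eqP; rewrite eqn_leq size_poly /= ltnNge; apply/negP => h.
  by move: lc; rewrite nth_default ?eqxx.
(* The [N] given zeros are distinct and [p] has degree [N], so they are all its roots. *)
have Ep : p = lead_coef p *: \prod_(a <- s) ('X - a%:P).
  apply: all_roots_prod_XsubC; first by rewrite sp size_map size_enum_ord.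
    by apply/allP => _ /mapP[j _ ->]; exact: zroot.
  by rewrite uniq_rootsE.
pose q := \prod_(a <- [seq z j | j <- enum 'I_N & j != i]) ('X - a%:P).
have Eq : p = lead_coef p *: (('X - (z i)%:P) * q).
  rewrite {1}Ep; congr (_ *: _); rewrite /s /q !big_map big_filter.
  by rewrite !big_enum_cond /= (bigD1 i).
have lcp : lead_coef p != 0 by rewrite lead_coefE sp.
have zq : z i \notin [seq z j | j <- enum 'I_N & j != i].
  apply/negP => /mapP[j]; rewrite mem_filter => /andP[ji _] /zinj e.
  by rewrite e eqxx in ji.
have q0 : q.[z i] != 0.
  rewrite /q horner_prod prodf_seq_neq0; apply/allP => a ain /=.
  rewrite !hornerE subr_eq0; apply: contraNneq zq => ->; exact: ain.
have hr : p.[z i] = 0 := rootP (zroot i).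
move: (lead_coef p) lcp Eq => c c0 Eq.
have := laguerre_ode N (z i) nu0; rewrite -/p hr mulr0 addr0 Eq.
rewrite !derivZ derivM derivXsubC mul1r derivD derivM derivXsubC mul1r !hornerE.
have dq : q^`().[z i] = q.[z i] * \sum_(j | j != i) (z i - z j)^-1.
  by rewrite /q deriv_prod_XsubC; [rewrite !big_map !big_filter !big_enum_cond|exact: zq].
rewrite dq subrr !mul0r !addr0; set T := \sum_(_ | _) _.
move=> h.
have {}h : z i * c * (q.[z i] * T + q.[z i] * T + 0) + (nu - z i) * c * q.[z i] = 0 := h.
have {h} : c * q.[z i] * (2 * z i * T - (z i - nu)) = 0.
  by rewrite -[RHS]h; ring.
move/eqP; rewrite !mulf_eq0 (negbTE c0) (negbTE q0) /= subr_eq0.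
by move/eqP.
Qed.

(** Since r_i^2 = 2 z_i, the sum 1/(r_i - r_j) + 1/(r_i + r_j) equals r_i / (z_i - z_j), and the
    Stieltjes relation for the [z i] becomes stationarity for the [r i]. *)
Lemma laguerre_drift (N : nat) (nu : R) (z : 'I_N -> R) : 0 < nu ->
  (forall i j : 'I_N, (i < j)%N -> z j < z i) -> (forall i, 0 < z i) ->
  (forall i, root (laguerre N (nu - 1)) (z i)) ->
  let r i := Num.sqrt (2 * z i) in
  forall G, drift nu r G = 2^-1 * \sum_i r i * G i.
Proof.
move=> nu0 zlt z0 zroot r G; rewrite driftE mulr_sumr; apply: eq_bigr => i _.
rewrite mulrA; congr (_ * _).
have r2 j : r j ^+ 2 = 2 * z j by rewrite sqr_sqrtr // mulr_ge0 // ltW.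
have r0 j : 0 < r j by rewrite sqrtr_gt0 mulr_gt0.
have E : \sum_(j | j != i) ((r i - r j)^-1 + (r i + r j)^-1) =
    r i * \sum_(j | j != i) (z i - z j)^-1.
  rewrite mulr_sumr; apply: eq_bigr => j ji.
  have zij : z i - z j != 0.
    rewrite subr_eq0; move: ji; have [h|h|/val_inj -> /eqP//] := ltngtP j i.
      by move=> _; rewrite lt_eqF ?zlt.
    by move=> _; rewrite gt_eqF ?zlt.
  have e : (r i - r j) * (r i + r j) = 2 * (z i - z j).
    by rewrite -subr_sqr !r2; ring.
  have : (r i - r j) * (r i + r j) != 0 by rewrite e mulf_neq0 // pnatr_eq0.
  rewrite mulf_eq0 negb_or => /andP[h1 h2].
  have -> : (z i - z j)^-1 = 2 / ((r i - r j) * (r i + r j)).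
    by rewrite e; field.
  by field; rewrite h1 h2.
have st := laguerre_stieltjes nu0 zlt zroot i.
rewrite E; set T := \sum_(_ | _) _ in st *.
have ri : r i != 0 by rewrite gt_eqF.
apply: (mulfI ri); rewrite mulrDr mulrA -expr2 r2 st.
have -> : r i * (2^-1 * r i) = z i by rewrite mulrCA -expr2 r2; field.
by field.
Qed.

End Laguerre.

Section RealSymmetric.
Import complex.

(* The complex spectral theorem followed by real parts. *)
Lemma real_symmetric_eigensum {R : realType} (n : nat) (S : 'M[R]_n) (xi : 'rV[R]_n) :
  S^T = S -> exists (lam : 'I_n -> R) (a : 'I_n -> 'rV[R]_n),
    (forall k, a k *m S = lam k *: a k) /\ xi = \sum_k a k.
Proof.
move=> symS.
pose C := complex R.
pose A : 'M[C]_n := map_mx (fun t : R => Complex t 0 : C) S.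
have hA : A \is hermsymmx.
  apply: realsym_hermsym.
    apply/is_hermitianmxP; rewrite expr0 scale1r; apply/matrixP => i j.
    by rewrite !mxE -{1}symS mxE.
  apply/mxOverP => i j; rewrite mxE; apply/orP.
  by case: (leP 0 (S i j)) => h; [left|right]; rewrite lecE /= eqxx //= ltW.
have dreal := hermitian_spectral_diag_real hA.
have /orthomx_spectralP := hermitian_normalmx hA.
set Pm := spectralmx A; set dg := spectral_diag A => EA.
have uP : Pm \in unitmx by exact: spectral_unit.
pose xc : 'rV[C]_n := map_mx (fun t : R => Complex t 0 : C) xi.
pose c := xc *m invmx Pm.
have rowA k : row k Pm *m A = dg 0 k *: row k Pm.
  rewrite {1}EA !mulmxA -row_mul mulmxV // row1 -rowE row_diag_mx.
  by rewrite -scalemxAl -rowE.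
pose re (v : 'rV[C]_n) : 'rV[R]_n := map_mx (@Re R) v.
have reA v : re (v *m A) = re v *m S.
  apply/rowP => j; rewrite !mxE raddf_sum; apply: eq_bigr => i _; rewrite !mxE.
  by case: (v 0 i) => p q /=; rewrite mulr0 subr0.
have reM (p : R) (u : C) : Re ((Complex p 0 : C) * u) = p * Re u.
  by case: u => a b /=; rewrite mul0r subr0.
(* The real parts may vanish and need not be orthogonal. All that is claimed is that each satisfies
   the eigenvector equation and that they add up to [xi]. *)
exists (fun k => Re (dg 0 k)), (fun k => re (c 0 k *: row k Pm)); split.
  move=> k; rewrite -reA -scalemxAl rowA scalerA mulrC -scalerA.
  have : dg 0 k \is Num.real by move/mxOverP : dreal; apply.
  case: (dg 0 k) => p q /= hq.
  have q0 : q = 0 by move: hq; rewrite realE !lecE /= => /orP[] /andP[/eqP].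
  apply/rowP => j; rewrite !mxE q0.
  exact: reM.
have -> : \sum_k re (c 0 k *: row k Pm) = re (\sum_k c 0 k *: row k Pm).
  apply/rowP => j; rewrite mxE !summxE raddf_sum.
  by apply: eq_bigr => k _; rewrite !mxE.
rewrite -mulmx_sum_row /c mulmxKV //.
by apply/rowP => j; rewrite !mxE.
Qed.

End RealSymmetric.

(** * Test functions and moment bounds *)

Section Generator.
Context {R : realType} {N : nat}.
Local Notation V := 'rV[R]_N.
Local Notation W := ('S_N * {ffun 'I_N -> bool})%type.
Local Notation rootT := ('I_N * 'I_N * bool)%type.

Definition genC2 (nu b : R) (g : 'I_N -> V -> R) (H : 'I_N -> 'I_N -> V -> R) (y : V) :=
  2^-1 * (\sum_i H i i y) + b * drift nu (y ord0) (g^~ y).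

Lemma genB_genC2 (nu b : R) (f : V -> R) g H (y : V) : hasC2 f g H ->
  genB (nu * b) b f y = genC2 nu b g H y.
Proof.
move=> h; rewrite (genB_hasC2 _ _ _ h) /genC2 -addrA driftE; congr (_ + _).
rewrite [nu * b]mulrC -mulrA -mulrDr; congr (_ * _).
rewrite mulr_sumr -big_split /=; apply: eq_bigr => i _.
by rewrite mulrDl mulr_suml mulrA.
Qed.

Lemma genC2_mul (nu b : R) (f1 : V -> R) g1 H1 (f2 : V -> R) g2 H2 (y : V) :
  genC2 nu b (fun i y => f1 y * g2 i y + f2 y * g1 i y)
    (fun i j y => (f1 y * H2 i j y + g2 i y * g1 j y)
      + (f2 y * H1 i j y + g1 i y * g2 j y)) y =
  f1 y * genC2 nu b g2 H2 y + f2 y * genC2 nu b g1 H1 y + \sum_i g1 i y * g2 i y.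
Proof.
rewrite /genC2 driftD !driftZ !big_split /= -!mulr_sumr.
have -> : \sum_i g2 i y * g1 i y = \sum_i g1 i y * g2 i y.
  by apply: eq_bigr => i _; rewrite mulrC.
by field.
Qed.

(** Each quotient is 1, except on a wall, where the convention 1/0 = 0 makes it 0; hence two
    inequalities instead of the value [kaptot N nu]. *)
Lemma drift_scale nu (y : 'I_N -> R) : 0 <= nu -> 0 <= drift nu y y <= kaptot N nu.
Proof.
move=> nu0; apply/andP; split.
  apply: sumr_ge0 => e _; apply: mulr_ge0; first exact: kap_ge0.
  by have [->|h] := eqVneq (rdf e y) 0; rewrite ?invr0 ?mulr0// divff.
apply: ler_sum => e _; rewrite ler_piMr ?kap_ge0//.
by have [->|h] := eqVneq (rdf e y) 0; rewrite ?invr0 ?mulr0// divff.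
Qed.

(** The orthogonal reflection in the hyperplane of the root [e]: a transposition, with both signs
    flipped when [e.2] holds. For the zero vector [(i, i, false)] it is the identity. *)
Definition rfl (e : rootT) : W :=
  (tperm e.1.1 e.1.2, [ffun k => e.2 && ((k == e.1.1) || (k == e.1.2))]).

Lemma BN_invariant_act (f : V -> R) (w : W) y : BN_invariant f -> f (act w y) = f y.
Proof.
move=> [h1 h2].
rewrite -(h1 w.1 y) -(h2 (fun i => w.2 i) (\row_i _)); congr f.
apply/rowP => i; rewrite !mxE /Defs.coord !mxE.
by case: (w.2 i); rewrite ?mulN1r ?mul1r.
Qed.

(** The gradient of an invariant function is equivariant, so its component along a root is odd under
    the reflection in that root. *)
Lemma rdf_grad_rfl (f : V -> R) g H (e : rootT) (y : V) : hasC2 f g H -> BN_invariant f ->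
  rdf e (g^~ (act (rfl e) y)) = - rdf e (g^~ y).
Proof.
move=> hf inv.
have ha := hasC2_act (rfl e) hf.
have fE : (fun y => f (act (rfl e) y)) = f.
  by apply/funext => z; exact: BN_invariant_act.
have gE k : g k y = (-1) ^+ (rfl e).2 ((rfl e).1^-1%g k) * g ((rfl e).1^-1%g k) (act (rfl e) y).
  by rewrite -(hasC2_pd hf) -[in LHS]fE (hasC2_pd ha).
clear ha fE; case: e gE => -[i j] b gE; rewrite /rdf /= in gE *.
have := gE i; have := gE j; rewrite /rfl /= tpermV !ffunE tpermL tpermR !eqxx /= orbT andbT.
move=> -> ->; rewrite mulrA -signr_addb addbb mul1r.
by case: b {gE}; rewrite /= ?expr0 ?expr1; ring.
Qed.

Lemma coord_step (h : V -> R) (h' : V -> R) (B : R) (i : 'I_N) :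
  (forall x, is_derive x (evec R i) h (h' x)) -> (forall x, `|h' x| <= B) ->
  forall (c : R) y, `|h (c *: evec R i + y) - h y| <= B * `|c|.
Proof.
move=> dh hB c y.
have D (s : R) : is_derive s (1 : R) (fun s : R => h (s *: evec R i + y))
    (h' (s *: evec R i + y)).
  have -> : (fun s : R => h (s *: evec R i + y)) =
      (fun u : R => h (u *: evec R i + (s *: evec R i + y))) \o (fun u => u - s).
    by apply/funext => u /=; rewrite addrA -scalerDl subrK.
  have E1 : is_derive s (1 : R) (fun u : R => u - s) 1.
    by apply: is_derive_eq; rewrite subr0.
  rewrite -[h' _]mulr1; apply: is_derive1_comp.
  by rewrite subrr; apply/is_derive_line; exact: dh.
have cont (a b : R) : {within `[a, b], continuous (fun s : R => h (s *: evec R i + y))}.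
  by apply: derivable_within_continuous => s _; have [] := D s.
have B0 : 0 <= B := le_trans (normr_ge0 _) (hB 0).
have [c0|c0|<-] := ltgtP 0 c.
- have [u _] := @MVT R _ _ 0 c c0 (fun s _ => D s) (cont _ _).
  rewrite scale0r add0r => ->; rewrite normrM subr0.
  by apply: ler_wpM2r => //; exact: hB.
- have [u _] := @MVT R _ _ c 0 c0 (fun s _ => D s) (cont _ _).
  rewrite scale0r add0r distrC => ->; rewrite normrM sub0r normrN.
  by apply: ler_wpM2r => //; exact: hB.
- by rewrite scale0r add0r subrr normr0 mulr_ge0.
Qed.

(** This tames the singular drift. The component [G] of the gradient along [e] is odd under the
    reflection, so twice its size is the difference of its values at [y] and at the mirror image,
    and bounded second derivatives make this at most a multiple of the distance to the wall. *)
Lemma rdf_grad_bound (f : V -> R) g H (B : R) (e : rootT) (y : V) : hasC2 f g H -> BN_invariant f ->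
  (forall i j x, `|H i j x| <= B) ->
  `|rdf e (g^~ y)| <= 2 * B * `|rdf e (y ord0)|.
Proof.
move=> hf inv HB; have rfE := rdf_grad_rfl e y hf inv.
have [_ dg _ _ _] := hf.
case: e rfE => -[i j] b rfE.
set G := fun x => rdf (i, j, b) (g^~ x) in rfE *.
have stepG k (c : R) x : `|G (c *: evec R k + x) - G x| <= 2 * B * `|c|.
  have h1 := coord_step (fun x => dg x i k) (HB i k) c x.
  have h2 := coord_step (fun x => dg x j k) (HB j k) c x.
  rewrite /G /rdf /=.
  set A1 := g i (_ + _) in h1 *; set A2 := g j (_ + _) in h2 *.
  have -> : A1 - (-1) ^+ b * A2 - (g i x - (-1) ^+ b * g j x) =
    (A1 - g i x) - (-1) ^+ b * (A2 - g j x) by ring.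
  apply: (le_trans (ler_normB _ _)).
  by rewrite normrM normrX normrN1 expr1n mul1r; lra.
set D := rdf (i, j, b) (y ord0).
(* The mirror image is reached by moving coordinate [i] by [- D] and, if [j] differs from [i],
   coordinate [j] by plus or minus [D]; each move changes [G] by at most [2 * B * |D|]. *)
have E : act (rfl (i, j, b)) y = (if i == j then 0 else (- (-1) ^+ b * - D)) *: evec R j
   + ((- D) *: evec R i + y).
  apply/rowP => k; rewrite /D /rdf !mxE /= ffunE /=.
  have [ij|ij] := eqVneq i j.
    rewrite -ij tperm1 perm1 orbb mul0r add0r.
    have [->|ki] := eqVneq k i; last by rewrite andbF mul1r mulr0 add0r.
    by rewrite andbT /=; case: b {rfE G stepG D} => /=; ring.
  have [->|ki] := eqVneq k i.
    by rewrite tpermL (negbTE ij) /= andbT; case: b {rfE G stepG D} => /=; ring.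
  have [->|kj] := eqVneq k j.
    by rewrite tpermR /= andbT; case: b {rfE G stepG D} => /=; ring.
  by rewrite tpermD 1?eq_sym //= andbF /=; ring.
have H2 : `|G (act (rfl (i, j, b)) y) - G y| <= 2 * (2 * B * `|D|).
  rewrite E; set z := (- D) *: evec R i + y.
  have e1 := stepG i (- D) y; rewrite -/z normrN in e1.
  set c := (if _ then _ else _).
  have e2 := stepG j c z.
  have cD : 2 * B * `|c| <= 2 * B * `|D|.
    apply: ler_wpM2l.
      by rewrite mulr_ge0// (le_trans (normr_ge0 _) (HB i j 0)).
    rewrite /c; case: ifP => _; first by rewrite normr0.
    by rewrite normrM !normrN normrX normrN1 expr1n mul1r.
  have -> : G (c *: evec R j + z) - G y = (G (c *: evec R j + z) - G z) + (G z - G y).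
    ring.
  by apply: (le_trans (ler_normD _ _)); lra.
have rE : G (act (rfl (i, j, b)) y) = - G y := rfE.
move: H2; rewrite rE (_ : - G y - G y = - (2 * G y)); last by ring.
rewrite normrN normrM ger0_norm // ler_pM2l //.
Qed.

Lemma genB_bounded (nu b : R) (f : V -> R) : 0 <= nu -> test_fun f ->
  exists C, forall y, `|genB (nu * b) b f y| <= C.
Proof.
move=> nu0 [c2 [inv [M fM]]].
have [d1 [d2 [cf [c1 c2']]]] := c2.
have hf : hasC2 f (fun i => pd i f) (fun i j => pd j (pd i f)).
  by split.
have out (h : V -> R) (k : 'I_N) : (forall x, M < `|x| -> h x = 0) ->
    forall x, M < `|x| -> pd k h x = 0.
  move=> hM x xM; have op : open [set z : V | M < `|z|].
    have -> : [set z : V | M < `|z|] = (fun z : V => `|z|) @^-1` [set r : R | M < r] by [].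
    by apply: open_comp; [move=> z _; exact: norm_continuous|exact: open_gt].
  rewrite /pd; have -> : 'D_(evec R k) h x = 'D_(evec R k) (cst 0) x.
    apply: near_eq_derive.
    by apply: filterS (open_nbhs_nbhs (conj op xM)) => z /= zM; rewrite hM.
  by rewrite derive_cst.
have bd (h : V -> R) : continuous h -> (forall x, M < `|x| -> h x = 0) ->
    exists C, 0 <= C /\ forall x, `|h x| <= C.
  move=> ch hM; have [C hC] := continuous_bounded_ball M ch.
  exists `|C|; split => // x; case: (leP `|x| M) => [/hC h1|/hM ->].
    exact: le_trans h1 (ler_norm _).
  by rewrite normr0.
have bH (p : 'I_N * 'I_N) : exists C, 0 <= C /\ forall x, `|pd p.2 (pd p.1 f) x| <= C.
  apply: bd; first exact: c2'.
  exact: (out _ p.2 (out _ p.1 fM)).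
have [Cp hCp] := choice bH.
pose B := \sum_p Cp p.
have HB i j x : `|pd j (pd i f) x| <= B.
  apply: (le_trans ((hCp (i, j)).2 x)); rewrite /B (bigD1 (i, j)) //= lerDl.
  by apply: sumr_ge0 => p _; exact: (hCp p).1.
exists (2^-1 * (\sum_(i < N) B) + `|b| * \sum_(e : rootT) kap nu e * (2 * B)) => y.
rewrite (genB_genC2 _ _ _ hf) /genC2.
apply: (le_trans (ler_normD _ _)); apply: lerD.
  rewrite normrM ger0_norm ?invr_ge0 // ler_pM2l ?invr_gt0 //.
  by apply: (le_trans (ler_norm_sum _ _ _)); apply: ler_sum => i _.
rewrite normrM; apply: ler_wpM2l => //.
apply: (le_trans (ler_norm_sum _ _ _)); apply: ler_sum => e _.
rewrite normrM ger0_norm ?kap_ge0 //; apply: ler_wpM2l; first exact: kap_ge0.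
have h := rdf_grad_bound e y hf inv HB.
rewrite normrM normfV; have [->|d0] := eqVneq (rdf e (y ord0)) 0.
  rewrite normr0 invr0 mulr0 mulr_ge0 //.
  by apply: (le_trans (normr_ge0 (pd e.1.1 (pd e.1.1 f) 0)) (HB _ _ _)).
by rewrite ler_pdivrMr ?normr_gt0.
Qed.

End Generator.

Section PositivePart.
Context {R : realType}.

(** The cutoffs are built from the third power, the lowest one that is twice continuously
    differentiable. *)
Definition pospow (k : nat) (x : R) : R := Num.max 0 x ^+ k.

Lemma is_derive_pospow (k : nat) (x : R) :
  is_derive x (1 : R) (pospow k.+2) (k.+2%:R * pospow k.+1 x).
Proof.
have [x0|x0|<-] := ltgtP 0 x.
- apply: (@near_eq_is_derive _ _ _ (fun y : R => y ^+ k.+2)).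
    near=> y; rewrite /pospow max_r // ltW //; near: y; exact: lt_nbhsr.
  rewrite /pospow max_r ?ltW //.
  apply: DeriveDef; first exact: exprn_derivable.
  by rewrite exp_derive /GRing.scale /= mulr1.
- apply: (@near_eq_is_derive _ _ _ (cst 0)).
    near=> y; rewrite /pospow max_l ?expr0n //= ltW //; near: y; exact: lt_nbhsl.
  by rewrite /pospow max_l ?ltW // expr0n mulr0; exact: is_derive_cst.
- rewrite /pospow maxxx expr0n mulr0.
  have h : (fun h : R => h^-1 *: ((pospow k.+2 \o shift 0) (h *: (1 : R)) - pospow k.+2 0))
     @ (0 : R)^' --> (0 : R).
    apply/cvgrPdist_lt => e e0; near=> h.
    have h0 : h != 0 by near: h; exact: nbhs_dnbhs_neq.
    rewrite sub0r normrN /= addr0 /GRing.scale /= mulr1 /pospow maxxx expr0n subr0.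
    have hle : `|h| < Num.min 1 e.
      by near: h; apply: dnbhs0_lt; rewrite lt_min ltr01 e0.
    move: hle; rewrite lt_min => /andP[h1 he].
    rewrite normrM normfV normrX.
    have hm : `|Num.max 0 h| <= `|h|.
      by have [|] := leP 0 h => hh; rewrite ?normr0.
    apply: (le_lt_trans _ he).
    rewrite ler_pdivrMl ?normr_gt0 // -expr2.
    apply: (@le_trans _ _ (`|h| ^+ k.+2)); first by apply: lerXn2r; rewrite ?nnegrE.
    rewrite -addn2 exprD ler_piMl ?sqr_ge0 // exprn_ile1 // ltW //.
  split; first by apply/cvg_ex; exists 0; exact: h.
  exact: (cvg_lim (@Rhausdorff R) h).
Unshelve. all: by end_near. Qed.

Lemma continuous_pospow k : continuous (pospow k).
Proof.
move=> x; apply: (@continuous_comp _ _ _ (fun x : R => Num.max 0 x) (fun y => y ^+ k)).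
  by apply: (@continuous_max R R^o (cst 0) idfun); [exact: cvg_cst|exact: cvg_id].
exact: exprn_continuous.
Qed.

Lemma pospow1_ge0 (x : R) : 0 <= pospow 1 x.
Proof. by rewrite /pospow expr1 le_max lexx. Qed.

Lemma pospowE k (x : R) : pospow k x = pospow 1 x ^+ k.
Proof. by rewrite /pospow expr1. Qed.

End PositivePart.

Section RadialFunctions.
Context {R : realType} {N : nat}.
Local Notation V := 'rV[R]_N.

Definition nsq (y : V) : R := \sum_i y ord0 i ^+ 2.

Lemma nsq_ge0 y : 0 <= nsq y.
Proof. by apply: sumr_ge0 => i _; exact: sqr_ge0. Qed.

Lemma norm_sq_le_nsq y : `|y| ^+ 2 <= nsq y.
Proof.
suff : `|y| <= Num.sqrt (nsq y).
  move=> h; rewrite -[leRHS]sqr_sqrtr ?nsq_ge0 //.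
  by apply: lerXn2r; rewrite ?nnegrE ?sqrtr_ge0.
rewrite [leLHS]/Num.norm/= mx_normrE; apply/bigmax_leP; split; first exact: sqrtr_ge0.
move=> [a i] _ /=; rewrite ord1 -sqrtr_sqr ler_wsqrtr //.
rewrite /nsq (bigD1 i) //= lerDl.
by apply: sumr_ge0 => j _; exact: sqr_ge0.
Qed.

Lemma hasC2_nsq : hasC2 nsq (fun i (y : V) => 2 * y ord0 i)
  (fun i j _ => 2 * (i == j)%:R).
Proof.
have h k := hasC2_mul (@hasC2_coord R N k) (@hasC2_coord R N k).
apply: hasC2_eq (hasC2_sum (index_enum 'I_N) h) _ _ _.
- by move=> y; apply: eq_bigr => i _; rewrite expr2.
- move=> i y /=; rewrite (bigD1 i) //= eqxx big1 ?addr0 => [|k ki].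
    by rewrite mulr1 -mulr2n mulr_natl.
  by rewrite (negbTE ki) !mulr0 addr0.
- move=> i j y /=; rewrite (bigD1 i) //= eqxx big1 ?addr0 => [|k ki].
    by rewrite mulr0 !add0r mul1r -mulr2n mulr_natl.
  by rewrite (negbTE ki) !mulr0 !mul0r !addr0.
Qed.

Lemma BN_invariant_nsq : BN_invariant nsq.
Proof.
split=> [s x|eps x]; rewrite /nsq.
  rewrite [RHS](reindex_inj (@perm_inj _ s)).
  by apply: eq_bigr => i _; rewrite !mxE.
by apply: eq_bigr => i _; rewrite mxE /Defs.coord; case: (eps i); rewrite ?sqrrN.
Qed.

(** An explicit invariant C^2 cutoff of squared radius [k]. Its derivatives are again powers of the
    same positive part, which keeps all generator computations polynomial. *)
Definition chi (k : R) (y : V) : R := pospow 3 (1 - k^-1 * nsq y).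

Lemma hasC2_chi k : hasC2 (chi k)
  (fun i (y : V) => (- (3 * k^-1) * pospow 2 (1 - k^-1 * nsq y)) * (2 * y ord0 i))
  (fun i j (y : V) => - (3 * k^-1) * pospow 2 (1 - k^-1 * nsq y) * (2 * (i == j)%:R)
    + (6 * k^-2 * pospow 1 (1 - k^-1 * nsq y)) * (2 * y ord0 j) * (2 * y ord0 i)).
Proof.
have h0 : hasC2 (fun y : V => 1 - k^-1 * nsq y) (fun i y => - k^-1 * (2 * y ord0 i))
    (fun i j _ => - k^-1 * (2 * (i == j)%:R)).
  apply: hasC2_eq (hasC2_add (hasC2_cst 1) (hasC2_scale (- k^-1) hasC2_nsq)) _ _ _.
  - by move=> y /=; rewrite mulNr.
  - by move=> i y /=; rewrite add0r.
  - by move=> i j y /=; rewrite add0r.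
have := @hasC2_comp R N (pospow 3) (fun x => 3 * pospow 2 x) (fun x => 6 * pospow 1 x)
  _ _ _ h0.
move=> /(_ (fun x => is_derive_pospow 1 _)).
have d2 (x : R) : is_derive x (1 : R) (fun x => 3 * pospow 2 x) (6 * pospow 1 x).
  have h := is_derive_pospow 0 x.
  have -> : (fun x => 3 * pospow 2 x) = (3 : R) *: pospow 2 by [].
  by apply: is_derive_eq; rewrite /GRing.scale /=; ring.
move=> /(_ (fun x => d2 _)).
have c6 (x : R) : {for x, continuous (fun x : R => 6 * pospow 1 x)}.
  by apply: (@continuousM _ _ (cst 6)); [exact: cst_continuous|exact: continuous_pospow].
move=> /(_ (fun x => c6 _)) h.
apply: hasC2_eq h _ _ _ => //.
  by move=> i y /=; ring.
by move=> i j y /=; rewrite -exprVn; ring.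
Qed.

Lemma BN_invariant_chi k : BN_invariant (chi k).
Proof. exact: (BN_invariant_comp (fun t => pospow 3 (1 - k^-1 * t)) BN_invariant_nsq). Qed.

Lemma chi_support k (f : V -> R) : 0 < k -> compact_support (fun y => f y * chi k y).
Proof.
move=> k0; exists (k + 1) => y hy; rewrite /chi /pospow max_l ?expr0n ?mulr0 //.
rewrite subr_le0 mulrC ler_pdivlMr // mul1r.
apply: le_trans (norm_sq_le_nsq y).
have : 1 < `|y| by apply: lt_trans hy; rewrite ltrDr.
have : k < `|y| by apply: lt_trans hy; rewrite ltrDl.
by rewrite expr2; nra.
Qed.

(** The last bound is 1 - (1 - q)^3 <= 3 q. It turns the cost of the cutoff into a second moment
    divided by [k]. *)
Lemma chi_bounds k y : 0 < k ->
  [/\ 0 <= chi k y, chi k y <= 1 & 1 - chi k y <= 3 * (k^-1 * nsq y)].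
Proof.
move=> k0; rewrite /chi /pospow.
suff H (q : R) : 0 <= q -> [/\ 0 <= Num.max 0 (1 - q) ^+ 3,
    Num.max 0 (1 - q) ^+ 3 <= 1 & 1 - Num.max 0 (1 - q) ^+ 3 <= 3 * q].
  by apply: H; rewrite mulr_ge0 ?nsq_ge0 // invr_ge0 ltW.
move=> q0.
have [h|h] := leP 0 (1 - q); last by rewrite expr0n /=; split; lra.
have -> : (1 - q) ^+ 3 = (1 - q) * ((1 - q) * (1 - q)) by ring.
have h1 : 1 - q <= 1 by lra.
have h2 : 0 <= (1 - q) * (1 - q) <= 1 by apply/andP; split; nra.
by case/andP: h2 => h2 h3; split; nra.
Qed.

Lemma genC2_chi (nu b k : R) (y : V) :
  genC2 nu b (fun i (y : V) => (- (3 * k^-1) * pospow 2 (1 - k^-1 * nsq y)) * (2 * y ord0 i))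
  (fun i j (y : V) => - (3 * k^-1) * pospow 2 (1 - k^-1 * nsq y) * (2 * (i == j)%:R)
    + (6 * k^-2 * pospow 1 (1 - k^-1 * nsq y)) * (2 * y ord0 j) * (2 * y ord0 i)) y =
  let p := pospow 1 (1 - k^-1 * nsq y) in
  - (3 * k^-1) * p ^+ 2 * (N%:R + 2 * b * drift nu (y ord0) (y ord0))
    + 12 * k^-2 * p * nsq y.
Proof.
rewrite /genC2 /= driftZ driftZ.
rewrite [pospow 2 _]pospowE; set p := pospow 1 _; set D := drift _ _ _.
have -> : \sum_i (- (3 * k^-1) * p ^+ 2 * (2 * (i == i)%:R) +
    6 * k^-2 * p * (2 * y ord0 i) * (2 * y ord0 i)) =
    N%:R * (- (3 * k^-1) * p ^+ 2 * 2) + 24 * k^-2 * p * nsq y.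
  rewrite big_split /=; congr (_ + _).
    under eq_bigr do rewrite eqxx mulr1.
    by rewrite [RHS]mulr_natl sumr_const card_ord.
  by rewrite /nsq mulr_sumr; apply: eq_bigr => i _; ring.
by rewrite -exprVn; move: (k^-1) => k'; field.
Qed.

Lemma genC2_nsq (nu b : R) (y : V) :
  genC2 nu b (fun i (y : V) => 2 * y ord0 i) (fun i j (_ : V) => 2 * (i == j)%:R) y =
  N%:R + 2 * b * drift nu (y ord0) (y ord0).
Proof.
rewrite /genC2 driftZ; under eq_bigr do rewrite eqxx mulr1.
by rewrite sumr_const card_ord -[2 *+ N]mulr_natl; field.
Qed.

Lemma genC2_scale (nu b c : R) g H (y : V) :
  genC2 nu b (fun i y => c * g i y) (fun i j y => c * H i j y) y = c * genC2 nu b g H y.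
Proof. by rewrite /genC2 driftZ -mulr_sumr; ring. Qed.

Lemma pospow1_lt0_eq (k : R) (y : V) : 0 < k ->
  let p := pospow 1 (1 - k^-1 * nsq y) in
  [/\ 0 <= p, p <= 1 & p = 0 \/ nsq y <= k].
Proof.
move=> k0 p; have n0 := nsq_ge0 y.
split; first exact: pospow1_ge0.
  rewrite /p /pospow expr1 ge_max ler01 /= gerBl mulr_ge0 // invr_ge0 ltW //.
rewrite /p /pospow expr1; have [h|h] := leP 0 (1 - k^-1 * nsq y); [right|by left].
by move: h; rewrite subr_ge0 mulrC ler_pdivrMr // mul1r.
Qed.

End RadialFunctions.

Section Fatou.
Context {R : realType} d (T : measurableType d) (P : probability T R).

Lemma Rintegral_fatou (f : nat -> T -> R) (g : T -> R) (C : R) :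
  (forall n, P.-integrable setT (EFin \o f n)) -> (forall n w, 0 <= f n w) ->
  (forall w, f n w @[n --> \oo] --> g w) -> (forall n, \int[P]_w f n w <= C) ->
  P.-integrable setT (EFin \o g) /\ \int[P]_w g w <= C.
Proof.
move=> fi f0 fg fC.
have mf n : measurable_fun setT (f n) by have /integrableP[/measurable_EFinP] := fi n.
have mg : measurable_fun setT g.
  by apply: (@measurable_fun_cvg _ _ _ setT f) => // w _; exact: fg.
have g0 w : 0 <= g w.
  rewrite -(cvg_lim (@Rhausdorff R) (fg w)); apply: limr_ge.
    by apply/cvg_ex; eexists; exact: fg.
  by apply: nearW => n.
have le : (\int[P]_w (g w)%:E <= C%:E)%E.
  have E w : limn_einf (fun n => (f n w)%:E) = (g w)%:E.
    have h : (f n w)%:E @[n --> \oo] --> (g w)%:E.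
      by apply: cvg_EFin; [exact: nearW|exact: fg].
    have [_ h2] := cvg_limn_einf_sup h.
    by have [-> _] := cvg_limn_einf_sup h.
  under eq_integral do rewrite -E.
  apply: (@le_trans _ _ (limn_einf (fun n => \int[P]_w (f n w)%:E)%E)).
    apply: fatou => //.
      by move=> n; exact/measurable_EFinP.
    by move=> n w _; rewrite lee_fin.
  rewrite limn_einf_lim; apply: lime_le; first exact: is_cvg_einfs.
  apply: nearW => n; apply: (@le_trans _ _ (\int[P]_w (f n w)%:E)%E).
    by apply: ereal_inf_lbound; exists n => //=.
  rewrite -[leLHS]fineK ?lee_fin; first exact: fC.
  exact: (integrable_fin_num measurableT (fi n)).
have gi : P.-integrable setT (EFin \o g).
  apply/integrableP; split; first exact/measurable_EFinP.
  apply: (@le_lt_trans _ _ C%:E); last exact: ltry.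
  by under eq_integral do rewrite /= ger0_norm //.
split => //; rewrite -lee_fin fineK //.
exact: (integrable_fin_num measurableT gi).
Qed.

End Fatou.

(** Summing over n + 1 equal steps, with the rate taken at the right end of each, overshoots the
    integral of A + B s by B T^2 / (2 (n + 1)), which tends to 0. No differentiability of [phi] is
    involved. *)
Lemma quadratic_growth {R : realType} (phi : R -> R) (A B T : R) : 0 <= B -> 0 <= T ->
  (forall s s', 0 <= s -> s <= s' -> s' <= T ->
     phi s' - phi s <= (A + B * s') * (s' - s)) ->
  phi T - phi 0 <= A * T + 2^-1 * B * T ^+ 2.
Proof.
move=> B0 T0 h.
have step n k : (k <= n.+1)%N -> let s := k%:R * (T / n.+1%:R) in
    phi s - phi 0 <= A * s + 2^-1 * B * s ^+ 2
      + k%:R * (2^-1 * B * (T / n.+1%:R) ^+ 2).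
  have d0 : 0 <= T / n.+1%:R by rewrite divr_ge0.
  have dT : n.+1%:R * (T / n.+1%:R) = T by rewrite mulrC divfK // pnatr_eq0.
  elim: k => [|k IH] kn /=; first by rewrite !mul0r subrr mulr0 expr0n /= !mulr0 !addr0.
  have {IH} := IH (ltnW kn).
  set dl := T / n.+1%:R in d0 dT *; set s := k%:R * dl => IH.
  have -> : k.+1%:R * dl = s + dl by rewrite -[k.+1%:R]natr1 mulrDl mul1r.
  have s0 : 0 <= s by rewrite mulr_ge0.
  have sT : s + dl <= T.
    rewrite -[leRHS]dT (_ : s + dl = k.+1%:R * dl); last by rewrite -[k.+1%:R]natr1 mulrDl mul1r.
    by apply: ler_wpM2r => //; rewrite ler_nat.
  have := h s (s + dl) s0 _ sT; rewrite lerDl => /(_ d0).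
  rewrite [s + dl - s]addrC addKr -[k.+1%:R]natr1 => h1.
  rewrite /= in IH.
  move: IH h1; set Q := k%:R * (2^-1 * B * dl ^+ 2) => IH h1.
  have -> : (k%:R + 1) * (2^-1 * B * dl ^+ 2) = Q + 2^-1 * B * dl ^+ 2.
    by rewrite /Q; ring.
  have -> : 2^-1 * B * (s + dl) ^+ 2 =
     2^-1 * B * s ^+ 2 + B * (s + dl) * dl - 2^-1 * B * dl ^+ 2 by field.
  by move: IH h1; rewrite !mulrDl !mulrDr; lra.
rewrite leNgt; apply/negP => H.
set D := phi T - phi 0 - (A * T + 2^-1 * B * T ^+ 2).
have D0 : 0 < D by rewrite /D subr_gt0.
pose n := Num.bound (2^-1 * B * T ^+ 2 / D).
have hn : 2^-1 * B * T ^+ 2 / D < n.+1%:R.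
  have q0 : 0 <= 2^-1 * B * T ^+ 2 / D.
    by rewrite divr_ge0 ?mulr_ge0 ?sqr_ge0 // ltW.
  by apply: (lt_le_trans (archi_boundP q0)); rewrite ler_nat.
have := step n n.+1 (leqnn _) => /=.
have nn0 : n.+1%:R != 0 :> R by rewrite pnatr_eq0.
have -> : n.+1%:R * (T / n.+1%:R) = T by rewrite mulrC divfK.
have -> : n.+1%:R * (2^-1 * B * (T / n.+1%:R) ^+ 2) = 2^-1 * B * T ^+ 2 / n.+1%:R.
  by move: (n.+1%:R : R) nn0 => c c0; field.
move=> h2; move: hn; rewrite ltr_pdivrMr // => hn.
have {}hn : 2^-1 * B * T ^+ 2 / n.+1%:R < D.
  by rewrite ltr_pdivrMr ?ltr0n // [D * _]mulrC.
move: (2^-1 * B * T ^+ 2 / n.+1%:R) hn h2 => Y; rewrite /D.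
by move: (2^-1 * B * T ^+ 2) (A * T) (phi T) (phi 0) => *; lra.
Qed.

(** * Second and fourth moments of the process *)

Section Moments.
Context {R : realType} {N : nat} (nu b : R) (x : 'rV[R]_N).
Context d (Omega : measurableType d) (P : probability Omega R).
Context (X : R -> Omega -> 'rV[R]_N).
Hypothesis HX : bessel_B (nu * b) b x P X.
Hypothesis nu0 : 0 <= nu.
Hypothesis b0 : 0 <= b.
Local Notation V := 'rV[R]_N.
Local Notation m := (kaptot N nu).

Lemma bessel_CNB t w : 0 <= t -> CNB (X t w).
Proof. by move=> t0; case: HX => _ [_ [+ _]]; apply. Qed.

Lemma expect_start (f : V -> R) : \int[P]_w f (X 0 w) = f x.
Proof.
transitivity (\int[P]_(w in setT) f x).
  by apply: eq_Rintegral => w _; case: HX => _ [-> _].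
by rewrite Rintegral_cst // [X in fine X](probability_setT P) mulr1.
Qed.

Lemma bessel_lower (f : V -> R) g H (h : V -> R) (Ch c s t : R) :
  hasC2 f g H -> BN_invariant f -> compact_support f -> continuous h ->
  (forall y, CNB y -> `|h y| <= Ch) -> (forall y, CNB y -> h y <= genC2 nu b g H y) ->
  0 <= s -> s <= t -> (forall u, s <= u <= t -> c <= \int[P]_w h (X u w)) ->
  c * (t - s) <= \int[P]_w f (X t w) - \int[P]_w f (X s w).
Proof.
move=> hf inv cs ch hC hle s0 st hc.
have tf : test_fun f by split; [exact: hasC2_C2 hf|].
have [C hgC] := genB_bounded b nu0 tf.
apply: (bessel_compare HX (h := h) (C := Num.max C Ch)) => //.
- by move=> y _; rewrite le_max hgC.
- by move=> y /hC hy; rewrite le_max hy orbT.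
- by move=> y /hle; rewrite (genB_genC2 _ _ _ hf).
Qed.

Lemma bessel_upper (f : V -> R) g H (h : V -> R) (Ch c s t : R) :
  hasC2 f g H -> BN_invariant f -> compact_support f -> continuous h ->
  (forall y, CNB y -> `|h y| <= Ch) -> (forall y, CNB y -> genC2 nu b g H y <= h y) ->
  0 <= s -> s <= t -> (forall u, s <= u <= t -> \int[P]_w h (X u w) <= c) ->
  \int[P]_w f (X t w) - \int[P]_w f (X s w) <= c * (t - s).
Proof.
move=> hf inv cs ch hC hle s0 st hc.
have cf : continuous f by case: hf.
have t0 : 0 <= t by exact: le_trans st.
have [Cf hCf] : exists Cf, forall y, CNB y -> `|f y| <= Cf.
  have [M hM] := cs; have [Cf hf'] := continuous_bounded_ball M cf.
  exists `|Cf| => y _; case: (leP `|y| M) => [/hf' h1|/hM ->].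
    exact: le_trans h1 (ler_norm _).
  by rewrite normr0.
have neg u (k : V -> R) (Ck : R) : 0 <= u -> continuous k -> (forall y, CNB y -> `|k y| <= Ck) ->
    \int[P]_w (-1 * k (X u w)) = - \int[P]_w k (X u w).
  by move=> u0 ck kC; rewrite RintegralZl ?mulN1r //; exact: (bessel_integrable HX u0 ck kC).
have := @bessel_lower (fun y => -1 * f y) _ _ (fun y => -1 * h y) Ch (- c) s t
  (hasC2_scale (-1) hf) (BN_invariant_comp (fun r => -1 * r) inv).
rewrite (neg t _ Cf) // (neg s _ Cf) // => hh.
suff : - c * (t - s) <= - (\int[P]_w f (X t w)) - - (\int[P]_w f (X s w)).
  by rewrite mulNr; lra.
apply: hh => //.
- have [M hM] := cs; exists M => y /hM ->; exact: mulr0.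
- by move=> y; apply: (@continuousM _ _ (cst (-1))); [exact: cst_continuous|exact: ch].
- by move=> y /hC; rewrite mulN1r normrN.
- by move=> y /hle; rewrite genC2_scale !mulN1r lerN2.
- move=> u su; rewrite (neg u _ Ch) // ?lerN2; first exact: hc.
  by case/andP: su => /(le_trans s0).
Qed.

(** Without cutoff, the generator maps |y|^2 to at most N + 2 b m and |y|^4 to at most (2 N + 4 + 4
    b m)|y|^2. The extra 12 pays for the second derivative of the cutoff. What matters later is that
    the coefficients of [b] are sharp. *)
Let A1 : R := N%:R + 12 + 2 * b * m.
Let A2 : R := 2 * N%:R + 16 + 4 * b * m.

Let theta1 (k : R) (y : V) := nsq y * chi k y.
Let hth1 (k : R) := hasC2_mul (@hasC2_nsq R N) (@hasC2_chi R N k).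
Let hth2 (k : R) := hasC2_mul (@hasC2_nsq R N) (hth1 k).

Let m0 : 0 <= m.
Proof. by apply: sumr_ge0 => e _; exact: kap_ge0. Qed.

Let A10 : 0 <= A1.
Proof. by rewrite /A1 !addr_ge0 // !mulr_ge0. Qed.

Let A20 : 0 <= A2.
Proof. by rewrite /A2 !addr_ge0 // !mulr_ge0. Qed.

Let rad (k : R) (y : V) : 0 < k ->
  let p := pospow 1 (1 - k^-1 * nsq y) in
  let D := drift nu (y ord0) (y ord0) in
  [/\ 0 <= p, p <= 1, 0 <= N%:R + 2 * b * D, N%:R + 2 * b * D <= N%:R + 2 * b * m &
   p = 0 \/ (k^-1 * nsq y <= 1)].
Proof.
move=> k0 p D; have [p0 p1 pc] := pospow1_lt0_eq y k0.
have /andP[d0 dm] := drift_scale (y ord0) nu0.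
split => //.
- by rewrite addr_ge0 // !mulr_ge0.
- by rewrite lerD2l ler_wpM2l // mulr_ge0.
- by case: pc => [h|h]; [left; exact: h|right; rewrite mulrC ler_pdivrMr // mul1r].
Qed.

Let chiE (k : R) (y : V) : chi k y = pospow 1 (1 - k^-1 * nsq y) ^+ 3.
Proof. by rewrite /chi pospowE. Qed.

(** With q = |y|^2 / k and p the positive part of 1 - q, the terms containing the gradient of the
    cutoff are negative and are dropped. Its second derivative leaves 12 q^2 p, which is at most
    12. *)
Let gen1 (k : R) (y : V) : 0 < k -> forall g H, hasC2 (theta1 k) g H ->
  genC2 nu b g H y <= A1 /\ (pospow 1 (1 - k^-1 * nsq y) = 0 -> genC2 nu b g H y = 0).
Proof.
move=> k0 g H hg; rewrite -(genB_genC2 _ _ _ hg) (genB_genC2 _ _ _ (hth1 k)).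
rewrite genC2_mul genC2_nsq genC2_chi /= chiE.
have := rad y k0; set p := pospow 1 _; set D := drift _ _ _ => /= -[p0 p1 a0 am pc].
rewrite [pospow 2 _]pospowE -/p.
set a := N%:R + 2 * b * D in a0 am *.
have -> : \sum_i 2 * y ord0 i * (- (3 / k) * p ^+ 2 * (2 * y ord0 i)) =
    - 12 * p ^+ 2 * (k^-1 * nsq y).
  by rewrite /nsq !mulr_sumr; apply: eq_bigr => i _; ring.
have -> : nsq y * (- (3 / k) * p ^+ 2 * a + 12 / k ^+ 2 * p * nsq y) + p ^+ 3 * a +
    - 12 * p ^+ 2 * (k^-1 * nsq y) =
    - 3 * (k^-1 * nsq y) * p ^+ 2 * a + 12 * (k^-1 * nsq y) ^+ 2 * p + p ^+ 3 * a
    - 12 * p ^+ 2 * (k^-1 * nsq y).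
  by rewrite -exprVn; ring.
have q0 : 0 <= k^-1 * nsq y by rewrite mulr_ge0 ?nsq_ge0 // invr_ge0 ltW.
move: (k^-1 * nsq y) q0 pc => q q0 pc.
split; last by move=> ->; rewrite !expr0n /=; ring.
have [p0'|q1] := pc.
  by rewrite p0' !expr0n /= !mulr0 !mul0r !add0r oppr0; exact: A10.
have h1 : 0 <= q * p ^+ 2 * a by rewrite !mulr_ge0 // sqr_ge0.
have h2 : q ^+ 2 * p <= 1 by rewrite mulr_ile1 // ?sqr_ge0 // expr_le1.
have h3 : p ^+ 3 * a <= a by rewrite ler_piMl // expr_le1.
have h4 : 0 <= p ^+ 2 * q by rewrite mulr_ge0 // sqr_ge0.
have e1 : - 3 * q * p ^+ 2 * a = - 3 * (q * p ^+ 2 * a) by ring.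
have e2 : 12 * q ^+ 2 * p = 12 * (q ^+ 2 * p) by ring.
have e3 : 12 * p ^+ 2 * q = 12 * (p ^+ 2 * q) by ring.
rewrite e1 e2 e3 /A1; lra.
Qed.

(** The minimum with [k] makes the majorant bounded, as the comparison principle requires; outside
    the support of the cutoff both factors of the product rule vanish. *)
Let gen2 (k : R) (y : V) : 0 < k -> forall g H, hasC2 (fun y => nsq y * theta1 k y) g H ->
  genC2 nu b g H y <= A2 * Num.min (nsq y) k.
Proof.
move=> k0 g H hg; rewrite -(genB_genC2 _ _ _ hg) (genB_genC2 _ _ _ (hth2 k)).
rewrite genC2_mul genC2_nsq.
have [g1a g1b] := gen1 y k0 (hth1 k).
set L1 := genC2 nu b _ _ y in g1a g1b *.
have := rad y k0; rewrite chiE [pospow 2 _]pospowE; set p := pospow 1 _ in g1b *.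
set D := drift _ _ _ => /= -[p0 p1 a0 am pc].
set a := N%:R + 2 * b * D in a0 am *.
have n0 := nsq_ge0 y.
have -> : \sum_i 2 * y ord0 i * (nsq y * (- (3 / k) * p ^+ 2 * (2 * y ord0 i)) +
    p ^+ 3 * (2 * y ord0 i)) =
    4 * nsq y * (p ^+ 3 - 3 * p ^+ 2 * (k^-1 * nsq y)).
  transitivity (4 * (p ^+ 3 - 3 * p ^+ 2 * (k^-1 * nsq y)) * \sum_i y ord0 i ^+ 2).
    by rewrite mulr_sumr; apply: eq_bigr => i _; ring.
  by rewrite -/(nsq y); ring.
have q0 : 0 <= k^-1 * nsq y by rewrite mulr_ge0 // invr_ge0 ltW.
have [pz|q1] := pc.
  rewrite (g1b pz) pz !expr0n /= !(mulr0, mul0r, addr0, subr0).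
  by rewrite mulr_ge0 // le_min n0 ltW.
have nk : nsq y <= k by move: q1; rewrite mulrC ler_pdivrMr // mul1r.
rewrite min_l //.
have h1 : nsq y * L1 <= nsq y * A1 by exact: ler_wpM2l.
have h3 : nsq y * p ^+ 3 * a <= nsq y * a.
  by rewrite -mulrA ler_wpM2l // ler_piMl // expr_le1.
have h4 : nsq y * (p ^+ 3 - 3 * p ^+ 2 * (k^-1 * nsq y)) <= nsq y.
  rewrite ler_piMr // lerBlDr; apply: (@le_trans _ _ 1); first by rewrite expr_le1.
  by rewrite lerDl mulr_ge0 // mulr_ge0 // sqr_ge0.
have h5 : nsq y * a <= nsq y * (N%:R + 2 * b * m) by exact: ler_wpM2l.
have -> : A2 * nsq y = nsq y * A1 + nsq y * (N%:R + 2 * b * m) + 4 * nsq y.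
  by rewrite /A1 /A2; ring.
move: h1 h3 h4 h5; rewrite -[4 * _ * _]mulrA.
move: (nsq y * L1) (nsq y * p ^+ 3 * a) (nsq y * _) (nsq y * A1) (nsq y * a).
by move: (nsq y * (N%:R + 2 * b * m)) => *; lra.
Qed.

Let cvg_chi (y : V) : chi n.+1%:R y @[n --> \oo] --> (1 : R).
Proof.
have e : (1 : R) = pospow 3 (1 - 0 * nsq y).
  by rewrite /pospow mul0r subr0 max_r // expr1n.
rewrite {2}e /chi; apply: continuous_cvg; first exact: continuous_pospow.
apply: cvgB; first exact: cvg_cst.
by apply: cvgM; [exact: cvg_harmonic|exact: cvg_cst].
Qed.

Lemma second_moment t : 0 <= t ->
  P.-integrable setT (EFin \o (fun w => nsq (X t w))) /\
  \int[P]_w nsq (X t w) <= nsq x + A1 * t.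
Proof.
move=> t0.
have cth k : continuous (theta1 k) by case: (hth1 k).
have bth k : 0 < k -> forall y, `|theta1 k y| <= k.
  move=> k0 y; have [c0 c1 _] := chi_bounds y k0.
  rewrite (ger0_norm (mulr_ge0 (nsq_ge0 y) c0)).
  have [p0 p1 [pz|nk]] := pospow1_lt0_eq y k0.
    by rewrite /theta1 chiE pz expr0n mulr0 ltW.
  by apply: (le_trans _ nk); rewrite ler_piMr // nsq_ge0.
apply: (@Rintegral_fatou _ _ _ P (fun n w => theta1 n.+1%:R (X t w))).
- by move=> n; apply: (bessel_integrable HX (C := n.+1%:R)) => // y _; exact: bth.
- move=> n w; have [c0 _ _] := chi_bounds (X t w) (ltr0Sn R n).
  exact: (mulr_ge0 (nsq_ge0 _) c0).
- move=> w; rewrite -[nsq (X t w)]mulr1.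
  by apply: cvgM; [exact: cvg_cst|exact: cvg_chi].
- move=> n; have n0 := ltr0Sn R n.
  have := @bessel_upper (theta1 n.+1%:R) _ _ (cst A1) `|A1| A1 0 t (hth1 _).
  rewrite expect_start subr0 lerBlDr => h.
  apply: (@le_trans _ _ (A1 * t + theta1 n.+1%:R x)).
    apply: h => //.
    + exact: (BN_invariant_mul BN_invariant_nsq (BN_invariant_chi _)).
    + exact: chi_support.
    + by move=> y; exact: cst_continuous.
    + by move=> y _; exact: (gen1 y n0 (hth1 _)).1.
    + move=> u _; rewrite Rintegral_cst // [X in fine X](probability_setT P).
      by rewrite mulr1.
  rewrite addrC lerD2r /theta1 ler_piMr ?nsq_ge0 //.
  by have [] := chi_bounds x n0.
Qed.

(** The rate of growth of the fourth moment is a multiple of the second one, itself affine in time;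
    integrating gives the quadratic bound, and Fatou's lemma removes the cutoff. *)
Lemma fourth_moment t : 0 <= t ->
  P.-integrable setT (EFin \o (fun w => nsq (X t w) ^+ 2)) /\
  \int[P]_w nsq (X t w) ^+ 2 <=
    nsq x ^+ 2 + (A2 * nsq x * t + 2^-1 * (A2 * A1) * t ^+ 2).
Proof.
move=> t0.
have cth k : continuous (fun y => nsq y * theta1 k y) by case: (hth2 k).
have bth k : 0 < k -> forall y, `|nsq y * theta1 k y| <= k ^+ 2.
  move=> k0 y; have [c0 c1 _] := chi_bounds y k0; have n0 := nsq_ge0 y.
  rewrite (ger0_norm (mulr_ge0 n0 (mulr_ge0 n0 c0))).
  have [p0 p1 [pz|nk]] := pospow1_lt0_eq y k0.
    by rewrite /theta1 chiE pz expr0n !mulr0 sqr_ge0.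
  rewrite expr2; apply: ler_pM => //; first exact: (mulr_ge0 n0 c0).
  by apply: (le_trans _ nk); rewrite ler_piMr.
apply: (@Rintegral_fatou _ _ _ P (fun n w => nsq (X t w) * theta1 n.+1%:R (X t w))).
- by move=> n; apply: (bessel_integrable HX (h := fun y => nsq y * theta1 n.+1%:R y)
     (C := n.+1%:R ^+ 2)) => // y _; exact: bth.
- move=> n w; have [c0 _ _] := chi_bounds (X t w) (ltr0Sn R n).
  exact: (mulr_ge0 (nsq_ge0 _) (mulr_ge0 (nsq_ge0 _) c0)).
- move=> w; have -> : nsq (X t w) ^+ 2 = nsq (X t w) * (nsq (X t w) * 1).
    by rewrite mulr1 expr2.
  by apply: cvgM; [exact: cvg_cst|apply: cvgM; [exact: cvg_cst|exact: cvg_chi]].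
- move=> n; have n0 := ltr0Sn R n.
  pose phi u := \int[P]_w (nsq (X u w) * theta1 n.+1%:R (X u w)).
  have cmin : continuous (fun y : V => A2 * Num.min (nsq y) n.+1%:R).
    move=> y.
    have cn : {for y, continuous (@nsq R N)}.
      by case: (@hasC2_nsq R N) => _ _ + _ _; apply.
    have ci := @continuous_min R V (@nsq R N) (cst n.+1%:R) y cn (@cst_continuous _ _ _ y).
    exact: (@continuousM R V (cst A2) (fun z : V => Num.min (nsq z) n.+1%:R) y
      (@cst_continuous _ _ _ y) ci).
  have bmin : forall y : V, CNB y -> `|A2 * Num.min (nsq y) n.+1%:R| <= A2 * n.+1%:R.
    move=> y _; rewrite ger0_norm ?ler_wpM2l ?ge_min ?lexx ?orbT //.
    by rewrite mulr_ge0 // le_min nsq_ge0 ltW.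
  have := @quadratic_growth R phi (A2 * nsq x) (A2 * A1) t (mulr_ge0 A20 A10) t0.
  rewrite /phi (expect_start (fun y => nsq y * theta1 n.+1%:R y)) lerBlDr => h.
  apply: (@le_trans _ _ (A2 * nsq x * t + 2^-1 * (A2 * A1) * t ^+ 2
      + nsq x * theta1 n.+1%:R x)).
    apply: h => s s' s0 ss' s't.
    apply: (@bessel_upper _ _ _ _ _ _ _ _ (hth2 _) _ _ cmin bmin) => //.
    + exact: (BN_invariant_mul BN_invariant_nsq
        (BN_invariant_mul BN_invariant_nsq (BN_invariant_chi _))).
    + have [M hM] := chi_support (fun y : V => nsq y * nsq y) n0.
      by exists M => y /hM; rewrite mulrA.
    + by move=> y _; exact: (gen2 y n0 (hth2 _)).
    + move=> u /andP[su us']; have u0 := le_trans s0 su.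
      have [i1 i2] := second_moment u0.
      have imin : P.-integrable setT (EFin \o (fun w => A2 * Num.min (nsq (X u w)) n.+1%:R)).
        exact: (bessel_integrable HX u0 cmin bmin).
      apply: (@le_trans _ _ (\int[P]_w (A2 * nsq (X u w)))).
        apply: le_Rintegral => //.
          have -> : EFin \o (fun w => A2 * nsq (X u w)) =
            (fun w => A2%:E * (EFin \o (fun w => nsq (X u w))) w)%E.
            by apply/funext => w /=; rewrite EFinM.
          exact: integrableZl.
        by move=> w _; rewrite ler_wpM2l // ge_min lexx.
      rewrite RintegralZl //.
      have : A2 * \int[P]_w nsq (X u w) <= A2 * (nsq x + A1 * s').
        apply: ler_wpM2l => //; apply: (le_trans i2); rewrite lerD2l.
        exact: ler_wpM2l.
      by rewrite mulrDr mulrA.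
  rewrite addrC lerD2r /theta1 expr2 ler_wpM2l ?nsq_ge0 // ler_piMr ?nsq_ge0 //.
  by have [] := chi_bounds x n0.
Qed.

End Moments.

(** * A lower bound for the radial part *)

Section FiniteVariance.
Context {R : realType} {I : finType}.

(** The variance is half the double sum of p_w p_w' (a_w - a_w')^2, and only the pairs (u, v) and
    (v, u) are kept. *)
Lemma variance_ge (p a : I -> R) (u v : I) : (forall w, 0 <= p w) -> \sum_w p w = 1 ->
  p u * p v * (a u - a v) ^+ 2 <= \sum_w p w * a w ^+ 2 - (\sum_w p w * a w) ^+ 2.
Proof.
move=> p0 p1.
have E : \sum_w \sum_w' p w * p w' * (a w - a w') ^+ 2 =
    2 * (\sum_w p w * a w ^+ 2 - (\sum_w p w * a w) ^+ 2).
  have e1 : \sum_w \sum_w' p w * p w' * a w ^+ 2 = \sum_w p w * a w ^+ 2.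
    apply: eq_bigr => w _; rewrite -[RHS]mulr1 -p1 mulr_sumr.
    by apply: eq_bigr => w' _; ring.
  have e2 : \sum_w \sum_w' p w * p w' * a w' ^+ 2 = \sum_w p w * a w ^+ 2.
    rewrite exchange_big /=; rewrite -e1.
    by apply: eq_bigr => w _; apply: eq_bigr => w' _; ring.
  have e3 : \sum_w \sum_w' (p w * a w) * (p w' * a w') = (\sum_w p w * a w) ^+ 2.
    by rewrite expr2 mulr_suml; apply: eq_bigr => w _; rewrite mulr_sumr.
  transitivity (\sum_w \sum_w' p w * p w' * a w ^+ 2 + \sum_w \sum_w' p w * p w' * a w' ^+ 2
     - 2 * \sum_w \sum_w' (p w * a w) * (p w' * a w')).
    rewrite mulr_sumr -big_split -sumrB /=; apply: eq_bigr => w _.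
    rewrite mulr_sumr -big_split -sumrB /=; apply: eq_bigr => w' _; ring.
  by rewrite e1 e2 e3; ring.
have [->|uv] := eqVneq u v.
  rewrite subrr expr0n mulr0; suff : 0 <= 2 * (\sum_w p w * a w ^+ 2 - (\sum_w p w * a w) ^+ 2).
    by rewrite pmulr_rge0.
  rewrite -E; apply: sumr_ge0 => w _; apply: sumr_ge0 => w' _.
  by rewrite mulr_ge0 ?sqr_ge0 // mulr_ge0.
rewrite -(@ler_pM2l _ 2) // -E (bigD1 u) //= (bigD1 v) //=.
rewrite (bigD1 v (P := fun w => w != u)) /=; last by rewrite eq_sym.
rewrite [X in _ <= _ + (X + _)](bigD1 u) //=.
have t0 (Q : pred I) w : 0 <= \sum_(w' | Q w') p w * p w' * (a w - a w') ^+ 2.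
  by apply: sumr_ge0 => w' _; rewrite mulr_ge0 ?sqr_ge0 // mulr_ge0.
have t1 (Q : pred I) : 0 <= \sum_(w | Q w) \sum_w' p w * p w' * (a w - a w') ^+ 2.
  by apply: sumr_ge0 => w _; exact: (t0 predT).
have h1 := t0 (fun w => w != v) u; have h2 := t0 (fun w => w != u) v.
have h3 := t1 (fun w => (w != u) && (w != v)).
have -> : p v * p u * (a v - a u) ^+ 2 = p u * p v * (a u - a v) ^+ 2 by ring.
by move: h1 h2 h3; lra.
Qed.

(** Cauchy-Schwarz in the form of a quadratic in [tau], nonnegative term by term, evaluated at its
    minimum [m / S1]. Terms of weight 0 are skipped, since there [x e] may have any sign. *)
Lemma cauchy_ratio (k x : I -> R) : (forall e, 0 <= k e) ->
  (forall e, 0 < k e -> 0 < x e) ->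
  (\sum_e k e) ^+ 2 <= (\sum_e k e * x e) * (\sum_e k e * (x e)^-1).
Proof.
move=> k0 x0; set m := \sum_e k e; set S1 := \sum_e _; set S2 := \sum_e _.
have H tau : 2 * tau * m <= tau ^+ 2 * S1 + S2.
  rewrite /m /S1 /S2 !mulr_sumr -big_split /=; apply: ler_sum => e _.
  have [ke|ke|<-] := ltgtP 0 (k e); last 2 first.
  - by have := k0 e; rewrite leNgt ke.
  - by rewrite !mul0r !mulr0 addr0.
  have xe := x0 e ke; rewrite -subr_ge0.
  have -> : tau ^+ 2 * (k e * x e) + k e / x e - 2 * tau * k e =
    k e * (tau * x e - 1) ^+ 2 / x e by field; rewrite gt_eqF.
  by apply: divr_ge0; [apply: mulr_ge0; [exact: k0|exact: sqr_ge0]|exact: ltW].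
have m0 : 0 <= m by apply: sumr_ge0.
have S10 : 0 <= S1.
  apply: sumr_ge0 => e _; have := k0 e; rewrite le_eqVlt => /orP[/eqP <-|ke].
    by rewrite mul0r.
  by rewrite mulr_ge0 // ltW // x0.
move: S10; rewrite le_eqVlt => /orP[/eqP S1z|S1p].
  have [mz|mz] := eqVneq m 0; first by rewrite mz expr0n -S1z mul0r.
  have mp : 0 < m by rewrite lt_def mz.
  have := H ((S2 + 1) / (2 * m)); rewrite -S1z mulr0 add0r.
  have -> : 2 * ((S2 + 1) / (2 * m)) * m = S2 + 1 by field.
  by rewrite gerDl ler10.
have := H (m / S1).
have -> : (m / S1) ^+ 2 * S1 = m ^+ 2 / S1 by field; rewrite gt_eqF.
have -> : 2 * (m / S1) * m = m ^+ 2 / S1 + m ^+ 2 / S1 by field; rewrite gt_eqF.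
by rewrite lerD2l ler_pdivrMr // mulrC.
Qed.

End FiniteVariance.

(** * The smoothed support function of the orbit of [r] *)

Section LogSumExp.
Context {R : realType} {N : nat} (r : 'I_N -> R).
Hypothesis rdec : forall i j : 'I_N, (i < j)%N -> r j < r i.
Hypothesis rpos : forall i, 0 < r i.
Local Notation V := 'rV[R]_N.
Local Notation W := ('S_N * {ffun 'I_N -> bool})%type.
Local Notation rootT := ('I_N * 'I_N * bool)%type.
Local Notation e1 := (@weyl1 N).

Definition orb (w : W) (k : 'I_N) : R := (-1) ^+ w.2 k * r (w.1 k).

Definition reflw (e : rootT) (w : W) : W :=
  ((tperm e.1.1 e.1.2 * w.1)%g,
   [ffun k => w.2 (tperm e.1.1 e.1.2 k) (+) (e.2 && ((k == e.1.1) || (k == e.1.2)))]).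

Definition ip (a : 'I_N -> R) (y : V) : R := \sum_k a k * y ord0 k.

Lemma reflwK e : involutive (reflw e).
Proof.
case: e => -[i j] b [s f]; rewrite /reflw /=; congr pair.
  by rewrite mulgA tperm2 mul1g.
apply/ffunP => k; rewrite !ffunE /= tpermK -addbA.
have -> : (tperm i j k == i) || (tperm i j k == j) = (k == i) || (k == j).
  by case: tpermP => [->|->|/eqP/negbTE -> /eqP/negbTE ->]; rewrite ?eqxx ?orbT.
by rewrite addbb addbF.
Qed.

Lemma orb_refl e w k : orb (reflw e w) k =
  (-1) ^+ (e.2 && ((k == e.1.1) || (k == e.1.2))) * orb w (tperm e.1.1 e.1.2 k).
Proof.
by rewrite /orb /reflw /= ffunE permM signr_addb mulrCA mulrA.
Qed.

Lemma orb1 k : orb e1 k = r k.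
Proof. by rewrite /orb /= ffunE perm1 expr0 mul1r. Qed.

Lemma rdf_orb_refl e w : rdf e (orb (reflw e w)) = - rdf e (orb w).
Proof.
rewrite /rdf !orb_refl tpermL tpermR !eqxx orbT /= andbT.
case: e => -[i j] [] /=; rewrite ?expr0 ?expr1; ring.
Qed.

(** The factor 2 / |e|^2 in the reflection formula: |e|^2 is 2 for e_i plus or minus e_j with
    distinct indices, and 4 for 2 e_i. *)
Definition lam (e : rootT) : R := if e.1.1 == e.1.2 then 2^-1 else 1.

Lemma lam_ge e : 2^-1 <= lam e.
Proof. by rewrite /lam; case: ifP => // _; lra. Qed.

Lemma ip_refl e w y :
  ip (orb w) y - ip (orb (reflw e w)) y = lam e * rdf e (orb w) * rdf e (y ord0).
Proof.
rewrite /ip -sumrB /lam /rdf; case: e => -[i j] b /=.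
have [->|ij] := eqVneq i j.
  rewrite (bigD1 j) //= big1 ?addr0 => [|k kj].
    rewrite orb_refl /= tperm1 perm1 eqxx /= andbT.
    by case: b; rewrite ?expr0 ?expr1; field.
  by rewrite orb_refl /= tperm1 perm1 (negbTE kj) andbF mul1r subrr.
rewrite (bigD1 i) //= (bigD1 j) /=; last by rewrite eq_sym.
rewrite big1 ?addr0 => [|k /andP[ki kj]].
  rewrite !orb_refl /= tpermL tpermR !eqxx orbT /= andbT.
  by case: b; rewrite ?expr0 ?expr1; ring.
by rewrite orb_refl /= (negbTE ki) (negbTE kj) andbF mul1r tpermD 1?eq_sym // subrr.
Qed.

(** The roots e_i - e_j with i < j and 2 e_i. They do not exhaust the positive roots, but their
    half-spaces already cut out the chamber. *)
Definition PR (e : rootT) : bool :=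
  if e.2 then e.1.1 == e.1.2 else (e.1.1 < e.1.2)%N.

Lemma PR_ge0 (e : rootT) (y : V) : PR e -> CNB y -> 0 <= rdf e (y ord0).
Proof.
case: e => -[i j] [] /= pr [yd y0]; rewrite /rdf /=.
  by rewrite expr1 mulN1r opprK addr_ge0 //; exact: y0.
by rewrite expr0 mul1r subr_ge0; apply: yd; apply: ltnW.
Qed.

Lemma PR_r e : PR e -> 0 < rdf e r.
Proof.
case: e => -[i j] [] /= pr; rewrite /rdf /=.
  by rewrite expr1 mulN1r opprK addr_gt0.
by rewrite expr0 mul1r subr_gt0; exact: rdec.
Qed.

Lemma perm_homo_id (s : 'S_N) : (forall i j : 'I_N, (i < j)%N -> (s i < s j)%N) -> s = 1%g.
Proof.
move=> hs.
have ge (t : 'S_N) : (forall i j : 'I_N, (i < j)%N -> (t i < t j)%N) ->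
    forall i : 'I_N, (i <= t i)%N.
  move=> ht [k kN]; elim: k kN => [//|k IH] kN.
  have k'N : (k < N)%N by exact: ltnW.
  have := ht (Ordinal k'N) (Ordinal kN) (ltnSn k).
  exact: leq_ltn_trans (IH k'N).
apply/permP => i; rewrite perm1; apply/val_inj/eqP; rewrite eqn_leq ge // andbT.
have hV : forall i j : 'I_N, (i < j)%N -> ((s^-1)%g i < (s^-1)%g j)%N.
  move=> a c ac; rewrite ltnNge; apply/negP; rewrite leq_eqVlt => /orP[/eqP/val_inj|].
    by move=> /perm_inj e; rewrite e ltnn in ac.
  by move=> /hs; rewrite !permKV ltnNge ltnW.
by have := ge _ hV (s i); rewrite permK.
Qed.

(** If all these roots were nonnegative on the image of [r], positivity would rule out sign changes
    and strict monotonicity of [r] would force the permutation to be increasing, hence trivial. *)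
Lemma orb_neg w : w != e1 -> exists e, PR e /\ rdf e (orb w) < 0.
Proof.
move=> wn; apply: contrapT => /forallNP H.
have H' e : PR e -> 0 <= rdf e (orb w).
  by move=> pr; rewrite leNgt; apply/negP => h; exact: (H e).
have pos i : 0 <= orb w i.
  have := H' (i, i, true); rewrite /PR /rdf /= eqxx expr1 mulN1r opprK => /(_ isT).
  by lra.
have fi i : w.2 i = false.
  apply/negbTE/negP => wi; have := pos i; rewrite /orb wi expr1 mulN1r.
  by rewrite oppr_ge0 leNgt rpos.
have oi i : orb w i = r (w.1 i) by rewrite /orb fi expr0 mul1r.
have s1 : w.1 = 1%g.
  apply: perm_homo_id => i j ij; have := H' (i, j, false); rewrite /PR /rdf /= => /(_ ij).
  rewrite expr0 mul1r !oi subr_ge0 => h.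
  have [//|lt|/val_inj/perm_inj e] := ltngtP (w.1 i) (w.1 j).
    by have := rdec lt; rewrite ltNge h.
  by rewrite e ltnn in ij.
move/eqP: wn; apply; rewrite /weyl1; case: w {H H' pos oi} fi s1 => s f /= fi ->.
by congr pair; apply/ffunP => i; rewrite ffunE fi.
Qed.

(** A maximiser other than the identity has a root [e] that is negative on its image of [r] but
    positive on [y]; reflecting in [e] then strictly increases the pairing. *)
Lemma ip_max_int (y : V) : (forall e, PR e -> 0 < rdf e (y ord0)) ->
  forall w, ip (orb w) y <= ip r y.
Proof.
move=> yi w.
have E1 : ip r y = ip (orb e1) y by apply: eq_bigr => k _; rewrite orb1.
have := @arg_maxP _ _ _ e1 predT (fun w => ip (orb w) y) isT.
case=> ws _ hmax.
suff wE : ws = e1 by rewrite E1 -wE; exact: hmax.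
apply/eqP; apply: contraT => /orb_neg[e [pr neg]].
have h : ip (orb (reflw e ws)) y <= ip (orb ws) y := hmax (reflw e ws) isT.
move: h; rewrite leNgt => /negP []; rewrite -subr_lt0 ip_refl.
rewrite -mulrA pmulr_rlt0 ?nmulr_rlt0 ?yi //.
by apply: lt_le_trans (lam_ge e); rewrite invr_gt0.
Qed.

(** The closed chamber is reached by pushing [y] slightly into the interior. A violation of size [D]
    would survive a push of length proportional to [D]. *)
Lemma ip_max (y : V) : CNB y -> forall w, ip (orb w) y <= ip r y.
Proof.
move=> cy w.
(* The vector (N, N - 1, ..., 1), which lies in the open chamber. *)
pose z : V := \row_i (N - i)%:R.
have lin (dl : R) a : ip a (y + dl *: z) = ip a y + dl * ip a z.
  rewrite /ip mulr_sumr -big_split /=; apply: eq_bigr => k _; rewrite !mxE; ring.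
have H (dl : R) : 0 < dl -> ip (orb w) (y + dl *: z) <= ip r (y + dl *: z).
  move=> d0; apply: ip_max_int => e pr.
  have -> : rdf e ((y + dl *: z) ord0) = rdf e (y ord0) + dl * rdf e (z ord0).
    by rewrite /rdf !mxE; ring.
  have h := PR_ge0 pr cy; apply: ltr_wpDl => //; apply: mulr_gt0 => //.
  case: e pr {h} => -[i j] [] /= pr; rewrite /rdf !mxE /=.
    by rewrite expr1 mulN1r opprK -natrD ltr0n addn_gt0 subn_gt0 ltn_ord.
  by rewrite expr0 mul1r subr_gt0 ltr_nat ltn_sub2l // (ltn_trans pr).
rewrite leNgt; apply/negP => lt.
set D := ip (orb w) y - ip r y.
have D0 : 0 < D by rewrite subr_gt0.
set B := ip r z - ip (orb w) z.
have : 0 < D / (2 * (`|B| + 1)).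
  by rewrite divr_gt0 // mulr_gt0 // ltr_wpDl.
move=> /[dup] d0 /H; rewrite !lin -subr_ge0; set dl := D / _.
have -> : ip r y + dl * ip r z - (ip (orb w) y + dl * ip (orb w) z) = dl * B - D.
  by rewrite /D /B; ring.
apply/negP; rewrite -ltNge subr_lt0.
apply: (@le_lt_trans _ _ (dl * (`|B| + 1))).
  by apply: ler_wpM2l; [exact: ltW|apply: (le_trans (ler_norm _)); rewrite lerDl].
have B1 : 0 < `|B| + 1 by rewrite ltr_wpDl.
have -> : dl * (`|B| + 1) = D / 2 by rewrite /dl; field; rewrite gt_eqF.
by lra.
Qed.

Section Smoothing.
Variable eps : R.
Hypothesis eps0 : 0 < eps.

Definition ew (w : W) (y : V) : R := expR (eps^-1 * ip (orb w) y).
Definition Zw (y : V) : R := \sum_w ew w y.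
(** Gibbs weights on the orbit of [r]. The gradient of [fhat] is the mean of the orbit under these
    weights, and its Hessian is their covariance divided by [eps]. *)
Definition pw (w : W) (y : V) : R := ew w y / Zw y.
Definition fhat (y : V) : R := eps * ln (Zw y).
Definition fgrad (i : 'I_N) (y : V) : R := \sum_w pw w y * orb w i.
Definition fhess (i j : 'I_N) (y : V) : R :=
  eps^-1 * (\sum_w pw w y * (orb w i * orb w j) - fgrad i y * fgrad j y).

Lemma Zw_gt0 y : 0 < Zw y.
Proof.
rewrite /Zw (bigD1 e1) //= ltr_wpDr ?expR_gt0 //.
by apply: sumr_ge0 => w _; exact: expR_ge0.
Qed.

Lemma pw_ge0 w y : 0 <= pw w y.
Proof. by rewrite divr_ge0 ?expR_ge0 // ltW // Zw_gt0. Qed.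

Lemma pw_sum y : \sum_w pw w y = 1.
Proof. by rewrite /pw -mulr_suml divff // gt_eqF // Zw_gt0. Qed.

Lemma hasC2_ip (a : 'I_N -> R) : hasC2 (ip a) (fun i _ => a i) (fun _ _ => cst 0).
Proof.
have h k := hasC2_scale (a k) (@hasC2_coord R N k).
apply: hasC2_eq (hasC2_sum (index_enum 'I_N) h) _ _ _.
- by [].
- move=> i y /=; rewrite (bigD1 i) //= eqxx mulr1 big1 ?addr0 // => k ki.
  by rewrite (negbTE ki) mulr0.
- by move=> i j y /=; rewrite big1 // => k _; rewrite mulr0.
Qed.

Lemma hasC2_fhat : hasC2 fhat fgrad fhess.
Proof.
have dexp (x : R) : is_derive x (1 : R) (fun t => expR (eps^-1 * t))
    (eps^-1 * expR (eps^-1 * x)).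
  have -> : (fun t => expR (eps^-1 * t)) = expR \o ((eps^-1 : R) *: (idfun : R -> R)) by [].
  rewrite mulrC; apply: is_derive1_comp.
  by apply: is_derive_eq; rewrite /GRing.scale /= mulr1.
have dexp2 (x : R) : is_derive x (1 : R) (fun t => eps^-1 * expR (eps^-1 * t))
    (eps^-1 * eps^-1 * expR (eps^-1 * x)).
  have h := dexp x.
  have -> : (fun t => eps^-1 * expR (eps^-1 * t)) =
    (eps^-1 : R) *: (fun t => expR (eps^-1 * t)) by [].
  by apply: is_derive_eq; rewrite /GRing.scale /= mulrA.
have cexp (x : R) : {for x, continuous (fun t => eps^-1 * eps^-1 * expR (eps^-1 * t))}.
  apply: (@continuousM _ _ (cst (eps^-1 * eps^-1))); first exact: cst_continuous.
  apply: (@continuous_comp _ _ _ (fun t => eps^-1 * t) expR); last exact: continuous_expR.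
  by apply: (@continuousM _ _ (cst eps^-1)); [exact: cst_continuous|exact: cvg_id].
have hE w := @hasC2_comp R N (fun t => expR (eps^-1 * t)) _ _ _ _ _ (hasC2_ip (orb w))
  (fun x => dexp _) (fun x => dexp2 _) (fun x => cexp _).
have hZ : hasC2 Zw (fun i y => eps^-1 * \sum_w ew w y * orb w i)
    (fun i j y => eps^-2 * \sum_w ew w y * (orb w i * orb w j)).
  apply: hasC2_eq (hasC2_sum (index_enum W) hE) _ _ _ => //.
  - by move=> i y /=; rewrite mulr_sumr; apply: eq_bigr => w _; rewrite /ew; ring.
  - move=> i j y /=; rewrite mulr_sumr; apply: eq_bigr => w _.
    by rewrite -exprVn /ew; ring.
have dln (x : R) : 0 < x -> is_derive x (1 : R) (fun t => eps * ln t) (eps * x^-1).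
  move=> x0; have h := is_derive1_ln x0.
  have -> : (fun t => eps * ln t) = (eps : R) *: (@ln R) by [].
  by apply: is_derive_eq; rewrite /GRing.scale /=.
have dln2 (x : R) : 0 < x ->
    is_derive x (1 : R) (fun t => eps * t^-1) (- eps * (x ^+ 2)^-1).
  move=> x0; have xn : x != 0 by rewrite gt_eqF.
  have h := is_deriveV (f := idfun) xn (is_derive_id x 1).
  have -> : (fun t : R => eps * t^-1) = (eps : R) *: (fun t : R => t^-1) by [].
  by apply: is_derive_eq; rewrite /GRing.scale /=; field.
have cln (x : R) : 0 < x -> {for x, continuous (fun t : R => - eps * (t ^+ 2)^-1)}.
  move=> x0.
  have cV : {for x, continuous (fun t : R => (t ^+ 2)^-1)}.
    apply: (@continuousV R R (fun t : R => t ^+ 2)); first by rewrite sqrf_eq0 gt_eqF.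
    exact: exprn_continuous.
  exact: (@continuousM R R (cst (- eps)) _ x (@cst_continuous _ _ _ x) cV).
have := @hasC2_comp R N (fun t => eps * ln t) _ _ _ _ _ hZ
  (fun x => dln _ (Zw_gt0 x)) (fun x => dln2 _ (Zw_gt0 x)) (fun x => cln _ (Zw_gt0 x)).
have en : eps != 0 by rewrite gt_eqF.
have gE i y : eps * (Zw y)^-1 * (eps^-1 * \sum_w ew w y * orb w i) = fgrad i y.
  have Zn : Zw y != 0 by rewrite gt_eqF // Zw_gt0.
  rewrite /fgrad mulrA mulrAC -mulrA; transitivity ((Zw y)^-1 * \sum_w ew w y * orb w i).
    by move: (\sum_w _) => t; field; rewrite en Zn.
  by rewrite mulr_sumr; apply: eq_bigr => w _; rewrite /pw; ring.
move=> h; apply: hasC2_eq h _ _ _ => // i j y.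
have Zn : Zw y != 0 by rewrite gt_eqF // Zw_gt0.
rewrite /fhess -!gE.
have -> : \sum_w pw w y * (orb w i * orb w j) =
    (Zw y)^-1 * \sum_w ew w y * (orb w i * orb w j).
  by rewrite mulr_sumr; apply: eq_bigr => w _; rewrite /pw; ring.
move: (\sum_w ew w y * orb w i) (\sum_w ew w y * orb w j)
  (\sum_w ew w y * (orb w i * orb w j)) => a c q.
by field; rewrite en Zn.
Qed.

End Smoothing.
End LogSumExp.

Lemma finite_pos_lower_bound {R : realType} (I : finType) (Q : pred I) (f : I -> R) :
  (forall i, Q i -> 0 < f i) -> exists2 c : R, 0 < c & forall i, Q i -> c <= f i.
Proof.
move=> f0; pose S := 1 + \sum_(i | Q i) (f i)^-1.
have S0 : 0 < S.
  by rewrite ltr_wpDr // sumr_ge0 // => i /f0 fi; rewrite invr_ge0 ltW.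
exists S^-1; first by rewrite invr_gt0.
move=> i Qi; rewrite -[leRHS]invrK lef_pV2 ?posrE ?invr_gt0 ?f0 //.
rewrite /S (bigD1 i) //= addrCA lerDl addr_ge0 // sumr_ge0 // => j /andP[/f0 fj _].
by rewrite invr_ge0 ltW.
Qed.

Section SmoothingBounds.
Context {R : realType} {N : nat} (r : 'I_N -> R).
Hypothesis rdec : forall i j : 'I_N, (i < j)%N -> r j < r i.
Hypothesis rpos : forall i, 0 < r i.
Local Notation V := 'rV[R]_N.
Local Notation W := ('S_N * {ffun 'I_N -> bool})%type.
Local Notation rootT := ('I_N * 'I_N * bool)%type.
Local Notation e1 := (@weyl1 N).
Local Notation M := (#|{: W}|%:R : R).

Let M0 : 0 < M.
Proof. by rewrite ltr0n; apply/card_gt0P; exists e1. Qed.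

Let M1 : 1 <= M.
Proof. by rewrite ler1n; apply/card_gt0P; exists e1. Qed.

Let ipE1 y : ip (orb r e1) y = ip r y.
Proof. by apply: eq_bigr => k _; rewrite orb1. Qed.

Lemma ip_ge0 (y : V) : CNB y -> 0 <= ip r y.
Proof.
move=> [_ y0]; apply: sumr_ge0 => k _; apply: mulr_ge0; first exact: ltW.
exact: y0.
Qed.

Section FixedEps.
Variable eps : R.
Hypothesis eps0 : 0 < eps.
Local Notation p := (pw r eps).

Lemma fhat_ge (y : V) : ip r y <= fhat r eps y.
Proof.
rewrite /fhat -ler_pdivrMl // -[leLHS]expRK ler_ln ?posrE ?expR_gt0 ?Zw_gt0 //.
rewrite /Zw (bigD1 e1) //= /ew ipE1 lerDl.
by apply: sumr_ge0 => w _; exact: expR_ge0.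
Qed.

Lemma fhat_le (y : V) : CNB y -> fhat r eps y <= ip r y + eps * ln M.
Proof.
move=> cy; rewrite /fhat.
have -> : ip r y + eps * ln M = eps * (eps^-1 * ip r y + ln M).
  by rewrite mulrDr mulVKf // gt_eqF.
rewrite ler_pM2l // -[X in X + _]expRK -lnM ?posrE ?expR_gt0 //.
rewrite ler_ln ?posrE ?Zw_gt0 // ?mulr_gt0 ?expR_gt0 //.
apply: (@le_trans _ _ (\sum_(w : W) expR (eps^-1 * ip r y))); last first.
  by rewrite sumr_const mulr_natr.
apply: ler_sum => w _; rewrite /ew ler_expR ler_pM2l ?invr_gt0 //.
exact: ip_max.
Qed.

Lemma pw_refl e w (y : V) : p (reflw e w) y =
  p w y * expR (- (eps^-1 * (lam e * rdf e (orb r w) * rdf e (y ord0)))).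
Proof.
rewrite /pw mulrAC; congr (_ / _); rewrite /ew -expRD; congr expR.
by rewrite -ip_refl; ring.
Qed.

Lemma pw_max w (y : V) : CNB y -> p w y <= p e1 y.
Proof.
move=> cy; rewrite /pw ler_pM2r ?invr_gt0 ?Zw_gt0 // /ew ler_expR.
by rewrite ler_pM2l ?invr_gt0 // ipE1; exact: ip_max.
Qed.

Lemma pw_le1 w (y : V) : p w y <= 1.
Proof.
rewrite -[leRHS](pw_sum r eps y) (bigD1 w) //= lerDl.
by apply: sumr_ge0 => v _; exact: pw_ge0.
Qed.

Lemma pw1_ge (y : V) : CNB y -> M^-1 <= p e1 y.
Proof.
move=> cy; rewrite -[M^-1]mulr1 ler_pdivrMl // -[leLHS](pw_sum r eps y).
apply: (@le_trans _ _ (\sum_(w : W) p e1 y)); last by rewrite sumr_const mulr_natl.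
by apply: ler_sum => w _; exact: pw_max.
Qed.

(** The root component of the gradient of [fhat] divided by that of [y]: the contribution of [e] to
    the drift. *)
Definition frad (e : rootT) (y : V) : R :=
  \sum_w p w y * (rdf e (orb r w) / rdf e (y ord0)).

Lemma drift_fgrad nu (y : V) :
  drift nu (y ord0) ((fgrad r eps)^~ y) = \sum_e kap nu e * frad e y.
Proof.
apply: eq_bigr => e _; congr (_ * _).
rewrite /fgrad (rdf_sum _ e (fun w i => p w y * orb r w i)) mulr_suml.
by apply: eq_bigr => w _; rewrite rdfZ mulrA.
Qed.

Lemma frad_pair e (y : V) : frad e y = 2^-1 *
  \sum_w (p w y - p (reflw e w) y) * (rdf e (orb r w) / rdf e (y ord0)).
Proof.
have E : frad e y = - \sum_w p (reflw e w) y * (rdf e (orb r w) / rdf e (y ord0)).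
  rewrite /frad (reindex_inj (inv_inj (reflwK e))) /= -sumrN; apply: eq_bigr => w _.
  by rewrite rdf_orb_refl; ring.
have -> : \sum_w (p w y - p (reflw e w) y) * (rdf e (orb r w) / rdf e (y ord0)) =
   frad e y + frad e y.
  rewrite {2}E -sumrB; apply: eq_bigr => w _; ring.
by field.
Qed.

(** The ratio of the weights of w and of its reflection is the exponential of a positive multiple of
    <e, w r><e, y>, so the difference of weights has the sign of the quotient it multiplies. This is
    the favourable sign at the walls. *)
Lemma frad_term_ge0 e w (y : V) :
  0 <= (p w y - p (reflw e w) y) * (rdf e (orb r w) / rdf e (y ord0)).
Proof.
rewrite pw_refl; set c := rdf e _; set d := rdf e _.
have -> : p w y - p w y * expR (- (eps^-1 * (lam e * c * d))) =
  p w y * (1 - expR (- (eps^-1 * (lam e * c * d)))) by ring.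
rewrite -mulrA; apply: mulr_ge0; first exact: pw_ge0.
have [->|d0] := eqVneq d 0; first by rewrite invr0 !mulr0.
have l0 : 0 < eps^-1 * lam e.
  by rewrite mulr_gt0 ?invr_gt0 // (lt_le_trans _ (@lam_ge R N e)) // invr_gt0.
have -> : eps^-1 * (lam e * c * d) = eps^-1 * lam e * (c * d) by ring.
have -> : c / d = (c * d) / d ^+ 2 by field.
rewrite mulrA; apply: divr_ge0; last exact: sqr_ge0.
have [s0|s0] := leP 0 (c * d).
  apply: mulr_ge0 => //; rewrite subr_ge0 -expR0 ler_expR oppr_le0.
  by rewrite mulr_ge0 // ltW.
apply: mulr_le0; last exact: ltW.
rewrite subr_le0 -expR0 ler_expR oppr_ge0 pmulr_rle0 //; exact: ltW.
Qed.

Lemma frad_ge0 e (y : V) : 0 <= frad e y.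
Proof.
rewrite frad_pair mulr_ge0 ?invr_ge0 //.
by apply: sumr_ge0 => w _; exact: frad_term_ge0.
Qed.

(** After pairing each element with its reflection all terms are nonnegative; the identity and its
    reflection contribute the same term, which cancels the factor 1/2. *)
Lemma frad_ge e (y : V) : rdf e r != 0 ->
  (p e1 y - p (reflw e e1) y) * (rdf e r / rdf e (y ord0)) <= frad e y.
Proof.
move=> c0.
have o1 : orb r e1 = r by apply/funext => k; rewrite orb1.
have ne : reflw e e1 != e1.
  apply/eqP => h; have := rdf_orb_refl r e e1; rewrite h o1 => /eqP.
  by rewrite -subr_eq0 opprK -mulr2n mulrn_eq0 /= (negbTE c0).
rewrite frad_pair (bigD1 e1) //= (bigD1 (reflw e e1)) //= reflwK rdf_orb_refl o1.
set T := (_ - _) * _; set S := \sum_(_ | _) _.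
have S0 : 0 <= S by apply: sumr_ge0 => w _; exact: frad_term_ge0.
have -> : (p (reflw e e1) y - p e1 y) * (- rdf e r / rdf e (y ord0)) = T.
  by rewrite /T; ring.
by lra.
Qed.

Lemma fhess_ge0 i (y : V) : 0 <= fhess r eps i i y.
Proof.
rewrite /fhess; apply: mulr_ge0; first by rewrite invr_ge0 ltW.
rewrite -[fgrad _ _ _ _ * _]expr2.
have := variance_ge (orb r ^~ i) e1 e1 (pw_ge0 r eps ^~ y) (pw_sum r eps y).
by rewrite subrr expr0n mulr0; under [X in _ <= X - _ -> _]eq_bigr do rewrite expr2.
Qed.

(** The variance of one coordinate of the orbit, bounded below by the pair formed by [r] and its
    mirror image, which differ by [rdf e r] in coordinate [e.1.1]. *)
Lemma fhess_ge e (y : V) :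
  eps^-1 * (p e1 y * p (reflw e e1) y * rdf e r ^+ 2) <= fhess r eps e.1.1 e.1.1 y.
Proof.
rewrite /fhess ler_pM2l ?invr_gt0 // -[fgrad _ _ _ _ * _]expr2.
have := variance_ge (orb r ^~ e.1.1) e1 (reflw e e1) (pw_ge0 r eps ^~ y) (pw_sum r eps y).
under [X in _ <= X - _ -> _]eq_bigr do rewrite expr2.
apply: le_trans; rewrite orb_refl orb1 /= eqxx /= andbT tpermL orb1 le_eqVlt.
apply/orP; left; apply/eqP; congr (_ * _ ^+ 2).
Qed.

Lemma genC2_fhat_ge0 nu b (y : V) : 0 <= nu -> 0 <= b ->
  0 <= genC2 nu b (fgrad r eps) (fhess r eps) y.
Proof.
move=> nu0 b0; rewrite /genC2 drift_fgrad addr_ge0 // mulr_ge0 ?invr_ge0 //.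
  by apply: sumr_ge0 => i _; exact: fhess_ge0.
by apply: sumr_ge0 => e _; rewrite mulr_ge0 ?frad_ge0 // kap_ge0.
Qed.

Lemma genC2_fhat_ge_frad nu b e (y : V) : 0 <= nu -> 0 <= b ->
  b * (kap nu e * frad e y) <= genC2 nu b (fgrad r eps) (fhess r eps) y.
Proof.
move=> nu0 b0; rewrite /genC2 drift_fgrad ler_wpDl //.
  rewrite mulr_ge0 ?invr_ge0 //; apply: sumr_ge0 => i _; exact: fhess_ge0.
rewrite ler_wpM2l // (bigD1 e) //= lerDl.
by apply: sumr_ge0 => e' _; rewrite mulr_ge0 ?frad_ge0 // kap_ge0.
Qed.

Lemma genC2_fhat_ge_hess nu b i (y : V) : 0 <= nu -> 0 <= b ->
  2^-1 * fhess r eps i i y <= genC2 nu b (fgrad r eps) (fhess r eps) y.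
Proof.
move=> nu0 b0; rewrite /genC2 drift_fgrad ler_wpDr //.
  rewrite mulr_ge0 //.
  by apply: sumr_ge0 => e' _; rewrite mulr_ge0 ?frad_ge0 // kap_ge0.
rewrite ler_pM2l ?invr_gt0 // (bigD1 i) //= lerDl.
by apply: sumr_ge0 => j _; exact: fhess_ge0.
Qed.

End FixedEps.

(** The sign that makes a root of positive weight positive on the open chamber; it cancels in the
    quotients of [rdf_ratio]. *)
Let sg (e : rootT) : R := if e.2 then 1 else if (e.1.1 < e.1.2)%N then 1 else -1.

Lemma rdf_sign (nu : R) (e : rootT) (a : 'I_N -> R) : (forall e, PR e -> 0 < rdf e a) ->
  0 < kap nu e -> 0 < sg e * rdf e a.
Proof.
move=> ai; have a0 i : 0 < a i.
  by have := ai (i, i, true); rewrite /PR /rdf /= eqxx expr1 mulN1r opprK => /(_ isT); lra.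
case: e => -[i j] [] /=; rewrite /sg /kap /rdf /=.
  by rewrite expr1 mulN1r opprK mul1r addr_gt0.
have [//|ij] := eqVneq i j; first by rewrite ltxx.
move=> _; rewrite expr0 mul1r.
have [lt|lt|/val_inj e] := ltngtP i j; last by rewrite e eqxx in ij.
  by have := ai (i, j, false); rewrite /PR /rdf /= lt expr0 !mul1r => /(_ isT).
have := ai (j, i, false); rewrite /PR /rdf /= lt expr0 mul1r mulN1r opprB.
by move=> /(_ isT).
Qed.

Lemma rdf_ratio (nu : R) (e : rootT) (a c : 'I_N -> R) : (forall e, PR e -> 0 < rdf e a) ->
  (forall e, PR e -> 0 < rdf e c) -> 0 < kap nu e -> 0 < rdf e a / rdf e c.
Proof.
move=> ai ci ke; have ha := rdf_sign ai ke; have hc := rdf_sign ci ke.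
have s2 : sg e * sg e = 1 by rewrite /sg; case: ifP => _; [|case: ifP => _]; ring.
have -> : rdf e a / rdf e c = (sg e * rdf e a) / (sg e * rdf e c).
  have sn : sg e != 0 by apply/eqP => z; move: s2; rewrite z mul0r => /eqP; rewrite eq_sym oner_eq0.
  have cn : rdf e c != 0 by apply/eqP => z; move: hc; rewrite z mulr0 ltxx.
  by field; rewrite sn cn.
exact: divr_gt0.
Qed.

Lemma one_sub_exp_ge (t : R) : 0 < t -> t / (1 + t) <= 1 - expR (- t).
Proof.
move=> t0; have t1 : 0 < 1 + t by lra.
have h : expR (- t) <= (1 + t)^-1.
  by rewrite expRN lef_pV2 ?posrE ?expR_gt0 // expR_ge1Dx.
have -> : t / (1 + t) = 1 - (1 + t)^-1 by field; rewrite gt_eqF.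
by rewrite lerD2l lerN2.
Qed.

(** Three regimes. On a wall the Hessian is of order 1 / eps; within [d1] of a wall the drift along
    that root is of order 1 / d1; there [dl] times the generator already exceeds the target [A].
    Elsewhere the weights concentrate on the identity and Cauchy-Schwarz over the roots applies. The
    shift [dl] keeps the first factor away from 0 near the origin. *)
Lemma fhat_drift_lower (nu b eta dl : R) : 0 < nu -> 0 < b -> 0 < eta -> 0 < dl ->
  (forall G, drift nu r G = 2^-1 * \sum_i r i * G i) ->
  exists2 eps1 : R, 0 < eps1 & forall eps, 0 < eps -> eps < eps1 -> forall y, CNB y ->
   2 * b * kaptot N nu ^+ 2 * (1 - eta) <=
   (fhat r eps y + dl) * genC2 nu b (fgrad r eps) (fhess r eps) y.
Proof.
move=> nu0 b0 eta0 dl0 hr; set m := kaptot N nu.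
have nu0' := ltW nu0; have b0' := ltW b0.
set A := 2 * b * m ^+ 2.
have A0 : 0 <= A by rewrite /A mulr_ge0 ?sqr_ge0 // mulr_ge0.
have ri e : PR e -> 0 < rdf e r by exact: PR_r.
have [c1 c10 hc1] := finite_pos_lower_bound ri.
pose Q (we : W * rootT) := PR we.2 && (rdf we.2 (orb r we.1) < 0).
have [c2 c20 hc2] := @finite_pos_lower_bound R _ Q (fun we => - rdf we.2 (orb r we.1))
  (fun we h => eq_ind_r is_true (andP h).2 (oppr_gt0 _)).
pose cm := Num.min c1 c2.
have cm0 : 0 < cm by rewrite lt_min c10.
have hcm1 e : PR e -> cm <= rdf e r.
  by move=> /hc1; apply: le_trans; rewrite ge_min lexx.
have hcm2 w e : PR e -> rdf e (orb r w) < 0 -> rdf e (orb r w) <= - cm.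
  move=> pr neg; have := hc2 (w, e); rewrite /Q /= pr neg => /(_ isT) h.
  by rewrite lerNr; apply: le_trans h; rewrite ge_min lexx orbT.
pose km := Num.min nu 2^-1.
have km0 : 0 < km by rewrite lt_min nu0 /=; lra.
have hkm e : PR e -> km <= kap nu e.
  case: e => -[i j] [] /=; rewrite /PR /kap /=.
    by move=> ->; rewrite ge_min lexx.
  by move=> lt; rewrite (_ : (i == j) = false) ?ge_min ?lexx ?orbT // lt_eqF.
(* Chosen so that [dl * b * km * M^-1 * (cm / (2 * d1))] equals [A + 1], the gain needed close to a
   wall. *)
pose d1 := dl * b * km * cm / (2 * M * (A + 1)).
have A1 : 0 < A + 1 by lra.
have d10 : 0 < d1 by rewrite divr_gt0 ?mulr_gt0.
(* For [eps] below [E1] the Hessian suffices on the walls; below [E2] the length [eps / (lam e * c)]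
   is at most [d1]; below [E3] the weights off the identity add up to an error of at most [eta]. *)
pose E1 := dl * cm ^+ 2 / (2 * M ^+ 2 * (A + 1)).
pose E2 := d1 * cm / 2.
pose E3 := eta * cm * d1 / (2 * (M + 1)).
have E10 : 0 < E1 by rewrite divr_gt0 ?mulr_gt0 // exprn_gt0.
have two0 : 0 < 2 :> R by lra.
have E20 : 0 < E2 := divr_gt0 (mulr_gt0 d10 cm0) two0.
have E30 : 0 < E3 := divr_gt0 (mulr_gt0 (mulr_gt0 eta0 cm0) d10) (mulr_gt0 two0 (addr_gt0 M0 ltr01)).
exists (Num.min E1 (Num.min E2 E3)); first by rewrite !lt_min E10 E20.
move=> eps eps0; rewrite !lt_min => /andP[l1 /andP[l2 l3]] y cy.
set L := genC2 _ _ _ _ y.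
have L0 : 0 <= L by apply: genC2_fhat_ge0.
have ip0 := ip_ge0 cy.
have fg := fhat_ge eps0 y.
have ALe : A * (1 - eta) <= A by rewrite ler_piMr //; lra.
have hdl : dl * L <= (fhat r eps y + dl) * L by rewrite ler_wpM2r // lerDr (le_trans ip0).
have p1M := pw1_ge eps0 cy.
have Mi0 : 0 < M^-1 by rewrite invr_gt0.
(* On a wall of [e] the identity and its reflection have equal weight, at least [M^-1] each, so the
   variance along [e] is bounded below independently of [eps]. *)
have [/existsP[e /andP[pr /eqP d0]]|noz] := boolP [exists e, PR e && (rdf e (y ord0) == 0)].
  apply: (le_trans ALe); apply: (le_trans _ hdl).
  have h := le_trans (fhess_ge eps0 e y) (le_refl _).
  have h2 := genC2_fhat_ge_hess eps0 (b := b) e.1.1 y nu0' b0'.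
  have pe : pw r eps (reflw e e1) y = pw r eps e1 y.
    by rewrite pw_refl d0 !mulr0 oppr0 expR0 mulr1.
  rewrite pe in h.
  have h3 : eps^-1 * (M^-1 * M^-1 * cm ^+ 2) <=
      eps^-1 * (pw r eps e1 y * pw r eps e1 y * rdf e r ^+ 2).
    rewrite ler_pM2l ?invr_gt0 //; apply: ler_pM.
    - by rewrite mulr_ge0 // ltW.
    - exact: sqr_ge0.
    - by apply: ler_pM => //; exact: ltW.
    - by apply: lerXn2r; rewrite ?nnegrE; [exact: ltW|exact: ltW (ri _ pr)|exact: hcm1].
  have h4 : A + 1 <= dl * (2^-1 * (eps^-1 * (M^-1 * M^-1 * cm ^+ 2))).
    have -> : dl * (2^-1 * (eps^-1 * (M^-1 * M^-1 * cm ^+ 2))) =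
        dl * cm ^+ 2 / (2 * M ^+ 2) / eps.
      by move: (M) (M0) => K K0; field; rewrite !gt_eqF.
    rewrite ler_pdivlMr // mulrC; move: (ltW l1); rewrite /E1 invfM mulrA.
    by rewrite ler_pdivlMr.
  have h5 : dl * (2^-1 * (eps^-1 * (M^-1 * M^-1 * cm ^+ 2))) <= dl * L.
    rewrite ler_pM2l //; apply: (le_trans _ h2); rewrite ler_pM2l ?invr_gt0 //.
    exact: (le_trans h3 h).
  by apply: le_trans h5; apply: le_trans h4; rewrite lerDl.
have dpos e : PR e -> 0 < rdf e (y ord0).
  move=> pr; rewrite lt_def (PR_ge0 pr cy) andbT; apply: contraNneq noz => z.
  by apply/existsP; exists e; rewrite pr z eqxx.
(* Close to a wall, t / (1 + t) <= 1 - exp (- t) keeps the quotient at least c / (eps / (lam c) +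
   d), however small [d] and [eps] are relative to each other. *)
have [/existsP[e /andP[pr dlt]]|nos] := boolP [exists e, PR e && (rdf e (y ord0) < d1)].
  apply: (le_trans ALe); apply: (le_trans _ hdl).
  have h := genC2_fhat_ge_frad eps0 (b := b) e y nu0' b0'.
  have c0 := ri e pr; have cn : rdf e r != 0 by rewrite gt_eqF.
  have hf := frad_ge eps0 y cn; rewrite pw_refl in hf.
  have o1 : orb r e1 = r by apply/funext => k; rewrite orb1.
  rewrite o1 in hf.
  set c := rdf e r in c0 cn hf; set d := rdf e (y ord0) in dlt hf.
  have d0 : 0 < d := dpos _ pr.
  have cmc : cm <= c := hcm1 _ pr.
  have lg := @lam_ge R N e; have lp : 0 < lam e :> R by apply: lt_le_trans lg; rewrite invr_gt0.
  set t := eps^-1 * (lam e * c * d) in hf.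
  have t0 : 0 < t by rewrite !mulr_gt0 ?invr_gt0.
  have ht := one_sub_exp_ge t0.
  have h1 : M^-1 * (cm / (2 * d1)) <= frad eps e y.
    apply: (le_trans _ hf).
    have -> : (pw r eps e1 y - pw r eps e1 y * expR (- t)) * (c / d) =
      pw r eps e1 y * ((1 - expR (- t)) * (c / d)) by ring.
    apply: ler_pM; [exact: ltW| |exact: p1M|].
      by apply: divr_ge0; [exact: ltW|apply/ltW/mulr_gt0].
    apply: (@le_trans _ _ (t / (1 + t) * (c / d))); last first.
      by apply: ler_wpM2r => //; rewrite divr_ge0 ?ltW.
    have -> : t / (1 + t) * (c / d) = c / (eps / (lam e * c) + d).
      rewrite /t; field; rewrite !gt_eqF //= ?addr_gt0 ?mulr_gt0 //.
    have den : eps / (lam e * c) + d <= 2 * d1.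
      have : eps / (lam e * c) <= d1.
        rewrite ler_pdivrMr ?mulr_gt0 //; apply: (le_trans (ltW l2)).
        rewrite /E2 -mulrA ler_pM2l // mulrC.
        by apply: ler_pM; [rewrite invr_ge0|exact: ltW|exact: lg|exact: cmc].
      by move: (ltW dlt); lra.
    have den0 : 0 < eps / (lam e * c) + d by rewrite addr_gt0 ?divr_gt0 ?mulr_gt0.
    apply: ler_pM; [exact: ltW| |exact: cmc|].
      by rewrite invr_ge0; apply/ltW/mulr_gt0.
    by rewrite lef_pV2 ?posrE //; exact: mulr_gt0 two0 d10.
  have h2 : A + 1 <= dl * (b * (km * (M^-1 * (cm / (2 * d1))))).
    rewrite le_eqVlt; apply/orP; left; apply/eqP; rewrite /d1.
    by move: (M) (M0) => K K0; field; rewrite !gt_eqF.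
  have h3 : dl * (b * (km * (M^-1 * (cm / (2 * d1))))) <= dl * L.
    rewrite ler_pM2l //; apply: (le_trans _ h); rewrite ler_pM2l //.
    apply: ler_pM; [exact: ltW| |exact: hkm|exact: h1].
    by apply: mulr_ge0; [exact: ltW|apply: divr_ge0; [exact: ltW|apply/ltW/mulr_gt0]].
  by apply: le_trans h3; apply: le_trans h2; rewrite lerDl.
have dge e : PR e -> d1 <= rdf e (y ord0).
  move=> pr; rewrite leNgt; apply: contra nos => h.
  by apply/existsP; exists e; rewrite pr.
pose th := 2 * eps / (cm * d1).
have th0 : 0 < th := divr_gt0 (mulr_gt0 two0 eps0) (mulr_gt0 cm0 d10).
(* Reflecting in a negative root gains at least [th^-1] in the exponent, and exp (- 1 / th) <=
   th. *)
have small w : w != e1 -> pw r eps w y <= th.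
  move=> /(orb_neg rdec rpos)[e [pr neg]].
  have := pw_refl eps e w y => h.
  have lp : 0 < lam e :> R by apply: lt_le_trans (@lam_ge R N e); rewrite invr_gt0.
  set s := eps^-1 * (lam e * rdf e (orb r w) * rdf e (y ord0)) in h.
  have pE : pw r eps w y = pw r eps (reflw e w) y * expR s.
    by rewrite h -mulrA -expRD addNr expR0 mulr1.
  have q0 : 0 < th^-1 by rewrite invr_gt0.
  have sle : s <= - th^-1.
    rewrite /s /th invfM -invfM.
    have -> : - (2 * eps / (cm * d1))^-1 = eps^-1 * (2^-1 * - cm * d1).
      by field; rewrite !gt_eqF.
    rewrite ler_pM2l ?invr_gt0 //.
    have n2 := hcm2 w e pr neg; have d2 := dge e pr; have lg := @lam_ge R N e.
    rewrite -lerN2; have -> : - (2^-1 * - cm * d1) = 2^-1 * cm * d1 by ring.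
    have -> : - (lam e * rdf e (orb r w) * rdf e (y ord0)) =
      lam e * (- rdf e (orb r w)) * rdf e (y ord0) by ring.
    apply: ler_pM; [by apply: mulr_ge0; [rewrite invr_ge0|exact: ltW]|exact: ltW| |exact: d2].
    by apply: ler_pM; [rewrite invr_ge0|exact: ltW|exact: lg|rewrite lerNr].
  rewrite pE; apply: (@le_trans _ _ (expR (- th^-1))).
    rewrite -[leRHS]mul1r; apply: ler_pM; [exact: pw_ge0|exact: expR_ge0|exact: pw_le1|].
    by rewrite ler_expR.
  rewrite expRN -[leRHS]invrK lef_pV2 ?posrE ?expR_gt0 //.
  by apply: (le_trans _ (expR_ge1Dx _)); rewrite lerDr.
have Mth : (M + 1) * th <= eta.
  move: (ltW l3); rewrite /E3 /th ler_pdivlMr; last exact: mulr_gt0 two0 (addr_gt0 M0 ltr01).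
  move=> h.
  rewrite mulrA ler_pdivrMr; last exact: mulr_gt0 cm0 d10.
  have -> : (M + 1) * (2 * eps) = eps * (2 * (M + 1)) by ring.
  by rewrite [leRHS]mulrA.
have p1ge : 1 - M * th <= pw r eps e1 y.
  have := pw_sum r eps y; rewrite (bigD1 e1) //= => hs.
  rewrite lerBlDr -[leLHS]hs lerD2l; apply: (@le_trans _ _ (\sum_(w : W | w != e1) th)).
    by apply: ler_sum => w wn; exact: small.
  have -> : M * th = \sum_(w : W) th by rewrite sumr_const mulr_natl.
  by rewrite [leRHS](bigD1 e1) //= lerDr; exact: ltW.
have fradge e : 0 < kap nu e -> (1 - eta) * (rdf e r / rdf e (y ord0)) <= frad eps e y.
  move=> ke; have rat := rdf_ratio ri dpos ke.
  have cn : rdf e r != 0 by apply/eqP => z; move: rat; rewrite z mul0r ltxx.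
  apply: (le_trans _ (frad_ge eps0 y cn)); apply: ler_wpM2r; first exact: ltW.
  have ne : reflw e e1 != e1.
    have o1 : orb r e1 = r by apply/funext => k; rewrite orb1.
    apply/eqP => h; have := rdf_orb_refl r e e1; rewrite h o1 => /eqP.
    by rewrite -subr_eq0 opprK -mulr2n mulrn_eq0 /= (negbTE cn).
  have := small _ ne; move: Mth; rewrite mulrDl mul1r; lra.
have Lge : b * ((1 - eta) * \sum_e kap nu e * (rdf e r / rdf e (y ord0))) <= L.
  rewrite /L /genC2 drift_fgrad ler_wpDl //.
    by rewrite mulr_ge0 ?invr_ge0 //; apply: sumr_ge0 => i _; exact: fhess_ge0.
  rewrite ler_pM2l // mulr_sumr; apply: ler_sum => e _.
  have := kap_ge0 e nu0'; rewrite le_eqVlt => /orP[/eqP <-|ke]; first by rewrite !mul0r mulr0.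
  by rewrite mulrCA ler_pM2l //; exact: fradge.
(* Stationarity tested on [y] itself: the first factor of the Cauchy-Schwarz inequality is half of
   <r, y>. *)
have ipE : ip r y = 2 * \sum_e kap nu e * (rdf e (y ord0) / rdf e r).
  by have := hr (y ord0); rewrite /drift -/(ip r y) => ->; field.
have [eta1|eta1] := leP 1 eta.
  apply: (@le_trans _ _ 0); last first.
    by apply: mulr_ge0 => //; apply: addr_ge0; [exact: le_trans ip0 fg|exact: ltW].
  by apply: mulr_ge0_le0 => //; rewrite subr_le0.
have cs := @cauchy_ratio R _ (kap nu) (fun e => rdf e (y ord0) / rdf e r)
   (fun e => kap_ge0 e nu0') (fun e ke => rdf_ratio dpos ri ke).
rewrite -/m in cs.
set S1 := \sum_e kap nu e * (rdf e (y ord0) / rdf e r) in ipE cs.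
have S2E : \sum_e kap nu e * (rdf e (y ord0) / rdf e r)^-1 =
   \sum_e kap nu e * (rdf e r / rdf e (y ord0)).
  by apply: eq_bigr => e _; rewrite invf_div.
rewrite S2E in cs; set S2 := \sum_e _ in Lge cs.
apply: (@le_trans _ _ ((2 * S1) * (b * ((1 - eta) * S2)))).
  have -> : 2 * S1 * (b * ((1 - eta) * S2)) = 2 * b * (S1 * S2) * (1 - eta) by ring.
  apply: ler_wpM2r; first by rewrite subr_ge0 ltW.
  by apply: ler_wpM2l; [exact: mulr_ge0|exact: cs].
have S20 : 0 <= S2.
  apply: sumr_ge0 => e _; have := kap_ge0 e nu0'; rewrite le_eqVlt => /orP[/eqP <-|ke].
    by rewrite mul0r.
  by rewrite mulr_ge0 // ltW //; exact: rdf_ratio ke.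
apply: ler_pM => //.
- by rewrite -ipE.
- by apply: mulr_ge0 => //; apply: mulr_ge0 => //; rewrite subr_ge0 ltW.
- by rewrite -ipE (le_trans fg) // lerDl ltW.
Qed.

End SmoothingBounds.

Section RealIntegrability.
Context {R : realType} d (T : measurableType d) (P : probability T R).

Lemma integrable_cstR (c : R) : P.-integrable setT (EFin \o (fun _ : T => c)).
Proof. by apply: (@integrable_probability _ _ _ P _ `|c|). Qed.

Lemma integrable_addR (f g : T -> R) : P.-integrable setT (EFin \o f) ->
  P.-integrable setT (EFin \o g) -> P.-integrable setT (EFin \o (fun w => f w + g w)).
Proof.
move=> hf hg; have -> : EFin \o (fun w => f w + g w) = ((EFin \o f) \+ (EFin \o g))%E.
  by apply/funext => w /=; rewrite EFinD.
exact: integrableD.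
Qed.

Lemma integrable_subR (f g : T -> R) : P.-integrable setT (EFin \o f) ->
  P.-integrable setT (EFin \o g) -> P.-integrable setT (EFin \o (fun w => f w - g w)).
Proof.
move=> hf hg; have -> : EFin \o (fun w => f w - g w) = ((EFin \o f) \- (EFin \o g))%E.
  by apply/funext => w /=; rewrite EFinB.
exact: integrableB.
Qed.

Lemma integrable_scaleR (c : R) (f : T -> R) : P.-integrable setT (EFin \o f) ->
  P.-integrable setT (EFin \o (fun w => c * f w)).
Proof.
move=> hf; have -> : EFin \o (fun w => c * f w) = (fun w => c%:E * (EFin \o f) w)%E.
  by apply/funext => w /=; rewrite EFinM.
exact: integrableZl.
Qed.

Lemma Rintegral_cstR (c : R) : \int[P]_w c = c.
Proof. by rewrite Rintegral_cst // [X in fine X](probability_setT P) mulr1. Qed.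

End RealIntegrability.

Section RadialLowerBound.
Context {R : realType} {N : nat}.
Local Notation V := 'rV[R]_N.
Local Notation W := ('S_N * {ffun 'I_N -> bool})%type.

Lemma ip_sqr_le (a : 'I_N -> R) (y : V) : ip a y ^+ 2 <= (\sum_i a i ^+ 2) * nsq y.
Proof.
set A := \sum_i _; have A0 : 0 <= A by apply: sumr_ge0 => i _; exact: sqr_ge0.
have h : 0 <= A * (A * nsq y - ip a y ^+ 2).
  have -> : A * (A * nsq y - ip a y ^+ 2) = \sum_i (A * y ord0 i - ip a y * a i) ^+ 2.
    under eq_bigr do rewrite sqrrB !exprMn.
    rewrite big_split sumrB /= -!mulr_sumr -/A -/(nsq y).
    have -> : \sum_i A * y ord0 i * (ip a y * a i) *+ 2 = 2 * A * ip a y * ip a y.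
      rewrite {3}/ip mulr_sumr; apply: eq_bigr => i _; rewrite -mulr_natl; ring.
    ring.
  by apply: sumr_ge0 => i _; exact: sqr_ge0.
move: A0; rewrite le_eqVlt => /orP[/eqP A0|A0]; last first.
  by move: h; rewrite pmulr_rge0 // subr_ge0.
have a0 i : a i = 0.
  have /eqP := esym A0; rewrite psumr_eq0 => [/allP|j _]; last exact: sqr_ge0.
  by move=> /(_ i (mem_index_enum i)); rewrite sqrf_eq0 => /eqP.
by rewrite -A0 mul0r /ip big1 ?expr0n // => i _; rewrite a0 mul0r.
Qed.

(** Moving the group element from [r] to [y] replaces it by its inverse [iota], so the partition
    function is a group average of a single exponential. *)
Lemma BN_invariant_fhat (r : 'I_N -> R) eps : BN_invariant (fhat r eps).
Proof.
apply: (BN_invariant_comp (fun t => eps * ln t)).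
have -> : Zw r eps = fun y => \sum_(w : W) expR (eps^-1 * ip r (act w y)).
  apply/funext => y; rewrite /Zw.
  pose iota (w : W) : W := ((w.1)^-1%g, [ffun k => w.2 ((w.1)^-1%g k)]).
  have iK : involutive iota.
    move=> [s f]; rewrite /iota /= invgK; congr pair.
    by apply/ffunP => k; rewrite !ffunE permK.
  rewrite (reindex_inj (inv_inj iK)) /=; apply: eq_bigr => w _.
  rewrite /ew /ip (reindex_inj (@perm_inj _ w.1)) /=; congr (expR (_ * _)).
  by apply: eq_bigr => k _; rewrite /orb /iota /= ffunE permK mxE; ring.
exact: (BN_invariant_sum (fun y => expR (eps^-1 * ip r y))).
Qed.

Lemma bessel_dominated (k1 k2 : R) (x : V) d (Omega : measurableType d)
  (P : probability Omega R) (X : R -> Omega -> V) (HX : bessel_B k1 k2 x P X)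
  t (h k : V -> R) : 0 <= t -> continuous h ->
  P.-integrable setT (EFin \o (fun w => k (X t w))) ->
  (forall y, CNB y -> `|h y| <= k y) ->
  P.-integrable setT (EFin \o (fun w => h (X t w))).
Proof.
move=> t0 ch ki hk; apply: (le_integrable measurableT _ _ ki).
  by apply/measurable_EFinP; exact: (bessel_measurable HX t0 ch).
move=> w _ /=; rewrite lee_fin.
have cy : CNB (X t w) by case: HX => _ [_ [+ _]]; apply.
by apply: (le_trans (hk _ cy)); exact: ler_norm.
Qed.

Lemma le_of_perturbed (A E : R) : 0 <= A -> 0 <= E ->
  (forall k, 0 < k -> k < 1 -> A * (1 - k) <= (1 + k) * E + 2 * k) -> A <= E.
Proof.
move=> A0 E0 H; rewrite leNgt; apply/negP => lt.
set S := A + E + 2; have S0 : 0 < S by rewrite /S; lra.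
have k0 : 0 < (A - E) / (2 * S) by rewrite divr_gt0 ?subr_gt0 // mulr_gt0.
have k1 : (A - E) / (2 * S) < 1.
  by rewrite ltr_pdivrMr ?mulr_gt0 // mul1r /S; lra.
have kS : (A - E) / (2 * S) * S = (A - E) / 2 by field; rewrite gt_eqF.
have := H _ k0 k1; move: kS; rewrite /S.
by move: ((A - E) / (2 * (A + E + 2))) => k; lra.
Qed.

(** The generator of F^2 is 2 F times that of F plus |grad F|^2, and the last term is dropped. The
    gradient is exposed because the product with the cutoff has a cross term. *)
Lemma genC2_fhat_sqr (r : 'I_N -> R) eps dl nu b : 0 < eps ->
  exists g H, hasC2 (fun y : V => (fhat r eps y + dl) ^+ 2) g H /\ (forall y,
   [/\ g = (fun i y => 2 * (fhat r eps y + dl) * fgrad r eps i y) &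
    2 * ((fhat r eps y + dl) * genC2 nu b (fgrad r eps) (fhess r eps) y)
      <= genC2 nu b g H y]).
Proof.
move=> eps0.
have d1 (u : R) : is_derive u (1 : R) (fun u => (u + dl) ^+ 2) (2 * (u + dl)).
  by apply: is_derive_eq; rewrite /GRing.scale /=; ring.
have d2 (u : R) : is_derive u (1 : R) (fun u => 2 * (u + dl)) 2.
  have -> : (fun u => 2 * (u + dl)) = (2 : R) *: (fun u : R => u + dl) by [].
  by apply: is_derive_eq; rewrite /GRing.scale /=; ring.
have h := hasC2_comp (hasC2_fhat r eps0) (fun x => d1 _) (fun x => d2 _)
  (fun x => @cst_continuous _ _ (2 : R) _).
do 2 eexists; split; first exact: h.
move=> y; split => //.
rewrite /genC2 driftZ.
have -> : \sum_i (2 * (fhat r eps y + dl) * fhess r eps i i y +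
    2 * fgrad r eps i y * fgrad r eps i y) =
   2 * (fhat r eps y + dl) * (\sum_i fhess r eps i i y) + 2 * \sum_i fgrad r eps i y ^+ 2.
  by rewrite !mulr_sumr -big_split /=; apply: eq_bigr => i _; ring.
have g0 : 0 <= \sum_i fgrad r eps i y ^+ 2.
  by apply: sumr_ge0 => i _; exact: sqr_ge0.
move: (drift _ _ _) (\sum_i fhess _ _ _ _ _) (\sum_i fgrad _ _ _ _ ^+ 2) g0 => D S G g0.
rewrite -subr_ge0.
have -> : 2^-1 * (2 * (fhat r eps y + dl) * S + 2 * G) + b * (2 * (fhat r eps y + dl) * D) -
  2 * ((fhat r eps y + dl) * (2^-1 * S + b * D)) = G by field.
by [].
Qed.

Section Process.
Variables (nu b : R) (x : V).
Context d (Omega : measurableType d) (P : probability Omega R).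
Context (X : R -> Omega -> V).
Hypothesis HX : bessel_B (nu * b) b x P X.
Hypothesis nu0 : 0 < nu.
Hypothesis b0 : 0 < b.
Variable r : 'I_N -> R.
Hypothesis rdec : forall i j : 'I_N, (i < j)%N -> r j < r i.
Hypothesis rpos : forall i, 0 < r i.
Hypothesis rdrift : forall G, drift nu r G = 2^-1 * \sum_i r i * G i.
Local Notation m := (kaptot N nu).

Let nu0' : 0 <= nu := ltW nu0.
Let b0' : 0 <= b := ltW b0.

Let m0 : 0 <= m.
Proof. by apply: sumr_ge0 => e _; exact: kap_ge0. Qed.

Lemma continuous_ip (a : 'I_N -> R) : continuous (ip a).
Proof. by case: (@hasC2_ip R N a). Qed.

Lemma continuous_nsq : continuous (@nsq R N).
Proof. by case: (@hasC2_nsq R N). Qed.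

Lemma sqr_ip_integrable t : 0 <= t ->
  P.-integrable setT (EFin \o (fun w => ip r (X t w) ^+ 2)).
Proof.
move=> t0; have [i1 _] := second_moment HX nu0' b0' t0.
apply: (bessel_dominated HX (h := fun y => ip r y ^+ 2)
  (k := fun y => (\sum_i r i ^+ 2) * nsq y)) => //.
- move=> y; have c := @continuous_ip r y.
  exact: (@continuousM R V (ip r) (ip r) y c c).
- exact: integrable_scaleR.
- by move=> y _; rewrite ger0_norm ?sqr_ge0 //; exact: ip_sqr_le.
Qed.

(** In [C], the term 3 a is the loss in 1 - chi; 3 (N + 2 b m) comes from the generator of the
    cutoff and 12 from the gradient cross term, both multiplied by the bound of F^2 by a constant
    times 1 + |y|^2. *)
Let gen_lower (eps dl a k K0 C : R) g H (y : V) : 0 < eps -> 0 < dl -> 0 <= a -> 0 < k ->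
  K0 = eps * ln #|{: W}|%:R + dl -> 
  hasC2 (fun y => (fhat r eps y + dl) ^+ 2 * chi k y) g H -> CNB y ->
  (forall y, CNB y -> a <= 2 * ((fhat r eps y + dl) *
      genC2 nu b (fgrad r eps) (fhess r eps) y)) ->
  C = 3 * a + (3 * (N%:R + 2 * b * m) + 12) *
     (2 * (\sum_i r i ^+ 2) + 2 * K0 ^+ 2) ->
  a - C * (k^-1 * (1 + Num.min (nsq y) k)) <= genC2 nu b g H y.
Proof.
move=> eps0 dl0 a0 k0 K0E hg cy lowa CE.
have [g1 [H1 [h1 hgen]]] := genC2_fhat_sqr r dl nu b eps0.
have [g1E h2] := hgen y.
rewrite -(genB_genC2 _ _ _ hg) (genB_genC2 _ _ _ (hasC2_mul h1 (@hasC2_chi R N k))).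
rewrite genC2_mul genC2_chi /=.
set LG := genC2 nu b g1 H1 y in h2 *.
have {}h2 : a <= LG := le_trans (lowa y cy) h2.
have [c0 c1 c3] := chi_bounds y k0.
have chE : chi k y = pospow 1 (1 - k^-1 * nsq y) ^+ 3 by rewrite /chi pospowE.
rewrite [pospow 2 _]pospowE.
have [p0 p1 pc] := pospow1_lt0_eq y k0; move: chE p0 p1 pc.
set p := pospow 1 _ => chE p0 p1 pc.
set D := drift nu (y ord0) (y ord0).
have /andP[d0 dm] : 0 <= D <= m := drift_scale (y ord0) nu0'.
have n0 := nsq_ge0 y; have q0 : 0 <= k^-1 * nsq y by rewrite mulr_ge0 // invr_ge0 ltW.
set F := fhat r eps y + dl.
have ip0 := ip_ge0 rpos cy.
have f1 : ip r y <= F.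
  by rewrite /F; apply: (le_trans (fhat_ge r eps0 y)); rewrite lerDl ltW.
have f2 : F <= ip r y + K0.
  by rewrite /F K0E addrA lerD2r; exact: fhat_le.
have F0 : 0 <= F := le_trans ip0 f1.
have K00 : 0 <= K0.
  rewrite K0E; apply: addr_ge0; last exact: ltW.
  apply: mulr_ge0; first exact: ltW.
  rewrite ln_ge0 // ler1n.
  by apply/card_gt0P; exists (@weyl1 N).
have i0 : \sum_i fgrad r eps i y * y ord0 i <= F.
  apply: (le_trans _ f1); rewrite /fgrad.
  have -> : \sum_i (\sum_w pw r eps w y * orb r w i) * y ord0 i =
     \sum_w pw r eps w y * ip (orb r w) y.
    under eq_bigr do rewrite mulr_suml.
    rewrite exchange_big /=; apply: eq_bigr => w _; rewrite /ip mulr_sumr.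
    by apply: eq_bigr => i _; rewrite mulrA.
  rewrite -[leRHS]mul1r -[X in _ <= X * _](pw_sum r eps y) mulr_suml.
  apply: ler_sum => w _; apply: ler_wpM2l; first exact: pw_ge0.
  exact: ip_max.
have -> : \sum_i g1 i y * (- (3 / k) * p ^+ 2 * (2 * y ord0 i)) =
   - 12 * k^-1 * p ^+ 2 * (F * \sum_i fgrad r eps i y * y ord0 i).
  rewrite g1E !mulr_sumr; apply: eq_bigr => i _; rewrite /F; ring.
set I := \sum_i fgrad _ _ _ _ * _ in i0 *.
have F2 : F ^+ 2 <= (2 * (\sum_i r i ^+ 2) + 2 * K0 ^+ 2) * (1 + nsq y).
  have cs := ip_sqr_le r y.
  have s0 : 0 <= \sum_i r i ^+ 2 by apply: sumr_ge0 => i _; exact: sqr_ge0.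
  have : F ^+ 2 <= (ip r y + K0) ^+ 2.
    by apply: lerXn2r => //; rewrite nnegrE ?addr_ge0.
  move: (\sum_i r i ^+ 2) (ip r y) ip0 cs s0 => s i ii0 cs s0 h.
  apply: (le_trans h).
  have k2 : 0 <= K0 ^+ 2 by exact: sqr_ge0.
  have kn : 0 <= K0 ^+ 2 * nsq y by rewrite mulr_ge0.
  have sq : 0 <= (i - K0) ^+ 2 by exact: sqr_ge0.
  by move: cs kn k2 sq s0; rewrite !expr2; nra.
set B := 2 * _ + _ in CE F2.
have B0 : 0 <= B.
  by rewrite /B addr_ge0 // mulr_ge0 ?sqr_ge0 // sumr_ge0 // => i _; exact: sqr_ge0.
have ki0 : 0 <= k^-1 by rewrite invr_ge0 ltW.
set S := N%:R + 2 * b * D.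
set Sm := N%:R + 2 * b * m in CE *.
have SSm : S <= Sm by rewrite lerD2l ler_wpM2l // mulr_ge0.
have S0 : 0 <= S by rewrite /S addr_ge0 // mulr_ge0 // mulr_ge0.
have C0 : 3 * a <= C.
  rewrite CE lerDl; apply: mulr_ge0 => //; apply: addr_ge0 => //.
  by apply: mulr_ge0 => //; exact: le_trans SSm.
rewrite chE.
have [pz|nk] := pc.
  have kn : k <= nsq y.
    move: pz; rewrite /p /pospow expr1 => /eqP; rewrite eq_le ge_max lexx /=.
    by move=> /andP[+ _]; rewrite subr_le0 mulrC ler_pdivlMr // mul1r.
  rewrite pz !expr0n /= !(mulr0,mul0r,addr0) min_r // subr_le0.
  rewrite mulrDr mulr1 mulVf ?gt_eqF //.
  apply: (@le_trans _ _ (C * 1)); first by rewrite mulr1; apply: le_trans C0; lra.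
  apply: ler_wpM2l; last by rewrite lerDr.
  by apply: le_trans C0; rewrite mulr_ge0.
rewrite min_l //.
have e1 : p ^+ 3 * LG >= a - 3 * a * (k^-1 * nsq y).
  apply: (@le_trans _ _ (p ^+ 3 * a)); last by apply: ler_wpM2l => //; rewrite exprn_ge0.
  rewrite -subr_ge0.
  have -> : p ^+ 3 * a - (a - 3 * a * (k^-1 * nsq y)) = a * (3 * (k^-1 * nsq y) - (1 - p ^+ 3)).
    by ring.
  by rewrite mulr_ge0 // subr_ge0 -chE.
have e2 : F ^+ 2 * (- (3 / k) * p ^+ 2 * S + 12 / k ^+ 2 * p * nsq y) >=
    - (3 * k^-1 * Sm * (B * (1 + nsq y))).
  apply: (@le_trans _ _ (- (3 * k^-1 * Sm * F ^+ 2))).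
    rewrite lerN2; apply: ler_wpM2l => //.
    by rewrite mulr_ge0 ?mulr_ge0 // (le_trans S0).
  rewrite -subr_ge0.
  have -> : F ^+ 2 * (- (3 / k) * p ^+ 2 * S + 12 / k ^+ 2 * p * nsq y) -
    - (3 * k^-1 * Sm * F ^+ 2) =
    F ^+ 2 * k^-1 * 3 * (Sm - p ^+ 2 * S) + 12 * (F ^+ 2 * (k^-1 * (k^-1 * (p * nsq y)))).
    by rewrite -exprVn; ring.
  apply: addr_ge0.
    apply: mulr_ge0; first by rewrite !mulr_ge0 ?sqr_ge0.
    rewrite subr_ge0; apply: le_trans SSm; rewrite ler_piMl // expr_le1 //.
  by rewrite !mulr_ge0 ?sqr_ge0.
have e3 : - 12 * k^-1 * p ^+ 2 * (F * I) >= - (12 * k^-1 * (B * (1 + nsq y))).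
  have -> : - 12 * k^-1 * p ^+ 2 * (F * I) = - (12 * k^-1 * (p ^+ 2 * (F * I))) by ring.
  rewrite lerN2; apply: ler_wpM2l; first by rewrite mulr_ge0.
  apply: (@le_trans _ _ (p ^+ 2 * F ^+ 2)).
    by apply: ler_wpM2l; [rewrite sqr_ge0|rewrite expr2; exact: ler_wpM2l].
  apply: le_trans F2; rewrite ler_piMl ?sqr_ge0 // expr_le1 //.
have e4 : 3 * a * (k^-1 * nsq y) <= 3 * a * (k^-1 * (1 + nsq y)).
  by rewrite ler_wpM2l ?mulr_ge0 // ler_wpM2l // lerDr.
apply: (@le_trans _ _ (- (3 * k^-1 * Sm * (B * (1 + nsq y))) + (a - 3 * a * (k^-1 * nsq y))
  + - (12 * k^-1 * (B * (1 + nsq y))))); last first.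
  by apply: lerD => //; exact: lerD.
have -> : C * (k^-1 * (1 + nsq y)) = 3 * a * (k^-1 * (1 + nsq y)) +
  (3 * k^-1 * Sm * (B * (1 + nsq y))) + 12 * k^-1 * (B * (1 + nsq y)).
  by rewrite CE; ring.
move: e4; move: (3 * a * (k^-1 * nsq y)) (3 * a * _) (3 * k^-1 * Sm * _).
by move: (12 * k^-1 * _) => *; lra.
Qed.

(** The smoothed function is within [kk] of <r, y> on the chamber, and (i + kk)^2 <= (1 + kk) i^2 +
    2 kk. The cutoff is removed first, at fixed [kk], using the bounded second moment; then [kk]
    tends to 0. *)
Lemma sqr_ip_lower t : 0 <= t ->
  4 * b * m ^+ 2 * t <= \int[P]_w ip r (X t w) ^+ 2.
Proof.
move=> t0.
have E0 : 0 <= \int[P]_w ip r (X t w) ^+ 2.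
  by apply: Rintegral_ge0 => w _; exact: sqr_ge0.
apply: le_of_perturbed => //.
  by rewrite mulr_ge0 // mulr_ge0 ?sqr_ge0 // mulr_ge0.
move=> kk kk0 kk1.
have dl0 : 0 < kk / 2 by rewrite divr_gt0.
have [eps1 eps10 heps] := fhat_drift_lower rdec rpos nu0 b0 kk0 dl0 rdrift.
pose lM : R := ln #|{: W}|%:R.
have lM0 : 0 <= lM.
  by rewrite ln_ge0 // ler1n; apply/card_gt0P; exists (@weyl1 N).
have lM1 : 0 < lM + 1 by rewrite ltr_wpDl.
pose eps := Num.min (eps1 / 2) (kk / 2 / (lM + 1)).
have eps0 : 0 < eps by rewrite lt_min !divr_gt0.
have epsl : eps < eps1.
  by apply: (@le_lt_trans _ _ (eps1 / 2)); [rewrite ge_min lexx|lra].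
pose K0 := eps * lM + kk / 2.
have K00 : 0 <= K0 by rewrite addr_ge0 // ?mulr_ge0 // ltW.
have K0k : K0 <= kk.
  have : eps * (lM + 1) <= kk / 2 by rewrite -ler_pdivlMr // ge_min lexx orbT.
  rewrite /K0 mulrDr mulr1; move: (eps * lM) eps0 => q; move: (eps) => e; lra.
set a := 4 * b * m ^+ 2 * (1 - kk).
have a0 : 0 <= a.
  by rewrite /a mulr_ge0 ?subr_ge0 ?(ltW kk1) // mulr_ge0 ?sqr_ge0 // mulr_ge0.
have lowa (y : V) : CNB y -> a <= 2 * ((fhat r eps y + kk / 2) *
      genC2 nu b (fgrad r eps) (fhess r eps) y).
  move=> cy; have := heps _ eps0 epsl y cy; rewrite /a.
  have -> : 4 * b * m ^+ 2 * (1 - kk) = 2 * (2 * b * m ^+ 2 * (1 - kk)) by ring.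
  by rewrite ler_pM2l.
pose C := 3 * a + (3 * (N%:R + 2 * b * m) + 12) *
     (2 * (\sum_i r i ^+ 2) + 2 * K0 ^+ 2).
have C0 : 0 <= C.
  have s0 : 0 <= \sum_i r i ^+ 2 by apply: sumr_ge0 => i _; exact: sqr_ge0.
  have bm : 0 <= N%:R + 2 * b * m.
    by apply: addr_ge0 => //; apply: mulr_ge0 => //; exact: mulr_ge0.
  rewrite /C; apply: addr_ge0; first exact: mulr_ge0.
  apply: mulr_ge0; first by apply: addr_ge0 => //; exact: mulr_ge0.
  by apply: addr_ge0; apply: mulr_ge0 => //; exact: sqr_ge0.
set E := \int[P]_w _ in E0 *.
have up : forall k : R, 0 < k ->
    (a - C * (k^-1 * (1 + (nsq x + (N%:R + 12 + 2 * b * m) * t)))) * t <= (1 + kk) * E + 2 * kk.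
  move=> k k0.
  have [g1 [H1 [h1 _]]] := genC2_fhat_sqr r (kk / 2) nu b eps0.
  have hh := hasC2_mul h1 (@hasC2_chi R N k).
  have inv : BN_invariant (fun y => (fhat r eps y + kk / 2) ^+ 2 * chi k y).
    apply: BN_invariant_mul; last exact: BN_invariant_chi.
    exact: (BN_invariant_comp (fun u => (u + kk / 2) ^+ 2) (@BN_invariant_fhat r eps)).
  have supp := chi_support (fun y : V => (fhat r eps y + kk / 2) ^+ 2) k0.
  pose h (y : V) := a - C * (k^-1 * (1 + Num.min (nsq y) k)).
  have cmin : continuous (fun y : V => Num.min (nsq y) k).
    move=> y; exact: (@continuous_min R V (@nsq R N) (cst k) y (@continuous_nsq y)
      (@cst_continuous _ _ _ y)).
  have ch : continuous h.
    move=> y; have cc (c : R) : {for y, continuous (cst c : V -> R)}.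
      exact: cst_continuous.
    have c1 : {for y, continuous (fun z : V => 1 + Num.min (nsq z) k)}.
      exact: (continuousD (cc 1) (cmin y)).
    have c2 := @continuousM R V (cst k^-1) _ y (cc _) c1.
    have c3 := @continuousM R V (cst C) _ y (cc _) c2.
    exact: (continuousB (cc a) c3).
  have q01 (y : V) : 0 <= k^-1 * (1 + Num.min (nsq y) k) <= k^-1 * (1 + k).
    have k1 : 0 <= k^-1 by rewrite invr_ge0 ltW.
    apply/andP; split; first by rewrite mulr_ge0 // addr_ge0 // le_min nsq_ge0 ltW.
    by rewrite ler_wpM2l // lerD2l ge_min lexx orbT.
  have bh (y : V) : CNB y -> `|h y| <= a + C * (k^-1 * (1 + k)).
    move=> _; have /andP[q0 q1] := q01 y.
    rewrite /h; apply: (le_trans (ler_normB _ _)); rewrite (ger0_norm a0) lerD2l.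
    by rewrite ger0_norm; [exact: ler_wpM2l|exact: mulr_ge0].
  have low : forall u, 0 <= u <= t ->
     a - C * (k^-1 * (1 + (nsq x + (N%:R + 12 + 2 * b * m) * t))) <= \int[P]_w h (X u w).
    move=> u /andP[u0 ut].
    have [i1 i2] := second_moment HX nu0' b0' u0.
    have i3 : P.-integrable setT (EFin \o (fun w => C * k^-1 * nsq (X u w))).
      exact: integrable_scaleR.
    have ic : P.-integrable setT (EFin \o (fun w : Omega => a - C * k^-1)).
      exact: integrable_cstR.
    apply: (@le_trans _ _ (\int[P]_w (a - C * k^-1 - C * k^-1 * nsq (X u w)))).
      rewrite RintegralB // RintegralZl // Rintegral_cst //.
      rewrite [X in fine X](probability_setT P) mulr1.
      have : C * k^-1 * (\int[P]_w nsq (X u w)) <= C * k^-1 *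
         (nsq x + (N%:R + 12 + 2 * b * m) * t).
        apply: ler_wpM2l; first by rewrite mulr_ge0 // invr_ge0 ltW.
        apply: (le_trans i2); rewrite lerD2l ler_wpM2l //.
        by rewrite !addr_ge0 // !mulr_ge0.
      have -> : C * (k^-1 * (1 + (nsq x + (N%:R + 12 + 2 * b * m) * t))) =
        C * k^-1 + C * k^-1 * (nsq x + (N%:R + 12 + 2 * b * m) * t) by ring.
      by move: (C * k^-1 * _) (C * k^-1 * _) => *; lra.
    apply: le_Rintegral => //.
    - exact: integrable_subR.
    - exact: (bessel_integrable HX u0 ch bh).
    - move=> w _; rewrite /h mulrDr mulrDr mulr1 opprD addrA lerD2l lerN2 -!mulrA.
      apply: ler_wpM2l => //; apply: ler_wpM2l; first by rewrite invr_ge0 ltW.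
      by rewrite ge_min lexx.
  have := bessel_lower HX nu0' hh inv supp ch bh
    (fun y cy => gen_lower eps0 dl0 a0 k0 (erefl K0) hh cy lowa (erefl C)) (lexx 0) t0 low.
  rewrite subr0 => hl; apply: (le_trans hl).
  have F0 (y : V) : CNB y -> 0 <= (fhat r eps y + kk / 2) ^+ 2 * chi k y.
    by move=> _; rewrite mulr_ge0 ?sqr_ge0 //; have [] := chi_bounds y k0.
  rewrite lerBlDr -[leLHS]addr0; apply: lerD; last first.
    by apply: Rintegral_ge0 => w _; apply: F0; exact: (bessel_CNB HX).
  have i1 := sqr_ip_integrable t0.
  have i2 : P.-integrable setT (EFin \o (fun w => (1 + kk) * ip r (X t w) ^+ 2)).
    exact: integrable_scaleR.
  have ic : P.-integrable setT (EFin \o (fun w : Omega => 2 * kk)).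
    exact: integrable_cstR.
  have i3 : P.-integrable setT (EFin \o (fun w => (1 + kk) * ip r (X t w) ^+ 2 + 2 * kk)).
    exact: integrable_addR.
  apply: (@le_trans _ _ (\int[P]_w ((1 + kk) * ip r (X t w) ^+ 2 + 2 * kk))); last first.
    rewrite RintegralD // RintegralZl // Rintegral_cst //.
    by rewrite [X in fine X](probability_setT P) mulr1.
  have ptw (y : V) : CNB y -> (fhat r eps y + kk / 2) ^+ 2 * chi k y <=
      (1 + kk) * ip r y ^+ 2 + 2 * kk.
    move=> cy; have [c0 c1 _] := chi_bounds y k0.
    have f1 := fhat_ge r eps0 y; have f2 := fhat_le rdec rpos eps0 cy.
    have i0 := ip_ge0 rpos cy.
    apply: (@le_trans _ _ ((fhat r eps y + kk / 2) ^+ 2)); first by rewrite ler_piMr ?sqr_ge0.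
    apply: (@le_trans _ _ ((ip r y + kk) ^+ 2)).
      apply: lerXn2r; rewrite ?nnegrE ?addr_ge0 // ?(ltW kk0) ?(ltW dl0) //.
        exact: le_trans f1.
      by move: f2 K0k; rewrite /K0 /lM; lra.
    move: (ip r y) => i in i0 *; have : 0 <= kk * (i - 1) ^+ 2 by rewrite mulr_ge0 ?sqr_ge0 // ltW.
    have : kk * kk <= kk * 1 by rewrite ler_pM2l // ltW.
    by rewrite !expr2; nra.
  apply: le_Rintegral => //.
  - apply: (bessel_dominated HX (h := fun y => (fhat r eps y + kk / 2) ^+ 2 * chi k y)
      (k := fun y => (1 + kk) * ip r y ^+ 2 + 2 * kk)) => //.
      by case: hh.
    by move=> y cy; rewrite ger0_norm; [exact: ptw|exact: F0].
  - by move=> w _; apply: ptw; exact: (bessel_CNB HX).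
rewrite [leLHS]mulrAC -/a.
have [->|tn] := eqVneq t 0.
  by rewrite mulr0 addr_ge0 // mulr_ge0 // ltW // addr_gt0.
rewrite leNgt; apply/negP => lt.
set Q := 1 + (nsq x + (N%:R + 12 + 2 * b * m) * t).
have Q0 : 0 < Q.
  rewrite /Q ltr_wpDr // addr_ge0 ?nsq_ge0 // mulr_ge0 //.
  by rewrite !addr_ge0 // !mulr_ge0.
set D := a * t - ((1 + kk) * E + 2 * kk).
have D0 : 0 < D by rewrite /D subr_gt0.
(* A cutoff this large loses strictly less than the assumed deficit [D]. *)
have k0 : 0 < (C * Q * t + 1) / D.
  by rewrite divr_gt0 // ltr_wpDl // !mulr_ge0 // ltW.
have := up _ k0; rewrite -/Q invf_div.
have -> : (a - C * (D / (C * Q * t + 1) * Q)) * t = a * t - (C * Q * t) / (C * Q * t + 1) * D.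
  by ring.
have CQ : 0 <= C * Q * t by rewrite mulr_ge0 // mulr_ge0 // ltW.
have : (C * Q * t) / (C * Q * t + 1) < 1.
  by rewrite ltr_pdivrMr ?mul1r ?ltrDl // ltr_wpDl.
rewrite -(ltr_pM2r D0) mul1r; rewrite {2}/D.
by move: (_ / _ * D) (a * t) ((1 + kk) * E) => *; lra.
Qed.

(** Stationarity tested on [r], where every quotient of positive weight is 1. *)
Lemma sum_sqr_r : \sum_i r i ^+ 2 = 2 * m.
Proof.
have := rdrift r; under [in RHS]eq_bigr do rewrite -expr2.
have -> : drift nu r r = m.
  apply: eq_bigr => e _; have := kap_ge0 e nu0'; rewrite le_eqVlt => /orP[/eqP <-|ke].
    by rewrite mul0r.
  have := rdf_ratio (PR_r rdec rpos) (PR_r rdec rpos) ke.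
  by have [->|h] := eqVneq (rdf e r) 0; [rewrite mul0r ltxx|rewrite divff // mulr1].
by move=> ->; field.
Qed.

Lemma nsq_shift (c : R) (y : V) :
  nsq (y - c *: \row_i r i) = nsq y - 2 * c * ip r y + c ^+ 2 * (2 * m).
Proof.
rewrite -sum_sqr_r /nsq /ip !mulr_sumr -sumrB -big_split /=; apply: eq_bigr => i _.
by rewrite !mxE; ring.
Qed.

(** The squared deviation contains - 2 c <r, y>, whose mean is not directly controlled. It is
    dominated by a combination of the second and fourth moments and of - <r, y>^2, touching at y = c
    r; these are exactly the quantities estimated above. *)
Let major (c : R) (y : V) : R :=
  nsq y + (2 * m * c ^+ 2)^-1 * nsq y ^+ 2 + 2 * m * c ^+ 2 - 3 / (2 * m) * ip r y ^+ 2.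

Let major_ge c (y : V) : 0 < m -> 0 < c -> CNB y ->
  nsq (y - c *: \row_i r i) <= major c y.
Proof.
move=> mp cp cy; rewrite nsq_shift /major.
have cs := ip_sqr_le r y; rewrite sum_sqr_r in cs.
have i0 := ip_ge0 rpos cy; move: (ip r y) (nsq y) (nsq_ge0 y) cs i0 => i n n0 cs i0.
have mn : m != 0 by rewrite gt_eqF.
have cn : c != 0 by rewrite gt_eqF.
have m2 : 0 < 2 * m by rewrite mulr_gt0.
have h1 : i ^+ 2 / (2 * m) <= n by rewrite ler_pdivrMr // mulrC.
have h2 : (i ^+ 2 / (2 * m)) ^+ 2 <= n ^+ 2.
  by apply: lerXn2r => //; rewrite ?nnegrE // divr_ge0 ?sqr_ge0 // ltW.
have h3 : (2 * m * c ^+ 2)^-1 * (i ^+ 2 / (2 * m)) ^+ 2 <= (2 * m * c ^+ 2)^-1 * n ^+ 2.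
  by apply: ler_wpM2l => //; rewrite invr_ge0 ltW // mulr_gt0 // exprn_gt0.
have h4 : 0 <= (2 * m * c ^+ 2)^-1 * (i ^+ 2 / (2 * m)) ^+ 2 - 3 / (2 * m) * i ^+ 2 + 2 * c * i.
  (* The coefficients are those for which the quartic has a double root at i = 2 m c, the value of
     <r, c r>; the remaining factors are nonnegative. *)
  have -> : (2 * m * c ^+ 2)^-1 * (i ^+ 2 / (2 * m)) ^+ 2 - 3 / (2 * m) * i ^+ 2 + 2 * c * i =
    i * ((i - 2 * m * c) ^+ 2 * (i + 4 * m * c)) / (8 * m ^+ 3 * c ^+ 2).
    by field; rewrite mn cn.
  apply: divr_ge0; last by rewrite ltW // mulr_gt0 ?mulr_gt0 // exprn_gt0.
  apply: mulr_ge0 => //; apply: mulr_ge0; first exact: sqr_ge0.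
  by apply: addr_ge0 => //; rewrite mulr_ge0 ?mulr_ge0 // ltW.
move: h3 h4; move: (_ * n ^+ 2) (_ * (_ / _) ^+ 2) (3 / _ * _) => a b' e.
by rewrite [2 * m * _]mulrC; lra.
Qed.

(** With U = 2 b m s, the four parts of the majorant have leading terms U, U, U and - 3 U. These
    cancel, and what remains is bounded in [b] for fixed [s]. *)
Lemma deviation_bound s : 0 < m -> 0 < s ->
  let f w := nsq (X s w - Num.sqrt (b * s) *: \row_i r i) in
  P.-integrable setT (EFin \o f) /\
  \int[P]_w f w <= 3 * nsq x + (3 * N%:R + 32) * s
    + (nsq x + (N%:R + 12) * s) ^+ 2 / (2 * m * b * s).
Proof.
move=> mp sp f; have s0 := ltW sp.
have bs : 0 < b * s by rewrite mulr_gt0.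
have cp : 0 < Num.sqrt (b * s) by rewrite sqrtr_gt0.
have c2 : Num.sqrt (b * s) ^+ 2 = b * s by rewrite sqr_sqrtr // ltW.
have [i1 e1] := second_moment HX nu0' b0' s0.
have [i2 e2] := fourth_moment HX nu0' b0' s0.
have i3 := sqr_ip_integrable s0.
have e3 := sqr_ip_lower s0.
set c := Num.sqrt (b * s) in f cp c2 *.
have j1 := integrable_scaleR (2 * m * c ^+ 2)^-1 i2.
have j2 := integrable_scaleR (3 / (2 * m)) i3.
have jc := integrable_cstR P (2 * m * c ^+ 2).
have j3 := integrable_addR i1 j1; have j4 := integrable_addR j3 jc.
have mi : P.-integrable setT (EFin \o (fun w => major c (X s w))).
  exact: integrable_subR.
have fi : P.-integrable setT (EFin \o f).
  apply: (bessel_dominated HX (h := fun y => nsq (y - c *: \row_i r i)) (k := major c)) => //.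
    move=> y; apply: (@continuous_comp _ _ _ (fun y : V => y - c *: \row_i r i) (@nsq R N)).
      by apply: (continuousB (f := idfun)); [exact: cvg_id|exact: cst_continuous].
    exact: continuous_nsq.
  by move=> y cy; rewrite ger0_norm ?nsq_ge0 //; exact: major_ge.
split => //; apply: (@le_trans _ _ (\int[P]_w major c (X s w))).
  by apply: le_Rintegral => // w _; apply: major_ge => //; exact: (bessel_CNB HX).
have Z1 : \int[P]_w ((2 * m * c ^+ 2)^-1 * nsq (X s w) ^+ 2) =
  (2 * m * c ^+ 2)^-1 * \int[P]_w nsq (X s w) ^+ 2 by rewrite RintegralZl.
have Z2 : \int[P]_w (3 / (2 * m) * ip r (X s w) ^+ 2) =
  3 / (2 * m) * \int[P]_w ip r (X s w) ^+ 2 by rewrite RintegralZl.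
have -> : \int[P]_w major c (X s w) = \int[P]_w (nsq (X s w)
  + (2 * m * c ^+ 2)^-1 * nsq (X s w) ^+ 2 + 2 * m * c ^+ 2)
  - \int[P]_w (3 / (2 * m) * ip r (X s w) ^+ 2) by rewrite /major RintegralB.
rewrite RintegralD // RintegralD // Z1 Z2 Rintegral_cstR c2.
move: (\int[P]_w nsq (X s w)) (\int[P]_w nsq (X s w) ^+ 2) (\int[P]_w ip r (X s w) ^+ 2)
  e1 e2 e3 => I1 I2 I3 e1 e2 e3.
have mn : m != 0 by rewrite gt_eqF.
have bn : b != 0 by rewrite gt_eqF.
have sn : s != 0 by rewrite gt_eqF.
have q0 : 0 <= (2 * m * (b * s))^-1 by rewrite invr_ge0 ltW // mulr_gt0 // mulr_gt0.
have q1 : 0 <= 3 / (2 * m) by rewrite divr_ge0 // ltW // mulr_gt0.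
have f2 := ler_wpM2l q0 e2; have f3 := ler_wpM2l q1 e3.
have n0 := nsq_ge0 x; set n := nsq x in n0 e1 f2 *.
set A := 3 * n + _ + _.
have : (2 * m * (b * s))^-1 * (n ^+ 2 + ((2 * N%:R + 16 + 4 * b * m) * n * s +
     2^-1 * ((2 * N%:R + 16 + 4 * b * m) * (N%:R + 12 + 2 * b * m)) * s ^+ 2)) =
   A - n - (N%:R + 12 + 2 * b * m) * s + 4 * b * m * s -
   (2 * m * (b * s))^-1 * (8 * n * s + 4 * (N%:R + 12) * s ^+ 2).
  by rewrite /A; move: (N%:R : R) => N'; field; rewrite mn bn sn.
have : 0 <= (2 * m * (b * s))^-1 * (8 * n * s + 4 * (N%:R + 12) * s ^+ 2).
  apply: mulr_ge0 => //; apply: addr_ge0; first by rewrite mulr_ge0 // mulr_ge0.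
  by rewrite mulr_ge0 ?sqr_ge0 // mulr_ge0 // addr_ge0.
have : 3 / (2 * m) * (4 * b * m ^+ 2 * s) = 6 * b * m * s by field.
move: f2 f3 e1; move: (_ * I2) (_ * I3) => J2 J3.
move: (_^-1 * (n ^+ 2 + _)) (_^-1 * (8 * n * s + _)) => B1 B2.
move: (3 / (2 * m) * _) => B3.
have -> : 2 * m * (b * s) = 2 * b * m * s by ring.
rewrite mulrDl; have -> : 4 * b * m * s = 2 * (2 * b * m * s) by ring.
have -> : 6 * b * m * s = 3 * (2 * b * m * s) by ring.
move: (2 * b * m * s) ((N%:R + 12) * s) A => U U' A *; lra.
Qed.

End Process.
End RadialLowerBound.

(** * An approximate martingale *)

Section Localization.
Context {R : realType} {N : nat}.
Local Notation V := 'rV[R]_N.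
Local Notation W := ('S_N * {ffun 'I_N -> bool})%type.
Local Notation rootT := ('I_N * 'I_N * bool)%type.

Lemma hasC2_shift (f : V -> R) g H (a : V) : hasC2 f g H ->
  hasC2 (fun y => f (y - a)) (fun i y => g i (y - a)) (fun i j y => H i j (y - a)).
Proof.
have ds (h : V -> R) (x v : V) (l : R) : is_derive (x - a) v h l ->
    is_derive x v (fun y => h (y - a)) l.
  move=> /is_derive_line h1; apply/is_derive_line.
  by under eq_fun do rewrite -addrA.
have cs (h : V -> R) : continuous h -> continuous (fun y : V => h (y - a)).
  move=> ch y; apply: (@continuous_comp _ _ _ (fun y : V => y - a) h); last exact: ch.
  by apply: (continuousB (f := idfun)); [exact: cvg_id|exact: cst_continuous].
move=> [a1 a2 a3 a4 a5]; split.
- by move=> x i; exact: ds.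
- by move=> x i j; exact: ds.
- exact: cs.
- by move=> i; exact: cs.
- by move=> i j; exact: cs.
Qed.

Lemma genC2_sum (nu b : R) (I : finType) (g : I -> 'I_N -> V -> R)
    (H : I -> 'I_N -> 'I_N -> V -> R) (y : V) :
  genC2 nu b (fun i y => \sum_w g w i y) (fun i j y => \sum_w H w i j y) y =
  \sum_w genC2 nu b (g w) (H w) y.
Proof.
rewrite /genC2 big_split /= -!mulr_sumr exchange_big /=; congr (_ + _ * _).
rewrite /drift exchange_big /=; apply: eq_bigr => e _.
by rewrite (rdf_sum _ e (fun w i => g w i y)) mulr_suml mulr_sumr.
Qed.

Lemma rdf_sqr_le (e : rootT) (y : V) : rdf e (y ord0) ^+ 2 <= 4 * nsq y.
Proof.
case: e => -[i j] b; rewrite /rdf /=; set a := y ord0 i; set c := y ord0 j.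
have ai (k : 'I_N) : y ord0 k ^+ 2 <= nsq y.
  by rewrite /nsq (bigD1 k) //= lerDl sumr_ge0 // => l _; exact: sqr_ge0.
have := ai i; have := ai j; rewrite -/a -/c.
have := sqr_ge0 (a - c); have := sqr_ge0 (a + c).
by case: b; rewrite ?expr0 ?expr1 !expr2; nra.
Qed.

Lemma orb_regular (w : W) (y : V) : CNB y ->
  (forall e, PR e -> 0 < rdf e (act w y ord0)) -> w = @weyl1 N.
Proof.
move=> [yd y0] H.
have aE i : act w y ord0 i = (-1) ^+ w.2 i * y ord0 (w.1 i) by rewrite mxE.
have fi i : w.2 i = false.
  apply/negbTE/negP => wi; have := H (i, i, true).
  rewrite /PR /rdf /= eqxx expr1 mulN1r opprK aE wi expr1 mulN1r => /(_ isT).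
  by have := y0 (w.1 i); rewrite /Defs.coord; lra.
have s1 : w.1 = 1%g.
  apply: perm_homo_id => i j ij; have := H (i, j, false); rewrite /PR /rdf /= => /(_ ij).
  rewrite expr0 mul1r !aE !fi !expr0 !mul1r subr_gt0 => h.
  rewrite ltnNge; apply/negP => le; have := yd _ _ le; rewrite /Defs.coord.
  by rewrite leNgt h.
rewrite /weyl1; case: w {H aE} fi s1 => s f /= fi ->.
by congr pair; apply/ffunP => i; rewrite ffunE fi.
Qed.

Section Process.
Variables (nu b : R) (x : V).
Context d (Omega : measurableType d) (P : probability Omega R).
Context (X : R -> Omega -> V).
Hypothesis HX : bessel_B (nu * b) b x P X.
Hypothesis nu0 : 0 <= nu.

(* Deep inside the chamber the translates of the support by the signed
   permutations are disjoint, so symmetrising does not change f there. *)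
Lemma bessel_lower_local (f : V -> R) g H (h : V -> R) (rho : V) (k Ch c s t : R) :
  0 < k -> (forall e, PR e -> 4 * Num.sqrt k <= rdf e (rho ord0)) ->
  hasC2 f g H -> (forall y, k <= nsq (y - rho) ->
    [/\ f y = 0, forall i, g i y = 0 & forall i j, H i j y = 0]) ->
  continuous h -> (forall y, CNB y -> `|h y| <= Ch) ->
  (forall y, CNB y -> h y <= genC2 nu b g H y) ->
  0 <= s -> s <= t -> (forall u, s <= u <= t -> c <= \int[P]_w h (X u w)) ->
  c * (t - s) <= \int[P]_w f (X t w) - \int[P]_w f (X s w).
Proof.
move=> k0 deep hf van ch bh hle s0 st hc.
(* If the image were within sqrt k of [rho], each chamber root would be at least 4 sqrt k - 2 sqrt k
   > 0 on it, which places it in the open chamber and forces [w] to be the identity. *)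
have far (w : W) (y : V) : w != @weyl1 N -> CNB y -> k <= nsq (act w y - rho).
  move=> wn cy; rewrite leNgt; apply/negP => lt; move/eqP: wn; apply.
  apply: (orb_regular cy) => e pr.
  have rE : rdf e (act w y ord0) = rdf e (rho ord0) + rdf e ((act w y - rho) ord0).
    by rewrite /rdf !mxE; ring.
  have := rdf_sqr_le e (act w y - rho); have := deep e pr; rewrite rE.
  have sk : Num.sqrt k ^+ 2 = k by rewrite sqr_sqrtr // ltW.
  have sp : 0 < Num.sqrt k by rewrite sqrtr_gt0.
  move: lt; move: (rdf e _) (rdf e _) (nsq _) => a c' n nk da le.
  rewrite -sk in nk; move: (Num.sqrt k) sp nk da => q q0 nk da.
  have h1 : a ^+ 2 < (2 * q) ^+ 2.
    by apply: (le_lt_trans le); rewrite exprMn; nra.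
  have := h1; rewrite -[a ^+ 2]real_normK ?num_real // ltr_pXn2r ?nnegrE ?mulr_ge0 ?(ltW q0) //.
  by rewrite ltr_norml => /andP[h2 _]; lra.
pose F (y : V) := \sum_(w : W) f (act w y).
have hF := hasC2_sum (index_enum W) (fun w : W => hasC2_act w hf).
have FE (y : V) : CNB y -> F y = f y.
  move=> cy; rewrite /F (bigD1 (@weyl1 N)) //= act1 big1 ?addr0 // => w wn.
  by have [] := van _ (far w y wn cy).
have LE (y : V) : CNB y -> genC2 nu b g H y =
    genC2 nu b (fun i y => \sum_(w : W) (-1) ^+ w.2 (w.1^-1%g i) * g (w.1^-1%g i) (act w y))
     (fun i j y => \sum_(w : W) (-1) ^+ w.2 (w.1^-1%g i) * (-1) ^+ w.2 (w.1^-1%g j) *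
         H (w.1^-1%g i) (w.1^-1%g j) (act w y)) y.
  move=> cy; rewrite (genC2_sum nu b
    (fun (w : W) i y => (-1) ^+ w.2 (w.1^-1%g i) * g (w.1^-1%g i) (act w y))
    (fun (w : W) i j y => (-1) ^+ w.2 (w.1^-1%g i) * (-1) ^+ w.2 (w.1^-1%g j) *
         H (w.1^-1%g i) (w.1^-1%g j) (act w y))).
  rewrite (bigD1 (@weyl1 N)) //= big1 ?addr0 => [|w wn].
    have h1 := hasC2_act (@weyl1 N) hf; have e1 : f = fun y => f (act (@weyl1 N) y).
      by apply/funext => z; rewrite act1.
    by rewrite -(genB_genC2 _ _ _ h1) -e1 (genB_genC2 _ _ _ hf).
  have [_ g0 H0] := van _ (far w y wn cy).
  rewrite /genC2 big1 ?mulr0 ?add0r => [|i _]; last by rewrite H0 mulr0.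
  rewrite /drift big1 ?mulr0 // => e _.
  by rewrite /rdf !g0 !mulr0 subr0 mul0r mulr0.
have intE u : 0 <= u -> \int[P]_w f (X u w) = \int[P]_w F (X u w).
  by move=> u0; apply: eq_Rintegral => w _; rewrite FE //; exact: (bessel_CNB HX).
rewrite intE ?intE ?(le_trans s0) //.
apply: (bessel_lower HX nu0 hF _ _ ch bh _ s0 st hc).
- exact: BN_invariant_sum.
- exists (1 + 2 * k + 2 * nsq rho) => y hy.
  rewrite /F big1 // => w _; have [] // := van (act w y).
  have tri : nsq (act w y) <= 2 * nsq (act w y - rho) + 2 * nsq rho.
    rewrite /nsq !mulr_sumr -big_split /=; apply: ler_sum => i _; rewrite !mxE.
    move: (_ * y ord0 _) (rho ord0 i) => u v; have := sqr_ge0 (u - 2 * v).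
    by rewrite !expr2; nra.
  have := norm_sq_le_nsq y; rewrite -(BN_invariant_act w y BN_invariant_nsq).
  have := nsq_ge0 rho; move: hy tri; move: (nsq (act w y)) (nsq (_ - _)) (nsq rho) (`|y|).
  by move=> A B C D; rewrite expr2; nra.
- by move=> y cy; rewrite -LE //; exact: hle.
Qed.

End Process.

Lemma inv_expand1 (r z xi : R) : r != 0 -> r + z != 0 ->
  xi / (r + z) = xi / r - xi * z / r ^+ 2 + xi * z ^+ 2 / (r ^+ 2 * (r + z)).
Proof. by move=> r0 rz; field; rewrite r0 rz. Qed.

(** Taylor expansion of 1 / <e, sigma r + z>: to second order when paired with [xi], to first order
    when paired with [z]. The depth assumption gives |<e, z>| <= |<e, sigma r>| / 2, so each
    denominator loses at most a factor 2. *)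
Lemma drift_expand (nu k sigma dl : R) (r : 'I_N -> R) (z : V) (xi : 'I_N -> R) (Xi : R) :
  0 <= nu -> 0 < k -> 0 < sigma -> 0 < dl ->
  (forall e : rootT, 0 < kap nu e -> dl <= `|rdf e r|) -> 4 * Num.sqrt k <= sigma * dl ->
  nsq z <= k -> (forall e : rootT, `|rdf e xi| <= Xi) ->
  `|drift nu (fun i => sigma * r i + z ord0 i) xi - sigma^-1 * drift nu r xi
    + sigma^-2 * \sum_e kap nu e * (rdf e xi * rdf e (z ord0) / rdf e r ^+ 2)|
    <= kaptot N nu * (8 * k * Xi * sigma ^- 3 * dl ^- 3) /\
  `|drift nu (fun i => sigma * r i + z ord0 i) (z ord0) - sigma^-1 * drift nu r (z ord0)|
    <= kaptot N nu * (8 * nsq z * sigma ^- 2 * dl ^- 2).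
Proof.
move=> nu0 k0 s0 d0 hd deep nk hXi.
have n0 := nsq_ge0 z.
have key (e : rootT) : 0 < kap nu e ->
   let q := rdf e r in let y := sigma * q in let ze := rdf e (z ord0) in
   [/\ q != 0, y + ze != 0, rdf e (fun i => sigma * r i + z ord0 i) = y + ze,
    sigma * dl <= `|y| & `|y + ze|^-1 <= 2 / `|y|].
  move=> ke q y ze; have hq := hd e ke.
  have q0 : 0 < `|q| by apply: lt_le_trans hq.
  have yn : `|y| = sigma * `|q| by rewrite normrM gtr0_norm.
  have y4 : sigma * dl <= `|y| by rewrite yn ler_pM2l.
  have sk : Num.sqrt k ^+ 2 = k by rewrite sqr_sqrtr // ltW.
  have zn : `|ze| <= 2 * Num.sqrt k.
    rewrite -(@ler_pXn2r _ 2) ?nnegrE ?mulr_ge0 // ?sqrtr_ge0 // real_normK ?num_real //.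
    by rewrite exprMn sk (le_trans (rdf_sqr_le e z)) //; lra.
  have yz : `|y| / 2 <= `|y + ze|.
    have := lerB_normD y ze; move: (`|y + ze|) (`|y|) (`|ze|) zn y4 deep => *; lra.
  have y0 : 0 < `|y| by rewrite yn mulr_gt0.
  have yz0 : 0 < `|y + ze| by apply: lt_le_trans yz; rewrite divr_gt0.
  split => //.
  - by rewrite -normr_gt0.
  - by rewrite -normr_gt0.
  - by rewrite /rdf /y /ze /q /rdf; ring.
  - by rewrite -[2 / _]invf_div lef_pV2 ?posrE // divr_gt0.
have sn : sigma != 0 by rewrite gt_eqF.
have Xi0 (e : rootT) : 0 <= Xi by apply: le_trans (hXi e); exact: normr_ge0.
split.
  rewrite /drift !mulr_sumr -sumrB -big_split /= /kaptot mulr_suml.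
  apply: (le_trans (ler_norm_sum _ _ _)); apply: ler_sum => e _.
  have := kap_ge0 e nu0; rewrite le_eqVlt => /orP[/eqP <-|ke].
    by rewrite !mul0r !mulr0 subrr addr0 normr0.
  have [q0 yz0 -> yd yi] := key e ke; set q := rdf e r in q0 yz0 yd yi *.
  set ze := rdf e (z ord0) in yz0 yi *.
  have yn : sigma * q != 0 by rewrite mulf_neq0.
  have -> : kap nu e * (rdf e xi / (sigma * q + ze)) - sigma^-1 * (kap nu e * (rdf e xi / q)) +
     sigma^-2 * (kap nu e * (rdf e xi * ze / q ^+ 2)) =
     kap nu e * (rdf e xi * ze ^+ 2 * (sigma * q) ^- 2 * (sigma * q + ze)^-1).
    by rewrite (inv_expand1 _ yn yz0); field; rewrite q0 sn yz0.
  rewrite normrM (ger0_norm (ltW ke)); apply: ler_wpM2l; first exact: ltW.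
  have yp : 0 < `|sigma * q| by rewrite normr_gt0.
  rewrite 3!normrM !normfV !normrX.
  have z4 : `|ze| ^+ 2 <= 4 * k.
    by rewrite real_normK ?num_real // (le_trans (rdf_sqr_le e z)) // ler_pM2l.
  have sd : 0 < sigma * dl by rewrite mulr_gt0.
  have iv : `|sigma * q|^-1 <= (sigma * dl)^-1 by rewrite lef_pV2 ?posrE.
  have iv0 : 0 <= `|sigma * q|^-1 by rewrite invr_ge0.
  have -> : 8 * k * Xi * sigma ^- 3 * dl ^- 3 =
    Xi * (4 * k) * ((sigma * dl)^-1) ^+ 2 * (2 * (sigma * dl)^-1).
    by field; rewrite sn gt_eqF.
  rewrite -exprVn.
  apply: ler_pM; last exact: (le_trans yi (ler_wpM2l _ iv)).
  - by apply: mulr_ge0; [apply: mulr_ge0 => //; exact: sqr_ge0|exact: sqr_ge0].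
  - by rewrite invr_ge0.
  apply: ler_pM; [by apply: mulr_ge0 => //; exact: sqr_ge0|exact: sqr_ge0| |].
    by apply: ler_pM => //; exact: sqr_ge0.
  by apply: lerXn2r; rewrite ?nnegrE // invr_ge0 ltW.
rewrite /drift mulr_sumr -sumrB /= /kaptot mulr_suml.
apply: (le_trans (ler_norm_sum _ _ _)); apply: ler_sum => e _.
have := kap_ge0 e nu0; rewrite le_eqVlt => /orP[/eqP <-|ke].
  by rewrite !mul0r !mulr0 subrr normr0.
have [q0 yz0 -> yd yi] := key e ke; set q := rdf e r in q0 yz0 yd yi *.
set ze := rdf e (z ord0) in yz0 yi *.
have -> : kap nu e * (ze / (sigma * q + ze)) - sigma^-1 * (kap nu e * (ze / q)) =
   - (kap nu e * (ze ^+ 2 * (sigma * q)^-1 * (sigma * q + ze)^-1)).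
  by field; rewrite q0 sn yz0.
rewrite normrN normrM (ger0_norm (ltW ke)); apply: ler_wpM2l; first exact: ltW.
have yp : 0 < `|sigma * q| by rewrite normr_gt0 mulf_neq0.
have z4 : `|ze| ^+ 2 <= 4 * nsq z.
  by rewrite real_normK ?num_real // rdf_sqr_le.
have sd : 0 < sigma * dl by rewrite mulr_gt0.
have iv : `|sigma * q|^-1 <= (sigma * dl)^-1 by rewrite lef_pV2 ?posrE.
have -> : 8 * nsq z * sigma ^- 2 * dl ^- 2 =
  4 * nsq z * (sigma * dl)^-1 * (2 * (sigma * dl)^-1).
  by field; rewrite sn gt_eqF.
rewrite 2!normrM normrX !normfV.
apply: ler_pM; last exact: (le_trans yi (ler_wpM2l _ iv)).
- by apply: mulr_ge0; [exact: sqr_ge0|rewrite invr_ge0].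
- by rewrite invr_ge0.
- by apply: ler_pM.
Qed.

End Localization.

Section DerivativeRules.
Context {R : realType}.
Implicit Types (f g : R -> R) (x a b : R).

Lemma is_derive_mulR f g x a b : is_derive x (1 : R) f a -> is_derive x (1 : R) g b ->
  is_derive x (1 : R) (fun s => f s * g s) (f x * b + g x * a).
Proof. by move=> h1 h2; exact: is_deriveM. Qed.

Lemma is_derive_addR f g x a b : is_derive x (1 : R) f a -> is_derive x (1 : R) g b ->
  is_derive x (1 : R) (fun s => f s + g s) (a + b).
Proof. by move=> h1 h2; exact: is_deriveD. Qed.

Lemma is_derive_scaleR c f x a : is_derive x (1 : R) f a ->
  is_derive x (1 : R) (fun s => c * f s) (c * a).
Proof.
move=> h; have := is_derive_mulR (is_derive_cst c x 1) h.
by rewrite /cst mulr0 addr0.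
Qed.

Lemma is_derive_sumR n (f : 'I_n -> R -> R) x (a : 'I_n -> R) :
  (forall i, is_derive x (1 : R) (f i) (a i)) ->
  is_derive x (1 : R) (fun s => \sum_i f i s) (\sum_i a i).
Proof.
move=> h; have -> : (fun s => \sum_i f i s) = \sum_i f i.
  by apply/funext => s; rewrite fct_sumE.
exact: is_derive_sum.
Qed.

Lemma is_derive_compR (phi : R -> R) f x a b : is_derive (f x) (1 : R) phi a ->
  is_derive x (1 : R) f b -> is_derive x (1 : R) (fun s => phi (f s)) (a * b).
Proof. exact: is_derive1_comp. Qed.

Lemma is_derive_continuous f x a : is_derive x (1 : R) f a -> {for x, continuous f}.
Proof.
by move=> h; apply: differentiable_continuous; apply/derivable1_diffP; have [] := h.
Qed.

Lemma cvg_sumR (T : Type) (F : set_system T) (FF : Filter F) n (f : 'I_n -> T -> R)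
    (a : 'I_n -> R) :
  (forall i, f i k @[k --> F] --> a i) ->
  (\sum_i f i k) @[k --> F] --> \sum_i a i.
Proof.
by move=> h; apply: cvg_big => [|i _]; [exact: add_continuous|exact: h].
Qed.

Lemma normM_le (a a' q q' : R) : `|a| <= a' -> `|q| <= q' -> `|a * q| <= a' * q'.
Proof. by move=> h2 h3; rewrite normrM; apply: ler_pM. Qed.

End DerivativeRules.

(** * The test function that follows the centre sqrt (b s) r *)

Section MovingTestFunction.
Context {R : realType} {N : nat}.
Local Notation V := 'rV[R]_N.
Local Notation rootT := ('I_N * 'I_N * bool)%type.
Variables (nu b : R) (r : 'I_N -> R).
Hypothesis nu0 : 0 < nu.
Hypothesis b0 : 0 < b.
Hypothesis rdrift : forall G, drift nu r G = 2^-1 * \sum_i r i * G i.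
Variables (xi dxi : R -> 'I_N -> R) (c : R -> R) (th k : R).
Hypothesis k0 : 0 < k.
Hypothesis hxi : forall (s : R) (i : 'I_N), 0 < s -> is_derive s (1 : R) (xi^~ i) (dxi s i).
Hypothesis hdxi : forall (s : R) (i : 'I_N), 0 < s -> {for s, continuous (dxi^~ i)}.
Hypothesis hc : forall s : R, 0 < s -> is_derive s (1 : R) c (2^-1 * \sum_i xi s i ^+ 2).
Local Notation m := (kaptot N nu).
Local Notation rv := (\row_i r i).

Definition ctr (s : R) : R := Num.sqrt (b * s).
Definition dctr (s : R) (i : 'I_N) : R := ctr s * r i / (2 * s).
Definition dev (s : R) (y : V) : V := y - ctr s *: rv.
Definition phase (s : R) (y : V) : R := ip (xi s) (dev s y) + th.
(** The growth of [c] offsets - |xi|^2 / 2 from the second derivative of the cosine. In the phase,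
    the motion of the centre offsets the drift at the centre, and the motion of [xi] offsets the
    linear part of the drift around it. *)
Definition utest (s : R) (y : V) : R :=
  expR (c s) * (cos (phase s y) * chi k (dev s y)).
Definition dphase (s : R) (y : V) : R :=
  \sum_i dxi s i * dev s y ord0 i - \sum_i xi s i * dctr s i.
Definition dutest (s : R) (y : V) : R :=
  expR (c s) * ((2^-1 * (\sum_i xi s i ^+ 2) * cos (phase s y)
     - sin (phase s y) * dphase s y) * chi k (dev s y)
   + cos (phase s y) * (3 * pospow 2 (1 - k^-1 * nsq (dev s y)) *
       (k^-1 * (2 * \sum_i dev s y ord0 i * dctr s i)))).

Let devE s y i : dev s y ord0 i = y ord0 i - ctr s * r i.
Proof. by rewrite /dev !mxE. Qed.

Let ctr_gt0 s : 0 < s -> 0 < ctr s.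
Proof. by move=> s0; rewrite sqrtr_gt0 mulr_gt0. Qed.

Let ctr_sqr s : 0 < s -> ctr s ^+ 2 = b * s.
Proof. by move=> s0; rewrite sqr_sqrtr // ltW // mulr_gt0. Qed.

Let ctr_derive (s : R) : 0 < s -> is_derive s (1 : R) ctr (ctr s / (2 * s)).
Proof.
move=> s0; have bs : 0 < b * s by rewrite mulr_gt0.
have h1 : is_derive s (1 : R) (fun s => b * s) (b * 1).
  exact: (is_derive_scaleR b (is_derive_id s (1 : R))).
have := is_derive_compR (is_derive1_sqrt bs) h1.
rewrite -/(ctr s) => h; apply: is_derive_eq h _.
have c0 : ctr s != 0 by rewrite gt_eqF // ctr_gt0.
have sn : s != 0 by rewrite gt_eqF.
have e : b = ctr s ^+ 2 / s by rewrite ctr_sqr // mulfK.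
by rewrite {1}e; field; rewrite c0 sn.
Qed.

Let dev_derive (s : R) (y : V) (i : 'I_N) : 0 < s -> is_derive s (1 : R) (fun s => dev s y ord0 i) (- dctr s i).
Proof.
move=> s0; have -> : (fun s => dev s y ord0 i) = fun s => y ord0 i + (- r i) * ctr s.
  by apply/funext => u; rewrite devE; ring.
have := is_derive_addR (is_derive_cst (y ord0 i) s 1) (is_derive_scaleR (- r i) (ctr_derive s0)).
by move=> h; apply: is_derive_eq h _; rewrite /dctr; ring.
Qed.

Lemma utest_derive (s : R) (y : V) : 0 < s -> is_derive s (1 : R) (utest^~ y) (dutest s y).
Proof.
move=> s0.
have hph : is_derive s (1 : R) (phase^~ y) (dphase s y).
  have h := is_derive_addR (is_derive_sumR (fun i => is_derive_mulR (hxi i s0) (dev_derive y i s0)))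
    (is_derive_cst th s 1).
  have -> : phase^~ y = fun u => \sum_i xi u i * dev u y ord0 i + th by [].
  apply: is_derive_eq h _; rewrite addr0 /dphase -sumrB; apply: eq_bigr => i _; ring.
have hn : is_derive s (1 : R) (fun s => nsq (dev s y))
    (- (2 * \sum_i dev s y ord0 i * dctr s i)).
  have h := is_derive_sumR (fun i => is_derive_mulR (dev_derive y i s0) (dev_derive y i s0)).
  have -> : (fun s => nsq (dev s y)) = fun u => \sum_i dev u y ord0 i * dev u y ord0 i by [].
  by apply: is_derive_eq h _; rewrite mulr_sumr -sumrN; apply: eq_bigr => i _; ring.
have hq : is_derive s (1 : R) (fun s => 1 - k^-1 * nsq (dev s y))
    (k^-1 * (2 * \sum_i dev s y ord0 i * dctr s i)).
  have h := is_derive_addR (is_derive_cst (1 : R) s 1) (is_derive_scaleR (- k^-1) hn).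
  have -> : (fun s => 1 - k^-1 * nsq (dev s y)) = fun s => 1 + (- k^-1) * nsq (dev s y).
    by apply/funext => u; ring.
  by apply: is_derive_eq h _; ring.
have hchi := is_derive_compR (is_derive_pospow 1 _) hq.
have hcos := is_derive_compR (is_derive_cos _) hph.
have hexp := is_derive_compR (is_derive_expR _) (hc s0).
have h := is_derive_mulR hexp (is_derive_mulR hcos hchi).
by apply: is_derive_eq h _; rewrite /dutest /chi; ring.
Qed.

(** Joint convergence in time and space along a filter: it serves both for continuity at a fixed
    time and for limits along paths. *)
Lemma dutest_cvg (T : Type) (F : set_system T) (FF : Filter F) (s : R) (y : V)
    (sn : T -> R) (yn : T -> V) : 0 < s ->
  sn n @[n --> F] --> s -> yn n @[n --> F] --> y ->
  dutest (sn n) (yn n) @[n --> F] --> dutest s y.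
Proof.
move=> s0 hs hy.
have cc (f : R -> R) : {for s, continuous f} -> f (sn n) @[n --> F] --> f s.
  by move=> cf; exact: continuous_cvg cf hs.
have hctr : ctr (sn n) @[n --> F] --> ctr s.
  by apply: cc; exact: is_derive_continuous (ctr_derive s0).
have hex : expR (c (sn n)) @[n --> F] --> expR (c s).
  apply: continuous_cvg; first exact: continuous_expR.
  by apply: cc; exact: is_derive_continuous (hc s0).
have hx i : xi (sn n) i @[n --> F] --> xi s i.
  by apply: (cc (xi^~ i)); exact: is_derive_continuous (hxi i s0).
have hdx i : dxi (sn n) i @[n --> F] --> dxi s i by apply: (cc (dxi^~ i)); exact: hdxi.
have hdev i : dev (sn n) (yn n) ord0 i @[n --> F] --> dev s y ord0 i.
  rewrite devE; under eq_fun do rewrite devE.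
  apply: cvgB; last by apply: cvgM => //; exact: cvg_cst.
  apply: (@cvg_comp _ _ _ yn (fun y : V => y ord0 i)); first exact: hy.
  exact: coord_continuous.
have hdc i : dctr (sn n) i @[n --> F] --> dctr s i.
  rewrite /dctr; apply: cvgM; first by apply: cvgM => //; exact: cvg_cst.
  apply: cvgV; first by rewrite mulf_neq0 // gt_eqF.
  by apply: cvgM => //; exact: cvg_cst.
have hph : phase (sn n) (yn n) @[n --> F] --> phase s y.
  apply: cvgD; last exact: cvg_cst.
  by apply: cvg_sumR => i; exact: cvgM.
have hcos : cos (phase (sn n) (yn n)) @[n --> F] --> cos (phase s y).
  by apply: continuous_cvg; [exact: continuous_cos|exact: hph].
have hsin : sin (phase (sn n) (yn n)) @[n --> F] --> sin (phase s y).
  by apply: continuous_cvg; [exact: continuous_sin|exact: hph].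
have hq : 1 - k^-1 * nsq (dev (sn n) (yn n)) @[n --> F] --> 1 - k^-1 * nsq (dev s y).
  apply: cvgB; first exact: cvg_cst.
  apply: cvgM; first exact: cvg_cst.
  apply: cvg_sumR => i; rewrite expr2; under eq_fun do rewrite expr2.
  exact: cvgM.
have hp j : pospow j (1 - k^-1 * nsq (dev (sn n) (yn n))) @[n --> F] -->
    pospow j (1 - k^-1 * nsq (dev s y)).
  by apply: continuous_cvg; [exact: continuous_pospow|exact: hq].
apply: cvgM => //; apply: cvgD.
  apply: cvgM; last exact: hp.
  apply: cvgB; apply: cvgM => //.
    apply: cvgM; first exact: cvg_cst.
    apply: cvg_sumR => i; rewrite expr2; under eq_fun do rewrite expr2.
    exact: cvgM.
  by apply: cvgB; apply: cvg_sumR => i; exact: cvgM.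
apply: cvgM => //; apply: cvgM.
  by apply: cvgM; [exact: cvg_cst|exact: hp].
apply: cvgM; first exact: cvg_cst.
apply: cvgM; first exact: cvg_cst.
by apply: cvg_sumR => i; exact: cvgM.
Qed.

Lemma utest_gen s : exists g H, [/\ hasC2 (utest s) g H,
  forall y, k <= nsq (dev s y) ->
    [/\ utest s y = 0, forall i, g i y = 0 & forall i j, H i j y = 0] &
  forall y, let p := pospow 1 (1 - k^-1 * nsq (dev s y)) in
    genC2 nu b g H y = expR (c s) * (
     cos (phase s y) * (- (3 * k^-1) * p ^+ 2 * N%:R + 12 * k^-2 * p * nsq (dev s y)
         - 6 * k^-1 * p ^+ 2 * (b * drift nu (y ord0) (dev s y ord0)))
     + chi k (dev s y) * (- (2^-1 * (\sum_i xi s i ^+ 2) * cos (phase s y))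
         - sin (phase s y) * (b * drift nu (y ord0) (xi s)))
     + sin (phase s y) * (6 * k^-1 * p ^+ 2) * ip (xi s) (dev s y))].
Proof.
have h1 : hasC2 (fun y : V => ip (xi s) y + th) (fun i _ => xi s i) (fun _ _ => cst 0).
  apply: hasC2_eq (hasC2_add (hasC2_ip (xi s)) (hasC2_cst th)) _ _ _ => //.
  - by move=> i y /=; rewrite addr0.
  - by move=> i j y /=; rewrite addr0.
have dms (x : R) : is_derive x (1 : R) (fun t => - sin t) (- cos x).
  by have h := is_derive_sin x; apply: is_derive_eq (is_deriveN h) _.
have cmc : continuous (fun x : R => - cos x).
  by move=> x; apply: continuousN; exact: continuous_cos.
have h2 := hasC2_comp h1 (fun x => is_derive_cos _) (fun x => dms _) (fun x => cmc _).
have h3 := hasC2_scale (expR (c s)) (hasC2_mul (hasC2_shift (ctr s *: rv) h2)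
  (hasC2_shift (ctr s *: rv) (@hasC2_chi R N k))).
do 2 eexists; split; first exact: h3.
  move=> y; rewrite -/(dev s y) => kn.
  have pz j : pospow j.+1 (1 - k^-1 * nsq (dev s y)) = 0.
    rewrite /pospow max_l ?expr0n // subr_le0 mulrC ler_pdivlMr // mul1r //.
  split.
  - by rewrite /utest /chi pz !mulr0.
  - by move=> i; rewrite -/(dev s y) /chi !pz; ring.
  - by move=> i j; rewrite -/(dev s y) /chi !pz; ring.
move=> y p; rewrite genC2_scale genC2_mul -/(dev s y) -/(phase s y); congr (_ * _).
rewrite /genC2 -/(dev s y) -/(phase s y) !driftZ.
rewrite [pospow 2 _]pospowE -/p; congr (_ * _ + _ * _ + _).
- rewrite big_split /= -mulr_sumr.
  have -> : \sum_(i < N) (2 * (i == i)%:R : R) = 2 * N%:R.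
    under eq_bigr do rewrite eqxx mulr1.
    by rewrite sumr_const card_ord mulr_natr.
  have -> : \sum_i 6 / k ^+ 2 * p * (2 * dev s y ord0 i) * (2 * dev s y ord0 i) =
     24 / k ^+ 2 * p * nsq (dev s y).
    by rewrite /nsq mulr_sumr; apply: eq_bigr => i _; ring.
  by move: (drift _ _ _) (N%:R : R) => D N'; field; rewrite gt_eqF.
- have -> : \sum_i (- sin (phase s y) * cst 0 (dev s y)
      + - cos (phase s y) * xi s i * xi s i) = - cos (phase s y) * \sum_i xi s i ^+ 2.
    by rewrite mulr_sumr; apply: eq_bigr => i _; rewrite /cst /=; ring.
  by move: (drift _ _ _) => D; field.
rewrite /ip mulr_sumr; apply: eq_bigr => i _; ring.
Qed.

Variables (dl B t0 t1 : R).
Hypothesis dl0 : 0 < dl.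
Hypothesis t00 : 0 < t0.
Hypothesis hdl : forall e : rootT, 0 < kap nu e -> dl <= `|rdf e r|.
Hypothesis deep : 4 * Num.sqrt k <= ctr t0 * dl.
Hypothesis hode : forall s : R, 0 < s -> forall z : V, \sum_i dxi s i * z ord0 i =
  s^-1 * \sum_e kap nu e * (rdf e (xi s) * rdf e (z ord0) / rdf e r ^+ 2).
Hypothesis hB : forall s : R, t0 <= s <= t1 ->
  [/\ \sum_i xi s i ^+ 2 <= B, \sum_i dxi s i ^+ 2 <= B & expR (c s) <= B].

(** The first summand bounds the Taylor remainder of the phase, of order k / sqrt b. The other two
    come from the cutoff, of order 1 / k: terms growing with the squared deviation, then bounded
    ones. *)
Definition errc : R := B * (8 * m * (1 + 4 * B) * dl ^- 3 * t0^-1 * (Num.sqrt t0)^-1)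
  + B * (48 * m * t0^-1 * dl ^- 2 + 3) + B * (3 * N%:R + 12 + 3 * B).
Definition ebar (s : R) (y : V) : R :=
  errc * (k * (Num.sqrt b)^-1 + k^-1 * (1 + Num.min (nsq (dev s y)) k)).

Let m0 : 0 <= m.
Proof. by apply: sumr_ge0 => e _; exact: kap_ge0 (ltW nu0). Qed.

Lemma ctr_mono s : t0 <= s -> ctr t0 <= ctr s.
Proof. by move=> ts; apply: ler_wsqrtr; rewrite ler_pM2l. Qed.

Lemma errc_ge0 : 0 <= B -> 0 <= errc.
Proof.
move=> B0; have ti : 0 <= t0^-1 by rewrite invr_ge0 ltW.
have di : 0 <= dl^-1 by rewrite invr_ge0 ltW.
rewrite /errc -!exprVn; apply: addr_ge0; first apply: addr_ge0; apply: mulr_ge0 => //.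
- apply: mulr_ge0; last by rewrite invr_ge0 sqrtr_ge0.
  apply: mulr_ge0 => //; apply: mulr_ge0; last exact: exprn_ge0.
  by apply: mulr_ge0; [exact: mulr_ge0|apply: addr_ge0 => //; exact: mulr_ge0].
- apply: addr_ge0 => //; apply: mulr_ge0; last exact: exprn_ge0.
  by apply: mulr_ge0 => //; exact: mulr_ge0.
- apply: addr_ge0; last exact: mulr_ge0.
  by apply: addr_ge0 => //; exact: mulr_ge0.
Qed.

(** Time derivative plus generator of the test function is at least [- ebar]. Outside the cutoff
    both vanish; inside it the leading terms cancel and the remainders are collected. *)
Lemma utest_gen_lower s g H : t0 <= s <= t1 -> hasC2 (utest s) g H ->
  forall y, CNB y -> - dutest s y - ebar s y <= genC2 nu b g H y.
Proof.
move=> sI hg y cy; have /andP[ts st1] := sI.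
have s0 : 0 < s by apply: lt_le_trans ts.
have [B1 B2 B3] := hB sI.
have [g1 [H1 [h1 van gE]]] := utest_gen s.
rewrite -(genB_genC2 _ _ _ hg) (genB_genC2 _ _ _ h1).
have B0 : 0 <= B by apply: le_trans B3; exact: expR_ge0.
have e0 : 0 <= errc := errc_ge0 B0.
have n0 := nsq_ge0 (dev s y).
have ki : 0 <= k^-1 by rewrite invr_ge0 ltW.
have eb0 : 0 <= ebar s y.
  rewrite /ebar mulr_ge0 // addr_ge0 //; first by rewrite mulr_ge0 ?invr_ge0 ?sqrtr_ge0 // ltW.
  by rewrite mulr_ge0 // addr_ge0 // le_min n0 ltW.
have [kn|nk] := leP k (nsq (dev s y)).
  have [_ gz Hz] := van y kn.
  have -> : genC2 nu b g1 H1 y = 0.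
    rewrite /genC2 big1 ?mulr0 ?add0r => [|i _]; last by rewrite Hz.
    rewrite /drift big1 ?mulr0 // => e _.
    by rewrite /rdf !gz !mulr0 subr0 mul0r mulr0.
  have pz j : pospow j.+1 (1 - k^-1 * nsq (dev s y)) = 0.
    rewrite /pospow max_l ?expr0n // subr_le0 mulrC ler_pdivlMr // mul1r //.
  have -> : dutest s y = 0 by rewrite /dutest /chi !pz !(mulr0, mul0r) addr0 mulr0.
  by rewrite oppr0 add0r oppr_le0.
rewrite gE /ebar min_l; last exact: ltW.
rewrite /dutest [pospow 2 _]pospowE.
have [p0 p1 _] := pospow1_lt0_eq (dev s y) k0.
have [ch0 ch1 _] := chi_bounds (dev s y) k0.
move: p0 p1; set p := pospow 1 _ => p0 p1.
have p20 : 0 <= p ^+ 2 by exact: sqr_ge0.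
have p21 : p ^+ 2 <= 1 by rewrite expr_le1.
have xib (e : rootT) : `|rdf e (xi s)| <= 1 + 4 * B.
  have := rdf_sqr_le e (\row_i xi s i).
  have -> : rdf e ((\row_i xi s i) ord0) = rdf e (xi s) by rewrite /rdf !mxE.
  have -> : nsq (\row_i xi s i) = \sum_i xi s i ^+ 2.
    by apply: eq_bigr => i _; rewrite mxE.
  move: B1; move: (\sum_i _) (rdf e _) => S q SB qS.
  have : `|q| ^+ 2 = q ^+ 2 by rewrite real_normK ?num_real.
  have := sqr_ge0 (`|q| - 1); rewrite !expr2; nra.
have deep' : 4 * Num.sqrt k <= ctr s * dl.
  by apply: (le_trans deep); rewrite ler_pM2r //; exact: ctr_mono.
have [D1 D2] := drift_expand (ltW nu0) k0 (ctr_gt0 s0) dl0 hdl deep' (ltW nk) xib.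
have yE : (fun i => ctr s * r i + dev s y ord0 i) = y ord0.
  by apply/funext => i; rewrite devE; ring.
rewrite yE in D1 D2.
have cn : ctr s != 0 by rewrite gt_eqF // ctr_gt0.
have sn : s != 0 by rewrite gt_eqF.
have bn : b != 0 by rewrite gt_eqF.
have bE : b = ctr s ^+ 2 / s by rewrite ctr_sqr // mulfK.
(* By stationarity, the velocity of the centre is the drift at the centre. *)
have sdr G : \sum_i G i * dctr s i = b * ((ctr s)^-1 * drift nu r G).
  rewrite rdrift bE !mulr_sumr; apply: eq_bigr => i _.
  by rewrite /dctr; field; rewrite cn sn.
set DX := drift nu (y ord0) (xi s) in D1 *.
set DZ := drift nu (y ord0) (dev s y ord0) in D2 *.
(* Here b / (ctr s)^2 = 1 / s, so the equation for [xi] supplies exactly the first-order term of the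
   expansion. *)
have dphE : dphase s y + b * DX =
   b * (DX - (ctr s)^-1 * drift nu r (xi s) + (ctr s) ^- 2 *
     \sum_e kap nu e * (rdf e (xi s) * rdf e (dev s y ord0) / rdf e r ^+ 2)).
  rewrite /dphase hode // sdr; move: (\sum_e _) => Q.
  have -> : s^-1 = b * ctr s ^- 2 by rewrite bE; field; rewrite cn sn.
  by ring.
have E1 : `|dphase s y + b * DX| <=
   8 * m * (1 + 4 * B) * dl ^- 3 * t0^-1 * (Num.sqrt t0)^-1 * (k * (Num.sqrt b)^-1).
  rewrite dphE normrM (gtr0_norm b0).
  apply: (le_trans (ler_wpM2l (ltW b0) D1)).
  have -> : b * (m * (8 * k * (1 + 4 * B) / ctr s ^+ 3 / dl ^+ 3)) =
     8 * m * (1 + 4 * B) * dl ^- 3 * k * (s^-1 * (ctr s)^-1).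
    by rewrite {1}bE; field; rewrite cn sn gt_eqF.
  have -> : 8 * m * (1 + 4 * B) * dl ^- 3 * t0^-1 * (Num.sqrt t0)^-1 * (k * (Num.sqrt b)^-1)
    = 8 * m * (1 + 4 * B) * dl ^- 3 * k * (t0^-1 * (ctr t0)^-1).
    have -> : (ctr t0)^-1 = (Num.sqrt b)^-1 * (Num.sqrt t0)^-1.
      by rewrite /ctr sqrtrM ?(ltW b0) // invfM.
    by move: (dl ^- 3) (t0^-1) ((Num.sqrt t0)^-1) ((Num.sqrt b)^-1) => *; ring.
  apply: ler_wpM2l.
    rewrite mulr_ge0 ?(ltW k0) // mulr_ge0 ?invr_ge0 ?exprn_ge0 ?(ltW dl0) //.
    by rewrite mulr_ge0 ?addr_ge0 ?mulr_ge0.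
  apply: ler_pM; rewrite ?invr_ge0 ?(ltW s0) ?(ltW (ctr_gt0 s0)) //.
    by rewrite lef_pV2 ?posrE.
  by rewrite lef_pV2 ?posrE ?ctr_gt0 //; exact: ctr_mono.
have E2 : `|\sum_i dev s y ord0 i * dctr s i - b * DZ| <=
    8 * m * t0^-1 * dl ^- 2 * nsq (dev s y).
  rewrite sdr -mulrBr normrM (gtr0_norm b0) distrC.
  apply: (le_trans (ler_wpM2l (ltW b0) D2)).
  have -> : b * (m * (8 * nsq (dev s y) / ctr s ^+ 2 / dl ^+ 2)) =
      8 * m * s^-1 * dl ^- 2 * nsq (dev s y).
    by rewrite {1}bE; field; rewrite cn sn gt_eqF.
  apply: ler_wpM2r => //; apply: ler_wpM2r; first by rewrite invr_ge0 exprn_ge0 // ltW.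
  by apply: ler_wpM2l; [exact: mulr_ge0|rewrite lef_pV2 ?posrE].
have E3 : `|ip (xi s) (dev s y)| <= 2^-1 * (B + nsq (dev s y)).
  have := ip_sqr_le (xi s) (dev s y); move: B1 n0.
  move: (\sum_i _) (nsq _) (ip _ _) => S n q SB nn qS.
  have S0 : 0 <= S \/ S < 0 by case: (leP 0 S); [left|right].
  have : q ^+ 2 <= (2^-1 * (B + n)) ^+ 2.
    apply: (le_trans qS); have : 0 <= (B - n) ^+ 2 by exact: sqr_ge0.
    by rewrite !expr2; nra.
  rewrite -[q ^+ 2]real_normK ?num_real // ler_pXn2r ?nnegrE //.
  by rewrite mulr_ge0 // addr_ge0.
set C := cos (phase s y); set Sn := sin (phase s y).
have C1 : `|C| <= 1 by exact: cos_max.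
have S1 : `|Sn| <= 1 by exact: sin_max.
set X2 := \sum_i xi s i ^+ 2.
set ZD := \sum_i _ * dctr _ _ in E2 *.
rewrite -subr_ge0.
set n := nsq (dev s y) in n0 nk E2 E3 *.
set ch := chi k (dev s y) in ch0 ch1 *.
set I := ip (xi s) (dev s y) in E3 *.
set e1 := 8 * m * _ * _ * _ * _ * _ in E1.
set e2 := 8 * m * _ * _ * n in E2.
set A1 := dphase s y + b * DX in E1; set A2 := ZD - b * DZ in E2.
pose T := - (Sn * ch * A1) + C * (6 * k^-1 * p ^+ 2 * A2)
  + C * (- (3 * k^-1) * p ^+ 2 * N%:R + 12 * k^-2 * p * n)
  + Sn * (6 * k^-1 * p ^+ 2 * I).
have TE : expR (c s) * T = expR (c s) * ((2^-1 * X2 * C - Sn * dphase s y) * ch +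
     C * (3 * p ^+ 2 * (k^-1 * (2 * ZD)))) + expR (c s) *
   (C * (- (3 / k) * p ^+ 2 * N%:R + 12 / k ^+ 2 * p * n - 6 / k * p ^+ 2 * (b * DZ)) +
    ch * (- (2^-1 * X2 * C) - Sn * (b * DX)) + Sn * (6 / k * p ^+ 2) * I).
  by rewrite /T /A1 /A2; ring.
have T1 : `|Sn * ch * A1| <= 1 * 1 * e1.
  by apply: normM_le => //; apply: normM_le => //; rewrite ger0_norm.
have k6 : `|6 * k^-1 * p ^+ 2| <= 6 * k^-1 * 1.
  rewrite ger0_norm; last by rewrite mulr_ge0 // mulr_ge0.
  by apply: ler_wpM2l => //; rewrite mulr_ge0.
have T2 : `|C * (6 * k^-1 * p ^+ 2 * A2)| <= 1 * (6 * k^-1 * 1 * e2).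
  by apply: normM_le => //; apply: normM_le.
have T4 : `|Sn * (6 * k^-1 * p ^+ 2 * I)| <= 1 * (6 * k^-1 * 1 * (2^-1 * (B + n))).
  by apply: normM_le => //; apply: normM_le.
have T3 : `|C * (- (3 * k^-1) * p ^+ 2 * N%:R + 12 * k^-2 * p * n)| <=
    1 * (3 * k^-1 * N%:R + 12 * k^-1).
  apply: normM_le => //; apply: (le_trans (ler_normD _ _)); apply: lerD.
    rewrite !mulNr normrN ger0_norm; last by rewrite mulr_ge0 // mulr_ge0 // mulr_ge0.
    by apply: ler_wpM2r => //; rewrite ler_piMr // mulr_ge0.
  rewrite -exprVn ger0_norm; last by rewrite mulr_ge0 // mulr_ge0 // mulr_ge0 // sqr_ge0.
  have -> : 12 * k^-1 ^+ 2 * p * n = 12 * k^-1 * (p * (k^-1 * n)) by ring.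
  rewrite ler_piMr //; first by rewrite mulr_ge0.
  rewrite mulr_ile1 //; first by rewrite mulr_ge0.
  by rewrite mulrC ler_pdivrMr // mul1r ltW.
have Tle : `|T| <= e1 + 6 * k^-1 * e2 + (3 * k^-1 * N%:R + 12 * k^-1) + 3 * k^-1 * (B + n).
  rewrite /T; apply: (le_trans (ler_normD _ _)); apply: lerD; last first.
    by apply: (le_trans T4); rewrite le_eqVlt; apply/orP; left; apply/eqP; field; rewrite gt_eqF.
  apply: (le_trans (ler_normD _ _)); apply: lerD; last by move: T3; rewrite mul1r.
  apply: (le_trans (ler_normD _ _)); apply: lerD.
    by rewrite normrN; move: T1; rewrite !mul1r.
  by move: T2; rewrite mul1r mulr1.
have ET : `|expR (c s) * T| <= B * (e1 + 6 * k^-1 * e2 +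
    (3 * k^-1 * N%:R + 12 * k^-1) + 3 * k^-1 * (B + n)).
  by apply: normM_le => //; rewrite ger0_norm ?expR_ge0.
set EB := errc * _.
have EBge : B * (e1 + 6 * k^-1 * e2 +
    (3 * k^-1 * N%:R + 12 * k^-1) + 3 * k^-1 * (B + n)) <= EB.
  have ti : 0 <= t0^-1 by rewrite invr_ge0 ltW.
  have d3 : 0 <= dl ^- 3 by rewrite invr_ge0 exprn_ge0 // ltW.
  have d2 : 0 <= dl ^- 2 by rewrite invr_ge0 exprn_ge0 // ltW.
  have st : 0 <= (Num.sqrt t0)^-1 by rewrite invr_ge0 sqrtr_ge0.
  have sb : 0 <= k * (Num.sqrt b)^-1.
    by apply: mulr_ge0; [exact: ltW|rewrite invr_ge0 sqrtr_ge0].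
  rewrite /EB /errc /e1 /e2.
  set q1 := 8 * m * (1 + 4 * B) * dl ^- 3 * t0^-1 * (Num.sqrt t0)^-1.
  have q10 : 0 <= q1.
    apply: mulr_ge0 => //; apply: mulr_ge0 => //; apply: mulr_ge0 => //.
    by apply: mulr_ge0; [exact: mulr_ge0|apply: addr_ge0 => //; exact: mulr_ge0].
  set q2 := m * t0^-1 * dl ^- 2.
  have q20 : 0 <= q2 by apply: mulr_ge0 => //; exact: mulr_ge0.
  have -> : 8 * m * t0^-1 * dl ^- 2 * n = 8 * q2 * n by rewrite /q2; ring.
  have -> : 48 * m * t0^-1 * dl ^- 2 = 48 * q2 by rewrite /q2; ring.
  set K := k * _ in sb *; rewrite -subr_ge0.
  have -> : (B * q1 + B * (48 * q2 + 3) + B * (3 * N%:R + 12 + 3 * B)) * (K + k^-1 * (1 + n)) -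
    B * (q1 * K + 6 / k * (8 * q2 * n) + (3 / k * N%:R + 12 / k) + 3 / k * (B + n)) =
    B * (q1 * (k^-1 * (1 + n)) + (48 * q2 + 3 + 3 * N%:R + 12 + 3 * B) * K +
     (48 * q2 + 3) * k^-1 + (3 * N%:R + 12 + 3 * B) * (k^-1 * n)).
    by ring.
  have kn0 : 0 <= k^-1 * n by exact: mulr_ge0.
  have k1n0 : 0 <= k^-1 * (1 + n) by apply: mulr_ge0 => //; exact: addr_ge0.
  have a1 : 0 <= 48 * q2 + 3 by apply: addr_ge0 => //; exact: mulr_ge0.
  have a2 : 0 <= 3 * N%:R + 12 + 3 * B :> R.
    by apply: addr_ge0; [apply: addr_ge0 => //; exact: mulr_ge0|exact: mulr_ge0].
  apply: mulr_ge0 => //; apply: addr_ge0; last exact: mulr_ge0.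
  apply: addr_ge0; last exact: mulr_ge0.
  apply: addr_ge0; first exact: mulr_ge0.
  apply: mulr_ge0 => //.
  have -> : 48 * q2 + 3 + 3 * N%:R + 12 + 3 * B = (48 * q2 + 3) + (3 * N%:R + 12 + 3 * B).
    by ring.
  exact: addr_ge0.
have := le_trans ET EBge; rewrite ler_norml => /andP[lo _].
move: lo; rewrite TE; set U1 := expR _ * _; set U2 := expR _ * _; lra.
Qed.

End MovingTestFunction.

(** By contraposition: a point violating [Q] within 1/(n+1) of [s] for every n would form a sequence
    contradicting the hypothesis. *)
Lemma seq_delta {R : realType} (D Q : R -> Prop) (s : R) :
  (forall u : nat -> R, (forall n, D (u n)) -> u n @[n --> \oo] --> s -> exists n, Q (u n)) ->
  exists2 dl : R, 0 < dl & forall u, D u -> `|u - s| < dl -> Q u.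
Proof.
move=> H; apply: contrapT => N.
have H2 n : exists u, [/\ D u, `|u - s| < n.+1%:R^-1 & ~ Q u].
  apply: contrapT => N2; apply: N; exists n.+1%:R^-1; first by rewrite invr_gt0.
  by move=> u Du us; apply: contrapT => nQ; apply: N2; exists u.
have [u hu] := choice H2.
have cu : u n @[n --> \oo] --> s.
  apply/cvgrPdist_lt => e e0.
  have := @cvg_harmonic R => /cvgrPdist_lt /(_ e e0); apply: filterS => n.
  rewrite sub0r normrN /= => h; rewrite distrC; have [_ lt _] := hu n.
  by apply: (lt_trans lt); move: h; rewrite gtr0_norm ?invr_gt0.
have [|n Qn] := H u _ cu; first by move=> n; have [] := hu n.
by have [_ _ /(_ Qn)] := hu n.
Qed.

(** A local growth inequality on both sides of every point holds globally: the supremum of the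
    points reached from [a] is itself reached, by the left side, and cannot lie below [b], by the
    right side. *)
Lemma straddle_growth {R : realType} (F : R -> R) (a b K : R) : a <= b ->
  (forall s, a <= s <= b -> exists2 dl : R, 0 < dl & forall s', a <= s' <= b -> `|s' - s| < dl ->
     (s <= s' -> K * (s' - s) <= F s' - F s) /\ (s' <= s -> K * (s - s') <= F s - F s')) ->
  K * (b - a) <= F b - F a.
Proof.
move=> ab H.
pose A := [set s | a <= s <= b /\ K * (s - a) <= F s - F a].
have Aa : A a by split; rewrite ?lexx ?ab // !subrr mulr0.
have ubA : ubound A b by move=> s [/andP[]].
have hs : has_sup A by split; [exists a|exists b].
set sg := sup A.
have sgb : sg <= b by apply: ge_sup => //; exists a.
have asg : a <= sg by apply: ub_le_sup => //; exists b.
have [|dl dl0 hd] := H sg; first by rewrite asg.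
have Asg : A sg.
  have [s As sgs] := sup_adherent dl0 hs.
  have ssg : s <= sg by apply: ub_le_sup => //; exists b.
  have [/andP[as_ sb] hF] := As.
  have sI : a <= s <= b by rewrite as_ sb.
  have ds : `|s - sg| < dl.
    by rewrite distrC ger0_norm ?subr_ge0 // ltrBlDl -ltrBlDr.
  have [_ /(_ ssg) h] := hd s sI ds.
  split; first by rewrite asg.
  have -> : sg - a = (sg - s) + (s - a) by ring.
  by rewrite mulrDr; lra.
have [<-//|] := eqVneq sg b; first by case: Asg.
move=> ne; have lt : sg < b by rewrite lt_neqAle ne.
pose s' := Num.min b (sg + dl / 2).
have s'b : s' <= b by rewrite ge_min lexx.
have sgs' : sg < s' by rewrite lt_min lt ltrDl divr_gt0.
have s'd : s' - sg < dl.
  have : s' <= sg + dl / 2 by rewrite ge_min lexx orbT.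
  lra.
have s'I : a <= s' <= b by rewrite s'b andbT (le_trans asg) // ltW.
have ds' : `|s' - sg| < dl by rewrite gtr0_norm // subr_gt0.
have [h _] := hd s' s'I ds'.
have As' : A s'.
  split; first by rewrite s'b (le_trans asg) // ltW.
  have := h (ltW sgs'); case: Asg => _ h2.
  have -> : s' - a = (s' - sg) + (sg - a) by ring.
  by rewrite mulrDr; lra.
by have := ub_le_sup (ex_intro _ b ubA) As'; rewrite leNgt sgs'.
Qed.

Lemma sum_mul_le {R : realType} n (a b : 'I_n -> R) :
  `|\sum_i a i * b i| <= 2^-1 * (\sum_i a i ^+ 2 + \sum_i b i ^+ 2).
Proof.
apply: (le_trans (ler_norm_sum _ _ _)); rewrite -big_split mulr_sumr; apply: ler_sum => i _ /=.
have := sqr_ge0 (`|a i| - `|b i|); rewrite normrM.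
have <- : `|a i| ^+ 2 = a i ^+ 2 by rewrite real_normK ?num_real.
have <- : `|b i| ^+ 2 = b i ^+ 2 by rewrite real_normK ?num_real.
by rewrite !expr2; nra.
Qed.

(** * Growth in time of the mean of the moving test function *)

Section Growth.
Context {R : realType} {N : nat}.
Local Notation V := 'rV[R]_N.
Local Notation rootT := ('I_N * 'I_N * bool)%type.
Variables (nu b : R) (r : 'I_N -> R).
Hypothesis nu0 : 0 < nu.
Hypothesis b0 : 0 < b.
Hypothesis rdec : forall i j : 'I_N, (i < j)%N -> r j < r i.
Hypothesis rpos : forall i, 0 < r i.
Hypothesis rdrift : forall G, drift nu r G = 2^-1 * \sum_i r i * G i.
Variables (xi dxi : R -> 'I_N -> R) (c : R -> R) (th k : R).
Hypothesis k0 : 0 < k.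
Hypothesis hxi : forall (s : R) (i : 'I_N), 0 < s -> is_derive s (1 : R) (xi^~ i) (dxi s i).
Hypothesis hdxi : forall (s : R) (i : 'I_N), 0 < s -> {for s, continuous (dxi^~ i)}.
Hypothesis hc : forall s : R, 0 < s ->
  is_derive s (1 : R) c (2^-1 * \sum_i xi s i ^+ 2).
Variables (dl B t0 t1 M : R).
Hypothesis dl0 : 0 < dl.
Hypothesis t00 : 0 < t0.
Hypothesis t01 : t0 <= t1.
Hypothesis hdl : forall e : rootT, 0 < kap nu e -> dl <= `|rdf e r|.
Hypothesis deep : 4 * Num.sqrt k <= ctr b t0 * dl.
Hypothesis hode : forall s : R, 0 < s -> forall z : V, \sum_i dxi s i * z ord0 i =
  s^-1 * \sum_e kap nu e * (rdf e (xi s) * rdf e (z ord0) / rdf e r ^+ 2).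
Hypothesis hB : forall s : R, t0 <= s <= t1 ->
  [/\ \sum_i xi s i ^+ 2 <= B, \sum_i dxi s i ^+ 2 <= B & expR (c s) <= B].
Context (x : V) d (Omega : measurableType d) (P : probability Omega R).
Context (X : R -> Omega -> V).
Hypothesis HX : bessel_B (nu * b) b x P X.
Local Notation ut := (utest b r xi c th k).
Local Notation dut := (dutest b r xi dxi c th k).
Local Notation eb := (ebar nu b r k dl B t0).
Local Notation dv := (dev b r).
Hypothesis hM : forall s : R, t0 <= s <= t1 ->
  P.-integrable setT (EFin \o (fun w => nsq (dv s (X s w)))) /\
  \int[P]_w nsq (dv s (X s w)) <= M.

Let pos (s : R) : t0 <= s <= t1 -> 0 < s.
Proof. by case/andP => h _; apply: lt_le_trans h. Qed.

Let B0 : 0 <= B.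
Proof.
have [_ _ h] := hB (introT andP (conj (lexx t0) t01)).
by apply: le_trans h; exact: expR_ge0.
Qed.

Lemma utest_continuous s : continuous (ut s).
Proof. by have [g [H [[]]]] := utest_gen nu b r xi c th k0 s. Qed.

Lemma utest_bound s y : t0 <= s <= t1 -> `|ut s y| <= B.
Proof.
move=> sI; have [_ _ h] := hB sI; have [c0 c1 _] := chi_bounds (dv s y) k0.
rewrite -[leRHS]mulr1 -[X in _ * X]mulr1; apply: normM_le; first by rewrite ger0_norm ?expR_ge0.
by apply: normM_le; [exact: cos_max|rewrite ger0_norm].
Qed.

Lemma dutest_continuous s : 0 < s -> continuous (dut s).
Proof.
move=> s0 y; apply: (dutest_cvg b0 hxi hdxi hc (nbhs_filter y) s0); first exact: cvg_cst.
exact: cvg_id.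
Qed.

Lemma dutest_bounded : exists C, forall s y, t0 <= s <= t1 -> `|dut s y| <= C.
Proof.
pose D0 := b * (\sum_i r i ^+ 2) / (4 * t0).
have s2 : 0 <= \sum_i r i ^+ 2 by apply: sumr_ge0 => i _; exact: sqr_ge0.
have D00 : 0 <= D0.
  by apply: divr_ge0; [apply: mulr_ge0 => //; exact: ltW|apply: mulr_ge0 => //; exact: ltW].
have ki : 0 <= k^-1 by rewrite invr_ge0 ltW.
exists (B * ((2^-1 * B * 1 + 1 * (2^-1 * (B + k) + 2^-1 * (B + D0))) * 1
  + 1 * (3 * 1 * (k^-1 * (2 * (2^-1 * (k + D0))))))).
move=> s y sI; have s0 := pos sI; have [B1 B2 B3] := hB sI.
have [kn|nk] := leP k (nsq (dv s y)).
  have pz j : pospow j.+1 (1 - k^-1 * nsq (dv s y)) = 0.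
    rewrite /pospow max_l ?expr0n // subr_le0 mulrC ler_pdivlMr // mul1r //.
  rewrite /dutest /chi !pz !(mulr0, mul0r) addr0 mulr0 normr0.
  have k0' := ltW k0.
  do ![apply: mulr_ge0 => // | apply: addr_ge0 => //].
have [c0 c1 _] := chi_bounds (dv s y) k0.
have D1 : \sum_i dctr b r s i ^+ 2 <= D0.
  have -> : \sum_i dctr b r s i ^+ 2 = b * (\sum_i r i ^+ 2) / (4 * s).
    have cs : ctr b s ^+ 2 = b * s by rewrite sqr_sqrtr // mulr_ge0 // ltW.
    rewrite mulr_sumr mulr_suml; apply: eq_bigr => i _.
    rewrite /dctr !exprMn exprVn cs; field; exact: lt0r_neq0.
  apply: ler_wpM2l; first by apply: mulr_ge0 => //; exact: ltW.
  rewrite lef_pV2 ?posrE ?mulr_gt0 // ler_pM2l //; by case/andP: sI.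
have sq (u v : 'I_N -> R) (A A' : R) : \sum_i u i ^+ 2 <= A -> \sum_i v i ^+ 2 <= A' ->
    `|\sum_i u i * v i| <= 2^-1 * (A + A').
  by move=> h1 h2; apply: (le_trans (sum_mul_le _ _)); apply: ler_wpM2l => //; exact: lerD.
have p1 : `|pospow 2 (1 - k^-1 * nsq (dv s y))| <= 1.
  have [p0 p1 _] := pospow1_lt0_eq (dv s y) k0.
  by rewrite pospowE ger0_norm ?sqr_ge0 // expr_le1.
have nk' := ltW nk.
rewrite /dutest; apply: normM_le; first by rewrite ger0_norm ?expR_ge0.
apply: (le_trans (ler_normD _ _)); apply: lerD.
  apply: normM_le; last by rewrite ger0_norm.
  apply: (le_trans (ler_normB _ _)); apply: lerD.
    apply: normM_le; last exact: cos_max.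
    rewrite ger0_norm; first exact: ler_wpM2l.
    by apply: mulr_ge0 => //; apply: sumr_ge0 => i _; exact: sqr_ge0.
  apply: normM_le; first exact: sin_max.
  apply: (le_trans (ler_normB _ _)); apply: lerD; exact: sq.
apply: normM_le; first exact: cos_max.
apply: normM_le; first by apply: normM_le => //; rewrite ger0_norm.
apply: normM_le; first by rewrite ger0_norm.
apply: normM_le; first by rewrite ger0_norm.
exact: sq.
Qed.

Let ebE (s : R) (y : V) : eb s y = @errc R N nu dl B t0 *
  (k * (Num.sqrt b)^-1 + k^-1 * (1 + Num.min (nsq (dv s y)) k)).
Proof. by []. Qed.

Let er0 : 0 <= @errc R N nu dl B t0.
Proof. exact: errc_ge0. Qed.

Lemma ebar_continuous s : continuous (eb s).
Proof.
move=> y; have cc (u : R) : {for y, continuous (cst u : V -> R)} by exact: cst_continuous.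
have cn : {for y, continuous (fun y : V => nsq (dv s y))}.
  apply: (@continuous_comp _ _ _ (fun y : V => y - ctr b s *: \row_i r i) (@nsq R N)).
    by apply: (continuousB (f := idfun)); [exact: cvg_id|exact: cst_continuous].
  exact: continuous_nsq.
have cm : {for y, continuous (fun y : V => Num.min (nsq (dv s y)) k)}.
  exact: (@continuous_min R V (fun y : V => nsq (dv s y)) (cst k) y cn (cc k)).
have c1 : {for y, continuous (fun z : V => 1 + Num.min (nsq (dv s z)) k)}.
  exact: (continuousD (cc 1) cm).
have c2 := @continuousM R V (cst k^-1) _ y (cc _) c1.
have c3 := continuousD (cc (k * (Num.sqrt b)^-1)) c2.
exact: (@continuousM R V (cst (@errc R N nu dl B t0)) _ y (cc _) c3).
Qed.

Let min_bound (s : R) (y : V) : 0 <= Num.min (nsq (dv s y)) k <= k.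
Proof. by rewrite le_min nsq_ge0 (ltW k0) ge_min lexx orbT. Qed.

Lemma ebar_bound s y : `|eb s y| <=
  @errc R N nu dl B t0 * (k * (Num.sqrt b)^-1 + k^-1 * (1 + k)).
Proof.
have /andP[n0 n1] := min_bound s y; have ki : 0 <= k^-1 by rewrite invr_ge0 ltW.
have kb : 0 <= k * (Num.sqrt b)^-1.
  by apply: mulr_ge0; [exact: ltW|rewrite invr_ge0 sqrtr_ge0].
rewrite ger0_norm; last first.
  by apply: mulr_ge0 => //; apply: addr_ge0 => //; apply: mulr_ge0 => //; exact: addr_ge0.
by apply: ler_wpM2l => //; rewrite lerD2l; apply: ler_wpM2l => //; rewrite lerD2l.
Qed.

Lemma expect_continuous (h : V -> R) (C s e : R) : continuous h ->
  (forall y, CNB y -> `|h y| <= C) -> 0 <= s -> 0 < e ->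
  exists2 dl : R, 0 < dl & forall u, 0 <= u -> `|u - s| < dl ->
    `|\int[P]_w h (X u w) - \int[P]_w h (X s w)| < e.
Proof.
move=> ch hC s0 e0; apply: (@seq_delta R (fun u => 0 <= u)
  (fun u => `|\int[P]_w h (X u w) - \int[P]_w h (X s w)| < e)) => u u0 us.
have H : \int[P]_w h (X (u n) w) @[n --> \oo] --> \int[P]_w h (X s w).
  apply: (@Rintegral_dominated_cvg _ _ _ P (fun n w => h (X (u n) w)) _ C).
  - by move=> n; exact: (bessel_measurable HX).
  - by move=> n w; apply: hC; exact: (bessel_CNB HX).
  - move=> w; apply: continuous_cvg; first exact: ch.
    exact: (bessel_path_cvg HX).
move/cvgrPdist_lt: H => /(_ e e0) [n _ hn].
by exists n; rewrite distrC; exact: (hn n (leqnn n)).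
Qed.

(** The process is taken at the moving time [u]. The mean value theorem rewrites the quotient as
    [dutest] at an intermediate time, bounded uniformly, so dominated convergence along paths gives
    the limit. *)
Lemma utest_quotient s e : t0 <= s <= t1 -> 0 < e ->
  exists2 dl : R, 0 < dl & forall u, t0 <= u <= t1 /\ u != s -> `|u - s| < dl ->
   `|\int[P]_w ((ut u (X u w) - ut s (X u w)) / (u - s)) - \int[P]_w dut s (X s w)| < e.
Proof.
move=> sI e0; apply: (@seq_delta R (fun u => t0 <= u <= t1 /\ u != s)
  (fun u => `|\int[P]_w ((ut u (X u w) - ut s (X u w)) / (u - s))
     - \int[P]_w dut s (X s w)| < e)) => u uI us.
have s0 := pos sI.
have [C hC] := dutest_bounded.
have mvt n (y : V) : exists sg : R, [/\ t0 <= sg <= t1, `|sg - s| <= `|u n - s| &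
    (ut (u n) y - ut s y) / (u n - s) = dut sg y].
  have [uI' un] := uI n; have u0 := pos uI'.
  have der (v : R) : 0 < v -> is_derive v (1 : R) (ut^~ y) (dut v y).
    by move=> v0; apply: utest_derive.
  have cnt (a a' : R) : 0 < a -> {within `[a, a'], continuous (ut^~ y)}.
    move=> a0; apply: derivable_within_continuous => v; rewrite in_itv /= => /andP[av _].
    by have [] := der v (lt_le_trans a0 av).
  have /andP[h1 h2] := uI'; have /andP[h3 h4] := sI.
  have [lt|gt|eq] := ltgtP (u n) s; last by rewrite eq eqxx in un.
    have dd v : v \in `]u n, s[ -> is_derive v (1 : R) (ut^~ y) (dut v y).
      by rewrite in_itv /= => /andP[uv _]; apply: der; exact: lt_trans uv.
    have [sg sgI sgE] := MVT_segment (ltW lt) dd (cnt _ _ u0).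
    move: sgI; rewrite in_itv /= => /andP[g1 g2]; exists sg; split.
    - by rewrite (le_trans h1 g1) (le_trans g2 h4).
    - rewrite ler0_norm ?subr_le0 // ltr0_norm ?subr_lt0 // lerN2 lerD2r //.
    - have un0 : u n - s != 0 by rewrite subr_eq0.
      apply: (mulIf un0); rewrite divfK //; rewrite -(opprB (ut s y)) sgE; ring.
  have dd v : v \in `]s, u n[ -> is_derive v (1 : R) (ut^~ y) (dut v y).
    by rewrite in_itv /= => /andP[uv _]; apply: der; exact: lt_trans uv.
  have [sg sgI sgE] := MVT_segment (ltW gt) dd (cnt _ _ s0).
  move: sgI; rewrite in_itv /= => /andP[g1 g2]; exists sg; split.
  - by rewrite (le_trans h3 g1) (le_trans g2 h2).
  - by rewrite ger0_norm ?subr_ge0 // gtr0_norm ?subr_gt0 // lerD2r.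
  - have un0 : u n - s != 0 by rewrite subr_eq0.
    by apply: (mulIf un0); rewrite divfK.
have u0 n : 0 <= u n by have [h _] := uI n; exact: ltW (pos h).
have H : \int[P]_w ((ut (u n) (X (u n) w) - ut s (X (u n) w)) / (u n - s)) @[n --> \oo]
    --> \int[P]_w dut s (X s w).
  apply: (@Rintegral_dominated_cvg _ _ _ P
    (fun n w => (ut (u n) (X (u n) w) - ut s (X (u n) w)) / (u n - s)) _ C).
  - move=> n; apply: measurable_funM; last exact: measurable_cst.
    by apply: measurable_funB; apply: (bessel_measurable HX) => //; exact: utest_continuous.
  - by move=> n w; have [sg [sgI _ ->]] := mvt n (X (u n) w); exact: hC.
  - move=> w; have [sg hsg] := choice (fun n => mvt n (X (u n) w)).
    have -> : (fun n => (ut (u n) (X (u n) w) - ut s (X (u n) w)) / (u n - s)) =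
      fun n => dut (sg n) (X (u n) w) by apply/funext => n; have [] := hsg n.
    apply: (dutest_cvg b0 hxi hdxi hc) => //.
      apply/cvgrPdist_lt => e' e'0; move/cvgrPdist_lt: us => /(_ e' e'0).
      apply: filterS => n h; rewrite distrC; have [_ le _] := hsg n.
      by apply: (le_lt_trans le); rewrite distrC.
    exact: (bessel_path_cvg HX _ (ltW s0)).
move/cvgrPdist_lt: H => /(_ e e0) [n _ hn].
by exists n; rewrite distrC; exact: (hn n (leqnn n)).
Qed.

Let ut_int s u : t0 <= s <= t1 -> 0 <= u ->
  P.-integrable setT (EFin \o (fun w => ut s (X u w))).
Proof.
move=> sI u0; apply: (bessel_integrable HX u0 (@utest_continuous s) (C := B)) => y _.
exact: utest_bound.
Qed.

Lemma expect_ebar s : t0 <= s <= t1 -> \int[P]_w eb s (X s w) <=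
  @errc R N nu dl B t0 * (k * (Num.sqrt b)^-1 + k^-1 * (1 + M)).
Proof.
move=> sI; have s0 := ltW (pos sI); have [i1 i2] := hM sI.
have ki : 0 <= k^-1 by rewrite invr_ge0 ltW.
set E := errc _ _ _ _; pose E' := E * k^-1; pose E0 := E * (k * (Num.sqrt b)^-1) + E * k^-1.
have j1 := integrable_scaleR E' i1; have jc := integrable_cstR P E0.
have j2 := integrable_addR jc j1.
apply: (@le_trans _ _ (\int[P]_w (E0 + E' * nsq (dv s (X s w))))).
  apply: le_Rintegral => //.
    exact: (bessel_integrable HX s0 (@ebar_continuous s) (fun y _ => ebar_bound s y)).
  move=> w _; rewrite ebE -/E.
  have -> : E0 + E' * nsq (dv s (X s w)) =
    E * (k * (Num.sqrt b)^-1 + k^-1 * (1 + nsq (dv s (X s w)))) by rewrite /E0 /E'; ring.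
  apply: ler_wpM2l => //; rewrite lerD2l; apply: ler_wpM2l => //.
  by rewrite lerD2l ge_min lexx.
have Z : \int[P]_w (E' * nsq (dv s (X s w))) = E' * \int[P]_w nsq (dv s (X s w)).
  by rewrite RintegralZl.
rewrite RintegralD // Rintegral_cstR Z.
have -> : E * (k * (Num.sqrt b)^-1 + k^-1 * (1 + M)) = E0 + E' * M by rewrite /E0 /E'; ring.
by rewrite lerD2l; apply: ler_wpM2l => //; exact: mulr_ge0.
Qed.

(** Locally the increment splits into that of the process with the function frozen at [s], governed
    by the martingale problem, and that of the function with the process held at the other time,
    governed by the difference quotient. *)
Lemma utest_expect_growth :
  - (@errc R N nu dl B t0 * (k * (Num.sqrt b)^-1 + k^-1 * (1 + M))) * (t1 - t0) <=
  \int[P]_w ut t1 (X t1 w) - \int[P]_w ut t0 (X t0 w).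
Proof.
set e0 := errc _ _ _ _ * _.
have [C hC] := dutest_bounded.
(* One [e] is spent on each of the two parts of the increment; both disappear in the limit. *)
suff H e : 0 < e -> - (e0 + 2 * e) * (t1 - t0) <=
    \int[P]_w ut t1 (X t1 w) - \int[P]_w ut t0 (X t0 w).
  apply/ler_addgt0Pr => e ep.
  have tp : 0 < 2 * (t1 - t0 + 1) by rewrite mulr_gt0 // ltr_wpDl // subr_ge0.
  have := H (e / (2 * (t1 - t0 + 1))) (divr_gt0 ep tp).
  have le : 2 * (e / (2 * (t1 - t0 + 1))) * (t1 - t0) <= e.
    have -> : 2 * (e / (2 * (t1 - t0 + 1))) * (t1 - t0) = e * ((t1 - t0) / (t1 - t0 + 1)).
      by field; rewrite gt_eqF // ltr_wpDl // subr_ge0.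
    rewrite ler_piMr ?(ltW ep) // ler_pdivrMr ?mul1r ?lerDl //.
    by rewrite ltr_wpDl // subr_ge0.
  have -> : - (e0 + 2 * (e / (2 * (t1 - t0 + 1)))) * (t1 - t0) =
    - e0 * (t1 - t0) - 2 * (e / (2 * (t1 - t0 + 1))) * (t1 - t0) by ring.
  move: le; set u1 := 2 * _ * _; set u2 := - e0 * _; set u3 := \int[P]_w _.
  by set u4 := \int[P]_w _; lra.
move=> ep; apply: (@straddle_growth _ (fun s => \int[P]_w ut s (X s w))) => // s sI.
have s0 := pos sI; have s0' := ltW s0.
pose h (y : V) := - dut s y - eb s y.
have ch : continuous h.
  move=> y; have c1 : {for y, continuous (dut s)} := dutest_continuous s0 (x:=y).
  have c2 : {for y, continuous (eb s)} := @ebar_continuous s y.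
  exact: (continuousB (continuousN c1) c2).
pose Ch := C + @errc R N nu dl B t0 * (k * (Num.sqrt b)^-1 + k^-1 * (1 + k)).
have bh (y : V) : CNB y -> `|h y| <= Ch.
  move=> _; apply: (le_trans (ler_normB _ _)); rewrite normrN; apply: lerD; first exact: hC.
  exact: ebar_bound.
have [d1 d10 h1] := expect_continuous ch bh s0' ep.
have [d2 d20 h2] := utest_quotient sI ep.
have idut : P.-integrable setT (EFin \o (fun w => dut s (X s w))).
  exact: (bessel_integrable HX s0' (dutest_continuous s0) (fun y _ => hC s y sI)).
have ieb : P.-integrable setT (EFin \o (fun w => eb s (X s w))).
  exact: (bessel_integrable HX s0' (@ebar_continuous s) (fun y _ => ebar_bound s y)).
set G := \int[P]_w dut s (X s w) in h2.
have hE : - G - e0 <= \int[P]_w h (X s w).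
  have -> : \int[P]_w h (X s w) = - G - \int[P]_w eb s (X s w).
    have indut : P.-integrable setT (EFin \o (fun w => -1 * dut s (X s w))).
      exact: integrable_scaleR.
    transitivity (\int[P]_w (-1 * dut s (X s w) - eb s (X s w))).
      by apply: eq_Rintegral => w _; rewrite mulN1r.
    by rewrite RintegralB // RintegralZl // mulN1r.
  by rewrite lerD2l lerN2; exact: expect_ebar.
have loc u v : t0 <= u -> u <= v -> v <= t1 -> `|u - s| < d1 -> `|v - s| < d1 ->
    (- G - e0 - e) * (v - u) <= \int[P]_w ut s (X v w) - \int[P]_w ut s (X u w).
  move=> tu uv vt us vs.
  have [g [H [hg van _]]] := utest_gen nu b r xi c th k0 s.
  have dp e1 : PR e1 -> 4 * Num.sqrt k <= rdf e1 ((ctr b s *: \row_i r i) ord0).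
    move=> pr; have rp := PR_r rdec rpos pr.
    have -> : rdf e1 ((ctr b s *: \row_i r i) ord0) = ctr b s * rdf e1 r.
      by rewrite /rdf !mxE; ring.
    apply: (le_trans deep); apply: ler_pM; rewrite ?sqrtr_ge0 ?(ltW dl0) //.
      by apply: (ctr_mono b0); case/andP: sI.
    have := hdl (e := e1); rewrite gtr0_norm //; apply.
    case: e1 pr {rp} => -[i j] [] /=; rewrite /PR /kap /=; first by move=> ->.
    by move=> lt; rewrite lt_eqF ?invr_gt0.
  apply: (bessel_lower_local HX (ltW nu0) k0 dp hg van ch bh) => //.
  - by move=> y cy; apply: (utest_gen_lower nu0 b0 rdrift k0 dl0 t00 hdl deep hode hB sI hg).
  - exact: le_trans (ltW t00) tu.
  - move=> w /andP[uw wv].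
    have w0 : 0 <= w by apply: le_trans uw; exact: le_trans (ltW t00) tu.
    have ws : `|w - s| < d1.
      move: us vs; rewrite !ltr_norml => /andP[a1 a2] /andP[a3 a4].
      by apply/andP; split; [apply: lt_le_trans a1 _|apply: le_lt_trans a4]; rewrite lerD2r.
    have := h1 w w0 ws; rewrite ltr_norml => /andP[lo _]; move: lo hE.
    by move: (\int[P]_w _) (\int[P]_w _) => *; lra.
have quot u : t0 <= u <= t1 -> u != s -> \int[P]_w (ut u (X u w)) - \int[P]_w ut s (X u w) =
    (u - s) * \int[P]_w ((ut u (X u w) - ut s (X u w)) / (u - s)).
  move=> uI us; have u0 := ltW (pos uI).
  have us0 : u - s != 0 by rewrite subr_eq0.
  have i1 := ut_int uI u0; have i2 := ut_int sI u0; have i3 := integrable_subR i1 i2.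
  have -> : \int[P]_w ((ut u (X u w) - ut s (X u w)) / (u - s)) =
      (u - s)^-1 * \int[P]_w (ut u (X u w) - ut s (X u w)).
    rewrite -RintegralZl //; by apply: eq_Rintegral => w _; rewrite mulrC.
  by rewrite mulVKf // RintegralB.
exists (Num.min d1 d2); first by rewrite lt_min d10.
move=> u uI; rewrite lt_min => /andP[ud1 ud2].
have ss : `|s - s| < d1 by rewrite subrr normr0.
have /andP[tu ut1] := uI; have /andP[ts st1] := sI.
have [->|us] := eqVneq u s; first by rewrite !subrr !mulr0.
have := h2 u (conj uI us) ud2; rewrite ltr_norml => /andP[q1 q2].
have qE := quot u uI us.
set Q := \int[P]_w (_ / _) in q1 q2 qE.
have qG : G - e <= Q.
  rewrite -subr_ge0; have -> : Q - (G - e) = (Q - G) - - e by ring.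
  by rewrite subr_ge0 ltW.
set I1 := \int[P]_w ut s (X u w) in qE.
set I3 := \int[P]_w ut u (X u w) in qE *.
set I2 := \int[P]_w ut s (X s w).
split => le.
  have hl : (- G - e0 - e) * (u - s) <= I1 - I2 := loc s u ts le ut1 ss ud1.
  have hq : (G - e) * (u - s) <= I3 - I1.
    by rewrite qE mulrC ler_wpM2l // subr_ge0.
  have -> : - (e0 + 2 * e) * (u - s) = (- G - e0 - e) * (u - s) + (G - e) * (u - s) by ring.
  have -> : I3 - I2 = (I1 - I2) + (I3 - I1) by ring.
  exact: lerD.
have hl : (- G - e0 - e) * (s - u) <= I2 - I1 := loc u s tu le st1 ud1 ss.
have hq : (G - e) * (s - u) <= I1 - I3.
  have -> : I1 - I3 = (s - u) * Q by rewrite -opprB qE; ring.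
  by rewrite mulrC ler_wpM2l // subr_ge0.
have -> : - (e0 + 2 * e) * (s - u) = (- G - e0 - e) * (s - u) + (G - e) * (s - u) by ring.
have -> : I2 - I3 = (I2 - I1) + (I1 - I3) by ring.
exact: lerD.
Qed.

End Growth.

(** * The matrix S and the characteristic function *)

Section SmatForm.
Context {R : realType} {N : nat} (nu : R) (r : 'I_N -> R).
Hypothesis nu0 : 0 < nu.
Hypothesis rpos : forall i, 0 < r i.
Local Notation V := 'rV[R]_N.
Local Notation rootT := ('I_N * 'I_N * bool)%type.
Local Notation S := (Smat nu r).

(** The Hessian at [r] of - sum kap ln |<e, y>|, hence the negative of the derivative of the drift
    there; S is the identity plus twice this form. *)
Definition rform (u v : V) : R :=
  \sum_(e : rootT) kap nu e * (rdf e (u ord0) * rdf e (v ord0) / rdf e r ^+ 2).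

Lemma Smat_form (u v : V) :
  (u *m S *m v^T) ord0 ord0 = \sum_i u ord0 i * v ord0 i + 2 * rform u v.
Proof.
pose A i j := (r i - r j) ^- 2; pose B i j := (r i + r j) ^- 2.
pose T i j := (A i j + B i j) * (u ord0 i * v ord0 i) + (B i j - A i j) * (u ord0 i * v ord0 j).
have As i j : A i j = A j i by rewrite /A -opprB sqrrN.
have Bs i j : B i j = B j i by rewrite /B addrC.
have -> : (u *m S *m v^T) ord0 ord0 = \sum_i \sum_j u ord0 i * S i j * v ord0 j.
  rewrite !mxE exchange_big /=; apply: eq_bigr => j _; rewrite !mxE mulr_suml.
  by apply: eq_bigr => i _.
have -> : \sum_i \sum_j u ord0 i * S i j * v ord0 j = \sum_i (u ord0 i * v ord0 i
   + 2 * (nu / r i ^+ 2) * (u ord0 i * v ord0 i) + 2 * \sum_(j | j != i) T i j).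
  apply: eq_bigr => i _; rewrite (bigD1 i) //= mxE eqxx.
  have -> : \sum_(j | j != i) u ord0 i * S i j * v ord0 j =
     2 * \sum_(j | j != i) (B i j - A i j) * (u ord0 i * v ord0 j).
    rewrite mulr_sumr; apply: eq_bigr => j ji.
    by rewrite mxE eq_sym (negbTE ji) /A /B; ring.
  rewrite big_split /= -mulr_suml big_split /= -/(A i) /A /B.
  by move: (\sum_(l | l != i) (r i - r l) ^- 2) (\sum_(l | l != i) (r i + r l) ^- 2)
     (\sum_(l | l != i) _) => X Y Z; ring.
rewrite !big_split /= -addrA; congr (_ + _).
rewrite /rform sum_rootT.
have E i : \sum_j (kap nu (i, j, false) * (rdf (i, j, false) (u ord0) *
     rdf (i, j, false) (v ord0) / rdf (i, j, false) r ^+ 2) +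
   kap nu (i, j, true) * (rdf (i, j, true) (u ord0) * rdf (i, j, true) (v ord0)
     / rdf (i, j, true) r ^+ 2)) = (nu / r i ^+ 2) * (u ord0 i * v ord0 i) +
   2^-1 * (\sum_(j | j != i) T i j + \sum_(j | j != i) T j i).
  rewrite (bigD1 i) //= /kap /rdf /= eqxx mul0r add0r; congr (_ + _).
    have rn : r i != 0 by rewrite gt_eqF.
    have dbl (q : R) : q - (-1) ^+ 1 * q = 2 * q by ring.
    by rewrite !dbl; field.
  rewrite -big_split mulr_sumr; apply: eq_bigr => j ji /=.
  rewrite eq_sym (negbTE ji) expr0 expr1 !mul1r !mulN1r !opprK -/(A i j) -/(B i j).
  by rewrite /T (As j i) (Bs j i) /A /B; ring.
under [in RHS]eq_bigr do rewrite E.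
rewrite big_split /= mulrDr; congr (_ + _).
  by rewrite mulr_sumr; apply: eq_bigr => i _; rewrite -mulrA.
rewrite -!mulr_sumr big_split /=.
have -> : \sum_i \sum_(j | j != i) T j i = \sum_i \sum_(j | j != i) T i j.
  rewrite (exchange_big_dep predT) //=; apply: eq_bigr => i _.
  by apply: eq_bigl => j; rewrite eq_sym.
by move: (\sum_(i < N) _) => X; field.
Qed.

Lemma Smat_sym : S^T = S.
Proof.
apply/matrixP => i j; rewrite !mxE eq_sym; have [->//|ij] := eqVneq i j.
by rewrite [r j + _]addrC -[r j - r i]opprB sqrrN.
Qed.

Lemma rform_ge0 u : 0 <= rform u u.
Proof.
apply: sumr_ge0 => e _; apply: mulr_ge0; first exact: kap_ge0 (ltW nu0).
by apply: divr_ge0; [rewrite -expr2|]; exact: sqr_ge0.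
Qed.

(** The roots 2 e_i alone contribute nu u_i^2 / r_i^2, which is where [nu > 0] gives
    definiteness. *)
Lemma rform_gt0 (u : V) : u != 0 -> 0 < rform u u.
Proof.
move=> un; have [i ui] : exists i, u ord0 i != 0.
  apply: contrapT => /forallNP h; move/eqP: un; apply; apply/rowP => i; rewrite mxE.
  by have /negP := h i; rewrite negbK => /eqP.
rewrite /rform (bigD1 (i, i, true)) //= ltr_pwDl //.
  rewrite /kap /rdf /= eqxx expr1 mulN1r opprK mulr_gt0 // divr_gt0 //.
    by rewrite -expr2 exprn_even_gt0 //= -mulr2n mulrn_eq0 negb_or.
  by rewrite exprn_gt0 // mulN1r opprK addr_gt0.
apply: sumr_ge0 => e _; apply: mulr_ge0; first exact: kap_ge0 (ltW nu0).
by apply: divr_ge0; [rewrite -expr2|]; exact: sqr_ge0.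
Qed.

Lemma Smat_posdef (u : V) : u != 0 -> 0 < (u *m S *m u^T) ord0 ord0.
Proof.
move=> un; rewrite Smat_form ltr_wpDl //; last by rewrite mulr_gt0 // rform_gt0.
by apply: sumr_ge0 => i _; rewrite -expr2 sqr_ge0.
Qed.

Lemma Smat_unit : S \in unitmx.
Proof.
rewrite -row_free_unit -kermx_eq0; apply/eqP/row_matrixP => i; rewrite row0.
apply/eqP; apply: contraT => /Smat_posdef.
by rewrite -row_mul mulmx_ker row0 mul0mx mxE ltxx.
Qed.

Lemma rform_lin (I : finType) (w : I -> R) (a : I -> V) (z : V) :
  rform (\sum_k w k *: a k) z = \sum_k w k * rform (a k) z.
Proof.
rewrite /rform; under [RHS]eq_bigr do rewrite mulr_sumr.
rewrite exchange_big /=; apply: eq_bigr => e _.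
have -> : rdf e ((\sum_k w k *: a k) ord0) = \sum_k w k * rdf e (a k ord0).
  rewrite /rdf !summxE mulr_sumr -sumrB; apply: eq_bigr => k _.
  by rewrite !mxE; ring.
by rewrite !mulr_suml mulr_sumr; apply: eq_bigr => k _; ring.
Qed.

(* The path [xi s] solves xi' = (S - 1) xi / (2 s) with xi t given, along
   eigenvectors of S; its cost [c] satisfies c' = |xi|^2 / 2. *)
Lemma Smat_flow (t : R) (x : V) : 0 < t -> exists (xi dxi : R -> 'I_N -> R) (c : R -> R),
  [/\ (forall (s : R) (i : 'I_N), 0 < s -> is_derive s (1 : R) (xi^~ i) (dxi s i)),
      (forall (s : R) (i : 'I_N), 0 < s -> {for s, continuous (dxi^~ i)}),
      (forall s : R, 0 < s -> is_derive s (1 : R) c (2^-1 * \sum_i xi s i ^+ 2)) &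
   [/\ (forall s : R, 0 < s -> forall z : V, \sum_i dxi s i * z ord0 i =
        s^-1 * \sum_e kap nu e * (rdf e (xi s) * rdf e (z ord0) / rdf e r ^+ 2)),
       (forall i, xi t i = x ord0 i), c t = 2^-1 * t * (x *m invmx S *m x^T) ord0 ord0,
       (forall s0, 0 < s0 -> s0 <= t -> exists B, forall s, s0 <= s <= t ->
          [/\ \sum_i xi s i ^+ 2 <= B, \sum_i dxi s i ^+ 2 <= B & expR (c s) <= B]) &
       exists sn : nat -> R, [/\ (forall n, 0 < sn n), (forall n, sn n <= t),
         (\sum_i xi (sn n) i ^+ 2) @[n --> \oo] --> (0 : R) &
         c (sn n) @[n --> \oo] --> (0 : R)]]].
Proof.
move=> t0.
have [lam' [a [ha hx]]] := real_symmetric_eigensum x Smat_sym.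
(* A vanishing component satisfies the eigenvector equation for any number; 2 is a default that
   makes [mu k] positive. *)
pose lam k := if a k == 0 then 2 else lam' k.
have hl k : a k *m S = lam k *: a k.
  by rewrite /lam; case: eqP => [->|_]; [rewrite mul0mx scaler0|exact: ha].
pose mu k := 2^-1 * (lam k - 1).
have frm k (z : V) : rform (a k) z = mu k * \sum_i a k ord0 i * z ord0 i.
  have := Smat_form (a k) z; rewrite hl -scalemxAl mxE.
  have -> : (a k *m z^T) ord0 ord0 = \sum_i a k ord0 i * z ord0 i.
    by rewrite mxE; apply: eq_bigr => i _; rewrite mxE.
  by rewrite /mu; move: (\sum_i _) (rform _ _) (lam k) => X Y l; lra.
have mu0 k : 0 < mu k.
  have [ak|ak] := eqVneq (a k) 0; first by rewrite /mu /lam ak eqxx; lra.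
  have := rform_gt0 ak; rewrite frm => h; rewrite ltNge; apply/negP => le.
  move: h; rewrite ltNge => /negP; apply; apply: mulr_le0_ge0 => //.
  by apply: sumr_ge0 => i _; rewrite -expr2 sqr_ge0.
pose g k l := \sum_i a k ord0 i * a l ord0 i.
have gsym k l : g k l = g l k by apply: eq_bigr => i _; rewrite mulrC.
(* Symmetry of the form stands in for an orthogonal basis: g k l vanishes unless [mu k = mu l]. This
   is what evaluates [c] at time [t]. *)
have orth k l : mu k * g k l = mu l * g k l.
  rewrite -[in LHS]frm [in RHS]gsym -[in RHS]frm.
  by apply: eq_bigr => e _; ring.
pose ek k (s : R) := expR (mu k * (ln s - ln t)).
have dek k (s : R) : 0 < s -> is_derive s (1 : R) (ek k) (mu k / s * ek k s).
  move=> s0; have h1 := is_derive_addR (is_derive1_ln s0) (is_derive_cst (- ln t) s 1).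
  have h2 := is_derive_compR (is_derive_expR _) (is_derive_scaleR (mu k) h1).
  by apply: is_derive_eq h2 _; rewrite addr0 /ek; ring.
have ek0 k s : 0 <= ek k s by exact: expR_ge0.
have ek1 k s : 0 < s -> s <= t -> ek k s <= 1.
  move=> s0 st; rewrite -expR0 ler_expR mulr_ge0_le0 ?(ltW (mu0 k)) //.
  by rewrite subr_le0 ler_ln ?posrE.
pose xi s i := \sum_k ek k s * a k ord0 i.
pose dxi s i := s^-1 * \sum_k mu k * ek k s * a k ord0 i.
(* As [ek k s] is (s / t)^(mu k), this is the integral of |xi|^2 / 2 from 0 to s, taken termwise. *)
pose c s := 2^-1 * \sum_k \sum_l (s * (ek k s * ek l s)) * (g k l / (mu k + mu l + 1)).
have mm k l : mu k + mu l + 1 != 0.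
  by rewrite gt_eqF // addr_gt0 // addr_gt0.
exists xi, dxi, c; split.
- move=> s i s0.
  have h := is_derive_sumR (fun k => is_derive_mulR (dek k s s0) (is_derive_cst (a k ord0 i) s 1)).
  apply: is_derive_eq h _; rewrite /dxi mulr_sumr; apply: eq_bigr => k _.
  by rewrite mulr0 add0r /cst; ring.
- move=> s i s0.
  apply: (@continuousM R R (fun s => s^-1) (fun s => \sum_k mu k * ek k s * a k ord0 i)).
    by apply: inv_continuous; rewrite gt_eqF.
  have h := is_derive_sumR (fun k => is_derive_mulR (is_derive_scaleR (mu k) (dek k s s0))
    (is_derive_cst (a k ord0 i) s 1)).
  exact: is_derive_continuous h.
- move=> s s0.
  have h := is_derive_scaleR 2^-1 (is_derive_sumR (fun k => is_derive_sumR (fun l =>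
    is_derive_mulR (is_derive_mulR (is_derive_id s (1 : R))
       (is_derive_mulR (dek k s s0) (dek l s s0)))
      (is_derive_cst (g k l / (mu k + mu l + 1)) s 1)))).
  apply: is_derive_eq h _; congr (_ * _).
  have -> : \sum_i xi s i ^+ 2 = \sum_k \sum_l ek k s * ek l s * g k l.
    have -> : \sum_i xi s i ^+ 2 =
        \sum_i \sum_k \sum_l ek k s * ek l s * (a k ord0 i * a l ord0 i).
      apply: eq_bigr => i _; rewrite expr2 /xi mulr_suml; apply: eq_bigr => k _.
      by rewrite mulr_sumr; apply: eq_bigr => l _; ring.
    rewrite exchange_big /=; apply: eq_bigr => k _; rewrite exchange_big /=.
    by apply: eq_bigr => l _; rewrite mulr_sumr.
  apply: eq_bigr => k _; apply: eq_bigr => l _.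
  by rewrite mulr0 add0r /cst; field; rewrite mm gt_eqF.
split.
- move=> s s0 z.
  have -> : \sum_e kap nu e * (rdf e (xi s) * rdf e (z ord0) / rdf e r ^+ 2) =
     rform (\sum_k ek k s *: a k) z.
    apply: eq_bigr => e _; congr (_ * (_ * _ / _)).
    by rewrite /rdf !summxE /xi; congr (_ - _ * _); apply: eq_bigr => k _; rewrite mxE.
  rewrite rform_lin; under [in RHS]eq_bigr do rewrite frm.
  have -> : \sum_i dxi s i * z ord0 i =
      s^-1 * \sum_i \sum_k mu k * ek k s * a k ord0 i * z ord0 i.
    by rewrite mulr_sumr; apply: eq_bigr => i _; rewrite -mulrA mulr_suml.
  congr (_ * _); rewrite exchange_big /=; apply: eq_bigr => k _.
  by rewrite !mulr_sumr; apply: eq_bigr => i _; ring.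
- move=> i; rewrite /xi hx summxE; apply: eq_bigr => k _.
  by rewrite /ek subrr mulr0 expR0 mul1r.
- rewrite /c -mulrA; congr (_ * _).
  have inva l : a l *m invmx S = (lam l)^-1 *: a l.
    have ln0 : lam l != 0.
      by apply/eqP => z; have := mu0 l; rewrite /mu z; lra.
    have h : a l = (lam l)^-1 *: (a l *m S) by rewrite hl scalerA mulVf // scale1r.
    by rewrite {1}h -scalemxAl mulmxK ?Smat_unit.
  have -> : (x *m invmx S *m x^T) ord0 ord0 = \sum_k \sum_l (lam k)^-1 * g k l.
    rewrite hx mulmx_suml mulmx_suml summxE; apply: eq_bigr => k _.
    rewrite inva -scalemxAl mxE -mulr_sumr; congr (_ * _).
    rewrite mxE exchange_big /=; apply: eq_bigr => i _.
    by rewrite mxE summxE mulr_sumr.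
  rewrite mulr_sumr; apply: eq_bigr => k _; rewrite mulr_sumr; apply: eq_bigr => l _.
  rewrite /ek subrr !mulr0 expR0 !mulr1; congr (_ * _).
  have lE : lam k = 2 * mu k + 1 by rewrite /mu; field.
  have ln0 : lam k != 0 by rewrite lE gt_eqF // addr_gt0 // mulr_gt0.
  apply: (mulfI ln0); rewrite mulVKf //; apply: (mulIf (mm k l)).
  rewrite -mulrA divfK // lE.
  have := orth k l; move: (g k l) (mu k) (mu l) => G u v h.
  by rewrite !mulrDr !mulrDl ?mul1r; move: h; lra.
- move=> s0 s00 s0t.
  pose Ba i := \sum_k `|a k ord0 i|; pose Bd i := s0^-1 * \sum_k mu k * `|a k ord0 i|.
  pose Bc := 2^-1 * \sum_k \sum_l (t * `|g k l / (mu k + mu l + 1)|).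
  have Bc0 : 0 <= Bc.
    apply: mulr_ge0 => //; apply: sumr_ge0 => k _; apply: sumr_ge0 => l _.
    by apply: mulr_ge0 => //; exact: ltW.
  have S1 : 0 <= \sum_i Ba i ^+ 2 by apply: sumr_ge0 => i _; exact: sqr_ge0.
  have S2 : 0 <= \sum_i Bd i ^+ 2 by apply: sumr_ge0 => i _; exact: sqr_ge0.
  have S3 := expR_ge0 Bc.
  exists (\sum_i Ba i ^+ 2 + \sum_i Bd i ^+ 2 + expR Bc) => s /andP[ss st].
  have sp : 0 < s by apply: lt_le_trans ss.
  have sqle (u v : R) : `|u| <= v -> u ^+ 2 <= v ^+ 2.
    move=> h; rewrite -[u ^+ 2]real_normK ?num_real //.
    by apply: lerXn2r; rewrite ?nnegrE // (le_trans _ h).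
  have b1 i : `|xi s i| <= Ba i.
    apply: (le_trans (ler_norm_sum _ _ _)); apply: ler_sum => k _.
    by rewrite normrM ger0_norm // ler_piMl // ek1.
  have b2 i : `|dxi s i| <= Bd i.
    rewrite normrM gtr0_norm ?invr_gt0 //; apply: ler_pM => //; first by rewrite invr_ge0 ltW.
      by rewrite lef_pV2 ?posrE.
    apply: (le_trans (ler_norm_sum _ _ _)); apply: ler_sum => k _.
    rewrite normrM [`|mu k * _|]normrM (gtr0_norm (mu0 k)) (ger0_norm (ek0 k s)) -mulrA.
    by apply: ler_wpM2l; [exact: ltW|rewrite ler_piMl // ek1].
  have b3 : c s <= Bc.
    apply: ler_wpM2l => //; apply: ler_sum => k _; apply: ler_sum => l _.
    apply: (le_trans (ler_norm _)); rewrite normrM; apply: ler_wpM2r => //.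
    have e0 : 0 <= ek k s * ek l s by exact: mulr_ge0.
    rewrite ger0_norm; last by apply: mulr_ge0 => //; exact: ltW.
    rewrite -[leRHS]mulr1; apply: ler_pM => //; first exact: ltW.
    by rewrite mulr_ile1 // ek1.
  have c1 : \sum_i xi s i ^+ 2 <= \sum_i Ba i ^+ 2 by apply: ler_sum => i _; exact: sqle.
  have c2 : \sum_i dxi s i ^+ 2 <= \sum_i Bd i ^+ 2 by apply: ler_sum => i _; exact: sqle.
  have c3 : expR (c s) <= expR Bc by rewrite ler_expR.
  split.
  + by apply: (le_trans c1); rewrite -addrA lerDl addr_ge0.
  + by apply: (le_trans c2); rewrite addrAC lerDr addr_ge0.
  + by apply: (le_trans c3); rewrite lerDr addr_ge0.
(* At the times t e^(-n) each component of the flow is a geometric sequence, of ratio e^(- mu k) <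
   1. *)
have ekn k : ek k (t * expR (- n%:R)) @[n --> \oo] --> (0 : R).
  have -> : (fun n => ek k (t * expR (- n%:R))) = (fun n => expR (- mu k) ^+ n).
    apply/funext => n; rewrite /ek lnM ?posrE ?expR_gt0 // expRK addrAC subrr add0r.
    by rewrite -expRM_natl; congr expR; ring.
  by apply: cvg_expr; rewrite gtr0_norm ?expR_gt0 // -expR0 ltr_expR oppr_lt0.
have snn : t * expR (- n%:R) @[n --> \oo] --> (t * 0 : R).
  apply: cvgM; first exact: cvg_cst.
  have -> : (fun n : nat => expR (- n%:R) : R) = (fun n => expR (- 1) ^+ n).
    by apply/funext => n; rewrite -expRM_natl; congr expR; ring.
  by apply: cvg_expr; rewrite gtr0_norm ?expR_gt0 // -expR0 ltr_expR oppr_lt0.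
exists (fun n => t * expR (- n%:R)); split.
- by move=> n; rewrite mulr_gt0 ?expR_gt0.
- by move=> n; rewrite ler_piMr ?(ltW t0) // -expR0 ler_expR oppr_le0.
- have h : \sum_i xi (t * expR (- n%:R)) i ^+ 2 @[n --> \oo] -->
      \sum_(i < N) (\sum_(k < N) 0 * a k ord0 i) * (\sum_(k < N) 0 * a k ord0 i).
    apply: cvg_sumR => i; under eq_fun do rewrite expr2.
    have h : \sum_k ek k (t * expR (- n%:R)) * a k ord0 i @[n --> \oo] -->
        (\sum_(k < N) 0 * a k ord0 i : R).
      by apply: cvg_sumR => k; apply: cvgM; [exact: ekn|exact: cvg_cst].
    exact: cvgM.
  rewrite big1 in h; first exact: h.
  by move=> i _; rewrite big1 ?mulr0 // => k _; rewrite mul0r.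
have h : c (t * expR (- n%:R)) @[n --> \oo] -->
    2^-1 * \sum_(k < N) \sum_(l < N) (t * 0 * (0 * 0)) * (g k l / (mu k + mu l + 1)).
  apply: cvgM; first exact: cvg_cst.
  apply: cvg_sumR => k; apply: cvg_sumR => l; apply: cvgM; last exact: cvg_cst.
  by apply: cvgM; [exact: snn|apply: cvgM; exact: ekn].
rewrite big1 ?mulr0 in h; first exact: h.
by move=> k _; rewrite big1 // => l _; rewrite mul0r.
Qed.

End SmatForm.

Section CosineBounds.
Context {R : realType}.
Implicit Types (C h K J a th kp n : R).

Lemma mul_cutoff_le C h : -1 <= C -> h <= 1 -> C * h <= C + (1 - h).
Proof.
move=> C1 h1; rewrite -subr_ge0; have -> : C + (1 - h) - C * h = (C - -1) * (1 - h) by ring.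
by rewrite mulr_ge0 // subr_ge0.
Qed.

Lemma mul_cutoff_ge C h K J a : C <= 1 -> h <= 1 -> a - J <= C -> J <= K ->
  a - K - (1 - h) <= C * h.
Proof.
move=> C1 h1 aC JK; apply: (@le_trans _ _ (C - (1 - h))); first by lra.
rewrite -subr_ge0; have -> : C * h - (C - (1 - h)) = (1 - C) * (1 - h) by ring.
by rewrite mulr_ge0 // subr_ge0.
Qed.

Lemma norm_le_of_sqr a kp n : 0 <= kp -> 0 <= n -> a ^+ 2 <= kp ^+ 2 * n ->
  `|a| <= kp * (1 + n).
Proof.
move=> kp0 n0 h; have k1 : 0 <= kp * (1 + n) by rewrite mulr_ge0 // addr_ge0.
have : a ^+ 2 <= (kp * (1 + n)) ^+ 2.
  apply: (le_trans h); rewrite exprMn; apply: ler_wpM2l; first exact: sqr_ge0.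
  by rewrite !expr2; nra.
by rewrite -[a ^+ 2]real_normK ?num_real // ler_pXn2r ?nnegrE.
Qed.

Lemma cos_lipschitz a th : `|cos (a + th) - cos th| <= `|a|.
Proof.
have cder (v : R) : is_derive v (1 : R) (cos : R -> R) (- sin v) by exact: is_derive_cos.
have ccont (u v : R) : {within `[u, v], continuous (cos : R -> R)}.
  by apply: continuous_subspaceT => w; exact: continuous_cos.
have H (u v : R) : u <= v -> `|cos v - cos u| <= v - u.
  move=> uv; have [w _ ->] := MVT_segment uv (fun w _ => cder w) (ccont _ _).
  rewrite normrM normrN (ger0_norm (x := v - u)) ?subr_ge0 // ler_piMl ?subr_ge0 //.
  exact: sin_max.
have [a0|a0] := leP 0 a.
  by apply: (le_trans (H th (a + th) _)); rewrite ?lerDr // addrK ger0_norm.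
rewrite distrC; apply: (le_trans (H (a + th) th _)); first by rewrite gerDr ltW.
by rewrite opprD addrCA subrr addr0 ltr0_norm.
Qed.

End CosineBounds.

Section CharacteristicFunction.
Context {R : realType} {N : nat} (nu : R) (r : 'I_N -> R) (n0 t : R).
Hypothesis nu0 : 0 < nu.
Hypothesis rdec : forall i j : 'I_N, (i < j)%N -> r j < r i.
Hypothesis rpos : forall i, 0 < r i.
Hypothesis rdrift : forall G, drift nu r G = 2^-1 * \sum_i r i * G i.
Hypothesis m0 : 0 < kaptot N nu.
Hypothesis t0 : 0 < t.
Local Notation V := 'rV[R]_N.
Local Notation rootT := ('I_N * 'I_N * bool)%type.
Local Notation m := (kaptot N nu).

(** The deviation bound for a start with |x|^2 = n0, made uniform over s <= t and b s >= 1. *)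
Definition devc : R := 3 * n0 + (3 * N%:R + 32) * t + (n0 + (N%:R + 12) * t) ^+ 2 / (2 * m).

Section Process.
Variables (b : R) (x : V).
Context d (Omega : measurableType d) (P : probability Omega R).
Context (X : R -> Omega -> V).
Hypothesis HX : bessel_B (nu * b) b x P X.
Hypothesis b0 : 0 < b.
Hypothesis xn0 : nsq x = n0.

Lemma deviation_uniform s : 0 < s -> s <= t -> 1 <= b * s ->
  P.-integrable setT (EFin \o (fun w => nsq (dev b r s (X s w)))) /\
  \int[P]_w nsq (dev b r s (X s w)) <= devc.
Proof.
move=> s0 st bs; have [h1 h2] := deviation_bound HX nu0 b0 rdec rpos rdrift m0 s0.
split; first exact: h1.
have n00 : 0 <= n0 by rewrite -xn0 nsq_ge0.
have N0 : 0 <= N%:R :> R by [].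
apply: (le_trans h2); rewrite xn0 /devc; apply: lerD.
  by rewrite lerD2l; apply: ler_wpM2l => //; rewrite addr_ge0 // mulr_ge0.
have q1 : 0 <= n0 + (N%:R + 12) * s.
  by apply: addr_ge0 => //; apply: mulr_ge0; [exact: addr_ge0|exact: ltW].
apply: ler_pM; first exact: sqr_ge0.
- by rewrite invr_ge0 ltW // -mulrA mulr_gt0 ?mulr_gt0.
- apply: lerXn2r; rewrite ?nnegrE //.
    by apply: (le_trans q1); rewrite lerD2l; apply: ler_wpM2l => //; exact: addr_ge0.
  by rewrite lerD2l; apply: ler_wpM2l => //; exact: addr_ge0.
rewrite lef_pV2 ?posrE ?mulr_gt0 //; first by rewrite -mulrA ler_peMr // ltW // mulr_gt0.
Qed.

Let dev_continuous s : continuous (fun y : V => dev b r s y).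
Proof. by move=> y; apply: (continuousB (f := idfun)); [exact: cvg_id|exact: cst_continuous]. Qed.

Lemma one_sub_chi_le s k : 0 < s -> s <= t -> 1 <= b * s -> 0 < k ->
  P.-integrable setT (EFin \o (fun w => 1 - chi k (dev b r s (X s w)))) /\
  \int[P]_w (1 - chi k (dev b r s (X s w))) <= 3 * devc * k^-1.
Proof.
move=> s0 st bs k0; have [i1 e1] := deviation_uniform s0 st bs.
have ki : 0 <= k^-1 by rewrite invr_ge0 ltW.
have i2 := integrable_scaleR (3 * k^-1) i1.
have i3 : P.-integrable setT (EFin \o (fun w => 1 - chi k (dev b r s (X s w)))).
  apply: (bessel_integrable HX (ltW s0) (h := fun y => 1 - chi k (dev b r s y)) (C := 1)).
    have cch : continuous (fun y : V => chi k (dev b r s y)).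
      move=> y; apply: (@continuous_comp _ _ _ (fun y : V => dev b r s y) (@chi R N k)).
        exact: dev_continuous.
      by case: (@hasC2_chi R N k) => _ _ + _ _; apply.
    move=> y; have cc : {for y, continuous (cst (1 : R) : V -> R)} by exact: cst_continuous.
    exact: (continuousB cc (cch y)).
  move=> y _; have [c0 c1 _] := chi_bounds (dev b r s y) k0.
  by rewrite ger0_norm ?subr_ge0 // gerBl.
split => //; apply: (@le_trans _ _ (\int[P]_w (3 * k^-1 * nsq (dev b r s (X s w))))).
  apply: le_Rintegral => // w _; have [_ _ h] := chi_bounds (dev b r s (X s w)) k0.
  by rewrite -mulrA.
rewrite RintegralZl //; have -> : 3 * devc * k^-1 = 3 * k^-1 * devc by ring.
by apply: ler_wpM2l => //; exact: mulr_ge0.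
Qed.

Variables (xi dxi : R -> 'I_N -> R) (c : R -> R) (th : R).
Hypothesis hxi : forall (s : R) (i : 'I_N), 0 < s -> is_derive s (1 : R) (xi^~ i) (dxi s i).
Hypothesis hdxi : forall (s : R) (i : 'I_N), 0 < s -> {for s, continuous (dxi^~ i)}.
Hypothesis hc : forall s : R, 0 < s ->
  is_derive s (1 : R) c (2^-1 * \sum_i xi s i ^+ 2).
Hypothesis hode : forall s : R, 0 < s -> forall z : V, \sum_i dxi s i * z ord0 i =
  s^-1 * \sum_e kap nu e * (rdf e (xi s) * rdf e (z ord0) / rdf e r ^+ 2).

(** The growth estimate is read from [s] to [t]. At either end, removing the cutoff costs 3 devc /
    k; at [s], the cosine is compared with cos th, at a cost of at most |xi (s)| (1 +
    |deviation|^2). *)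
Lemma charfun_lower (k dl B s : R) : 0 < k -> 0 < dl -> 0 < s -> s <= t ->
  (forall e : rootT, 0 < kap nu e -> dl <= `|rdf e r|) ->
  4 * Num.sqrt k <= ctr b s * dl -> 1 <= b * s ->
  (forall u : R, s <= u <= t ->
    [/\ \sum_i xi u i ^+ 2 <= B, \sum_i dxi u i ^+ 2 <= B & expR (c u) <= B]) ->
  expR (c s) * (cos th - Num.sqrt (\sum_i xi s i ^+ 2) * (1 + devc) - 3 * devc * k^-1)
   - expR (c t) * (3 * devc * k^-1)
   - @errc R N nu dl B s * (k * (Num.sqrt b)^-1 + k^-1 * (1 + devc)) * (t - s) <=
  expR (c t) * \int[P]_w cos (ip (xi t) (dev b r t (X t w)) + th).
Proof.
move=> k0 dl0 s0 st hdl deep bs hB.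
have t0' := ltW t0; have s0' := ltW s0.
have bsu u : s <= u -> 1 <= b * u by move=> su; apply: (le_trans bs); rewrite ler_pM2l.
have hM u : s <= u <= t -> P.-integrable setT (EFin \o (fun w => nsq (dev b r u (X u w)))) /\
  \int[P]_w nsq (dev b r u (X u w)) <= devc.
  move=> /andP[su ut]; apply: deviation_uniform => //; last exact: bsu.
  exact: lt_le_trans su.
have := utest_expect_growth nu0 b0 rdec rpos rdrift th k0 hxi hdxi hc dl0 s0 st hdl deep hode
  hB HX hM.
set E := errc _ _ _ _ * _; rewrite mulNr.
have ph_cont u : continuous (fun y : V => cos (ip (xi u) (dev b r u y) + th)).
  move=> y; apply: (@continuous_comp _ _ _ (fun y : V => ip (xi u) (dev b r u y) + th) cos).
    apply: (continuousD (f := fun y : V => ip (xi u) (dev b r u y)) (g := cst th));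
      last exact: cst_continuous.
    apply: (@continuous_comp _ _ _ (fun y : V => dev b r u y) (@ip R N (xi u))).
      exact: dev_continuous.
    exact: continuous_ip.
  exact: continuous_cos.
have icos u : 0 <= u ->
    P.-integrable setT (EFin \o (fun w => cos (ip (xi u) (dev b r u (X u w)) + th))).
  move=> u0; apply: (bessel_integrable HX u0 (ph_cont u) (C := 1)) => y _.
  exact: cos_max.
have iut u : s <= u <= t ->
    P.-integrable setT (EFin \o (fun w => utest b r xi c th k u (X u w))).
  move=> uI; have u0 : 0 <= u by case/andP: uI => su _; exact: le_trans su.
  apply: (bessel_integrable HX u0 (C := B)).
    exact: utest_continuous.
  by move=> y _; exact: (utest_bound b r th k0 hB y uI).
have tI : s <= t <= t by rewrite st lexx.
have sI : s <= s <= t by rewrite st lexx.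
have [j1 e1] := one_sub_chi_le t0 (lexx t) (bsu t st) k0.
have [j2 e2] := one_sub_chi_le s0 st bs k0.
have up : \int[P]_w utest b r xi c th k t (X t w) <=
   expR (c t) * (\int[P]_w cos (ip (xi t) (dev b r t (X t w)) + th) + 3 * devc * k^-1).
  have i4 := integrable_scaleR (expR (c t)) (integrable_addR (icos t t0') j1).
  apply: (@le_trans _ _ (\int[P]_w (expR (c t) * (cos (ip (xi t) (dev b r t (X t w)) + th) +
      (1 - chi k (dev b r t (X t w))))))).
    apply: le_Rintegral => //; first exact: iut.
    move=> w _; rewrite /utest; apply: ler_wpM2l; first exact: expR_ge0.
    rewrite /phase; have [c0 c1 _] := chi_bounds (dev b r t (X t w)) k0.
    have := cos_max (ip (xi t) (dev b r t (X t w)) + th); rewrite ler_norml => /andP[C1 _].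
    exact: mul_cutoff_le.
  rewrite RintegralZl //; last exact: integrable_addR (icos t t0') j1.
  apply: ler_wpM2l; first exact: expR_ge0.
  by rewrite (RintegralD measurableT (icos t t0') j1) lerD2l; exact: e1.
have [i5 e5] := hM s sI.
set kp := Num.sqrt (\sum_i xi s i ^+ 2).
have kp0 : 0 <= kp by exact: sqrtr_ge0.
have lo : expR (c s) * (cos th - kp * (1 + devc) - 3 * devc * k^-1) <=
    \int[P]_w utest b r xi c th k s (X s w).
  have i6 := integrable_scaleR kp (integrable_addR (integrable_cstR P 1) i5).
  have i7 := integrable_subR (integrable_subR (integrable_cstR P (cos th)) i6) j2.
  apply: (@le_trans _ _ (\int[P]_w (expR (c s) * (cos th - kp * (1 + nsq (dev b r s (X s w)))
     - (1 - chi k (dev b r s (X s w))))))).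
    rewrite RintegralZl //; apply: ler_wpM2l; first exact: expR_ge0.
    rewrite RintegralB //; last exact: integrable_subR (integrable_cstR P (cos th)) i6.
    rewrite RintegralB //; last exact: integrable_cstR.
    have -> : \int[P]_w (kp * (1 + nsq (dev b r s (X s w)))) =
        kp * \int[P]_w (1 + nsq (dev b r s (X s w))).
      by rewrite RintegralZl //; exact: (integrable_addR (integrable_cstR P 1) i5).
    rewrite RintegralD //; last exact: integrable_cstR.
    rewrite !Rintegral_cstR; apply: lerB => //; rewrite lerD2l lerN2.
    by apply: ler_wpM2l => //; rewrite lerD2l.
  apply: le_Rintegral => //; [exact: integrable_scaleR|exact: iut|].
  move=> w _; rewrite /utest; apply: ler_wpM2l; first exact: expR_ge0.
  rewrite /phase; set I := ip (xi s) _.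
  have [c0 c1 _] := chi_bounds (dev b r s (X s w)) k0.
  have Ile : `|I| <= kp * (1 + nsq (dev b r s (X s w))).
    apply: norm_le_of_sqr => //; first exact: nsq_ge0.
    have := ip_sqr_le (xi s) (dev b r s (X s w)); rewrite -/I.
    have -> // : \sum_i xi s i ^+ 2 = kp ^+ 2.
    by rewrite sqr_sqrtr // sumr_ge0 // => i _; exact: sqr_ge0.
  have := cos_lipschitz I th; rewrite ler_norml => /andP[cl _].
  have := cos_max (I + th); rewrite ler_norml => /andP[_ C2].
  apply: (@mul_cutoff_ge _ _ _ _ `|I|) => //.
  by rewrite -lerBrDl.
move: up lo; rewrite mulrDr.
set U1 := \int[P]_w utest _ _ _ _ _ _ t _; set U2 := \int[P]_w utest _ _ _ _ _ _ s _.
set A1 := expR (c s) * _; set A2 := expR (c t) * (3 * _ * _); set A3 := expR (c t) * _.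
set A4 := E * _ => up lo h.
have h1 : A1 - A4 <= U1.
  by rewrite lerBlDr (le_trans lo) // -lerBlDl -[leLHS]opprB lerNl.
by rewrite addrAC lerBlDr (le_trans h1).
Qed.

End Process.

Section Family.
Variable x : V.
Context d (Omega : R -> measurableType d) (P : forall be : R, probability (Omega be) R).
Context (X : forall be : R, R -> Omega be -> V).
Hypothesis xn0 : nsq x = n0.
Hypothesis HX : forall be : R, 0 < be -> bessel_B (nu * be) be x (P be) (@X be).

Let devc0 : 0 <= devc.
Proof.
have n00 : 0 <= n0 by rewrite -xn0 nsq_ge0.
rewrite /devc; apply: addr_ge0; first apply: addr_ge0.
- exact: mulr_ge0.
- by apply: mulr_ge0; [apply: addr_ge0 => //; exact: mulr_ge0|exact: ltW].
- by apply: divr_ge0; [exact: sqr_ge0|apply: mulr_ge0 => //; exact: ltW].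
Qed.

(** A third of [eta] is spent on each choice: a time [s] at which the flow is small, then a cutoff
    [k] making Q / k small, then [b] making k / sqrt b small. The constant [Er] depends on [s] but
    not on [k] or [b]. *)
Lemma charfun_liminf (v : V) (th eta : R) : 0 < eta ->
  let C := 2^-1 * t * (v *m invmx (Smat nu r) *m v^T) ord0 ord0 in
  exists2 b0 : R, 0 < b0 & forall b, b0 <= b -> cos th - eta <=
    expR C * \int[P b]_w cos (ip (v ord0) (dev b r t (X t w)) + th).
Proof.
move=> eta0; have [xi [dxi [c [hxi hdxi hc [hode xit ct hB [sn [sn0 snt snx snc]]]]]]] :=
  Smat_flow nu0 rpos v t0.
move=> C; have CE : C = c t by rewrite ct.
have xitE : xi t = v ord0 by apply/funext => i; rewrite xit.
have lim : expR (c (sn n)) * (cos th - Num.sqrt (\sum_i xi (sn n) i ^+ 2) * (1 + devc))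
    @[n --> \oo] --> expR 0 * (cos th - Num.sqrt 0 * (1 + devc)).
  apply: cvgM.
    by apply: continuous_cvg; [exact: continuous_expR|exact: snc].
  apply: cvgB; first exact: cvg_cst.
  apply: cvgM; last exact: cvg_cst.
  by apply: continuous_cvg; [exact: sqrt_continuous|exact: snx].
rewrite expR0 sqrtr0 mul0r subr0 mul1r in lim.
have eta3 : 0 < eta / 3 by rewrite divr_gt0.
move/cvgrPdist_lt: lim => /(_ _ eta3) [n _ /(_ n (leqnn n)) /=].
move: (sn n) (sn0 n) (snt n) => s s0 st.
rewrite ltr_norml => /andP[_ hs].
have [B hB'] := hB s s0 st.
have B0 : 0 <= B.
  have [_ _ h] := hB' s (introT andP (conj (lexx s) st)).
  by apply: le_trans h; exact: expR_ge0.
have kr (e : rootT) : 0 < kap nu e -> 0 < `|rdf e r|.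
  move=> ke; have := rdf_ratio (PR_r rdec rpos) (PR_r rdec rpos) ke.
  by rewrite normr_gt0; have [->|//] := eqVneq (rdf e r) 0; rewrite mul0r ltxx.
have [dl dl0 hdl] := finite_pos_lower_bound kr.
pose Er := @errc R N nu dl B s.
have Er0 : 0 <= Er by apply: errc_ge0.
have cs0 := expR_ge0 (c s); have ct0 := expR_ge0 (c t).
pose Q := (expR (c s) + expR (c t)) * (3 * devc) + Er * (1 + devc) * t.
have d1 : 0 <= 1 + devc by exact: addr_ge0.
have Q0 : 0 <= Q.
  apply: addr_ge0.
    by apply: mulr_ge0; [exact: addr_ge0|exact: mulr_ge0].
  by apply: mulr_ge0; [exact: mulr_ge0|exact: ltW].
pose k := 3 * Q / eta + 1.
have k0 : 0 < k by apply: ltr_wpDl => //; apply: divr_ge0; [exact: mulr_ge0|exact: ltW].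
have Qk : Q * k^-1 <= eta / 3.
  rewrite ler_pdivrMr // /k mulrDr mulr1.
  have -> : eta / 3 * (3 * Q / eta) = Q by field; rewrite gt_eqF.
  by rewrite lerDl ltW.
pose q := 3 * (Er * k * t) / eta + 1.
have q0' : 0 <= Er * k * t.
  by apply: mulr_ge0; [apply: mulr_ge0 => //|]; exact: ltW.
have q0 : 0 < q by apply: ltr_wpDl => //; apply: divr_ge0; [exact: mulr_ge0|exact: ltW].
have i1 : 0 < s^-1 by rewrite invr_gt0.
have i2 : 0 < 16 * k / (dl ^+ 2 * s).
  by apply: divr_gt0; apply: mulr_gt0 => //; exact: exprn_gt0.
have i3 : 0 < q ^+ 2 by exact: exprn_gt0.
(* The three summands ensure, in order, b s >= 1, that the cutoff lies deep in the chamber, and sqrt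
   b >= q. *)
exists (s^-1 + 16 * k / (dl ^+ 2 * s) + q ^+ 2).
  by apply: addr_gt0 => //; exact: addr_gt0.
move=> b hb.
have hb1 : s^-1 <= b by apply: le_trans hb; rewrite -addrA lerDl ltW // addr_gt0.
have hb2 : 16 * k / (dl ^+ 2 * s) <= b.
  by apply: le_trans hb; rewrite addrAC lerDr ltW // addr_gt0.
have hb3 : q ^+ 2 <= b by apply: le_trans hb; rewrite lerDr ltW // addr_gt0.
have b0 : 0 < b by apply: lt_le_trans hb1.
have bs : 1 <= b * s by rewrite -ler_pdivrMr // mul1r.
have deep : 4 * Num.sqrt k <= ctr b s * dl.
  have h4 : (4 * Num.sqrt k) ^+ 2 <= (ctr b s * dl) ^+ 2.
    rewrite !exprMn !sqr_sqrtr ?(ltW k0) //; last by rewrite mulr_ge0 // ltW.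
    move: hb2; rewrite ler_pdivrMr; last by rewrite mulr_gt0 // exprn_gt0.
    by move=> h; apply: (le_trans _ (le_trans h _)); rewrite le_eqVlt; apply/orP; left; apply/eqP; ring.
  rewrite -(@ler_pXn2r _ 2) ?nnegrE ?mulr_ge0 ?sqrtr_ge0 ?(ltW dl0) //.
have qb : q <= Num.sqrt b.
  by rewrite -[leLHS](ger0_norm (ltW q0)) -sqrtr_sqr; exact: ler_wsqrtr.
have sb0 : 0 < Num.sqrt b by rewrite sqrtr_gt0.
have qE : Er * k * t * (Num.sqrt b)^-1 <= eta / 3.
  rewrite ler_pdivrMr //; apply: (@le_trans _ _ (eta / 3 * q)).
    have -> : eta / 3 * q = Er * k * t + eta / 3 by rewrite /q; field; rewrite gt_eqF.
    by rewrite lerDl ltW.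
  by rewrite ler_pM2l.
have := charfun_lower (HX b0) b0 xn0 th hxi hdxi hc hode k0 dl0 s0 st hdl deep bs hB'.
rewrite CE -xitE; apply: le_trans.
have ki : 0 <= k^-1 by rewrite invr_ge0 ltW.
have ts : t - s <= t by rewrite gerBl ltW.
have e0 : 0 <= Er * (k * (Num.sqrt b)^-1 + k^-1 * (1 + devc)).
  apply: mulr_ge0 => //; apply: addr_ge0; last exact: mulr_ge0.
  by apply: mulr_ge0; [exact: ltW|rewrite invr_ge0 ltW].
have hE := ler_wpM2l e0 ts; rewrite -/Er.
have QE : Q * k^-1 + Er * k * t * (Num.sqrt b)^-1 = expR (c s) * (3 * devc * k^-1) +
    expR (c t) * (3 * devc * k^-1) + Er * (k * (Num.sqrt b)^-1 + k^-1 * (1 + devc)) * t.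
  by rewrite /Q; ring.
rewrite mulrBr; move: hs QE hE Qk qE.
set T1 := expR (c s) * (cos th - _); set T2 := expR (c s) * _; set T3 := expR (c t) * _.
set T4 := _ * (t - s); set T5 := _ * t; set T6 := Q * _; set T7 := _ * (Num.sqrt b)^-1.
clear -eta0; move: eta0 (cos th) T1 T2 T3 T4 T5 T6 T7 => eta0 T0 T1 T2 T3 T4 T5 T6 T7; lra.
Qed.

(** Lower bounds suffice: replacing th by th + pi changes the sign of the cosine and yields the
    upper bound. *)
Lemma charfun_cvg (v : V) (th : R) :
  (fun be => \int[P be]_w cos (ip (v ord0) (X t w - Num.sqrt (be * t) *: \row_i r i) + th))
  @ +oo --> expR (- (2^-1 * t * (v *m invmx (Smat nu r) *m v^T) ord0 ord0)) * cos th.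
Proof.
apply/cvgrPdist_le => e e0; set C := 2^-1 * t * _.
have eC : 0 < e * expR C by rewrite mulr_gt0 ?expR_gt0.
have [b1 b10 h1] := charfun_liminf v th eC.
have [b2 b20 h2] := charfun_liminf v (th + pi) eC.
exists (b1 + b2); split; first exact: num_real.
move=> b hb /=.
have hb1 : b1 <= b by apply: le_trans (ltW hb); rewrite lerDl ltW.
have hb2 : b2 <= b by apply: le_trans (ltW hb); rewrite lerDr ltW.
have b0 : 0 < b by apply: lt_le_trans hb1.
have := h1 b hb1; have := h2 b hb2; rewrite -/C /dev /ctr.
have -> : \int[P b]_w cos (ip (v ord0) (X t w - Num.sqrt (b * t) *: \row_i r i) + (th + pi))
   = - \int[P b]_w cos (ip (v ord0) (X t w - Num.sqrt (b * t) *: \row_i r i) + th).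
  have ic : (P b).-integrable setT
     (EFin \o (fun w => cos (ip (v ord0) (X t w - Num.sqrt (b * t) *: \row_i r i) + th))).
    apply: (bessel_integrable (HX b0) (ltW t0)
      (h := fun y => cos (ip (v ord0) (y - Num.sqrt (b * t) *: \row_i r i) + th)) (C := 1)).
      move=> y; apply: (@continuous_comp _ _ _
        (fun y : V => ip (v ord0) (y - Num.sqrt (b * t) *: \row_i r i) + th) cos).
        apply: (continuousD (f := fun y : V => ip (v ord0) (y - Num.sqrt (b * t) *: \row_i r i))
          (g := cst th)); last exact: cst_continuous.
        apply: (@continuous_comp _ _ _ (fun y : V => y - Num.sqrt (b * t) *: \row_i r i)
          (@ip R N (v ord0))); last exact: continuous_ip.
        by apply: (continuousB (f := idfun)); [exact: cvg_id|exact: cst_continuous].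
      exact: continuous_cos.
    by move=> y _; exact: cos_max.
  rewrite -mulN1r -RintegralZl //; apply: eq_Rintegral => w _.
  by rewrite addrA cosDpi mulN1r.
rewrite cosDpi; set J := \int[P b]_w _ => k2 k1.
have JE : J = expR (- C) * (expR C * J) by rewrite mulrA -expRD addNr expR0 mul1r.
rewrite JE -mulrBr normrM (ger0_norm (expR_ge0 _)).
have -> : e = expR (- C) * (e * expR C) by rewrite mulrCA -expRD addNr expR0 mulr1.
apply: ler_wpM2l; first exact: expR_ge0.
rewrite mulrN in k2; rewrite ler_norml; move: k1 k2.
by move: (expR C * J) (e * expR C) (cos th) => *; apply/andP; split; lra.
Qed.

End Family.
End CharacteristicFunction.

(** * Gaussian integrals *)

Section LebesgueTools.
Context {R : realType}.
Local Notation mu := (@lebesgue_measure R).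

Lemma Rintegral_dct d (T : measurableType d) (nu : {measure set T -> \bar R})
    (f : nat -> T -> R) (g G : T -> R) :
  (forall n, measurable_fun setT (f n)) -> nu.-integrable setT (EFin \o G) ->
  (forall n w, `|f n w| <= G w) -> (forall w, f n w @[n --> \oo] --> g w) ->
  \int[nu]_w f n w @[n --> \oo] --> \int[nu]_w g w.
Proof.
move=> mf iG fG fg.
have mg : measurable_fun setT g.
  by apply: (@measurable_fun_cvg _ _ _ setT f) => // w _; exact: fg.
have hc w : setT w -> (f n w)%:E @[n --> \oo] --> (g w)%:E.
  by move=> _; apply: cvg_EFin; [exact: nearW|exact: fg].
have [ig _ h] := @dominated_convergence _ T R nu setT measurableT
  (fun n w => (f n w)%:E) (fun w => (g w)%:E) (EFin \o G)
  (fun n => (measurable_EFinP _ _).2 (mf n)) ((measurable_EFinP _ _).2 mg)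
  (aeW _ hc) iG (aeW _ (fun w n _ => fG n w)).
apply: fine_cvg; rewrite fineK; first exact: h.
exact: integrable_fin_num.
Qed.

Lemma integrable_dominated d (T : measurableType d) (nu : {measure set T -> \bar R})
    (f G : T -> R) :
  measurable_fun setT f -> nu.-integrable setT (EFin \o G) ->
  (forall w, `|f w| <= G w) -> nu.-integrable setT (EFin \o f).
Proof.
move=> mf iG fG; apply: (le_integrable measurableT _ _ iG).
  exact/measurable_EFinP.
by move=> w _ /=; rewrite lee_fin (le_trans (fG w)) // ler_norm.
Qed.

(** The fundamental theorem on [-n, n], with domination to pass to the line; this is integration by
    parts without boundary terms. *)
Lemma Rintegral_derivative_eq0 (F f G : R -> R) :
  (forall y, is_derive y (1 : R) F (f y)) -> continuous f ->
  mu.-integrable setT (EFin \o G) -> (forall y, `|f y| <= G y) ->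
  F n%:R @[n --> \oo] --> (0 : R) -> F (- n%:R) @[n --> \oo] --> (0 : R) ->
  \int[mu]_y f y = 0.
Proof.
move=> dF cf iG fG F1 F2.
have mf : measurable_fun setT f by exact: measurable_realfun.continuous_measurable_fun.
pose A (n : nat) : set (measurableTypeR R) := `[- n%:R, n%:R]%classic.
have mA n : measurable (A n) by exact: measurable_itv.
pose fn n (y : measurableTypeR R) := f y * \1_(A n) y.
have h1 : \int[mu]_y fn n y @[n --> \oo] --> \int[mu]_y f y.
  apply: (@Rintegral_dct _ _ mu fn f G) => //.
  - by move=> n; apply: measurable_funM => //; exact: measurable_indic.
  - move=> n y; rewrite /fn normrM (le_trans _ (fG y)) // ler_piMr //.
    by rewrite indicE; case: (y \in _); rewrite ?normr1 ?normr0.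
  - move=> y; apply: cvg_near_cst; have [N _ hN] := near_infty_natSinv_lt (PosNum (@ltr01 R)).
    have ny : 0 <= `|y| by [].
    exists (Num.bound `|y|) => // n /= bn; rewrite /fn indicE mem_set ?mulr1 //.
    rewrite /A /= in_itv /= -ler_norml ltW //.
    by apply: (lt_le_trans (archi_boundP ny)); rewrite ler_nat.
have h2 n : \int[mu]_y fn n.+1 y = F n.+1%:R - F (- n.+1%:R).
  have n0 : 0 < n.+1%:R :> R by rewrite ltr0n.
  have ab : - n.+1%:R < n.+1%:R :> R by lra.
  transitivity (\int[mu]_(y in A n.+1) f y).
    rewrite [RHS]Rintegral_mkcond; apply: eq_Rintegral => y _.
    by rewrite /fn patchE indicE; case: (y \in _); rewrite ?mulr1 ?mulr0.
  rewrite /Rintegral (@continuous_FTC2 _ f F (- n.+1%:R) n.+1%:R ab).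
  - by [].
  - exact: continuous_subspaceT.
  - have cF y : {for y, continuous F} by exact: is_derive_continuous (dF y).
    split; first by move=> y _; have [] := dF y.
      by apply: cvg_at_right_filter; exact: cF.
    by apply: cvg_at_left_filter; exact: cF.
  - by move=> y _; rewrite derive1E; have [_ ->] := dF y.
have h3 : \int[mu]_y fn n.+1 y @[n --> \oo] --> (0 : R).
  under eq_fun do rewrite h2.
  rewrite -(subr0 (0 : R)); apply: cvgB.
    by rewrite (cvg_shiftS (fun n => F n%:R)).
  by rewrite (cvg_shiftS (fun n => F (- n%:R))).
have h4 : \int[mu]_y fn n y @[n --> \oo] --> (0 : R).
  by rewrite -(cvg_shiftS (fun n => \int[mu]_y fn n y)).
exact: (cvg_unique (@Rhausdorff R) h1 h4).
Qed.

End LebesgueTools.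

Section Gaussian1D.
Context {R : realType}.
Local Notation mu := (@lebesgue_measure R).
Implicit Types (s m y b th p c : R).

Definition gs (s m y : R) : R := expR (- (s * (y - m) ^+ 2 / 2)).

Lemma gs_derive s m y : is_derive y (1 : R) (gs s m) (gs s m y * (- s * (y - m))).
Proof.
have h1 := is_derive_addR (is_derive_id y (1 : R)) (is_derive_cst (- m) y 1).
have h2 := is_derive_scaleR (- s / 2) (is_derive_mulR h1 h1).
have h3 := is_derive_compR (is_derive_expR _) h2.
have -> : gs s m = fun y => expR (- s / 2 * ((id y + cst (- m) y) * (id y + cst (- m) y))).
  by apply/funext => z; rewrite /gs /cst /=; congr expR; field.
by apply: is_derive_eq h3 _; rewrite /cst /=; field.
Qed.

Lemma gs_continuous s m : continuous (gs s m).
Proof. by move=> y; exact: is_derive_continuous (gs_derive s m y). Qed.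

Lemma gs_ge0 s m y : 0 <= gs s m y. Proof. exact: expR_ge0. Qed.

Let gs_normal s m y : 0 < s -> gs s m y =
  (normal_peak (Num.sqrt s)^-1)^-1 * normal_pdf m (Num.sqrt s)^-1 y.
Proof.
move=> s0; have sn : (Num.sqrt s)^-1 != 0 by rewrite invr_eq0 gt_eqF // sqrtr_gt0.
have -> : normal_pdf m (Num.sqrt s)^-1 y =
  normal_peak (Num.sqrt s)^-1 * normal_fun m (Num.sqrt s)^-1 y by rewrite normal_pdfE.
rewrite mulKf ?gt_eqF ?normal_peak_gt0 //.
rewrite /normal_fun /gs exprVn sqr_sqrtr ?(ltW s0) //; congr expR.
by rewrite -mulr_natr; field; rewrite gt_eqF.
Qed.

Lemma gs_integrable s m : 0 < s -> mu.-integrable setT (EFin \o gs s m).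
Proof.
move=> s0; have -> : EFin \o gs s m = (fun y => ((normal_peak (Num.sqrt s)^-1)^-1)%:E
     * (normal_pdf m (Num.sqrt s)^-1 y)%:E)%E.
  by apply/funext => y /=; rewrite gs_normal // EFinM.
by apply: integrableZl => //; exact: integrable_normal_pdf.
Qed.

Lemma gs_integral s m : 0 < s -> \int[mu]_y gs s m y = Num.sqrt (2 * pi / s).
Proof.
move=> s0; under eq_Rintegral do rewrite gs_normal //.
rewrite RintegralZl //; last exact: integrable_normal_pdf.
rewrite [X in _ * X](_ : _ = 1); last first.
  by rewrite /Rintegral integral_normal_pdf.
rewrite mulr1 /normal_peak invrK exprVn sqr_sqrtr ?(ltW s0) //; congr Num.sqrt.
by rewrite -mulr_natr; field; rewrite gt_eqF.
Qed.

(** Half of the Gaussian decay absorbs the linear factor. *)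
Let mul_gs_le s m y : 0 < s -> `|y - m| * gs s m y <= (1 + 4 / s) * gs (s / 2) m y.
Proof.
move=> s0; have -> : gs s m y = gs (s / 2) m y * gs (s / 2) m y.
  by rewrite /gs -expRD; congr expR; field.
rewrite mulrA; apply: ler_wpM2r; first exact: gs_ge0.
set u := y - m; rewrite /gs -/u expRN -ler_pdivlMr ?invr_gt0 ?expR_gt0 // invrK.
have e1 : 1 + s / 2 * u ^+ 2 / 2 <= expR (s / 2 * u ^+ 2 / 2) := expR_ge1Dx _.
have d0 : 0 <= 4 / s by rewrite divr_ge0 // ltW.
apply: (@le_trans _ _ ((1 + 4 / s) * (1 + s / 2 * u ^+ 2 / 2))); last first.
  by apply: ler_wpM2l => //; exact: addr_ge0.
have -> : (1 + 4 / s) * (1 + s / 2 * u ^+ 2 / 2) = 1 + u ^+ 2 + 4 / s + s / 4 * u ^+ 2.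
  by field; rewrite gt_eqF.
have s4 : 0 <= s / 4 * u ^+ 2 by rewrite mulr_ge0 ?sqr_ge0 // divr_ge0 // ltW.
have : `|u| <= 1 + u ^+ 2.
  rewrite -[u ^+ 2]real_normK ?num_real //; have := sqr_ge0 (`|u| - 1).
  by rewrite !expr2; move: (`|u|) => v; nra.
by move=> h; apply: (le_trans h); rewrite -addrA lerDl addr_ge0.
Qed.

Lemma cvg_gs_infty s m : 0 < s -> gs s m n%:R @[n --> \oo] --> (0 : R) /\
  gs s m (- n%:R) @[n --> \oo] --> (0 : R).
Proof.
move=> s0.
have H (u : nat -> R) : (forall n, n%:R <= `|u n - m| + `|m|) -> gs s m (u n) @[n --> \oo] --> (0 : R).
  move=> hu; apply/cvgrPdist_le => e e0.
  pose K := `|m| + 1 + 2 / (s * e).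
  have K0 : 0 <= K by rewrite addr_ge0 // ?addr_ge0 // divr_ge0 // ltW // mulr_gt0.
  exists (Num.bound K) => // n /= bn.
  have Kn : K <= n%:R by rewrite ltW // (lt_le_trans (archi_boundP K0)) // ler_nat.
  rewrite sub0r normrN ger0_norm ?gs_ge0 // /gs expRN.
  have un : 1 + 2 / (s * e) <= `|u n - m|.
    by have := hu n; move: Kn; rewrite /K; move: (2 / _) (`|m|) (`|u n - m|) => *; lra.
  have d0 : 0 <= 2 / (s * e) by rewrite divr_ge0 // ltW // mulr_gt0.
  have sq : 2 / (s * e) <= (u n - m) ^+ 2.
    rewrite -[X in _ <= X]real_normK ?num_real //.
    by move: un d0; move: (2 / _) (`|u n - m|) => a c; rewrite expr2; nra.
  have E : e^-1 <= expR (s * (u n - m) ^+ 2 / 2).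
    apply: (@le_trans _ _ (s * (u n - m) ^+ 2 / 2)); last first.
      by apply: (le_trans _ (expR_ge1Dx _)); rewrite lerDr.
    have -> : e^-1 = s * (2 / (s * e)) / 2 by field; rewrite !gt_eqF.
    by apply: ler_wpM2r => //; rewrite ler_pM2l.
  by rewrite -[leRHS]invrK lef_pV2 ?posrE ?expR_gt0 ?invr_gt0.
split; apply: H => n.
  by have := ler_normD (n%:R - m) m; rewrite subrK ger0_norm.
by have := ler_normD (- n%:R - m) m; rewrite subrK normrN ger0_norm.
Qed.

(** As a function of the frequency, the integral [M] satisfies M' = - (b / s) M, by differentiation
    under the integral and integration by parts. So M exp (b^2 / (2 s)) is constant, equal to its
    value at frequency 0. *)
Lemma gs_cos_integral s m b th : 0 < s -> \int[mu]_y (gs s m y * cos (b * (y - m) + th)) =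
  Num.sqrt (2 * pi / s) * expR (- (b ^+ 2 / (2 * s))) * cos th.
Proof.
move=> s0; pose M b := \int[mu]_y (gs s m y * cos (b * (y - m) + th)).
pose G y := (1 + 4 / s) * gs (s / 2) m y.
have s20 : 0 < s / 2 by rewrite divr_gt0.
have iG : mu.-integrable setT (EFin \o G).
  have -> : EFin \o G = (fun y => (1 + 4 / s)%:E * (EFin \o gs (s / 2) m) y)%E.
    by apply/funext => y /=; rewrite EFinM.
  by apply: integrableZl => //; exact: gs_integrable.
have lin_der (b' y : R) : is_derive y (1 : R) (fun y => b' * (y - m) + th) b'.
  have h := is_derive_addR (is_derive_scaleR b' (is_derive_addR (is_derive_id y (1 : R))
    (is_derive_cst (- m) y 1))) (is_derive_cst th y 1).
  by apply: is_derive_eq h _; rewrite !addr0 mulr1.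
have lin_der2 (b' y : R) : is_derive b' (1 : R) (fun b' => b' * (y - m) + th) (y - m).
  have h := is_derive_addR (is_derive_mulR (is_derive_id b' (1 : R)) (is_derive_cst (y - m) b' 1))
    (is_derive_cst th b' 1).
  by apply: is_derive_eq h _; rewrite /cst mulr0 add0r mulr1 addr0.
have clin (b' : R) (phi : R -> R) : continuous phi -> continuous (fun y => phi (b' * (y - m) + th)).
  move=> cphi y; apply: (@continuous_comp _ _ _ (fun y => b' * (y - m) + th) phi).
    exact: is_derive_continuous (lin_der b' y).
  exact: cphi.
have cgs : continuous (gs s m) := @gs_continuous s m.
have ccos (b' : R) : continuous (fun y => gs s m y * cos (b' * (y - m) + th)).
  by move=> y; apply: continuousM; [exact: cgs|exact: (clin _ _ (@continuous_cos R))].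
have csin (b' : R) : continuous (fun y => gs s m y * (- (y - m) * sin (b' * (y - m) + th))).
  move=> y; apply: continuousM; first exact: cgs.
  apply: continuousM; last exact: (clin _ _ (@continuous_sin R)).
  apply: continuousN; apply: (continuousB (f := idfun)); [exact: cvg_id|exact: cst_continuous].
have icos (b' : R) : mu.-integrable setT (EFin \o (fun y => gs s m y * cos (b' * (y - m) + th))).
  apply: (@integrable_dominated R _ (measurableTypeR R) mu _ (gs s m)).
  - by apply: measurable_realfun.continuous_measurable_fun; exact: ccos.
  - exact: gs_integrable.
  - move=> y; rewrite normrM (ger0_norm (gs_ge0 _ _ _)) ler_piMr ?gs_ge0 //; exact: cos_max.
have dom (b' y : R) : `|gs s m y * (- (y - m) * sin (b' * (y - m) + th))| <= G y.
  apply: le_trans (mul_gs_le m y s0); rewrite normrM (ger0_norm (gs_ge0 _ _ _)) mulrC.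
  by apply: ler_wpM2r; [exact: gs_ge0|rewrite normrM normrN ler_piMr // sin_max].
have isin (b' : R) : mu.-integrable setT
    (EFin \o (fun y => gs s m y * (- (y - m) * sin (b' * (y - m) + th)))).
  apply: (@integrable_dominated R _ (measurableTypeR R) mu _ G) => //.
  by apply: measurable_realfun.continuous_measurable_fun; exact: csin.
have pder (b' y : R) : is_derive b' (1 : R) (fun b' => gs s m y * cos (b' * (y - m) + th))
    (gs s m y * (- (y - m) * sin (b' * (y - m) + th))).
  have h := is_derive_scaleR (gs s m y) (is_derive_compR (is_derive_cos _) (lin_der2 b' y)).
  by apply: is_derive_eq h _; ring.
have ibp (b' : R) : \int[mu]_y (gs s m y * (- (y - m) * sin (b' * (y - m) + th))) = - (b' / s) * M b'.
  pose F y := gs s m y * sin (b' * (y - m) + th).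
  pose f1 y := gs s m y * (- (y - m) * sin (b' * (y - m) + th)).
  pose f2 y := gs s m y * cos (b' * (y - m) + th).
  have h0 : \int[mu]_y (s * f1 y + b' * f2 y) = 0.
    have dF (y : R) : is_derive y (1 : R) F (s * f1 y + b' * f2 y).
      have h := is_derive_mulR (gs_derive s m y)
        (is_derive_compR (is_derive_sin _) (lin_der b' y)).
      by apply: is_derive_eq h _; rewrite /f1 /f2; ring.
    have sq (u : nat -> R) : gs s m (u n) @[n --> \oo] --> (0 : R) ->
        F (u n) @[n --> \oo] --> (0 : R).
      move=> h; apply/cvgrPdist_lt => e e0; move/cvgrPdist_lt: h => /(_ e e0).
      apply: filterS => n; rewrite !sub0r !normrN; apply: le_lt_trans.
      by rewrite /F normrM ler_piMr // sin_max.
    apply: (@Rintegral_derivative_eq0 R F (fun y : R => s * f1 y + b' * f2 y)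
      (fun y : R => s * G y + `|b'| * gs s m y) dF).
    - move=> y.
      have c1 : {for y, continuous (fun y : R => s * f1 y)} :=
        @continuousM R R (cst s) f1 y (@cst_continuous _ _ _ y) (csin b' y).
      have c2 : {for y, continuous (fun y : R => b' * f2 y)} :=
        @continuousM R R (cst b') f2 y (@cst_continuous _ _ _ y) (ccos b' y).
      exact: (continuousD c1 c2).
    - have -> : EFin \o (fun y => s * G y + `|b'| * gs s m y) =
        (fun y => s%:E * (EFin \o G) y + `|b'|%:E * (EFin \o gs s m) y)%E.
        by apply/funext => y /=; rewrite EFinD !EFinM.
      apply: integrableD => //; first exact: integrableZl.
      by apply: integrableZl => //; exact: gs_integrable.
    - move=> y; apply: (le_trans (ler_normD _ _)); apply: lerD.
        by rewrite normrM (gtr0_norm s0); apply: ler_wpM2l; [exact: ltW|exact: dom].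
      rewrite normrM; apply: ler_wpM2l => //.
      by rewrite normrM (ger0_norm (gs_ge0 _ _ _)) ler_piMr ?gs_ge0 // cos_max.
    - by have [h _] := cvg_gs_infty m s0; exact: sq h.
    - by have [_ h] := cvg_gs_infty m s0; exact: sq h.
  have scl (k : R) (f : R -> R) : mu.-integrable setT (EFin \o f) ->
      mu.-integrable setT (EFin \o (fun y => k * f y)).
    move=> hf; have -> : EFin \o (fun y => k * f y) = (fun y => k%:E * (EFin \o f) y)%E.
      by apply/funext => y /=; rewrite EFinM.
    exact: integrableZl.
  have i1 := scl s _ (isin b'); have i2 := scl b' _ (icos b').
  rewrite RintegralD // in h0.
  have z1 : \int[mu]_y (s * f1 y) = s * \int[mu]_y f1 y by rewrite RintegralZl //; exact: isin.
  have z2 : \int[mu]_y (b' * f2 y) = b' * M b' by rewrite RintegralZl //; exact: icos.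
  rewrite z1 z2 in h0; move: h0; rewrite -/(f1 _); set I := \int[mu]_y f1 y => h0.
  have -> : I = (s * I) / s by field; rewrite gt_eqF.
  have -> : s * I = - (b' * M b') by move: h0; move: (s * I) (b' * M b') => *; lra.
  by field; rewrite gt_eqF.
have dM b' : is_derive b' (1 : R) M (- (b' / s) * M b').
  pose f (u y : R) := gs s m y * cos (u * (y - m) + th).
  have d1E u y : partial1of2 f u y = gs s m y * (- (y - m) * sin (u * (y - m) + th)).
    by rewrite partial1of2E; have [_ ->] := pder u y.
  have bI : (`]b' - 1, b' + 1[%classic : set R) b' by rewrite /= in_itv /=; apply/andP; split; lra.
  have iGf u : (`]b' - 1, b' + 1[%classic : set R) u -> mu.-integrable setT (EFin \o f u).
    by move=> _; exact: icos.
  have dr u y : (`]b' - 1, b' + 1[%classic : set R) u -> [set: measurableTypeR R] y ->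
      derivable (f ^~ y) u 1 by move=> _ _; have [] := pder u y.
  have G0 y : 0 <= G y by apply: le_trans (dom 0 y).
  have Gb u y : (`]b' - 1, b' + 1[%classic : set R) u -> [set: measurableTypeR R] y ->
      `|partial1of2 f u y| <= G y by move=> _ _; rewrite d1E.
  have h1 := @derivable_under_integral R _ _ mu f setT measurableT b' _ _ bI iGf dr G G0 iG Gb.
  have h2 := @differentiation_under_integral R _ _ mu f setT measurableT b' _ _ bI iGf dr G G0 iG Gb.
  split; first exact: h1.
  by rewrite -derive1E [LHS]h2 -ibp; apply: eq_Rintegral => y _; rewrite d1E.
have dH b' : is_derive b' (1 : R) (fun b => M b * expR (b ^+ 2 / (2 * s))) 0.
  have hq : is_derive b' (1 : R) (fun b => b ^+ 2 / (2 * s)) (b' / s).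
    have h := is_derive_mulR (is_derive_mulR (is_derive_id b' (1 : R)) (is_derive_id b' (1 : R)))
      (is_derive_cst ((2 * s)^-1) b' 1).
    by apply: is_derive_eq h _; rewrite /cst; field; rewrite gt_eqF.
  have h := is_derive_mulR (dM b') (is_derive_compR (is_derive_expR _) hq).
  by apply: is_derive_eq h _; ring.
have := is_derive_0_is_cst b 0 dH; rewrite expr0n mul0r expR0 mulr1.
have -> : M 0 = Num.sqrt (2 * pi / s) * cos th.
  rewrite /M; under eq_Rintegral do rewrite mul0r add0r mulrC.
  by rewrite RintegralZl ?gs_integral // 1?mulrC //; exact: gs_integrable.
rewrite -/(M b) => h; rewrite mulrAC -h -mulrA -expRD subrr expR0 mulr1 //.
Qed.

(** Completing the square moves the centre to p / s, which shifts the phase by p b / s. *)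
Lemma gauss1 s c p b th : 0 < s ->
  \int[mu]_y (expR (c + p * y - s * y ^+ 2 / 2) * cos (b * y + th)) =
  Num.sqrt (2 * pi / s) * expR (c + (p ^+ 2 - b ^+ 2) / (2 * s)) * cos (p * b / s + th).
Proof.
move=> s0; have sn : s != 0 by rewrite gt_eqF.
transitivity (\int[mu]_y (expR (c + p ^+ 2 / (2 * s)) *
    (gs s (p / s) y * cos (b * (y - p / s) + (p * b / s + th))))).
  apply: eq_Rintegral => y _; rewrite mulrA /gs -expRD; congr (expR _ * cos _); by field.
rewrite RintegralZl //.
  rewrite gs_cos_integral // -!mulrA mulrCA; congr (_ * _).
  by rewrite [LHS]mulrA -expRD; congr (expR _ * _); field.
apply: (@integrable_dominated R _ (measurableTypeR R) mu _ (gs s (p / s))).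
- apply: measurable_realfun.continuous_measurable_fun => y; apply: continuousM.
    exact: gs_continuous.
  apply: (@continuous_comp _ _ _ (fun y => b * (y - p / s) + (p * b / s + th)) cos).
    have h := is_derive_addR (is_derive_scaleR b (is_derive_addR (is_derive_id y (1 : R))
      (is_derive_cst (- (p / s)) y 1))) (is_derive_cst (p * b / s + th) y 1).
    exact: is_derive_continuous h.
  exact: continuous_cos.
- exact: gs_integrable.
- move=> y; rewrite normrM (ger0_norm (gs_ge0 _ _ _)) ler_piMr ?gs_ge0 //; exact: cos_max.
Qed.

End Gaussian1D.

Section IteratedIntegral.
Context {R : realType}.
Local Notation mu := (@lebesgue_measure R).
Implicit Types (F G : (nat -> R) -> R) (v : nat -> R) (C : R).

Definition upd (n : nat) (y : R) (v : nat -> R) : nat -> R :=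
  fun k => if k == n then y else v k.

(** Continuity along pointwise convergent sequences of arguments, which is what dominated
    convergence in the iterated integrals consumes. *)
Definition scont (F : (nat -> R) -> R) : Prop :=
  forall (u : nat -> nat -> R) v, (forall k, u j k @[j --> \oo] --> v k) ->
    F (u j) @[j --> \oo] --> F v.

Variable l : R.
Hypothesis l0 : 0 < l.

Definition gbd (n : nat) C F : Prop := forall v, `|F v| <= C * \prod_(k < n) gs l 0 (v k).

Local Notation K := (Num.sqrt (2 * pi / l)).

Let gs1 y : gs l 0 y <= 1.
Proof.
rewrite /gs -expR0 ler_expR oppr_le0 divr_ge0 // mulr_ge0 ?sqr_ge0 //; exact: ltW.
Qed.

Let gbd_ge0 n C F : gbd n C F -> 0 <= C.
Proof.
move=> h; have := le_trans (normr_ge0 _) (h (fun _ => 0)).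
by rewrite pmulr_lge0 // prodr_gt0 // => k _; exact: expR_gt0.
Qed.

Let gbd_upd n C F y : gbd n.+1 C F -> gbd n (C * gs l 0 y) (fun v => F (upd n y v)).
Proof.
move=> h v; have := h (upd n y v); rewrite big_ord_recr /= /upd eqxx.
under eq_bigr => k _ do rewrite ltn_eqF //.
by rewrite mulrAC mulrA mulrAC.
Qed.

Let gbd_le n C C' F : C <= C' -> gbd n C F -> gbd n C' F.
Proof.
move=> CC h v; apply: (le_trans (h v)); apply: ler_wpM2r => //.
by apply: prodr_ge0 => k _; exact: gs_ge0.
Qed.

Let scont_upd n F y : scont F -> scont (fun v => F (upd n y v)).
Proof.
move=> h u v uv; apply: h => k; rewrite /upd.
by case: (k == n); [exact: cvg_cst|exact: uv].
Qed.

Lemma seq_continuous (f : R -> R) :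
  (forall (u : nat -> R) x, u n @[n --> \oo] --> x -> f (u n) @[n --> \oo] --> f x) ->
  continuous f.
Proof.
move=> h x; apply/cvgrPdist_lt => e e0.
have H (u : nat -> R) : (forall n : nat, True) -> u n @[n --> \oo] --> x ->
    exists n, `|f x - f (u n)| < e.
  move=> _ ux; move/cvgrPdist_lt: (h u x ux) => /(_ e e0) [n _ hn].
  by exists n; exact: (hn n (leqnn n)).
have [dl dl0 hd] := @seq_delta R (fun _ => True) (fun u => `|f x - f u| < e) x H.
near=> y; apply: hd => //; near: y.
Unshelve. all: by end_near. Qed.

Lemma iter_intS n F :
  iter_int n.+1 F = \int[mu]_y iter_int n (fun v => F (upd n y v)).
Proof. by []. Qed.

(** The two statements need a joint induction: measurability of the inner integral in the outer
    variable follows from its continuity, which is dominated convergence one level below. *)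
Let main n :
  (forall F C, scont F -> gbd n C F -> `|iter_int n F| <= C * K ^+ n) /\
  (forall (Fj : nat -> (nat -> R) -> R) F C, (forall j, scont (Fj j)) ->
     (forall j, gbd n C (Fj j)) -> (forall v, Fj j v @[j --> \oo] --> F v) ->
     iter_int n (Fj j) @[j --> \oo] --> iter_int n F).
Proof.
elim: n => [|n [IHb IHd]].
  split=> [F C _ h|Fj F C _ _ h]; last exact: h.
  by have := h (fun _ => 0); rewrite big_ord0 !mulr1.
have K0 : 0 <= K by exact: sqrtr_ge0.
have b1 F C y : scont F -> gbd n.+1 C F ->
    `|iter_int n (fun v => F (upd n y v))| <= C * K ^+ n * gs l 0 y.
  move=> sF gF; rewrite mulrAC; apply: IHb; [exact: scont_upd|exact: gbd_upd].
have c1 F C : scont F -> gbd n.+1 C F -> continuous (fun y => iter_int n (fun v => F (upd n y v))).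
  move=> sF gF; have C0 := gbd_ge0 gF; apply: seq_continuous => u x ux.
  apply: (IHd (fun j v => F (upd n (u j) v)) (fun v => F (upd n x v)) C).
  - by move=> j; exact: scont_upd.
  - by move=> j; apply: gbd_le (gbd_upd (u j) gF); rewrite ler_piMr.
  - move=> v; apply: sF => k; rewrite /upd.
    by case: (k == n); [exact: ux|exact: cvg_cst].
have iG C : mu.-integrable setT (EFin \o (fun y => C * K ^+ n * gs l 0 y)).
  have -> : EFin \o (fun y => C * K ^+ n * gs l 0 y) =
    (fun y => (C * K ^+ n)%:E * (EFin \o gs l 0) y)%E.
    by apply/funext => y /=; rewrite EFinM.
  by apply: integrableZl => //; exact: gs_integrable.
have m1 F C : scont F -> gbd n.+1 C F ->
    measurable_fun setT (fun y : measurableTypeR R => iter_int n (fun v => F (upd n y v))).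
  by move=> sF gF; apply: measurable_realfun.continuous_measurable_fun; exact: (c1 F C).
split=> [F C sF gF|Fj F C sF gF cF].
  have iF := @integrable_dominated R _ (measurableTypeR R) mu _ _ (m1 F C sF gF) (iG C)
    (fun y => b1 F C y sF gF).
  apply: (le_trans (le_normr_Rintegral _ _)) => //.
  apply: (@le_trans _ _ (\int[mu]_y (C * K ^+ n * gs l 0 y))).
    apply: le_Rintegral => //; last by move=> y _; exact: b1.
    have -> : EFin \o (fun y => `|iter_int n (fun v => F (upd n y v))|) =
      (abse \o (EFin \o (fun y => iter_int n (fun v => F (upd n y v)))))%E by [].
    exact: integrable_abse.
  by rewrite RintegralZl ?gs_integral // ?exprSr ?mulrA //; exact: gs_integrable.
apply: (@Rintegral_dct R _ (measurableTypeR R) mu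
  (fun j y => iter_int n (fun v => Fj j (upd n y v))) _ (fun y => C * K ^+ n * gs l 0 y)).
- by move=> j; exact: (m1 _ C).
- exact: iG.
- by move=> j y; exact: b1.
- move=> y; apply: (IHd (fun j v => Fj j (upd n y v)) _ (C * gs l 0 y)).
  + by move=> j; exact: scont_upd.
  + by move=> j; exact: gbd_upd.
  + by move=> v; exact: cF.
Qed.

Let slice n F C : scont F -> gbd n.+1 C F ->
  mu.-integrable setT (EFin \o (fun y => iter_int n (fun v => F (upd n y v)))).
Proof.
move=> sF gF; have [IHb IHd] := main n; have C0 := gbd_ge0 gF.
apply: (@integrable_dominated R _ (measurableTypeR R) mu _ (fun y => C * K ^+ n * gs l 0 y)).
- apply: measurable_realfun.continuous_measurable_fun; apply: seq_continuous => u x ux.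
  apply: (IHd (fun j v => F (upd n (u j) v)) (fun v => F (upd n x v)) C).
  + by move=> j; exact: scont_upd.
  + by move=> j; apply: gbd_le (gbd_upd (u j) gF); rewrite ler_piMr.
  + move=> v; apply: sF => k; rewrite /upd.
    by case: (k == n); [exact: ux|exact: cvg_cst].
- have -> : EFin \o (fun y => C * K ^+ n * gs l 0 y) =
    (fun y => (C * K ^+ n)%:E * (EFin \o gs l 0) y)%E.
    by apply/funext => y /=; rewrite EFinM.
  by apply: integrableZl => //; exact: gs_integrable.
- by move=> y; rewrite mulrAC; apply: IHb; [exact: scont_upd|exact: gbd_upd].
Qed.

Lemma iter_int_lin n F G a CF CG : scont F -> gbd n CF F -> scont G -> gbd n CG G ->
  iter_int n (fun v => F v + a * G v) = iter_int n F + a * iter_int n G.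
Proof.
elim: n F G CF CG => [//|n IH] F G CF CG sF gF sG gG.
have i1 := slice sF gF; have i2 := slice sG gG.
have i3 : mu.-integrable setT
    (EFin \o (fun y => a * iter_int n (fun v => G (upd n y v)))).
  have -> : EFin \o (fun y => a * iter_int n (fun v => G (upd n y v))) =
    (fun y => a%:E * (EFin \o (fun y => iter_int n (fun v => G (upd n y v)))) y)%E.
    by apply/funext => y /=; rewrite EFinM.
  exact: integrableZl.
rewrite !iter_intS.
transitivity (\int[mu]_y (iter_int n (fun v => F (upd n y v)) +
    a * iter_int n (fun v => G (upd n y v)))).
  apply: eq_Rintegral => y _.
  refine (IH (fun v => F (upd n y v)) (fun v => G (upd n y v)) _ _
    (scont_upd sF) (gbd_upd y gF) (scont_upd sG) (gbd_upd y gG)).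
by rewrite RintegralD // RintegralZl.
Qed.

Lemma iter_int_le n F G CF CG : scont F -> gbd n CF F -> scont G -> gbd n CG G ->
  (forall v, F v <= G v) -> iter_int n F <= iter_int n G.
Proof.
elim: n F G CF CG => [|n IH] F G CF CG sF gF sG gG FG; first exact: FG.
have i1 := slice sF gF; have i2 := slice sG gG.
rewrite !iter_intS; apply: le_Rintegral => // y _.
exact: (IH (fun v => F (upd n y v)) (fun v => G (upd n y v)) _ _
  (scont_upd sF) (gbd_upd y gF) (scont_upd sG) (gbd_upd y gG) (fun v => FG (upd n y v))).
Qed.

End IteratedIntegral.

Section GaussianFormula.
Context {R : realType}.
Local Notation mu := (@lebesgue_measure R).
Variable A : nat -> nat -> R.
Hypothesis symA : forall i j, A i j = A j i.

(** Indices and arguments live in [nat], as in [iter_int], so that the induction on the number of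
    variables needs no coercion between ordinals. *)
Definition bform (n : nat) (u v : nat -> R) : R :=
  \sum_(i < n) \sum_(j < n) A i j * (u i * v j).
Definition posdef (n : nat) : Prop :=
  forall u : nat -> R, (exists2 i, (i < n)%N & u i != 0) -> 0 < bform n u u.
Definition amat (n : nat) : 'M[R]_n := \matrix_(i, j) A i j.
Let col (n : nat) (u : nat -> R) : R := \sum_(i < n) A i n * u i.

Lemma bformS n u v : bform n.+1 u v =
  bform n u v + v n * col n u + u n * col n v + A n n * (u n * v n).
Proof.
rewrite /bform big_ord_recr /= big_ord_recr /=.
under eq_bigr do rewrite big_ord_recr /=.
rewrite big_split /= /col !mulr_sumr -!addrA; congr (_ + (_ + (_ + _))).
- by apply: eq_bigr => i _; ring.
- by apply: eq_bigr => i _; rewrite symA; ring.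
Qed.

Let upd_last n y (v : nat -> R) : upd n y v n = y.
Proof. by rewrite /upd eqxx. Qed.

Lemma bform_upd n y u v : bform n (upd n y u) v = bform n u v.
Proof.
by apply: eq_bigr => i _; apply: eq_bigr => j _; rewrite /upd ltn_eqF.
Qed.

Lemma bform_sym n u v : bform n u v = bform n v u.
Proof.
rewrite /bform exchange_big /=; apply: eq_bigr => i _; apply: eq_bigr => j _.
by rewrite symA; ring.
Qed.

Lemma bform_lin n u v w (c : R) : bform n u (fun k => v k + c * w k) = bform n u v + c * bform n u w.
Proof.
rewrite /bform mulr_sumr -big_split /=; apply: eq_bigr => i _.
by rewrite mulr_sumr -big_split /=; apply: eq_bigr => j _; ring.
Qed.

Lemma posdefW n : posdef n.+1 -> posdef n.
Proof.
move=> h u [i iN ui]; have := h (upd n 0 u).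
rewrite bformS !upd_last !mul0r mulr0 !addr0 bform_upd bform_sym bform_upd; apply.
by exists i; [exact: ltnW|rewrite /upd ltn_eqF].
Qed.

Let solve n : \det (amat n) != 0 -> exists w : nat -> R, forall u, bform n u w = col n u.
Proof.
move=> dn; have un : amat n \in unitmx by rewrite unitmxE unitfE.
pose wv := invmx (amat n) *m (\col_(i < n) A i n).
pose w k := if insub k is Some i then wv i ord0 else 0 : R.
exists w => u; apply: eq_bigr => i _.
have : (amat n *m wv) i ord0 = A i n by rewrite /wv mulKVmx // mxE.
rewrite mxE => <-; rewrite mulr_suml; apply: eq_bigr => j _.
by rewrite mxE /w valK; ring.
Qed.

(** Multiplication by the unitriangular matrix with last column (- w, 1) leaves in the last column
    only the Schur complement, along which the determinant is expanded. *)
Let det_step n (w : nat -> R) : (forall u, bform n u w = col n u) ->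
  \det (amat n.+1) = \det (amat n) * (A n n - col n w).
Proof.
move=> hw; pose U : 'M[R]_n.+1 :=
  \matrix_(i, j) (if j == ord_max then (if i == ord_max then 1 else - w i) else (i == j)%:R).
have dU : \det U = 1.
  rewrite -det_tr det_trig.
    by rewrite big1 // => i _; rewrite !mxE eqxx; case: (i == ord_max).
  apply/is_trig_mxP => i j ij; rewrite !mxE.
  have -> : (i == ord_max) = false.
    by rewrite -val_eqE /= ltn_eqF // (leq_trans ij) // -ltnS.
  by rewrite -val_eqE /= gtn_eqF.
have hwi (i : 'I_n) : \sum_(j < n) A i j * w j = A i n.
  have := hw (fun k => (k == i)%:R).
  have -> : bform n (fun k => (k == i)%:R) w = \sum_(j < n) A i j * w j.
    rewrite /bform (bigD1 i) //= [X in _ + X]big1 ?addr0 => [|j ji].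
      by apply: eq_bigr => j _; rewrite eqxx mul1r.
    by rewrite big1 // => k _; rewrite (_ : (j == i :> nat) = false) ?mul0r ?mulr0 //; exact: negbTE.
  move=> ->; rewrite /col (bigD1 i) //= big1 ?addr0 ?eqxx ?mulr1 // => j ji.
  by rewrite (_ : (j == i :> nat) = false) ?mulr0 //; exact: negbTE.
pose Bm := amat n.+1 *m U.
have Bcol i : Bm i ord_max = if i == ord_max then A n n - col n w else 0.
  rewrite mxE big_ord_recr /= !mxE !eqxx mulr1.
  have -> : \sum_(j < n) amat n.+1 i (widen_ord (leqnSn n) j) * U (widen_ord (leqnSn n) j) ord_max
     = - \sum_(j < n) A i j * w j.
    rewrite -sumrN; apply: eq_bigr => j _; rewrite !mxE eqxx -val_eqE /= ltn_eqF //.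
    by rewrite mulrN.
  have [->|ni] := eqVneq i ord_max.
    rewrite /= addrC; congr (_ - _); by apply: eq_bigr => j _; rewrite symA.
  have iN : (i < n)%N by rewrite ltn_neqAle -ltnS ltn_ord andbT; exact: ni.
  by rewrite (hwi (Ordinal iN)) addNr.
have <- : \det Bm = \det (amat n.+1) by rewrite det_mulmx dU mulr1.
rewrite (expand_det_col _ ord_max) (bigD1 ord_max) //= big1 ?addr0 => [|i ni]; last first.
  by rewrite Bcol (negbTE ni) mul0r.
rewrite Bcol eqxx mulrC /cofactor addnn -signr_odd odd_double expr0 mul1r; congr (\det _ * _).
apply/matrixP => i j; rewrite !mxE (bigD1 (lift ord_max j)) //= big1 ?addr0 => [|k kj].
  rewrite !mxE eqxx.
  have -> : (lift ord_max j == ord_max) = false by rewrite eq_sym (negbTE (neq_lift _ _)).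
  by rewrite mulr1 /= /bump !(leqNgt n) !ltn_ord.
rewrite !mxE.
have -> : (lift ord_max j == ord_max) = false by rewrite eq_sym (negbTE (neq_lift _ _)).
by rewrite (negbTE kj) mulr0.
Qed.

(** The Schur complement is the value of the quadratic form at (w, -1). *)
Let schur_gt0 n (w : nat -> R) : posdef n.+1 -> (forall u, bform n u w = col n u) ->
  0 < A n n - col n w.
Proof.
move=> pd hw; have := pd (upd n (-1) w).
rewrite bformS !upd_last bform_upd bform_sym bform_upd hw.
have -> : col n (upd n (-1) w) = col n w.
  by apply: eq_bigr => i _; rewrite /upd ltn_eqF.
have -> : col n w + -1 * col n w + -1 * col n w + A n n * (-1 * -1) = A n n - col n w by ring.
apply; exists n; first exact: ltnSn.
by rewrite /upd eqxx oppr_eq0 oner_eq0.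
Qed.

Lemma det_gt0 n : posdef n -> 0 < \det (amat n).
Proof.
elim: n => [|n IH] pd; first by rewrite det_mx00.
have d0 := IH (posdefW pd); have [w hw] := solve (lt0r_neq0 d0).
by rewrite (det_step hw) mulr_gt0 //; exact: schur_gt0.
Qed.

(* Integrating out the last variable [y] with the others first: the inner
   integral is again Gaussian, with [p], [z] shifted along the Schur vector [w]. *)
Lemma gauss_formula n (p z : nat -> R) (c th : R) : posdef n ->
  iter_int n (fun v => expR (c + bform n v p - bform n v v / 2) * cos (bform n v z + th)) =
  Num.sqrt ((2 * pi) ^+ n / \det (amat n)) *
    expR (c + (bform n p p - bform n z z) / 2) * cos (bform n p z + th).
Proof.
elim: n p z c th => [|n IH] p z c th pd.
  by rewrite /= /bform !big_ord0 det_mx00 divr1 expr0 sqrtr1 mul1r !(subr0, mul0r, addr0, add0r).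
have pd' := posdefW pd; have d0 := det_gt0 pd'.
have [w hw] := solve (lt0r_neq0 d0).
have s0 := schur_gt0 pd hw; set s := A n n - col n w in s0.
have sn : s != 0 by rewrite gt_eqF.
have colU y v : col n (upd n y v) = col n v.
  by apply: eq_bigr => i _; rewrite /upd ltn_eqF.
have bU y u v : bform n u (upd n y v) = bform n u v.
  by rewrite bform_sym bform_upd bform_sym.
have bf2 u v (a e : R) : bform n (fun k => u k + a * w k) (fun k => v k + e * w k) =
    bform n u v + e * col n u + a * col n v + a * e * col n w.
  rewrite (bform_lin n (fun k => u k + a * w k) v w e) hw.
  rewrite (bform_sym n (fun k => u k + a * w k) v) (bform_lin n v u w a) hw (bform_sym n v u).
  have -> : col n (fun k => u k + a * w k) = col n u + a * col n w.
    by rewrite /col mulr_sumr -big_split /=; apply: eq_bigr => k _; ring.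
  by ring.
pose K : R := Num.sqrt ((2 * pi) ^+ n / \det (amat n)).
have K0 : 0 < K by rewrite sqrtr_gt0 divr_gt0 // exprn_gt0 // mulr_gt0 // pi_gt0.
have eK u : expR (ln K + u) = K * expR u by rewrite expRD lnK.
(* Constant and phase of the remaining one-variable integral, found by collecting the terms free of
   [y]; the normalisation of the inner integral enters the exponent as [ln K]. *)
pose c1 := c + (bform n p p - bform n z z) / 2 + p n * col n p - z n * col n z
   + col n w * (p n ^+ 2 - z n ^+ 2) / 2.
pose th1 := bform n p z + z n * col n p + p n * col n z + p n * z n * col n w + th.
rewrite iter_intS; transitivity (\int[mu]_y (expR ((c1 + ln K) + (s * p n) * y - s * y ^+ 2 / 2)
    * cos ((s * z n) * y + th1))).
  apply: eq_Rintegral => y _.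
  pose p' k := p k + (p n - y) * w k; pose z' k := z k + z n * w k.
  pose c' := c + y * (col n p + A n n * p n) - A n n * y ^+ 2 / 2.
  pose th' := th + y * (col n z + A n n * z n).
  have -> : (fun v => expR (c + bform n.+1 (upd n y v) p - bform n.+1 (upd n y v) (upd n y v) / 2)
     * cos (bform n.+1 (upd n y v) z + th)) =
     (fun v => expR (c' + bform n v p' - bform n v v / 2) * cos (bform n v z' + th')).
    apply/funext => v; rewrite !bformS !bU !bform_upd !colU.
    rewrite !upd_last /p' /z' !bform_lin !hw.
    by congr (expR _ * cos _); rewrite /c' /th'; field.
  rewrite IH // -/K.
  have -> : c1 + ln K + s * p n * y - s * y ^+ 2 / 2 =
      ln K + (c1 + s * p n * y - s * y ^+ 2 / 2) by ring.
  rewrite eK /p' /z' !bf2; congr (_ * expR _ * cos _).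
    by rewrite /c' /c1 /s; field.
  by rewrite /th' /th1 /s; ring.
rewrite gauss1 //.
have -> : c1 + ln K + ((s * p n) ^+ 2 - (s * z n) ^+ 2) / (2 * s) =
  ln K + (c + (bform n.+1 p p - bform n.+1 z z) / 2).
  by rewrite !bformS /c1 /s; field; rewrite -/s.
rewrite eK (det_step hw) -/s.
have -> : s * p n * (s * z n) / s + th1 = bform n.+1 p z + th.
  by rewrite bformS /th1 /s; field; rewrite -/s.
have -> : Num.sqrt ((2 * pi) ^+ n.+1 / (\det (amat n) * s)) = Num.sqrt (2 * pi / s) * K.
  rewrite /K -sqrtrM; last by rewrite divr_ge0 ?mulr_ge0 ?pi_ge0 // ltW.
  by congr Num.sqrt; rewrite exprS; field; rewrite sn gt_eqF.
by rewrite !mulrA.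
Qed.

End GaussianFormula.

(** * Levy continuity *)

Section TrigonometricSums.
Context {R : realType} {N : nat}.
Local Notation V := 'rV[R]_N.
Implicit Types (f g h : V -> R) (c th : R) (y : V).

(** The free phase covers sines too, so this is the span of all real characters; each element
    inherits convergence from the cosines by induction. *)
Inductive trig : (V -> R) -> Prop :=
| trig_cos (v : 'I_N -> R) th : trig (fun y => cos (ip v y + th))
| trig_lin f g c : trig f -> trig g -> trig (fun y => f y + c * g y).

Lemma trigZ c f : trig f -> trig (fun y => c * f y).
Proof.
move=> tf; have -> : (fun y => c * f y) = (fun y => f y + (c - 1) * f y).
  by apply/funext => y; ring.
exact: trig_lin.
Qed.

Lemma trig_cst c : trig (fun=> c).
Proof.
have -> : (fun=> c) = (fun y => c * cos (ip (fun=> 0) y + 0)).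
  apply/funext => y; rewrite /ip big1 ?addr0 ?cos0 ?mulr1 // => i _; exact: mul0r.
by apply: trigZ; exact: trig_cos.
Qed.

Lemma trigD f g : trig f -> trig g -> trig (fun y => f y + g y).
Proof.
move=> tf tg; have -> : (fun y => f y + g y) = (fun y => f y + 1 * g y).
  by apply/funext => y; rewrite mul1r.
exact: trig_lin.
Qed.

Lemma trigM f g : trig f -> trig g -> trig (fun y => f y * g y).
Proof.
move=> tf tg; elim: tf => [v th|f1 f2 c _ IH1 _ IH2]; last first.
  have -> : (fun y => (f1 y + c * f2 y) * g y) = (fun y => f1 y * g y + c * (f2 y * g y)).
    by apply/funext => y; ring.
  exact: trig_lin.
elim: tg => [w th'|g1 g2 c _ IH1 _ IH2]; last first.
  have -> : (fun y => cos (ip v y + th) * (g1 y + c * g2 y)) =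
      (fun y => cos (ip v y + th) * g1 y + c * (cos (ip v y + th) * g2 y)).
    by apply/funext => y; ring.
  exact: trig_lin.
have -> : (fun y => cos (ip v y + th) * cos (ip w y + th')) =
   (fun y => 2^-1 * cos (ip (fun k => v k + w k) y + (th + th')) +
     2^-1 * cos (ip (fun k => v k + -1 * w k) y + (th - th'))).
  apply/funext => y.
  have E c : ip (fun k => v k + c * w k) y = ip v y + c * ip w y.
    by rewrite /ip mulr_sumr -big_split /=; apply: eq_bigr => k _; ring.
  have -> : ip (fun k => v k + w k) y = ip v y + ip w y.
    by rewrite /ip -big_split /=; apply: eq_bigr => k _; ring.
  rewrite E; have -> : ip v y + ip w y + (th + th') = (ip v y + th) + (ip w y + th') by ring.
  have -> : ip v y + -1 * ip w y + (th - th') = (ip v y + th) - (ip w y + th') by ring.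
  by rewrite (cosD (ip v y + th)) (cosB (ip v y + th)); field.
by apply: trig_lin; [apply: trigZ|]; exact: trig_cos.
Qed.

Lemma trig_continuous f : trig f -> continuous f.
Proof.
elim=> [v th y|f1 f2 c _ c1 _ c2 y].
  apply: (@continuous_comp _ _ _ (fun y => ip v y + th) cos); last exact: continuous_cos.
  by apply: continuousD; [exact: continuous_ip|exact: (@cst_continuous _ _ _ y)].
apply: (@continuousD _ _ _ f1 (fun y => c * f2 y)); first exact: c1.
exact: (@continuousM R V (cst c) f2 y (@cst_continuous _ _ _ y) (c2 y)).
Qed.

Lemma trig_bounded f : trig f -> exists C, forall y, `|f y| <= C.
Proof.
elim=> [v th|f1 f2 c _ [C1 h1] _ [C2 h2]].
  by exists 1 => y; rewrite ler_norml cos_geN1 cos_le1.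
exists (C1 + `|c| * C2) => y; apply: (le_trans (ler_normD _ _)); apply: lerD => //.
by rewrite normrM; apply: ler_wpM2l.
Qed.

(** A trigonometric coordinate with values in [0, 1]. For eta = pi / (2 A) it is injective on
    [-A, A], because the argument of the cosine then runs through [0, pi]. *)
Definition tcoord (eta : R) (i : 'I_N) (y : V) : R :=
  (1 + cos (ip (fun k => eta * (k == i)%:R) y + pi / 2)) / 2.

Lemma tcoordE eta i y : tcoord eta i y = (1 + cos (eta * y ord0 i + pi / 2)) / 2.
Proof.
rewrite /tcoord /ip (bigD1 i) //= big1 ?addr0 ?eqxx ?mulr1 // => k /negbTE ->.
by rewrite mulr0 mul0r.
Qed.

Lemma trig_tcoord eta i : trig (tcoord eta i).
Proof.
have -> : tcoord eta i =
    (fun y => 2^-1 + 2^-1 * cos (ip (fun k => eta * (k == i)%:R) y + pi / 2)).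
  by apply/funext => y; rewrite /tcoord; field.
by apply: trig_lin; [exact: trig_cst|exact: trig_cos].
Qed.

Lemma tcoord_itv eta i y : 0 <= tcoord eta i y <= 1.
Proof.
rewrite tcoordE; have := cos_le1 (eta * y ord0 i + pi / 2).
have := cos_geN1 (eta * y ord0 i + pi / 2); move: (cos _) => u h1 h2.
by apply/andP; split; lra.
Qed.

Lemma tcoord_inj A i y y' : 0 < A -> `|y ord0 i| <= A -> `|y' ord0 i| <= A ->
  tcoord (pi / (2 * A)) i y = tcoord (pi / (2 * A)) i y' -> y ord0 i = y' ord0 i.
Proof.
move=> A0 yA yA'; rewrite !tcoordE => E.
have p0 : 0 < pi :> R := pi_gt0 R.
have e0 : 0 < pi / (2 * A) by rewrite divr_gt0 // mulr_gt0.
have H (u : R) : `|u| <= A -> pi / (2 * A) * u + pi / 2 \in `[0, pi].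
  rewrite ler_norml in_itv /= => /andP[u1 u2].
  have -> : pi / (2 * A) * u + pi / 2 = pi / (2 * A) * (u + A) by field; rewrite gt_eqF.
  rewrite mulr_ge0 ?(ltW e0) //=; last by rewrite -lerBlDr sub0r.
  have {2}-> : pi = pi / (2 * A) * (A + A) by field; rewrite gt_eqF.
  by apply: ler_wpM2l; [exact: ltW|rewrite lerD2r].
have E' : cos (pi / (2 * A) * y ord0 i + pi / 2) = cos (pi / (2 * A) * y' ord0 i + pi / 2) by lra.
move/cos_inj: E' => /(_ (H _ yA) (H _ yA'))/addIr/mulfI; apply.
by rewrite gt_eqF.
Qed.

(** Uniform continuity of [g] on the box in the trigonometric coordinates: on the compact set of
    pairs with |g y - g y'| >= e, the squared distance of the coordinates attains a minimum,
    positive by injectivity. *)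
Lemma tcoord_modulus g (A e : R) : continuous g -> 0 < A -> 0 < e ->
  exists2 dl : R, 0 < dl & forall y y',
    (forall i, `|y ord0 i| <= A) -> (forall i, `|y' ord0 i| <= A) ->
    \sum_i (tcoord (pi / (2 * A)) i y - tcoord (pi / (2 * A)) i y') ^+ 2 < dl ->
    `|g y - g y'| < e.
Proof.
move=> cg A0 e0; set eta := pi / (2 * A).
pose bx := [set y : V | forall i, `[- A, A]%classic (y ord0 i)].
have bxP y : bx y <-> forall i, `|y ord0 i| <= A.
  by split=> h i; have := h i; rewrite /= in_itv /= ler_norml.
have cbx : compact (bx `*` bx).
  have cb : compact bx.
    by apply: (@rV_compact _ _ (fun=> `[- A, A]%classic)) => i; exact: segment_compact.
  exact: compact_setX.
pose df (p : V * V) := `|g p.1 - g p.2|.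
have cdf : continuous df.
  move=> p; apply: (@continuous_comp _ _ _ (fun p : V * V => g p.1 - g p.2) Num.norm).
    apply: (@continuousB _ _ _ (fun p : V * V => g p.1) (fun p : V * V => g p.2)).
      by apply: (@continuous_comp _ _ _ fst g); [exact: cvg_fst|exact: cg].
    by apply: (@continuous_comp _ _ _ snd g); [exact: cvg_snd|exact: cg].
  exact: norm_continuous.
pose K := (bx `*` bx) `&` df @^-1` [set u | e <= u].
have cK : compact K.
  apply: (@subclosed_compact _ _ (bx `*` bx)) => //; last by move=> p [].
  apply: closedI; first by apply: compact_closed => //; exact: norm_hausdorff.
  by apply: closed_comp; [move=> p _; exact: cdf|exact: closed_ge].
have [K0|K0] := pselect (K !=set0); last first.
  exists 1 => // y y' /bxP yA /bxP yA' _; rewrite ltNge; apply/negP => h.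
  by apply: K0; exists (y, y').
pose S (p : V * V) := \sum_i (tcoord eta i p.1 - tcoord eta i p.2) ^+ 2.
have cS : continuous S.
  move=> p; apply: cvg_sumR => i.
  have H : {for p, continuous (fun p : V * V => tcoord eta i p.1 - tcoord eta i p.2)}.
    apply: (@continuousB _ _ _ (fun p : V * V => tcoord eta i p.1) (fun p : V * V => tcoord eta i p.2)).
      apply: (@continuous_comp _ _ _ fst (tcoord eta i)); first exact: cvg_fst.
      exact: (trig_continuous (trig_tcoord eta i)).
    apply: (@continuous_comp _ _ _ snd (tcoord eta i)); first exact: cvg_snd.
    exact: (trig_continuous (trig_tcoord eta i)).
  exact: (@continuousM R _ _ _ p H H).
have [p pK pm] := compact_EVT_min K0 cK (continuous_subspaceT cS).
move: pK; rewrite inE => -[[/= p1 p2] pe].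
have Sp : 0 < S p.
  rewrite lt_neqAle eq_sym sumr_ge0 ?andbT; last by move=> i _; exact: sqr_ge0.
  apply/eqP => S0; have : forall i, p.1 ord0 i = p.2 ord0 i.
    move=> i; apply: (tcoord_inj A0); [exact: (bxP p.1).1|exact: (bxP p.2).1|].
    have := psumr_eq0P (fun i _ => sqr_ge0 _) S0 (i := i) isT.
    by move/eqP; rewrite sqrf_eq0 subr_eq0 => /eqP.
  move=> E; have E' : p.1 = p.2 by apply/rowP.
  by move: pe; rewrite /= /df E' subrr normr0 leNgt e0.
exists (S p) => // y y' /bxP yA /bxP yA' h; rewrite ltNge; apply/negP => he.
have : S p <= S (y, y') by apply: pm; rewrite inE.
by rewrite leNgt h.
Qed.

Section RandomWalk.
Variables (p : 'I_N -> R) (q : R).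
Hypothesis p01 : forall i, 0 <= p i <= 1.
Implicit Types (F G : ('I_N -> R) -> R) (a : 'I_N -> R) (s : seq 'I_N).

(* Expectation of [F] at the endpoint of a walk from [a] which, for each [i]
   in [s], moves coordinate [i] by [q] with probability [p i]. *)
Fixpoint walk s F a : R :=
  if s is i :: s' then
    p i * walk s' F (fun k => a k + q * (k == i)%:R) + (1 - p i) * walk s' F a
  else F a.

Lemma walk_cst s c a : walk s (fun=> c) a = c.
Proof. by elim: s a => //= i s IH a; rewrite !IH; ring. Qed.

Lemma walk_lin s F G c a :
  walk s (fun a => F a + c * G a) a = walk s F a + c * walk s G a.
Proof. by elim: s a => //= i s IH a; rewrite !IH; ring. Qed.

Lemma walk_sum s (n : nat) (F : 'I_n -> ('I_N -> R) -> R) a :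
  walk s (fun a => \sum_i F i a) a = \sum_i walk s (F i) a.
Proof.
by elim: s a => //= i s IH a; rewrite !IH !mulr_sumr -big_split.
Qed.

Lemma walk_le s F G a : (forall a, F a <= G a) -> walk s F a <= walk s G a.
Proof.
move=> FG; elim: s a => //= i s IH a; have /andP[h0 h1] := p01 i.
by apply: lerD; apply: ler_wpM2l; rewrite ?subr_ge0.
Qed.

Lemma walk_norm_le s F c a : (forall a, `|F a| <= c) -> `|walk s F a| <= c.
Proof.
move=> Fc; rewrite ler_norml -(walk_cst s c a) -[- walk s _ a]mulN1r -[X in X && _]/(_ <= _).
have -> : -1 * walk s (fun=> c) a = walk s (fun=> - c) a by rewrite !walk_cst mulN1r.
by apply/andP; split; apply: walk_le => a'; have := Fc a'; rewrite ler_norml => /andP[].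
Qed.

(** Squared bias plus variance: coordinate [i] receives as many independent Bernoulli steps of size
    [q] as [i] occurs in [s]. *)
Lemma walk_sqr s i c a : walk s (fun a => (a i - c) ^+ 2) a =
  (a i + q * (count_mem i s)%:R * p i - c) ^+ 2
    + q ^+ 2 * (count_mem i s)%:R * (p i * (1 - p i)).
Proof.
elim: s a => [a|j s IH a] /=; first by ring.
rewrite !IH eq_sym natrD; have [->|ij] := eqVneq j i; last by rewrite /=; ring.
by rewrite /=; ring.
Qed.

End RandomWalk.

Lemma trig_walk (p : 'I_N -> V -> R) q s F a : (forall i, trig (p i)) ->
  trig (fun y => walk (fun i => p i y) q s F a).
Proof.
move=> tp; elim: s a => [a|i s IH a] /=; first exact: trig_cst.
apply: trigD; apply: trigM => //.
have -> : (fun y => 1 - p i y) = (fun y => 1 + -1 * p i y).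
  by apply/funext => y; ring.
by apply: trig_lin => //; exact: trig_cst.
Qed.

(** Bernstein's proof by Chebyshev's inequality. The mean of [phi] at the end of the walk is a
    polynomial in the coordinates, it inherits the bound [B] everywhere, and inside the box it
    differs from [g] by [e] plus a multiple of the variance N / n. *)
Lemma trig_approx g (B A e : R) : continuous g -> (forall y, `|g y| <= B) -> 0 < A -> 0 < e ->
  exists2 h, trig h & (forall y, `|h y| <= B) /\
    (forall y, (forall i, `|y ord0 i| <= A) -> `|h y - g y| <= 2 * e).
Proof.
move=> cg gB A0 e0; have B0 : 0 <= B := le_trans (normr_ge0 _) (gB 0).
have [dl dl0 hd] := tcoord_modulus cg A0 e0; set eta := pi / (2 * A) in hd.
pose X i y := tcoord eta i y.
pose D (a : 'I_N -> R) y := \sum_i (a i - X i y) ^+ 2.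
have D0 a y : 0 <= D a y by apply: sumr_ge0 => i _; exact: sqr_ge0.
have dl4 : 0 < dl / 4 by rewrite divr_gt0.
pose near_pt a y := (forall i, `|y ord0 i| <= A) /\ D a y < dl / 4.
(* A function of the coordinates standing for [g]: its value at some point of the box with
   coordinates close to [a], and 0 if there is none. Two such points have squared distance below
   [dl]. *)
pose phi (a : 'I_N -> R) : R :=
  if pselect (exists y, near_pt a y) is left H then g (projT1 (cid H)) else 0.
have phiB a : `|phi a| <= B by rewrite /phi; case: pselect => [H|_]; rewrite ?normr0.
pose C := 2 * B * (4 / dl).
have C0 : 0 <= C := mulr_ge0 (mulr_ge0 (ler0n _ 2) B0) (divr_ge0 (ler0n _ 4) (ltW dl0)).
have phig a y : (forall i, `|y ord0 i| <= A) -> `|phi a - g y| <= e + C * D a y.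
  move=> yA; case: (ltP (D a y) (dl / 4)) => Da.
    rewrite /phi; case: pselect => [H|[]]; last by exists y.
    case: (cid H) => y' /= [yA' Da'].
    apply: (@le_trans _ _ e); last by rewrite lerDl mulr_ge0.
    apply/ltW/hd => //.
    apply: (@le_lt_trans _ _ (2 * D a y' + 2 * D a y)); last by lra.
    rewrite /D !mulr_sumr -big_split /=; apply: ler_sum => i _.
    rewrite -/(X i y) -/(X i y') -subr_ge0.
    have -> : 2 * (a i - X i y') ^+ 2 + 2 * (a i - X i y) ^+ 2 - (X i y' - X i y) ^+ 2 =
      (2 * a i - X i y - X i y') ^+ 2 by ring.
    exact: sqr_ge0.
  apply: (@le_trans _ _ (2 * B)).
    by apply: (le_trans (ler_normB _ _)); rewrite mulr_natl mulr2n; apply: lerD.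
  have h : 1 <= 4 / dl * D a y.
    have E1 : 4 / dl * (dl / 4) = 1 by field; rewrite gt_eqF.
    rewrite -[leLHS]E1; by apply: ler_wpM2l => //; rewrite divr_ge0 // ltW.
  rewrite /C -mulrA; apply: (@le_trans _ _ (2 * B * (4 / dl * D a y))); last first.
    by rewrite mulrA lerDr ltW.
  by rewrite ler_peMr // mulr_ge0.
pose n := (Num.bound (C * N%:R / e)).+1.
have n0 : 0 < n%:R :> R by rewrite ltr0n.
have u0 : 0 <= C * N%:R / e := divr_ge0 (mulr_ge0 C0 (ler0n _ N)) (ltW e0).
have nC : C * N%:R / n%:R <= e.
  rewrite ler_pdivrMr // [leRHS]mulrC -ler_pdivrMr //.
  by apply: (le_trans (ltW (archi_boundP u0))); rewrite ler_nat.
pose s := flatten (nseq n (enum 'I_N)).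
have sc i : count_mem i s = n.
  rewrite /s count_flatten map_nseq sumn_nseq count_uniq_mem ?enum_uniq // mem_enum.
  by rewrite mul1n.
pose h y := walk (fun i => X i y) n%:R^-1 s phi (fun=> 0).
exists h; first by apply: trig_walk => i; exact: trig_tcoord.
have X01 y i : 0 <= X i y <= 1 by exact: tcoord_itv.
split=> y; first by apply: walk_norm_le.
move=> yA; have walkS : walk (fun i => X i y) n%:R^-1 s (fun a => D a y) (fun=> 0) <= N%:R / n%:R.
  rewrite /D walk_sum.
  have -> : N%:R / n%:R = \sum_(i < N) n%:R^-1 :> R by rewrite sumr_const card_ord mulr_natl.
  apply: ler_sum => i _; rewrite walk_sqr sc.
  have -> : (0 + n%:R^-1 * n%:R * X i y - X i y) = 0 by field; rewrite gt_eqF.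
  have -> : 0 ^+ 2 + n%:R^-1 ^+ 2 * n%:R * (X i y * (1 - X i y)) = n%:R^-1 * (X i y * (1 - X i y)).
    by field; rewrite gt_eqF.
  have /andP[x0 x1] := X01 y i.
  by rewrite ler_piMr ?invr_ge0 ?(ltW n0) // mulr_ile1 ?subr_ge0 // lerBlDr lerDl.
(* Applied with c = 1 and c = -1, to avoid absolute values under the walk. *)
have H c : (forall a, c * (phi a - g y) <= e + C * D a y) -> c * (h y - g y) <= 2 * e.
  move=> hc; have := walk_le n%:R^-1 (X01 y) s (fun=> 0) hc.
  have -> : (fun a => c * (phi a - g y)) = (fun a => - (c * g y) + c * phi a).
    by apply/funext => a; ring.
  rewrite (walk_lin _ _ _ (fun=> e)) (walk_lin _ _ _ (fun=> - (c * g y))) !walk_cst -/(h y) => h1.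
  apply: (@le_trans _ _ (e + C * (N%:R / n%:R))).
    have -> : c * (h y - g y) = - (c * g y) + c * h y by ring.
    apply: (le_trans h1); rewrite lerD2l; exact: ler_wpM2l.
  by rewrite [2 * e]mulr_natl mulr2n lerD2l mulrA.
have K1 : -1 * (h y - g y) <= 2 * e.
  by apply: H => a; rewrite mulN1r; apply: (le_trans (ler_norm _)); rewrite normrN; exact: phig.
have K2 : 1 * (h y - g y) <= 2 * e.
  by apply: H => a; rewrite mul1r; apply: (le_trans (ler_norm _)); exact: phig.
by rewrite ler_norml; apply/andP; split; lra.
Qed.

End TrigonometricSums.

Section LevyContinuity.
Context {R : realType} {N : nat}.
Local Notation V := 'rV[R]_N.
Implicit Types (f g h : V -> R) (L : (V -> R) -> R).

Definition quad_growth f : Prop :=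
  continuous f /\ exists C, forall y, `|f y| <= C * (1 + nsq y).

(** Positive normalised linear functionals on functions of quadratic growth. This covers both the
    law of the process and the iterated Gaussian integral, which is not presented as a measure. *)
Definition expectation L : Prop :=
  [/\ (forall f g c, quad_growth f -> quad_growth g ->
        L (fun y => f y + c * g y) = L f + c * L g),
      (forall f g, quad_growth f -> quad_growth g -> (forall y, f y <= g y) -> L f <= L g)
    & L (fun=> 1) = 1].

Lemma quad_growth_bounded f C : continuous f -> (forall y, `|f y| <= C) -> quad_growth f.
Proof.
move=> cf fC; split=> //; exists C => y; have C0 := le_trans (normr_ge0 _) (fC y).
by apply: (le_trans (fC y)); rewrite ler_peMr // lerDl nsq_ge0.
Qed.

Lemma quad_growth_nsq : quad_growth (@nsq R N).
Proof.
split; first exact: continuous_nsq.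
by exists 1 => y; rewrite mul1r ger0_norm ?nsq_ge0 // lerDr.
Qed.

Lemma quad_growth_lin f g c : quad_growth f -> quad_growth g ->
  quad_growth (fun y => f y + c * g y).
Proof.
move=> [cf [C1 h1]] [cg [C2 h2]]; split.
  move=> y; apply: (@continuousD _ _ _ f (fun y => c * g y)); first exact: cf.
  exact: (@continuousM R V (cst c) g y (@cst_continuous _ _ _ y) (cg y)).
exists (C1 + `|c| * C2) => y; rewrite mulrDl; apply: (le_trans (ler_normD _ _)).
by apply: lerD => //; rewrite normrM -mulrA; apply: ler_wpM2l.
Qed.

Lemma quad_growth_trig f : trig f -> quad_growth f.
Proof.
by move=> tf; have [C hC] := trig_bounded tf; apply: (quad_growth_bounded (trig_continuous tf) hC).
Qed.

Lemma expectation_near L g h (e c M : R) : expectation L -> quad_growth g -> quad_growth h ->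
  0 <= c -> L (@nsq R N) <= M -> (forall y, `|h y - g y| <= e + c * nsq y) ->
  `|L h - L g| <= e + c * M.
Proof.
move=> [lin mono one] qg qh c0 LM hg.
have q1 : quad_growth (fun=> 1).
  by apply: (@quad_growth_bounded _ 1) => [y|y]; [exact: cst_continuous|rewrite normr1].
have H f1 f2 : quad_growth f1 -> quad_growth f2 ->
    (forall y, f1 y <= f2 y + e * 1 + c * nsq y) -> L f1 <= L f2 + (e + c * M).
  move=> q2 q3 h12; have q4 := quad_growth_lin e q3 q1.
  have := mono _ _ q2 (quad_growth_lin c q4 quad_growth_nsq) h12.
  rewrite lin //; last exact: quad_growth_nsq.
  rewrite lin // one mulr1 => h3; apply: (le_trans h3).
  by rewrite addrA lerD2l; apply: ler_wpM2l.
have H1 : L h <= L g + (e + c * M).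
  by apply: H => // y; have := hg y; rewrite ler_norml => /andP[_]; lra.
have H2 : L g <= L h + (e + c * M).
  by apply: H => // y; have := hg y; rewrite ler_norml => /andP[]; lra.
by rewrite ler_norml; apply/andP; split; lra.
Qed.

(** The approximant is close to [g] on a box and bounded by [B] outside it, where 2 B <= c |y|^2;
    second moments then control the tail under every functional at once. *)
Lemma levy_continuity (T : Type) (F : set_system T) (FF : Filter F)
    (E : T -> (V -> R) -> R) (L : (V -> R) -> R) (M : R) :
  (\forall b \near F, expectation (E b) /\ E b (@nsq R N) <= M) -> expectation L ->
  (forall (v : 'I_N -> R) th, E b (fun y => cos (ip v y + th)) @[b --> F] -->
     L (fun y => cos (ip v y + th))) ->
  forall g, continuous g -> bdd_fun g -> E b g @[b --> F] --> L g.
Proof.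
move=> EM eL Ecos g cg [B gB]; have qg := quad_growth_bounded cg gB.
have B0 : 0 <= B := le_trans (normr_ge0 _) (gB 0).
have Etrig h : trig h -> E b h @[b --> F] --> L h.
  elim=> [v th|f1 f2 c t1 IH1 t2 IH2]; first exact: Ecos.
  have [lin _ _] := eL; rewrite lin; [|exact: quad_growth_trig..].
  apply: (@cvg_trans _ ((fun b => E b f1 + c * E b f2) @ F)); last first.
    by apply: cvgD => //; apply: cvgM => //; exact: cvg_cst.
  apply: near_eq_cvg; apply: filterS EM => b [[lb _ _] _].
  by rewrite lb //; exact: quad_growth_trig.
apply/cvgrPdist_le => e e0; have e8 : 0 < e / 8 by rewrite divr_gt0.
pose M1 := `|M| + `|L (@nsq R N)| + 1.
have M10 : 0 < M1 by rewrite ltr_wpDl // addr_ge0.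
(* The box is so large that [2 * B / A ^+ 2] times the bound [M1] on second moments is at most e /
   8. *)
pose A := Num.sqrt (1 + 2 * B * M1 / (e / 8)).
have A20 : 0 < 1 + 2 * B * M1 / (e / 8).
  by rewrite ltr_wpDr // divr_ge0 ?(ltW e8) // mulr_ge0 ?(ltW M10) // mulr_ge0.
have A0 : 0 < A by rewrite sqrtr_gt0.
have A2 : A ^+ 2 = 1 + 2 * B * M1 / (e / 8) by rewrite sqr_sqrtr // ltW.
pose c := 2 * B / A ^+ 2.
have c0 : 0 <= c := divr_ge0 (mulr_ge0 (ler0n _ 2) B0) (sqr_ge0 A).
have cM : c * M1 <= e / 8.
  have -> : c * M1 = 2 * B * M1 / A ^+ 2 by rewrite /c; ring.
  rewrite ler_pdivrMr ?exprn_gt0 // A2.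
  have -> : e / 8 * (1 + 2 * B * M1 / (e / 8)) = e / 8 + 2 * B * M1 by field; rewrite gt_eqF.
  by rewrite lerDr ltW.
have [h th [hB hg]] := trig_approx cg gB A0 e8; have qh := quad_growth_trig th.
have near_hg y : `|h y - g y| <= 2 * (e / 8) + c * nsq y.
  have [yA|[i yi]] : (forall i, `|y ord0 i| <= A) \/ exists i, A < `|y ord0 i|.
    have [/forallP yA|/forallPn[i yi]] := boolP [forall i, `|y ord0 i| <= A]; first by left.
    by right; exists i; rewrite ltNge.
    by apply: (le_trans (hg y yA)); rewrite lerDl mulr_ge0 ?nsq_ge0.
  apply: (@le_trans _ _ (2 * B)).
    by apply: (le_trans (ler_normB _ _)); rewrite mulr_natl mulr2n; apply: lerD.
  have : A ^+ 2 <= nsq y.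
    apply: (@le_trans _ _ (y ord0 i ^+ 2)).
      by rewrite -[leRHS]real_normK ?num_real // lerXn2r ?nnegrE // ltW.
    by rewrite /nsq (bigD1 i) //= lerDl sumr_ge0 // => j _; exact: sqr_ge0.
  move=> An; apply: (@le_trans _ _ (c * A ^+ 2)).
    by rewrite /c divfK // gt_eqF // exprn_gt0.
  by apply: ler_wpDl; [rewrite mulr_ge0 // ltW|exact: ler_wpM2l].
have near_e L' : expectation L' -> L' (@nsq R N) <= M1 -> `|L' h - L' g| <= 3 * (e / 8).
  move=> eL' LM; have := expectation_near eL' qg qh c0 LM near_hg; lra.
have NL : `|L h - L g| <= 3 * (e / 8).
  apply: near_e => //; apply: (le_trans (ler_norm _)).
  by rewrite /M1 addrAC lerDr addr_ge0.
have /cvgrPdist_le/(_ _ e8) Nh := Etrig h th.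
near=> b; have NE : `|E b h - E b g| <= 3 * (e / 8).
  have [eb Mb] : expectation (E b) /\ E b (@nsq R N) <= M by near: b.
  apply: near_e => //; apply: (le_trans Mb); apply: (le_trans (ler_norm _)).
  by rewrite /M1 -addrA lerDl addr_ge0.
have Nb : `|L h - E b h| <= e / 8 by near: b.
move: NL NE Nb; rewrite !ler_norml => /andP[a1 a2] /andP[a3 a4] /andP[a5 a6].
by apply/andP; split; lra.
Unshelve. all: by end_near. Qed.

End LevyContinuity.

(** * The limit law *)

Section GaussianIntegral.
Context {R : realType} {N : nat}.
Local Notation V := 'rV[R]_N.
Variables (C : 'M[R]_N) (l : R).
Hypothesis Cunit : C \in unitmx.
Hypothesis Csym : (invmx C)^T = invmx C.
Hypothesis l0 : 0 < l.
Hypothesis Cpos : forall y : V, l * nsq y <= (y *m invmx C *m y^T) ord0 ord0.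

Let row_of (v : nat -> R) : V := \row_i v (nat_of_ord i).
Let A (i j : nat) : R :=
  if (insub i, insub j) is (Some i', Some j') then invmx C (i' : 'I_N) (j' : 'I_N) else 0.
Let ext (y : V) (k : nat) : R := if insub k is Some i then y ord0 i else 0.

Let AE (i j : 'I_N) : A i j = invmx C i j.
Proof. by rewrite /A !valK. Qed.

Let symA i j : A i j = A j i.
Proof.
rewrite /A; case: insubP => [i' _ _|_]; case: insubP => [j' _ _|_] //.
by rewrite -[in LHS]Csym mxE.
Qed.

Let row_ext y : row_of (ext y) = y.
Proof. by apply/rowP => i; rewrite mxE /ext valK. Qed.

Let bformE u v : bform A N u v = (row_of u *m invmx C *m (row_of v)^T) ord0 ord0.
Proof.
rewrite mxE /bform exchange_big /=; apply: eq_bigr => j _; rewrite !mxE mulr_suml.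
by apply: eq_bigr => i _; rewrite !mxE AE; ring.
Qed.

Let pdA : posdef A N.
Proof.
move=> u [i iN ui]; rewrite bformE; apply: lt_le_trans (Cpos _); apply: mulr_gt0 => //.
rewrite /nsq (bigD1 (Ordinal iN)) //= ltr_pwDl //; last first.
  by apply: sumr_ge0 => j _; exact: sqr_ge0.
by rewrite mxE /= exprn_even_gt0.
Qed.

Let amatE : amat A N = invmx C.
Proof. by apply/matrixP => i j; rewrite mxE AE. Qed.

Let detC : 0 < \det C.
Proof. by have := det_gt0 symA pdA; rewrite amatE det_inv invr_gt0. Qed.

Let K : R := Num.sqrt ((2 * pi) ^+ N * \det C).
Let K0 : 0 < K.
Proof. by rewrite sqrtr_gt0 mulr_gt0 // exprn_gt0 // mulr_gt0 // pi_gt0. Qed.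

Let densE v : gauss_density C (row_of v) = expR (ln K^-1 - bform A N v v / 2).
Proof.
by rewrite /gauss_density expRD lnK ?posrE ?invr_gt0 // bformE mulNr.
Qed.

(** The Gaussian formula with p = 0 and z = v C, for which the pairing with [invmx C] becomes <v,
    y>; the determinant cancels the normalisation of the density. *)
Lemma gauss_int_cos (v : V) th :
  gauss_int C (fun y => cos (ip (v ord0) y + th)) =
  expR (- (2^-1 * (v *m C *m v^T) ord0 ord0)) * cos th.
Proof.
rewrite /gauss_int.
have E0 : bform A N (fun=> 0) = fun=> 0.
  apply/funext => w; rewrite /bform big1 // => i _; rewrite big1 // => j _.
  by rewrite mul0r mulr0.
have E1 u : bform A N u (fun=> 0) = 0 by rewrite (bform_sym symA) E0.
have E2 u : bform A N u (ext (v *m C)) = ip (v ord0) (row_of u).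
  rewrite (bform_sym symA) bformE row_ext mulmxK // mxE /ip.
  by apply: eq_bigr => i _; rewrite !mxE.
have E3 : bform A N (ext (v *m C)) (ext (v *m C)) = (v *m C *m v^T) ord0 ord0.
  rewrite E2 row_ext [RHS]mxE /ip; apply: eq_bigr => i _.
  by rewrite [v^T i ord0]mxE mulrC.
have := gauss_formula symA (fun=> 0) (ext (v *m C)) (ln K^-1) th pdA.
rewrite !E0 /= E3 amatE det_inv invrK -/K !add0r => G.
transitivity (iter_int N (fun u => expR (ln K^-1 + bform A N u (fun=> 0) - bform A N u u / 2) *
   cos (bform A N u (ext (v *m C)) + th))).
  congr (iter_int N _); apply/funext => u.
  by rewrite E1 E2 addr0 -densE mulrC.
rewrite G expRD lnK ?posrE ?invr_gt0 // [K * _]mulrA mulfV ?gt_eqF // mul1r.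
by congr (expR _ * _); ring.
Qed.

Let expR_dom (u : R) : 0 <= u -> (1 + u) * expR (- (l * u / 2)) <= (1 + 4 / l) * expR (- (l * u / 4)).
Proof.
move=> u0; have -> : - (l * u / 2) = - (l * u / 4) + - (l * u / 4) by field.
rewrite expRD mulrA; apply: ler_wpM2r; first exact: expR_ge0.
have h := expR_ge1Dx (l * u / 4).
rewrite expRN ler_pdivrMr ?expR_gt0 //.
apply: (@le_trans _ _ ((1 + 4 / l) * (1 + l * u / 4))).
  have -> : (1 + 4 / l) * (1 + l * u / 4) = 1 + u + (l * u / 4 + 4 / l).
    by field; rewrite gt_eqF.
  by rewrite lerDl addr_ge0 ?divr_ge0 ?mulr_ge0 // ltW.
by apply: ler_wpM2l => //; rewrite addr_ge0 // divr_ge0 // ltW.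
Qed.

Let scont_dens (f : V -> R) : continuous f -> scont (fun v => f (row_of v) * gauss_density C (row_of v)).
Proof.
move=> cf u v uv; have rv : row_of (u j) @[j --> \oo] --> row_of v.
  by apply: cvg_rV => i; rewrite mxE; under eq_fun do rewrite mxE; exact: uv.
apply: cvgM; first by apply: continuous_cvg; [exact: cf|exact: rv].
under eq_fun do rewrite densE; rewrite densE.
apply: continuous_cvg; first exact: continuous_expR.
apply: cvgB; first exact: cvg_cst.
apply: cvgM; last exact: cvg_cst.
apply: cvg_sumR => i; apply: cvg_sumR => j; apply: cvgM; first exact: cvg_cst.
by apply: cvgM; exact: uv.
Qed.

(** Half of the Gaussian decay is traded for the quadratic growth, leaving a product of one-variable
    Gaussians. *)
Let gbd_dens (f : V -> R) c : (forall y, `|f y| <= c * (1 + nsq y)) ->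
  gbd (l / 2) N (c * (1 + 4 / l) * K^-1) (fun v => f (row_of v) * gauss_density C (row_of v)).
Proof.
move=> fc v; set y := row_of v.
have c0 : 0 <= c.
  by have := le_trans (normr_ge0 _) (fc 0); rewrite pmulr_lge0 // ltr_pwDl // nsq_ge0.
have n0 := nsq_ge0 y.
have Ep : \prod_(k < N) gs (l / 2) 0 (v k) = expR (- (l * nsq y / 4)).
  rewrite /gs -expR_sum; congr expR.
  rewrite /nsq mulr_sumr mulr_suml -sumrN; apply: eq_bigr => k _.
  by rewrite mxE subr0; field.
rewrite Ep normrM densE (ger0_norm (expR_ge0 _)) expRD lnK ?posrE ?invr_gt0 //.
have h1 : expR (- (bform A N v v / 2)) <= expR (- (l * nsq y / 2)).
  by rewrite ler_expR lerN2 ler_pM2r ?invr_gt0 // bformE; exact: Cpos.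
apply: (@le_trans _ _ (c * (1 + nsq y) * (K^-1 * expR (- (l * nsq y / 2))))).
  by apply: ler_pM => //; rewrite ?mulr_ge0 ?expR_ge0 ?invr_ge0 ?(ltW K0) // ler_wpM2l // invr_ge0 ltW.
have -> : c * (1 + nsq y) * (K^-1 * expR (- (l * nsq y / 2))) =
  c * K^-1 * ((1 + nsq y) * expR (- (l * nsq y / 2))) by ring.
have -> : c * (1 + 4 / l) * K^-1 * expR (- (l * nsq y / 4)) =
  c * K^-1 * ((1 + 4 / l) * expR (- (l * nsq y / 4))) by ring.
by apply: ler_wpM2l; [rewrite mulr_ge0 // invr_ge0 ltW|exact: expR_dom].
Qed.

Lemma gauss_int_expectation : expectation (gauss_int C).
Proof.
have l2 : 0 < l / 2 by rewrite divr_gt0.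
split.
- move=> f g c [cf [c1 h1]] [cg [c2 h2]].
  have := iter_int_lin l2 c (scont_dens cf) (gbd_dens h1) (scont_dens cg) (gbd_dens h2).
  rewrite /gauss_int => <-; congr (iter_int N _); apply/funext => v.
  by rewrite -/(row_of v); ring.
- move=> f g [cf [c1 h1]] [cg [c2 h2]] fg.
  apply: (iter_int_le l2 (scont_dens cf) (gbd_dens h1) (scont_dens cg) (gbd_dens h2)) => v.
  by apply: ler_wpM2r => //; rewrite densE expR_ge0.
- have -> : (fun _ : V => 1) = (fun y => cos (ip ((0 : V) ord0) y + 0)) :> (V -> R).
    apply/funext => y; rewrite addr0 /ip big1 ?cos0 // => i _; by rewrite mxE mul0r.
  by rewrite gauss_int_cos !mul0mx mxE mulr0 oppr0 expR0 cos0 mulr1.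
Qed.

End GaussianIntegral.

Section BesselLimit.
Context {R : realType} {N : nat}.
Local Notation V := 'rV[R]_N.

Lemma bessel_expectation (k1 k2 : R) (x : V) d (Omega : measurableType d)
    (P : probability Omega R) (X : R -> Omega -> V) (t : R) (a : V) :
  bessel_B k1 k2 x P X -> 0 <= t ->
  P.-integrable setT (EFin \o (fun w => nsq (X t w - a))) ->
  expectation (fun f => \int[P]_w f (X t w - a)).
Proof.
move=> HX t0 iN.
have iQ f : quad_growth f -> P.-integrable setT (EFin \o (fun w => f (X t w - a))).
  move=> [cf [C fC]].
  have cs (h : V -> R) : continuous h -> continuous (fun y : V => h (y - a)).
    move=> ch y; apply: (@continuous_comp _ _ _ (fun y : V => y - a) h); last exact: ch.
    by apply: continuousB => //; exact: (@cst_continuous _ _ _ y).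
  apply: (@bessel_dominated R N k1 k2 x d Omega P X HX t (fun y => f (y - a))
    (fun y => C * (1 + nsq (y - a))) t0 (cs _ cf)); last by move=> y _; exact: fC.
  by apply: integrable_scaleR; apply: integrable_addR; [exact: integrable_cstR|exact: iN].
split; last exact: Rintegral_cstR.
- move=> f g c qf qg; have i1 := iQ f qf; have i2 := iQ g qg.
  have i3 := integrable_scaleR c i2.
  rewrite (RintegralD measurableT i1 i3); congr (_ + _).
  exact: RintegralZl.
- move=> f g qf qg fg; apply: le_Rintegral => //.
  + exact: iQ.
  + exact: iQ.
Qed.

End BesselLimit.

Unset Implicit Arguments.

Theorem theorem3p3 (R : realType) (N : nat) (nu : R) (z : 'I_N -> R)
  (x : 'rV[R]_N)
  (d : measure_display) (Omega : R -> measurableType d)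
  (P : forall beta : R, probability (Omega beta) R)
  (X : forall beta : R, R -> Omega beta -> 'rV[R]_N) :
  (1 <= N)%N -> 0 < nu ->
  (forall i j : 'I_N, (i < j)%N -> z j < z i) ->
  (forall i, 0 < z i) ->
  (forall i, root (laguerre N (nu - 1)) (z i)) ->
  CNB x ->
  (forall beta, 0 < beta -> bessel_B (nu * beta) beta x (P beta) (X beta)) ->
  let r : 'I_N -> R := fun i => Num.sqrt (2 * z i) in
  let rv : 'rV[R]_N := \row_i r i in
  let S := Smat nu r in
  S \in unitmx /\
  forall t : R, 0 < t ->
  forall g : 'rV[R]_N -> R, continuous g -> bdd_fun g ->
    (fun beta => Rintegral (P beta) setT
        (fun w => g (X beta t w - Num.sqrt (beta * t) *: rv)))
      @ +oo --> gauss_int (t *: invmx S) g.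
Proof.
move=> N1 nu0 zdec zpos zroot _ HX r rv S.
have rpos i : 0 < r i by rewrite sqrtr_gt0 mulr_gt0.
have rdec (i j : 'I_N) : (i < j)%N -> r j < r i.
  by move=> ij; rewrite ltr_sqrt ?mulr_gt0 // ltr_pM2l // zdec.
have rdrift := laguerre_drift nu0 zdec zpos zroot.
(* [N >= 1] provides a root 2 e_i, of weight [nu]. *)
have m0 : 0 < kaptot N nu.
  pose i0 : 'I_N := Ordinal N1.
  have k0 : kap nu (i0, i0, true) = nu by rewrite /kap eqxx.
  rewrite /kaptot (bigD1 (i0, i0, true)) //= k0 ltr_pwDl // sumr_ge0 // => e _.
  exact: kap_ge0 (ltW nu0).
have Su : S \in unitmx := Smat_unit nu0 rpos.
split=> // t t0 g cg bg; set C := t *: invmx S.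
have Cu : C \in unitmx by rewrite unitmxZ ?unitmx_inv // unitfE gt_eqF.
have CV : invmx C = t^-1 *: S by rewrite /C invmxZ // invmxK.
have Csym : (invmx C)^T = invmx C by rewrite CV linearZ /= Smat_sym.
have tV0 : 0 < t^-1 by rewrite invr_gt0.
(* S dominates the identity, so the limiting density decays at least like a Gaussian of precision 1
   / t. *)
have Cpos (y : 'rV[R]_N) : t^-1 * nsq y <= (y *m invmx C *m y^T) ord0 ord0.
  rewrite CV -scalemxAr -scalemxAl mxE; apply: ler_wpM2l; first exact: ltW.
  rewrite (Smat_form nu rpos) -[leLHS]addr0; apply: lerD.
    by rewrite /nsq; apply: ler_sum => i _; rewrite expr2.
  by apply: mulr_ge0 => //; exact: rform_ge0.
pose E be (f : 'rV[R]_N -> R) := \int[P be]_w f (X be t w - Num.sqrt (be * t) *: rv).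
refine (@levy_continuity R N R (pinfty_nbhs R) _ E (gauss_int C) (devc nu (nsq x) t) _ _ _ g cg bg).
- near=> be; have be0 : 0 < be by near: be; exact: nbhs_pinfty_gt.
  have bet : 1 <= be * t.
    by rewrite -ler_pdivrMr // mul1r; near: be; exact: nbhs_pinfty_ge.
  have [h1 h2] := deviation_uniform nu0 rdec rpos rdrift m0 (HX be be0) be0 erefl t0 (lexx t) bet.
  split; last exact: h2.
  exact: (bessel_expectation (HX be be0) (ltW t0) h1).
- exact: (gauss_int_expectation Cu Csym tV0 Cpos).
- move=> v th; have vE : (\row_i v i) ord0 = v by apply/funext => i; rewrite mxE.
  have := gauss_int_cos Cu Csym tV0 Cpos (\row_i v i) th; rewrite vE => ->.
  have := charfun_cvg nu0 rdec rpos rdrift m0 t0 erefl HX (v := \row_i v i) (th := th).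
  have -> : (\row_i v i *m C *m (\row_i v i)^T) ord0 ord0 =
      t * (\row_i v i *m invmx S *m (\row_i v i)^T) ord0 ord0.
    by rewrite /C -scalemxAr -scalemxAl [LHS]mxE.
  by rewrite vE mulrA.
Unshelve. all: by end_near. Qed.
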